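(* Let $T$ be the universal theory of unital C$^*$-algebras, and let enforceability be with respect to $T$. Let $\mathcal O_2$ be the Cuntz algebra and $\mathcal U$ a nonprincipal ultrafilter on $\mathbb N$. The following are equivalent: (1) The Kirchberg Embedding Problem has a positive solution, i.e. every C$^*$-algebra embeds into an ultrapower of $\mathcal O_2$. (2) $\sigma_{\mathrm{nuc}}^{T^f}=0$, i.e. the property $\sigma_{\mathrm{nuc}}=0$ of the compiled structure is enforceable. (3) $\mathcal O_2$ is enforceable. (4) $\mathcal O_2^{\mathcal U}$-embeddability is enforceable, i.e. the property that the compiled C$^*$-algebra embeds into $\mathcal O_2^{\mathcal U}$ is enforceable.
   Context: Unital C$^*$-algebras are regarded as structures in a many-sorted continuous language $L$: for each $k\ge1$ a sort for the closed operator-norm ball of radius $k$ with metric $\|x-y\|$, function symbols for the $*$-algebra operations (addition, multiplication, adjoint, multiplication by scalars in $\mathbb Q(i)$), constants $0,1$ and inclusion maps between balls. Embeddings are injective unital $*$-homomorphisms; ultrapowers are norm ultrapowers. $T$ is a universal $L$-theory whose models are exactly the unital C$^*$-algebras. Game. Fix a countable set $C$ of new constant symbols, infinitely many of each sort, and set $L(C)=L\cup C$. A restricted formula is one built using a fixed countable family of continuous connectives whose compositions are uniformly dense among all continuous connectives. A condition is a finite set $p$ of expressions $\varphi<r$, with $\varphi$ a quantifier-free restricted $L(C)$-sentence and $r\in\mathbb R$, such that $T\cup p$ is satisfiable. Two players $\forall$ and $\exists$ alternately play conditions $p_0\subseteq p_1\subseteq p_2\subseteq\cdots$ ($\forall$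 moves first; each move contains the previous one) for $\omega$ steps; let $\bar p=\bigcup_i p_i$. The play is definitive if for every atomic $L(C)$-sentence $\varphi$ there is a unique real $r$ with $T\cup\bar p\models\varphi=r$; then $\bar p$ determines a prestructure on the algebra of closed $L(C)$-terms, whose completion is the compiled structure. A property $P$ is enforceable (with respect to $T$) if $\exists$ has a strategy guaranteeing, whatever $\forall$ plays, that the play is definitive and the compiled structure has $P$. A structure $A$ is enforceable if the property ''the $L$-reduct of the compiled structure is isomorphic to $A$'' is enforceable. A $\sup\bigvee\inf$-sentence is an infinitary sentence $\sup_x\inf_n\varphi_n(x)$ with $x$ a finite tuple and each $\varphi_n$ existential (i.e. $\inf_y\psi$ with $\psi$ quantifier-free). Nuclearity is defined by countably many $\sup\bigvee\inf$-sentences $\sigma_m$: $A$ is nuclear iff $\sigma_m^A=0$ for all $m$; $\sigma_{\mathrm{nuc}}:=\sup_m\sigma_m$. $\sigma_{\mathrm{nuc}}^{T^f}$ denotes the unique real $r$ such that $\sigma_{\mathrm{nuc}}=r$ is enforceable. *)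

(* Defs.v *)
From HB Require Import structures.
From mathcomp Require Import all_boot all_order all_algebra.
From mathcomp Require Import complex.
From mathcomp Require Import all_classical all_reals all_analysis.

Set Implicit Arguments.
Unset Strict Implicit.
Unset Printing Implicit Defensive.

Import Order.TTheory GRing.Theory Num.Theory.
Import numFieldNormedType.Exports.

Local Open Scope classical_set_scope.
Local Open Scope ring_scope.
Local Open Scope complex_scope.

(** * Unital C*-algebras *)

(* The library has no structure joining rings and normed modules (and
   Hierarchy-Builder does not allow adding one above [numDomainType]), so the
   norm is a field of the mixin. An [algType] is unital with [1 != 0]: the zero
   algebra is excluded. *)
HB.mixin Record Algebra_isCStarAlgebra (R : realType) A
    of GRing.Algebra R[i] A := {
  cnorm : A -> R;
  star : A -> A;
  cnorm_eq0 : forall x : A, cnorm x = 0 -> x = 0;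
  cnormD : forall x y : A, cnorm (x + y) <= cnorm x + cnorm y;
  cnormZ : forall (a : R[i]) (x : A),
    cnorm (a *: x) = complex.Re `|a| * cnorm x;
  cnormM : forall x y : A, cnorm (x * y) <= cnorm x * cnorm y;
  cnorm_complete : forall u : nat -> A,
    (forall eps : R, 0 < eps -> exists N : nat, forall m n : nat,
       (N <= m)%N -> (N <= n)%N -> cnorm (u m - u n) < eps) ->
    exists l : A, cnorm (u n - l) @[n --> \oo] --> (0 : R);
  starD : forall x y : A, star (x + y) = star x + star y;
  starZ : forall (a : R[i]) (x : A), star (a *: x) = a^* *: star x;
  starM : forall x y : A, star (x * y) = star y * star x;
  starK : forall x : A, star (star x) = x;
  cnorm_starM : forall x : A, cnorm (star x * x) = cnorm x ^+ 2
}.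

#[short(type="cstarAlgType")]
HB.structure Definition CStarAlgebra (R : realType) :=
  {A of Algebra_isCStarAlgebra R A & GRing.Algebra R[i] A}.

Definition cnorm_closure (R : realType) (A : cstarAlgType R) (S : set A) :
    set A :=
  [set x | forall eps : R, 0 < eps -> exists2 y, S y & cnorm (x - y) < eps].

Definition star_preserving (R : realType) (A B : cstarAlgType R)
    (f : A -> B) : Prop :=
  forall x, f (star x) = star (f x).

Definition embeds (R : realType) (A B : cstarAlgType R) : Prop :=
  exists f : {lrmorphism A -> B}, star_preserving f /\ injective f.

Definition cstar_iso (R : realType) (A B : cstarAlgType R) : Prop :=
  exists f : {lrmorphism A -> B}, star_preserving f /\ bijective f.

(** * The Cuntz algebra O_2 *)

Definition cuntz2_rel (R : realType) (A : cstarAlgType R) (s t : A) : Prop :=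
  [/\ star s * s = 1, star t * t = 1 & s * star s + t * star t = 1].

Definition cstar_subalgebra (R : realType) (A : cstarAlgType R)
    (S : set A) : Prop :=
  [/\ cnorm_closure S `<=` S, S 1,
      forall (a : R[i]) x y, S x -> S y -> S (a *: x + y),
      forall x y, S x -> S y -> S (x * y)
    & forall x, S x -> S (star x)].

Definition generated_by (R : realType) (A : cstarAlgType R)
    (G : set A) : Prop :=
  forall S : set A, cstar_subalgebra S -> G `<=` S -> S = setT.

(* The universal unital C*-algebra generated by two isometries whose range
   projections sum to 1. *)
Definition is_cuntz2 (R : realType) (B : cstarAlgType R) : Prop :=
  exists s t : B,
    [/\ cuntz2_rel s t, generated_by [set s; t]
      & forall (D : cstarAlgType R) (u v : D), cuntz2_rel u v ->
          exists f : {lrmorphism B -> D},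
            [/\ star_preserving f, f s = u & f t = v]].

(** * Ultrapowers *)

Definition bounded_family (R : realType) (I : Type) (B : cstarAlgType R)
    (x : I -> B) : Prop :=
  exists M : R, forall i, cnorm (x i) <= M.

(* [D], with the quotient map [q], is the norm ultrapower of [B] along [W]:
   the quotient of the algebra of bounded families by the ideal of those whose
   norm tends to 0 along [W]. Values of [q] on unbounded families are
   irrelevant. *)
Definition is_ultrapower (R : realType) (I : Type) (W : set_system I)
    (B D : cstarAlgType R) (q : (I -> B) -> D) : Prop :=
  (forall (a : R[i]) (x y : I -> B), bounded_family x -> bounded_family y ->
     q (fun i => a *: x i + y i) = a *: q x + q y) /\
  (forall x y : I -> B, bounded_family x -> bounded_family y ->
     q (fun i => x i * y i) = q x * q y) /\
  (forall x : I -> B, bounded_family x ->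
     q (fun i => star (x i)) = star (q x)) /\
  q (fun=> 1) = 1 /\
  (forall d : D, exists2 x : I -> B, bounded_family x & q x = d) /\
  (forall x : I -> B, bounded_family x ->
     cnorm (x i) @[i --> W] --> cnorm (q x)).

Definition embeds_in_ultrapower (R : realType) (I : Type) (W : set_system I)
    (B A : cstarAlgType R) : Prop :=
  exists (D : cstarAlgType R) (q : (I -> B) -> D),
    is_ultrapower W q /\ embeds A D.

Definition nonprincipal (I : Type) (W : set_system I) : Prop :=
  forall i : I, ~ W [set i].

Definition KEP (R : realType) (O2 : cstarAlgType R) : Prop :=
  forall A : cstarAlgType R, exists (I : Type) (W : set_system I),
    UltraFilter W /\ embeds_in_ultrapower W O2 A.

(** * Nuclearity: the completely positive approximation property *)

Definition mxadj (E : pzRingType) (st : E -> E) k (X : 'M[E]_k) : 'M[E]_k :=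
  (map_mx st X)^T.

Definition mxpositive (E : pzRingType) (st : E -> E) k (X : 'M[E]_k) : Prop :=
  exists Y : 'M[E]_k, X = mxadj st Y *m Y.

Definition completely_positive (E F : pzRingType) (stE : E -> E)
    (stF : F -> F) (f : E -> F) : Prop :=
  forall k (X : 'M[E]_k), mxpositive stE X -> mxpositive stF (map_mx f X).

Definition cmxstar (R : realType) n (X : 'M[R[i]]_n) : 'M[R[i]]_n :=
  mxadj (fun z : R[i] => z^*) X.

(* operator norm at most 1 for the Hilbert space norm on [C^n] *)
Definition mxcontraction (R : realType) n (X : 'M[R[i]]_n) : Prop :=
  forall v : 'cV[R[i]]_n,
    \sum_i `|(X *m v) i 0| ^+ 2 <= \sum_i `|v i 0| ^+ 2.

Definition nuclear (R : realType) (A : cstarAlgType R) : Prop :=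
  forall (s : seq A) (eps : R), 0 < eps ->
    exists (n : nat) (f : {linear A -> 'M[R[i]]_n})
           (g : {linear 'M[R[i]]_n -> A}),
      [/\ completely_positive (@star R A) (@cmxstar R n) f,
          completely_positive (@cmxstar R n) (@star R A) g,
          forall a : A, cnorm a <= 1 -> mxcontraction (f a),
          forall X, mxcontraction X -> cnorm (g X) <= 1
        & forall a, a \in s -> cnorm (g (f a) - a) < eps].

(** * Syntax *)

(* Sorts are indexed by the radius, a positive natural number. [symbols] is a
   family of free generators of the closed terms, to be used either as
   variables or as new constants; [x] has sort [(sym_sort x).+1]. *)
Record symbols := Symbols { sym :> Type; sym_sort : sym -> nat }.

(* Terms of the sort of radius [k]. [z : rat * rat] stands for the scalar
   [z.1 + z.2 i]. *)
Inductive term (X : symbols) : nat -> Type :=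
| t_sym (x : X) : term X (sym_sort x).+1
| t_zero : term X 1
| t_one : term X 1
| t_add k l : term X k -> term X l -> term X (k + l)
| t_mul k l : term X k -> term X l -> term X (k * l)
| t_star k : term X k -> term X k
| t_scale k l (z : rat * rat) :
    (0 < l)%N -> (z.1 ^+ 2 + z.2 ^+ 2) * k%:R ^+ 2 <= l%:R ^+ 2 ->
    term X k -> term X l
| t_incl k l : (k <= l)%N -> term X k -> term X l.

Record connectives (R : realType) := Connectives {
  conn :> Type;
  arity : conn -> nat;
  conn_fun : forall c : conn, 'rV[R]_(arity c) -> R;
  conn_continuous : forall c, continuous (@conn_fun c)
}.

Definition all_connectives (R : realType) : connectives R :=
  @Connectives R {n : nat & {f : 'rV[R]_n -> R | continuous f}}
    (fun c => projT1 c) (fun c => proj1_sig (projT2 c))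
    (fun c => proj2_sig (projT2 c)).

Inductive composition (R : realType) (K : connectives R) (n : nat) :
    ('rV[R]_n -> R) -> Prop :=
| comp_proj (i : 'I_n) : composition K (fun x => x 0 i)
| comp_conn (c : K) (g : 'I_(arity c) -> 'rV[R]_n -> R) :
    (forall i, composition K (g i)) ->
    composition K (fun x => conn_fun (\row_i g i x)).

(* Uniform density is meant on bounded sets, where formulas take their
   values. *)
Definition dense_connectives (R : realType) (K : connectives R) : Prop :=
  forall (n : nat) (f : 'rV[R]_n.+1 -> R), continuous f ->
  forall M eps : R, 0 < eps ->
  exists2 g, composition K g &
    forall x : 'rV[R]_n.+1, (forall i, `|x 0 i| <= M) -> `|f x - g x| < eps.

(* The metric is the only relation symbol. *)
Inductive qf (R : realType) (K : connectives R) (X : symbols) : Type :=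
| qf_dist k : term X k -> term X k -> qf K X
| qf_conn (c : K) : ('I_(arity c) -> qf K X) -> qf K X.

(** * Semantics *)

Section Semantics.
Variables (R : realType) (A : cstarAlgType R).

Definition rat_complex (z : rat * rat) : R[i] := ratr z.1 +i* ratr z.2.

Definition interpretation (X : symbols) (v : X -> A) : Prop :=
  forall x, cnorm (v x) <= (sym_sort x).+1%:R.

Fixpoint term_val (X : symbols) (v : X -> A) k (t : term X k) : A :=
  match t with
  | t_sym x => v x
  | t_zero => 0
  | t_one => 1
  | t_add _ _ t1 t2 => term_val v t1 + term_val v t2
  | t_mul _ _ t1 t2 => term_val v t1 * term_val v t2
  | t_star _ t1 => star (term_val v t1)
  | t_scale _ _ z _ _ t1 => rat_complex z *: term_val v t1
  | t_incl _ _ _ t1 => term_val v t1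
  end.

Fixpoint qf_val (K : connectives R) (X : symbols) (v : X -> A)
    (phi : qf K X) : R :=
  match phi with
  | qf_dist _ t1 t2 => cnorm (term_val v t1 - term_val v t2)
  | qf_conn c phis => conn_fun (\row_i qf_val v (phis i))
  end.
End Semantics.

Definition tuple_symbols n (so : 'I_n -> nat) : symbols := Symbols so.

Definition sum_symbols (X Y : symbols) : symbols :=
  @Symbols (X + Y)%type
    (fun z => match z with inl x => sym_sort x | inr y => sym_sort y end).

Definition sum_val (A : Type) (X Y : symbols) (v : X -> A) (w : Y -> A)
    (z : sum_symbols X Y) : A :=
  match z with inl x => v x | inr y => w y end.

(* [sup_x inf_n phi_n (x)] where [phi_n (x)] is [inf_y psi_n (x, y)]; the
   length and the sorts of the tuple [y] depend on [n]. *)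
Record supinf_sentence (R : realType) := SupInf {
  si_arity : nat;
  si_sort : 'I_si_arity -> nat;
  ex_arity : nat -> nat;
  ex_sort : forall n, 'I_(ex_arity n) -> nat;
  ex_matrix : forall n,
    qf (all_connectives R)
       (sum_symbols (tuple_symbols si_sort) (tuple_symbols (@ex_sort n)))
}.

Definition existential_val (R : realType) (A : cstarAlgType R)
    (s : supinf_sentence R) (x : tuple_symbols (@si_sort R s) -> A) (n : nat) :
    \bar R :=
  ereal_inf [set (qf_val (sum_val x y) (ex_matrix s n))%:E
            | y in @interpretation R A (tuple_symbols (@ex_sort R s n))].

Definition supinf_val (R : realType) (A : cstarAlgType R)
    (s : supinf_sentence R) : \bar R :=
  ereal_sup [set ereal_inf (range (existential_val x))
            | x in @interpretation R A (tuple_symbols (@si_sort R s))].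

(* As usual for conditions of the form [sigma = 0], the sentences are taken to
   be nonnegative, so that their supremum vanishes iff all of them do. *)
Definition defines_nuclearity (R : realType)
    (sigma : nat -> supinf_sentence R) : Prop :=
  (forall m (A : cstarAlgType R), (0 <= supinf_val A (sigma m))%E) /\
  (forall A : cstarAlgType R,
     nuclear A <-> forall m, supinf_val A (sigma m) = 0%E).

Definition sup_supinf_val (R : realType) (A : cstarAlgType R)
    (sigma : nat -> supinf_sentence R) : \bar R :=
  ereal_sup (range (fun m => supinf_val A (sigma m))).

(** * The game *)

(* [(k, n)] is the [n]-th new constant of the sort of radius [k.+1]. The models
   of [T] being the unital C*-algebras, satisfiability and entailment modulo
   [T] are expressed through these. *)
Definition new_constants : symbols := @Symbols (nat * nat)%type fst.

Section Game.
Variables (R : realType) (K : connectives R).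

(* [(phi, r)] stands for [phi < r]. *)
Definition expression : Type := (qf K new_constants * R)%type.

Definition models (A : cstarAlgType R) (v : new_constants -> A)
    (p : set expression) : Prop :=
  interpretation v /\ forall e, p e -> qf_val v e.1 < e.2.

Definition satisfiable (p : set expression) : Prop :=
  exists (A : cstarAlgType R) (v : new_constants -> A), models v p.

Definition entails_dist (p : set expression) k (t u : term new_constants k)
    (r : R) : Prop :=
  forall (A : cstarAlgType R) (v : new_constants -> A),
    models v p -> qf_val v (qf_dist K t u) = r.

Record condition := Condition {
  cond_set :> set expression;
  cond_finite : finite_set cond_set;
  cond_satisfiable : satisfiable cond_set
}.

Definition definitive (p : set expression) : Prop :=
  forall k (t u : term new_constants k), exists! r, entails_dist p t u r.

(* [M] is the completion of the algebra of closed terms for the prestructure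
   determined by [p]. *)
Definition compiled (p : set expression) (M : cstarAlgType R) : Prop :=
  exists v : new_constants -> M,
    [/\ interpretation v,
        forall k (t u : term new_constants k) r,
          entails_dist p t u r -> qf_val v (qf_dist K t u) = r
      & cnorm_closure [set x : M | exists k (t : term new_constants k),
                               x = term_val v t] = setT].

(* [tau h p] is the answer to the move [p] of the first player after the
   earlier moves [h] of both players. *)
Definition strategy : Type := seq condition -> condition -> condition.

Definition legal_strategy (tau : strategy) : Prop :=
  forall (h : seq condition) (p : condition), p `<=` tau h p.

Definition play_following (tau : strategy) (p : nat -> condition) : Prop :=
  (forall i, p i `<=` p i.+1) /\
  (forall i, p (i.*2).+1 = tau (mkseq p i.*2) (p i.*2)).

Definition enforceable (P : cstarAlgType R -> Prop) : Prop :=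
  exists2 tau : strategy, legal_strategy tau &
    forall p : nat -> condition, play_following tau p ->
      let pbar := \bigcup_i (p i : set expression) in
      definitive pbar /\ exists M : cstarAlgType R, compiled pbar M /\ P M.
End Game.

(* Main.v *)
(** All four properties are equivalent to: (KL) every condition has a model in
    [O2].

    Two Cuntz pairs of an algebra [B] are always conjugate by a unitary of an
    ultrapower of [B]: averaging gives approximate intertwiners in both
    directions, and a Cantor-Bernstein argument for intertwiners applies because
    each pair is equivalent to its double, the flip being connected to [1] by a
    path of unitaries. Under (KL) the second player can therefore enforce [O2]:
    at each move she names the two generators by fresh constants and records
    *-polynomials in them approximating the constants used so far; a model in
    [O2] of any later condition can then be conjugated so as to stay close to the
    previous one, and the successive models converge.

    A nuclear algebra [A] embeds into an iterated ultrapower of [O2]. The GNS form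
    of a completely positive map [A -> M_n], written with matrix units from a
    Cuntz pair, yields a linear map [b] commuting with a contraction [h] and
    multiplicative where [h] is nonzero; factoring [id_A] approximately through
    [M_n] intertwines [k(h) b] with [k(1 - h) b]. Filling a 2x2 matrix with
    [h b], [(1 - h) b] transported to [h b], and off-diagonal terms
    [sqrt (h (1 - h)) b] gives a *-homomorphism, which can be made unital because
    projections of the ultrapower absorb their doubles. Hence enforcing
    nuclearity implies (KL), and conversely [O2] itself is nuclear: compressing to
    words of length at least [d] and less than [d + L], and averaging over [L],
    factors the identity through matrices.

    Finally (KL) embeds any [A] into an ultrapower of [O2], along an ultrafilter
    on finite sets of pairs of terms with symbols for all elements of [A]. *)

Require Import Defs.
From HB Require Import structures.
From mathcomp Require Import all_boot all_order all_algebra.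
From mathcomp Require Import complex ring lra zify.
From mathcomp Require Import all_classical all_reals all_analysis.

Set Implicit Arguments.
Unset Strict Implicit.
Unset Printing Implicit Defensive.

Import Order.TTheory GRing.Theory Num.Theory.
Import numFieldNormedType.Exports.

Local Open Scope classical_set_scope.
Local Open Scope ring_scope.
Local Open Scope complex_scope.

(** * Elementary theory of C*-algebras *)

(** Truncating a GNS representation to finitely many vectors destroys multiplicativity at the edge.
    Grading the vectors by the number of operators needed to reach them, and damping by a weight
    that falls linearly to 0 on the last level, hides the edge and makes commutators with the weight
    as small as the inverse number of levels. The price is that only the cone over the algebra is
    represented; this is why the weight [t] has to be exchanged with [1 - t]. The three nested
    ultrapowers have separate tasks: one makes the weight central, one makes the approximate
    factorization exact, one turns a corner into a unital image. Conditions are finite and open, so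
    they descend through all of them. Positivity rests everywhere on one iteration for square roots,
    with [cnorm (1 - b) <= 1] standing for positivity of a self-adjoint [b]; positivity of forms is
    read off elements [z] for which [star z * z] is a scalar. *)

Section CStarBasics.
Variables (R : realType) (A : cstarAlgType R).
Implicit Types (x y z a b u : A) (r : R) (c : R[i]).

Lemma cnormZr r x : cnorm (r%:C *: x) = `|r| * cnorm x.
Proof. by rewrite cnormZ normc_def /= expr0n /= addr0 sqrtr_sqr. Qed.

Lemma cnorm0 : cnorm (0 : A) = 0.
Proof. by rewrite -(scale0r (0 : A)) cnormZ normr0 mul0r. Qed.

Lemma cnormN x : cnorm (- x) = cnorm x.
Proof. by rewrite -scaleN1r cnormZ normrN1 mul1r. Qed.

Lemma cnorm_ge0 x : 0 <= cnorm x.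
Proof.
have := cnormD x (- x); rewrite subrr cnorm0 cnormN; lra.
Qed.

Lemma cnormBC x y : cnorm (x - y) = cnorm (y - x).
Proof. by rewrite -cnormN opprB. Qed.

Lemma cnormB x y : cnorm (x - y) <= cnorm x + cnorm y.
Proof. by rewrite -(cnormN y); apply: cnormD. Qed.

Lemma cnorm_triangle z x y : cnorm (x - y) <= cnorm (x - z) + cnorm (z - y).
Proof. by rewrite -[x - y](subrKA z); apply: cnormD. Qed.

Lemma cnorm_dist x y : `|cnorm x - cnorm y| <= cnorm (x - y).
Proof.
have h1 := cnormD (x - y) y; have h2 := cnormD (y - x) x.
rewrite subrK in h1; rewrite subrK cnormBC in h2.
by rewrite ler_norml; apply/andP; split; lra.
Qed.

Lemma cnorm_sum (I : Type) (s : seq I) (P : pred I) (F : I -> A) :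
  cnorm (\sum_(i <- s | P i) F i) <= \sum_(i <- s | P i) cnorm (F i).
Proof.
elim/big_ind2: _ => [|x1 x2 y1 y2 h1 h2|//]; first by rewrite cnorm0.
exact: le_trans (cnormD _ _) (lerD h1 h2).
Qed.

Lemma star0 : star (0 : A) = 0.
Proof. by have := starZ 0 (0 : A); rewrite rmorph0 !scale0r. Qed.

Lemma starN x : star (- x) = - star x.
Proof. by apply/eqP; rewrite -subr_eq0 opprK -starD addrC subrr star0. Qed.

Lemma starB x y : star (x - y) = star x - star y.
Proof. by rewrite starD starN. Qed.

Lemma star1 : star (1 : A) = 1.
Proof. by rewrite -[LHS]mulr1 -{2}(starK (1 : A)) -starM mulr1 starK. Qed.

Lemma starZr r x : star (r%:C *: x) = r%:C *: star x.
Proof. by rewrite starZ [Num.conj _]conjc_real. Qed.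

Lemma star_sum (I : Type) (s : seq I) (P : pred I) (F : I -> A) :
  star (\sum_(i <- s | P i) F i) = \sum_(i <- s | P i) star (F i).
Proof. by apply: big_morph; [exact: starD|exact: star0]. Qed.

Lemma cnorm_star x : cnorm (star x) = cnorm x.
Proof.
suff le y : cnorm y <= cnorm (star y).
  by apply/le_anti; rewrite le -{2}(starK x) le.
have [->|/eqP y0] := eqVneq y 0; first by rewrite star0.
have yp : 0 < cnorm y.
  by rewrite lt0r cnorm_ge0 andbT; apply/eqP => /cnorm_eq0.
by rewrite -(ler_pM2r yp) -expr2 -cnorm_starM; apply: cnormM.
Qed.

Lemma cnorm1 : cnorm (1 : A) = 1.
Proof.
have h : cnorm (1 : A) * (cnorm (1 : A) - 1) = 0.
  by rewrite mulrBr mulr1 -expr2 -cnorm_starM star1 mulr1 subrr.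
move/eqP: h; rewrite mulf_eq0 subr_eq0.
by case/orP => /eqP // /cnorm_eq0 /eqP; rewrite oner_eq0.
Qed.

Lemma cnorm_eq0P x : cnorm x <= 0 -> x = 0.
Proof. by move=> h; apply: cnorm_eq0; apply/le_anti; rewrite h cnorm_ge0. Qed.

Lemma cnorm_gt0 x : x <> 0 -> 0 < cnorm x.
Proof. by move=> x0; rewrite ltNge; apply/negP => /cnorm_eq0P. Qed.

Lemma starM_eq0 x : star x * x = 0 -> x = 0.
Proof.
move=> h; apply: cnorm_eq0; apply/eqP.
by rewrite -sqrf_eq0 -cnorm_starM h cnorm0.
Qed.

Lemma cnorm_le_sqr x r : 0 <= r -> cnorm (star x * x) <= r ^+ 2 -> cnorm x <= r.
Proof. by rewrite cnorm_starM => r0; rewrite ler_sqr // nnegrE ?cnorm_ge0. Qed.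

Lemma isometry_norm x : star x * x = 1 -> cnorm x = 1.
Proof.
move=> h; apply/eqP; rewrite -(eqrXn2 (n := 2)) ?cnorm_ge0 ?ler01 //.
by rewrite -cnorm_starM h cnorm1 expr1n.
Qed.

Lemma proj_norm x : star x = x -> x * x = x -> cnorm x <= 1.
Proof.
move=> xs xx; have h : cnorm x * (cnorm x - 1) = 0.
  by rewrite mulrBr mulr1 -expr2 -cnorm_starM xs xx subrr.
move/eqP: h; rewrite mulf_eq0 subr_eq0.
by case/orP => /eqP->; rewrite ?lexx ?ler01.
Qed.

Lemma cnormMl x y : star x * x = 1 -> cnorm (x * y) = cnorm y.
Proof.
move=> h; apply/eqP; rewrite -(eqrXn2 (n := 2)) ?cnorm_ge0 //.
by rewrite -!cnorm_starM starM -mulrA (mulrA (star x)) h mul1r.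
Qed.

Lemma cnormMr x y : star y * y = 1 -> cnorm (x * star y) = cnorm x.
Proof. by move=> h; rewrite -cnorm_star starM starK cnormMl ?cnorm_star. Qed.

Lemma cnorm_conj u x : star u * u = 1 -> cnorm (u * x * star u) = cnorm x.
Proof. by move=> h; rewrite cnormMr // cnormMl. Qed.

End CStarBasics.

(* [abel] decides linear identities in an additive group: both sides are reified
   and the signed number of occurrences of each atom is compared. *)
Inductive aexp := AVar of nat | AZero | AAdd of aexp & aexp | AOpp of aexp.

Section Abel.
Variable V : zmodType.

Fixpoint aeval (env : seq V) e : V :=
  match e with
  | AVar n => nth 0 env n
  | AZero => 0
  | AAdd e1 e2 => aeval env e1 + aeval env e2
  | AOpp e1 => - aeval env e1
  end.

(** The flag carries the sign: positive and negative occurrences are counted separately, in natural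
    numbers. *)
Fixpoint acount (s : bool) e (i : nat) : nat :=
  match e with
  | AVar n => s && (n == i)
  | AZero => 0
  | AAdd e1 e2 => acount s e1 i + acount s e2 i
  | AOpp e1 => acount (~~ s) e1 i
  end.

Lemma aevalE env e : aeval env e =
  \sum_(i < size env) (nth 0 env i *+ acount true e i - nth 0 env i *+ acount false e i).
Proof.
elim: e => [n||e1 IH1 e2 IH2|e IH] /=.
- have [ns|sn] := ltnP n (size env); last first.
    rewrite nth_default // big1 // => i _; rewrite subr0.
    by case: eqP => // ni; rewrite ni leqNgt ltn_ord in sn.
  rewrite (bigD1 (Ordinal ns)) //= eqxx subr0 mulr1n big1 ?addr0 // => i.
  by move=> /eqP ni; rewrite subr0; case: eqP => // h; case: ni; apply: val_inj.
- by rewrite big1 // => i _; rewrite subrr.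
- rewrite IH1 IH2 -big_split /=; apply: eq_bigr => i _.
  by rewrite !mulrnDr opprD addrACA.
- by rewrite IH -sumrN; apply: eq_bigr => i _; rewrite opprB.
Qed.

Lemma abelP env e1 e2 :
  all (fun i => acount true e1 i + acount false e2 i
                == acount true e2 i + acount false e1 i)%N (iota 0 (size env)) ->
  aeval env e1 = aeval env e2.
Proof.
move=> /allP h; rewrite !aevalE; apply: eq_bigr => i _.
have /h/eqP hi : (i : nat) \in iota 0 (size env) by rewrite mem_iota add0n ltn_ord.
apply/eqP; rewrite subr_eq addrAC eq_sym subr_eq -!mulrnDr.
by rewrite -hi.
Qed.

End Abel.

Ltac ab_same x y :=
  first [ constr_eq x y
        | lazymatch x with
          | (?a * ?b)%R =>
            lazymatch y with (?c * ?d)%R => ab_same a c; ab_same b d end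
          | (?a + ?b)%R =>
            lazymatch y with (?c + ?d)%R => ab_same a c; ab_same b d end
          | (- ?a)%R => lazymatch y with (- ?c)%R => ab_same a c end
          | (?a *: ?b)%R =>
            lazymatch y with (?c *: ?d)%R => ab_same a c; ab_same b d end
          | star ?a => lazymatch y with star ?c => ab_same a c end
          | (1)%R => lazymatch y with (1)%R => idtac end
          end ].
Ltac ab_mem x l :=
  match l with
  | nil => constr:(false)
  | ?y :: _ => let _ := match goal with _ => ab_same x y end in constr:(true)
  | _ :: ?l' => ab_mem x l'
  end.
Ltac ab_idx x l :=
  match l with
  | ?y :: _ => let _ := match goal with _ => ab_same x y end in constr:(O)
  | _ :: ?l' => let n := ab_idx x l' in constr:(S n)
  end.
Ltac ab_atoms l t :=
  match t with
  | (?a + ?b)%R => let l1 := ab_atoms l a in ab_atoms l1 b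
  | (- ?a)%R => ab_atoms l a
  | (0)%R => l
  | _ => match ab_mem t l with true => l | false => constr:(t :: l) end
  end.
Ltac ab_reify l t :=
  match t with
  | (?a + ?b)%R => let x := ab_reify l a in let y := ab_reify l b in constr:(AAdd x y)
  | (- ?a)%R => let x := ab_reify l a in constr:(AOpp x)
  | (0)%R => constr:(AZero)
  | _ => let n := ab_idx t l in constr:(AVar n)
  end.
Ltac abel :=
  match goal with
  | |- @eq ?T ?a ?b =>
    let l0 := ab_atoms (@nil T) a in let l := ab_atoms l0 b in
    let x := ab_reify l a in let y := ab_reify l b in
    apply: (@abelP _ l x y); vm_compute; reflexivity
  end.
Ltac ncexp :=
  do 2 rewrite ?(mulrDl, mulrDr, mulNr, mulrN, mul0r, mulr0, mul1r, mulr1, mulrA, opprK, opprD).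
Ltac ncr := ncexp; abel.

(** * Norm convergence along a filter *)

Section Convergence.
Variables (R : realType) (A : cstarAlgType R) (I : Type) (F : set_system I).
Implicit Types (u v : I -> A) (l m : A).

Definition ccvg u l : Prop :=
  forall eps : R, 0 < eps -> \forall i \near F, cnorm (u i - l) < eps.

Context {FF : Filter F}.

Lemma ccvgE u l : ccvg u l <-> (cnorm (u i - l) @[i --> F] --> (0 : R)).
Proof.
split=> [h|/cvgrPdist_lt h].
  apply/cvgrPdist_lt => e e0; apply: filterS (h e e0) => i.
  by rewrite sub0r normrN ger0_norm // cnorm_ge0.
move=> e e0; apply: filterS (h e e0) => i.
by rewrite sub0r normrN ger0_norm // cnorm_ge0.
Qed.

Lemma ccvg_cst l : ccvg (fun=> l) l.
Proof. by move=> e e0; apply: filterE => i; rewrite subrr cnorm0. Qed.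

Lemma ccvg_ext u v l : (forall i, u i = v i) -> ccvg u l -> ccvg v l.
Proof. by move=> uv h e e0; apply: filterS (h e e0) => i; rewrite uv. Qed.

Lemma ccvg_eq u v l m :
  ccvg u l -> (forall i, u i = v i) -> l = m -> ccvg v m.
Proof. by move=> ul uv <-; apply: ccvg_ext ul. Qed.

Lemma ccvgD u v l m : ccvg u l -> ccvg v m -> ccvg (fun i => u i + v i) (l + m).
Proof.
move=> ul vm e e0; have e2 : 0 < e / 2 by lra.
apply: filterS2 (ul _ e2) (vm _ e2) => i h1 h2.
rewrite opprD addrACA; apply: le_lt_trans (cnormD _ _) _; lra.
Qed.

Lemma ccvgZ (c : R[i]) u l : ccvg u l -> ccvg (fun i => c *: u i) (c *: l).
Proof.
move=> ul e e0; have k0 : 0 <= complex.Re `|c|.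
  by have := normr_ge0 c; rewrite lecE /= => /andP[].
have h : 0 < e / (complex.Re `|c| + 1) by rewrite divr_gt0 //; lra.
apply: filterS (ul _ h) => i; rewrite -scalerBr cnormZ => hi.
have: complex.Re `|c| * cnorm (u i - l) <= (complex.Re `|c| + 1) * cnorm (u i - l).
  by rewrite ler_wpM2r ?cnorm_ge0 //; lra.
move=> /le_lt_trans; apply; rewrite mulrC -ltr_pdivlMr //; lra.
Qed.

Lemma ccvgN u l : ccvg u l -> ccvg (fun i => - u i) (- l).
Proof.
by move=> ul e e0; apply: filterS (ul e e0) => i; rewrite -opprD cnormN.
Qed.

Lemma ccvgB u v l m : ccvg u l -> ccvg v m -> ccvg (fun i => u i - v i) (l - m).
Proof. by move=> ul vm; apply: ccvgD ul (ccvgN vm). Qed.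

Lemma ccvg_star u l : ccvg u l -> ccvg (fun i => star (u i)) (star l).
Proof.
by move=> ul e e0; apply: filterS (ul e e0) => i; rewrite -starB cnorm_star.
Qed.

Lemma ccvgM u v l m : ccvg u l -> ccvg v m -> ccvg (fun i => u i * v i) (l * m).
Proof.
move=> ul vm e e0.
set k := cnorm l + cnorm m + 2.
have k0 : 0 < k by have := cnorm_ge0 l; have := cnorm_ge0 m; rewrite /k; lra.
have d0 : 0 < Num.min 1 (e / k / 2).
  by rewrite lt_min ltr01 /= !divr_gt0.
apply: filterS2 (ul _ d0) (vm _ d0) => i.
rewrite !lt_min => /andP[h1 h2] /andP[h3 h4].
have -> : u i * v i - l * m = (u i - l) * (v i - m) + (u i - l) * m + l * (v i - m).
  by ncr.
apply: le_lt_trans (cnormD _ _) _.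
apply: le_lt_trans (lerD (cnormD _ _) (lexx _)) _.
have a1 := cnormM (u i - l) (v i - m); have a2 := cnormM (u i - l) m.
have a3 := cnormM l (v i - m).
move: h1 h2 h3 h4 a1 a2 a3 (cnorm_ge0 (u i - l)) (cnorm_ge0 (v i - m)).
move: (cnorm_ge0 l) (cnorm_ge0 m); rewrite /k in k0 *.
set x := cnorm (u i - l); set y := cnorm (v i - m).
set p := cnorm (_ * _); set q := cnorm (_ * m); set s := cnorm (l * _).
set cl := cnorm l in k0 *; set cm := cnorm m in k0 *.
move=> cl0 cm0 x1 xe y1 ye pp qq ss x0 y0.
have xk : x * (cl + cm + 2) < e / 2.
  by rewrite -ltr_pdivlMr // -mulrA [2^-1 * _]mulrC mulrA.
have yk : y * (cl + cm + 2) < e / 2.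
  by rewrite -ltr_pdivlMr // -mulrA [2^-1 * _]mulrC mulrA.
nra.
Qed.

Lemma ccvg_norm u l : ccvg u l -> cnorm (u i) @[i --> F] --> cnorm l.
Proof.
move=> ul; apply/cvgrPdist_lt => e e0; apply: filterS (ul e e0) => i.
by apply: le_lt_trans; rewrite distrC cnorm_dist.
Qed.

Context {PF : ProperFilter F}.

Lemma ccvg_unique u l m : ccvg u l -> ccvg u m -> l = m.
Proof.
move=> ul um; apply/eqP; rewrite -subr_eq0; apply/eqP/cnorm_eq0P.
apply/ler_addgt0Pr => e e0; rewrite add0r; have e2 : 0 < e / 2 by lra.
have [i [h1 h2]] := filter_ex (filterI (ul _ e2) (um _ e2)).
have := cnorm_triangle (u i) l m; rewrite (cnormBC l (u i)); lra.
Qed.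

Lemma ccvg_norm_le u l (c : R) :
  ccvg u l -> (\forall i \near F, cnorm (u i) <= c) -> cnorm l <= c.
Proof.
move=> ul uc; apply/ler_addgt0Pr => e e0.
have [i [h1 h2]] := filter_ex (filterI (ul _ e0) uc).
have := cnormD (u i - l) (- u i); rewrite addrAC subrr add0r !cnormN; lra.
Qed.

Lemma ccvg_comm u l (y : A) :
  ccvg u l -> (forall i, y * u i = u i * y) -> y * l = l * y.
Proof.
move=> ul h; apply: (ccvg_unique (u := fun i => y * u i)).
  exact: ccvgM (ccvg_cst y) ul.
by apply: ccvg_ext (ccvgM ul (ccvg_cst y)) => i; rewrite h.
Qed.

End Convergence.

Arguments ccvg {R A I} F u l.
Arguments ccvgE {R A I F FF} u l.
Arguments ccvg_cst {R A I F FF} l.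
Arguments ccvg_ext {R A I F FF u v l} _ _.
Arguments ccvg_eq {R A I F FF u v l m} _ _ _.
Arguments ccvgD {R A I F FF u v l m} _ _.
Arguments ccvgB {R A I F FF u v l m} _ _.
Arguments ccvgN {R A I F FF u l} _.
Arguments ccvgZ {R A I F FF} c {u l} _.
Arguments ccvgM {R A I F FF u v l m} _ _.
Arguments ccvg_star {R A I F FF u l} _.
Arguments ccvg_norm {R A I F FF u l} _.
Arguments ccvg_unique {R A I F FF PF u l m} _ _.
Arguments ccvg_norm_le {R A I F FF PF u l c} _ _.
Arguments ccvg_comm {R A I F FF PF u l} y _ _.

Lemma ccauchy_cvg (R : realType) (A : cstarAlgType R) (u : nat -> A) :
  (forall eps : R, 0 < eps -> exists N, forall m n, (N <= m)%N -> (N <= n)%N ->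
     cnorm (u m - u n) < eps) ->
  exists l, ccvg \oo u l.
Proof. by move=> /cnorm_complete[l ul]; exists l; apply/ccvgE. Qed.

(** * Square roots by iteration *)

Section Sqrt.
Variables (R : realType).

(** This is [sqrt_seq] at the scalar [z = 1]. Being increasing and bounded it converges, and it
    majorizes both the norms and the increments of [sqrt_seq] for every [z] in the unit ball. *)
Fixpoint rho n : R := if n is m.+1 then (1 + rho m ^+ 2) / 2 else 0.

Lemma rho_bound n : 0 <= rho n <= 1.
Proof. elim: n => [|n /andP[h1 h2]] /=; [lra|rewrite expr2; nra]. Qed.

Lemma rhoS n : rho n <= rho n.+1.
Proof. by have := sqr_ge0 (1 - rho n); rewrite /= !expr2; nra. Qed.

Lemma rho_cauchy (eps : R) : 0 < eps ->
  exists N, forall m n, (N <= m)%N -> (N <= n)%N -> `|rho m - rho n| < eps.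
Proof.
move=> e0; have : cvgn rho.
  apply: nondecreasing_is_cvgn; first exact/nondecreasing_seqP/rhoS.
  by exists 1 => _ [n _ <-]; case/andP: (rho_bound n).
move=> /cvgrPdist_lt h; have e2 : 0 < eps / 2 by lra.
have [N _ hN] := h _ e2; exists N => m n Nm Nn.
rewrite -[_ - _](subrKA (limn rho)); apply: le_lt_trans (ler_normD _ _) _.
have h1 : `|rho m - limn rho| < eps / 2 by rewrite distrC; apply: hN.
have h2 : `|limn rho - rho n| < eps / 2 by apply: hN.
lra.
Qed.

Variable A : cstarAlgType R.
Implicit Types (x y z a b : A).

Fixpoint sqrt_seq z n : A :=
  if n is m.+1 then (2^-1 : R)%:C *: (z + sqrt_seq z m * sqrt_seq z m) else 0.

Lemma sqrt_seq_comm z y n : y * z = z * y ->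
  y * sqrt_seq z n = sqrt_seq z n * y.
Proof.
move=> h; elim: n => [|n IH] /=; first by rewrite mulr0 mul0r.
by rewrite -scalerAl -scalerAr mulrDl mulrDr h mulrA IH -!mulrA IH.
Qed.

Lemma star_sqrt_seq z n : star z = z -> star (sqrt_seq z n) = sqrt_seq z n.
Proof.
move=> h; elim: n => [|n IH] /=; first by rewrite star0.
by rewrite starZr starD starM h IH.
Qed.

Lemma sqrt_seq_norm z n : cnorm z <= 1 -> cnorm (sqrt_seq z n) <= rho n.
Proof.
move=> h; elim: n => [|n IH] /=; first by rewrite cnorm0.
rewrite cnormZr ger0_norm ?invr_ge0 ?ler0n //.
have h1 := cnormD z (sqrt_seq z n * sqrt_seq z n).
have h2 := cnormM (sqrt_seq z n) (sqrt_seq z n).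
have h3 := cnorm_ge0 (sqrt_seq z n); rewrite expr2; nra.
Qed.

(** All iterates commute, so a difference of squares factors: each increment is half the previous
    increment times the sum of the two iterates, and [rho] obeys the same recursion. *)
Lemma sqrt_seq_diff z n : cnorm z <= 1 ->
  cnorm (sqrt_seq z n.+1 - sqrt_seq z n) <= rho n.+1 - rho n.
Proof.
move=> h; elim: n => [|n IH].
  rewrite /= mulr0 addr0 subr0 cnormZr ger0_norm ?invr_ge0 ?ler0n //.
  by rewrite expr2; lra.
have -> : sqrt_seq z n.+2 - sqrt_seq z n.+1 =
  (2^-1 : R)%:C *: ((sqrt_seq z n.+1 - sqrt_seq z n) * (sqrt_seq z n.+1 + sqrt_seq z n)).
  rewrite [sqrt_seq z n.+2]/= {1 2}/sqrt_seq -/sqrt_seq -scalerBr; congr (_ *: _).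
  rewrite opprD addrACA subrr add0r mulrDr !mulrBl.
  rewrite (@sqrt_seq_comm z (sqrt_seq z n.+1) n); last first.
    by rewrite -sqrt_seq_comm.
  by rewrite addrA subrK.
rewrite cnormZr ger0_norm ?invr_ge0 ?ler0n //.
have h1 := cnormM (sqrt_seq z n.+1 - sqrt_seq z n) (sqrt_seq z n.+1 + sqrt_seq z n).
have h2 := cnormD (sqrt_seq z n.+1) (sqrt_seq z n).
have h3 := sqrt_seq_norm n.+1 h; have h4 := sqrt_seq_norm n h.
have h5 := cnorm_ge0 (sqrt_seq z n.+1 - sqrt_seq z n).
have h6 := cnorm_ge0 (sqrt_seq z n.+1 + sqrt_seq z n).
have -> : rho n.+2 - rho n.+1 = 2^-1 * ((rho n.+1 - rho n) * (rho n.+1 + rho n)).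
  have -> : rho n.+2 = (1 + rho n.+1 ^+ 2) / 2 by [].
  have : rho n.+1 = (1 + rho n ^+ 2) / 2 by [].
  by rewrite !expr2; move: (rho n.+1) (rho n) => p q; lra.
rewrite ler_pM2l ?invr_gt0 ?ltr0n //; apply: le_trans h1 _.
apply: ler_pM => //; lra.
Qed.

Lemma sqrt_seq_dist z n k : cnorm z <= 1 ->
  cnorm (sqrt_seq z (k + n) - sqrt_seq z n) <= rho (k + n) - rho n.
Proof.
move=> h; elim: k => [|k IH]; first by rewrite add0n !subrr cnorm0.
have := sqrt_seq_diff (k + n) h.
have := cnorm_triangle (sqrt_seq z (k + n)) (sqrt_seq z (k.+1 + n)) (sqrt_seq z n).
rewrite addSn; lra.
Qed.

(** The limit [r] of the iteration satisfies [2 r = z + r^2], so [b = 1 - r] squares to [1 - z]. The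
    norm bound on [1 - b] selects the positive root, and the last clause puts the root in the
    bicommutant of [z]. *)
Lemma csqrt_ex z : star z = z -> cnorm z <= 1 ->
  exists b, [/\ star b = b, b * b = 1 - z, cnorm (1 - b) <= 1
     & forall y, y * z = z * y -> y * b = b * y].
Proof.
move=> zs z1; have [|r ur] := @ccauchy_cvg R A (sqrt_seq z).
  move=> e e0; have [N hN] := rho_cauchy e0; exists N.
  suff le m n : (N <= m)%N -> (m <= n)%N -> cnorm (sqrt_seq z n - sqrt_seq z m) < e.
    move=> m n Nm Nn; case/orP: (leq_total m n) => mn; last exact: le.
    by rewrite cnormBC; apply: le.
  move=> Nm mn; apply: le_lt_trans (hN n m (leq_trans Nm mn) Nm).
  by rewrite -(subnK mn); apply: le_trans (sqrt_seq_dist _ _ z1) (ler_norm _).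
have rs : star r = r.
  apply: ccvg_unique (ccvg_star ur) _.
  by apply: ccvg_ext ur => n; rewrite star_sqrt_seq.
have req : (2^-1 : R)%:C *: (z + r * r) = r.
  apply: (@ccvg_unique _ _ _ \oo _ _ (fun n => sqrt_seq z n.+1)).
    exact: ccvgZ (ccvgD (ccvg_cst z) (ccvgM ur ur)).
  move=> e e0; have [N _ hN] := ur e e0; exists N => // n /= Nn.
  exact: (hN n.+1 (leqW Nn)).
exists (1 - r); split.
- by rewrite starB star1 rs.
- have h : z + r * r = r + r.
    rewrite -[in RHS]req -scalerDl -rmorphD /=.
    by rewrite (_ : 2^-1 + 2^-1 = 1 :> R) ?scale1r //; field.
  have -> : (1 - r) * (1 - r) = 1 - z + (z + r * r - (r + r)) by ncr.
  by rewrite h subrr addr0.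
- rewrite opprB addrCA subrr addr0; apply: (ccvg_norm_le ur).
  apply: nearW => n; apply: le_trans (sqrt_seq_norm n z1) _.
  by case/andP: (rho_bound n).
- move=> y yz; rewrite mulrBr mulrBl mulr1 mul1r; congr (_ - _).
  by apply: (ccvg_comm _ ur) => n; apply: sqrt_seq_comm.
Qed.

End Sqrt.

(** * Real scalars and conjugation in [R[i]] *)

Section RealScalars.
Variable R : realType.
Implicit Types r s : R.

Lemma rcD r s : (r + s)%:C = r%:C + s%:C :> R[i]. Proof. exact: rmorphD. Qed.
Lemma rcB r s : (r - s)%:C = r%:C - s%:C :> R[i]. Proof. exact: rmorphB. Qed.
Lemma rcM r s : (r * s)%:C = r%:C * s%:C :> R[i]. Proof. exact: rmorphM. Qed.
Lemma rcN r : (- r)%:C = - r%:C :> R[i]. Proof. exact: rmorphN. Qed.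
Lemma rc1 : 1%:C = 1 :> R[i]. Proof. by []. Qed.

Implicit Types x y : R[i].

Lemma cjD x y : Num.conj (x + y) = Num.conj x + Num.conj y. Proof. exact: rmorphD. Qed.
Lemma cjN x : Num.conj (- x) = - Num.conj x. Proof. exact: rmorphN. Qed.
Lemma cjB x y : Num.conj (x - y) = Num.conj x - Num.conj y. Proof. exact: rmorphB. Qed.
Lemma cjM x y : Num.conj (x * y) = Num.conj x * Num.conj y. Proof. exact: rmorphM. Qed.
Lemma cjV x : Num.conj x^-1 = (Num.conj x)^-1. Proof. exact: fmorphV. Qed.
Lemma cj0 : Num.conj (0 : R[i]) = 0. Proof. exact: rmorph0. Qed.
Lemma cj1 : Num.conj (1 : R[i]) = 1. Proof. exact: rmorph1. Qed.
Lemma cjK x : Num.conj (Num.conj x) = x. Proof. exact: conjCK. Qed.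
Lemma cjr r : Num.conj (r%:C : R[i]) = r%:C. Proof. exact: conjc_real. Qed.
Lemma cj_sum (I : Type) (s : seq I) (P : pred I) (F : I -> R[i]) :
  Num.conj (\sum_(i <- s | P i) F i) = \sum_(i <- s | P i) Num.conj (F i).
Proof. exact: rmorph_sum. Qed.

End RealScalars.

(** * Positivity of self-adjoint elements *)

Section Positivity.
Variables (R : realType) (A : cstarAlgType R).
Implicit Types (x y z a b u w : A) (r : R) (c : R[i]).

Lemma scaleMl c x y : (c *: x) * y = c *: (x * y).
Proof. by rewrite scalerAl. Qed.

Lemma scaleMr c x y : x * (c *: y) = c *: (x * y).
Proof. by rewrite scalerAr. Qed.

Lemma cnorm_invZ r x : 0 < r -> cnorm ((r^-1)%:C *: x) = cnorm x / r.
Proof. by move=> r0; rewrite cnormZr ger0_norm ?invr_ge0 ?(ltW r0) // mulrC. Qed.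

Lemma half_scale x : (2^-1 : R)%:C *: (x + x) = x.
Proof.
rewrite scalerDr -scalerDl -rmorphD /= (_ : 2^-1 + 2^-1 = 1) ?scale1r //.
by field.
Qed.

Lemma starZi x : star ('i *: x) = - ('i *: star x).
Proof. by rewrite starZ conjCi scaleNr. Qed.

Lemma scale_ii x : 'i *: ('i *: x) = - x :> A.
Proof. by rewrite scalerA -expr2 sqrCi scaleN1r. Qed.

(** [a] is the real part of the isometry [a + 'i *: b]. *)
Lemma sa_norm_le1 a b : star a = a -> star b = b -> a * b = b * a ->
  a * a + b * b = 1 -> cnorm a <= 1.
Proof.
move=> sa sb ab ab1; pose u := a + 'i *: b.
have su : star u = a - 'i *: b by rewrite starD starZi sa sb.
have uu : star u * u = 1.
  rewrite su /u !(mulrDl, mulrDr, mulNr, scaleMl, scaleMr) scale_ii ab -ab1.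
  by abel.
have un := isometry_norm uu.
have -> : a = (2^-1 : R)%:C *: (u + star u).
  by rewrite su /u addrACA subrr addr0 half_scale.
rewrite cnormZr ger0_norm ?invr_ge0 ?ler0n //.
by have := cnormD u (star u); rewrite cnorm_star un; lra.
Qed.

Lemma sa_compl a : star a = a -> cnorm a <= 1 ->
  exists b, [/\ star b = b, b * b = 1 - a * a, a * b = b * a & cnorm b <= 1].
Proof.
move=> sa a1; have [||b [bs bb _ bc]] := @csqrt_ex R A (a * a).
- by rewrite starM sa.
- by apply: le_trans (cnormM _ _) _; apply: mulr_ile1; rewrite ?cnorm_ge0.
have ab : a * b = b * a by apply: bc; rewrite mulrA.
exists b; split=> //; apply: (@sa_norm_le1 b a) => //.
by rewrite bb subrK.
Qed.

Lemma sa_sqr_compl a : star a = a -> cnorm a <= 1 -> cnorm (1 - a * a) <= 1.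
Proof.
move=> sa a1; have [b [_ <- _ b1]] := sa_compl sa a1.
by apply: le_trans (cnormM _ _) _; apply: mulr_ile1; rewrite ?cnorm_ge0.
Qed.

Lemma sa_sum_sqr_eq0 x y : star x = x -> star y = y -> x * y = y * x ->
  x * x + y * y = 0 -> x = 0 /\ y = 0.
Proof.
move=> sx sy xy h; have h0 : x + 'i *: y = 0.
  apply: starM_eq0; rewrite starD starZi sx sy.
  rewrite !(mulrDl, mulrDr, mulNr, scaleMl, scaleMr) scale_ii xy -[RHS]h.
  by abel.
have /(congr1 (@star R A)) := h0; rewrite star0 starD starZi sx sy => h1.
have x0 : x = 0.
  have : x + x = (x + 'i *: y) + (x - 'i *: y) by abel.
  by rewrite h0 h1 addr0 -{3}(half_scale x) => ->; rewrite scaler0.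
split=> //; move: h0; rewrite x0 add0r => /(congr1 (fun t => 'i *: t)).
by rewrite scale_ii scaler0 => /eqP; rewrite oppr_eq0 => /eqP.
Qed.

(** The norm bounds provide self-adjoint roots [b'] and [w'] of [b] and [w]. The difference [d]
    satisfies [d (b + w) = 0], so the squares of [b' d] and [w' d] add up to 0 and both vanish; then
    [b d = w d = 0] and [d^2 = 0]. *)
Lemma sqrt_unique b w : star b = b -> star w = w -> b * w = w * b ->
  b * b = w * w -> cnorm (1 - b) <= 1 -> cnorm (1 - w) <= 1 -> b = w.
Proof.
move=> sb sw bw e b1 w1.
have [|b' [sb' bb' _ cb']] := @csqrt_ex R A (1 - b) _ b1.
  by rewrite starB star1 sb.
have [|w' [sw' ww' _ cw']] := @csqrt_ex R A (1 - w) _ w1.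
  by rewrite starB star1 sw.
rewrite opprB addrCA subrr addr0 in bb'; rewrite opprB addrCA subrr addr0 in ww'.
have cb y : y * b = b * y -> y * b' = b' * y by move=> h; apply: cb'; ncexp; rewrite h.
have cw y : y * w = w * y -> y * w' = w' * y by move=> h; apply: cw'; ncexp; rewrite h.
have w'b : b * w' = w' * b by apply: cw.
have b'w' : w' * b' = b' * w' by apply: cb; rewrite w'b.
have w'w : w' * w = w * w' by rewrite -ww' mulrA.
have b'b : b' * b = b * b' by rewrite -bb' mulrA.
have wb' : w * b' = b' * w by apply: cb; rewrite bw.
pose d := b - w.
have db' : d * b' = b' * d by rewrite /d mulrBl mulrBr b'b wb'.
have dw' : d * w' = w' * d by rewrite /d mulrBl mulrBr w'b w'w.
have sd : star d = d by rewrite starB sb sw.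
have d0 : d * (b + w) = 0 by rewrite /d mulrBl !mulrDr e bw; abel.
have [||||h1 h2] := @sa_sum_sqr_eq0 (b' * d) (w' * d).
- by rewrite starM sb' sd.
- by rewrite starM sw' sd.
- by rewrite -!mulrA [d * (w' * d)]mulrA [d * (b' * d)]mulrA db' dw' !mulrA b'w'.
- have -> : b' * d * (b' * d) + w' * d * (w' * d) = d * (b + w) * d.
    clearbody d; rewrite -{1}db' -{1}dw' -bb' -ww' mulrDr mulrDl !mulrA.
    reflexivity.
  by rewrite d0 mul0r.
have bd : b * d = 0 by rewrite -bb' -mulrA h1 mulr0.
have wd : w * d = 0 by rewrite -ww' -mulrA h2 mulr0.
have : d = 0 by apply: starM_eq0; rewrite sd {1}/d mulrBl bd wd subrr.
by move/eqP; rewrite subr_eq0 => /eqP.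
Qed.

(** For self-adjoint [x] this says that the spectrum lies in [[0, 2 r]]. Phrased by a norm
    inequality, positivity is visibly stable under sums. *)
Definition cpos x := exists2 r : R, 0 <= r & cnorm (r%:C *: 1 - x) <= r.

Lemma cpos_add x y : cpos x -> cpos y -> cpos (x + y).
Proof.
move=> [r r0 xr] [s s0 ys]; exists (r + s); first exact: addr_ge0.
rewrite rmorphD scalerDl opprD addrACA.
exact: le_trans (cnormD _ _) (lerD xr ys).
Qed.

Lemma cpos_sqr a : star a = a -> cpos (a * a).
Proof.
move=> sa; pose s := cnorm a + 1.
have s0 : 0 < s by rewrite /s; have := cnorm_ge0 a; lra.
pose a' := (s^-1)%:C *: a.
have sa' : star a' = a' by rewrite starZr sa.
have a'1 : cnorm a' <= 1.
  by rewrite cnorm_invZ // ler_pdivrMr // mul1r /s; lra.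
exists (s ^+ 2); first exact: sqr_ge0.
have -> : (s ^+ 2)%:C *: 1 - a * a = (s ^+ 2)%:C *: (1 - a' * a').
  rewrite scalerBr /a' scaleMl scaleMr !scalerA -!rmorphM /= expr2.
  by rewrite mulrACA divff ?gt_eqF // mulr1 scale1r.
rewrite cnormZr ger0_norm ?sqr_ge0 //.
by apply: ler_piMr; rewrite ?sqr_ge0 ?sa_sqr_compl.
Qed.

Lemma starM_neq_N1 x : star x * x <> - 1.
Proof.
move=> h; pose a := x + star x; pose b := 'i *: (x - star x).
have sa : star a = a by rewrite starD starK addrC.
have sb : star b = b by rewrite /b starZi starB starK -scalerN opprB.
pose e := - (x * star x).
have se : star e = e by rewrite starN starM starK.
have ee : e * e = e.
  by rewrite /e mulrNN -mulrA [star x * _]mulrA h mulN1r mulrN.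
have hs : a * a + b * b + (e * e + e * e) = - (1 + 1).
  rewrite ee /a /b scaleMl scaleMr scale_ii /e.
  have -> : - (1 + 1) = star x * x + star x * x :> A by rewrite h; abel.
  by ncr.
have : cpos (- (1 + 1)).
  by rewrite -hs; apply/cpos_add; apply/cpos_add; apply/cpos_sqr.
case=> r r0; rewrite opprK -(scale1r (1 + 1)) scalerDr -!scalerDl.
rewrite -(rmorph1 (real_complex R)) -!rmorphD cnormZr cnorm1 ger0_norm; lra.
Qed.

Lemma scale1_inj c : c *: (1 : A) = 0 -> c = 0.
Proof. by move/eqP; rewrite scaler_eq0 oner_eq0 orbF => /eqP. Qed.

(** This is the source of positivity for sesquilinear forms: it suffices to realize their diagonal
    values as scalars [star x * x]. *)
Lemma starM_scalar_ge0 x c : star x * x = c *: 1 -> 0 <= c.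
Proof.
move=> h; have cr : c \is Num.real.
  apply/CrealP; apply/eqP; rewrite -subr_eq0; apply/eqP/scale1_inj.
  by rewrite scalerBl -h -{1}star1 -starZ -h starM starK subrr.
rewrite real_leNgt ?real0 //; apply/negP => c0.
pose s := sqrtC (- c); have s2 : s ^+ 2 = - c := sqrtCK _.
have s0 : 0 < s by rewrite sqrtC_gt0 oppr_gt0.
apply: (@starM_neq_N1 (s^-1 *: x)); rewrite starZ scaleMl scaleMr h !scalerA.
rewrite (_ : _ * _ = -1) ?scaleN1r //.
rewrite conj_Creal ?realV ?gtr0_real // -[c]opprK -s2 mulrN expr2.
by rewrite mulrACA mulVf ?gt_eqF // mul1r.
Qed.

End Positivity.

(** * Contractivity and isometry of star-homomorphisms *)

Section Morphisms.
Variables (R : realType) (A B : cstarAlgType R) (f : {lrmorphism A -> B}).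
Hypothesis fs : star_preserving f.
Implicit Types (x y a b : A).

(** A self-adjoint [a] of norm one and the root of [1 - a^2] commute, and their squares add up to 1.
    A homomorphism preserves these identities, and [sa_norm_le1] reads the bound off them. *)
Lemma starhom_contractive x : cnorm (f x) <= cnorm x.
Proof.
suff H a : star a = a -> cnorm (f a) <= cnorm a.
  apply: cnorm_le_sqr (cnorm_ge0 _) _; rewrite -fs -rmorphM -cnorm_starM.
  by apply: H; rewrite starM starK.
move=> sa; have [->|/eqP a0] := eqVneq a 0; first by rewrite linear0 !cnorm0.
have := cnorm_gt0 a0; set s := cnorm a => s0.
pose a' := (s^-1)%:C *: a.
have sa' : star a' = a' by rewrite starZr sa.
have a'1 : cnorm a' <= 1.
  by rewrite cnorm_invZ // divff ?gt_eqF.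
have [b [sb bb ab _]] := sa_compl sa' a'1.
have : cnorm (f a') <= 1.
  apply: (@sa_norm_le1 _ _ _ (f b)); rewrite -?fs ?sa' ?sb -?rmorphM ?ab //.
  have <- : f (a' * a' + b * b) = 1 by rewrite bb addrC subrK rmorph1.
  by rewrite raddfD.
by rewrite linearZ cnorm_invZ // ler_pdivrMr // mul1r.
Qed.

Hypothesis finj : injective f.

(** Suppose [cnorm a = 1] while [cnorm (f a) <= c < 1]. The element [y = (a^2 - c^2) / 2] has a
    negative image, so by uniqueness of roots its absolute value [b] is mapped to [- f y].
    Injectivity gives [b = - y], hence [a^2 + 2 b = c^2] with [b] positive, and [cnorm a <= c]
    follows. *)
Lemma starhom_isometric x : cnorm (f x) = cnorm x.
Proof.
suff H (b : A) : star b = b -> cnorm b <= cnorm (f b).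
  apply/le_anti; rewrite starhom_contractive /=.
  apply: cnorm_le_sqr (cnorm_ge0 _) _; rewrite -cnorm_starM -fs -rmorphM.
  by apply: H; rewrite starM starK.
clear x; move: b; suff H1 (a : A) (c : R) : star a = a -> cnorm a = 1 -> 0 < c -> c < 1 -> cnorm (f a) <= c -> False.
  move=> a sa; have [->|/eqP a0] := eqVneq a 0; first by rewrite cnorm0 cnorm_ge0.
  have := cnorm_gt0 a0; set s := cnorm a => s0.
  rewrite leNgt; apply/negP => fas.
  pose c := (cnorm (f a) / s + 1) / 2.
  have f0 : 0 <= cnorm (f a) / s by rewrite divr_ge0 ?cnorm_ge0 // ltW.
  have f1 : cnorm (f a) / s < 1 by rewrite ltr_pdivrMr // mul1r.
  apply: (H1 ((s^-1)%:C *: a) c); rewrite ?starZr ?sa //; rewrite ?/c; try lra.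
    by rewrite cnorm_invZ // divff ?gt_eqF.
  by rewrite linearZ cnorm_invZ //; lra.
move=> sa a1 c0 c1 fac; pose h : R := 2^-1.
(* Halving keeps [y] in the unit ball, as the construction of the root of [y^2] requires. *)
pose y := h%:C *: (a * a - (c ^+ 2)%:C *: 1).
have h0 : 0 < h by rewrite invr_gt0 ltr0n.
have sy : star y = y by rewrite starZr starB starM sa starZr star1.
have y1 : cnorm y <= 1.
  rewrite cnormZr ger0_norm ?(ltW h0) //.
  have h1 := cnormB (a * a) ((c ^+ 2)%:C *: 1); have h2 := cnormM a a.
  rewrite cnormZr cnorm1 mulr1 ger0_norm ?sqr_ge0 // in h1.
  have : c ^+ 2 <= 1 by rewrite expr_le1 // ltW.
  rewrite a1 mulr1 in h2; rewrite /h; lra.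
have yy1 : cnorm (1 - y * y) <= 1 by apply: sa_sqr_compl.
have [|b [sb bb b1 bc]] := @csqrt_ex R A (1 - y * y) _ yy1.
  by rewrite starB star1 starM sy.
rewrite opprB addrCA subrr addr0 in bb.
have yb : y * b = b * y by apply: bc; ncr.
have fy : f y = h%:C *: (f a * f a - (c ^+ 2)%:C *: 1).
  rewrite linearZ raddfB /= rmorph_alg [f (a * a)]rmorphM.
  reflexivity.
have fb : f b = - f y.
  apply: sqrt_unique; rewrite ?starN -?fs ?sb ?sy ?mulrNN -?rmorphM ?bb //.
  - by rewrite mulrN mulNr -!rmorphM yb.
  - by rewrite -(rmorph1 f) -raddfB; apply: le_trans (starhom_contractive _) b1.
  - rewrite opprK fy.
    have -> : 1 + h%:C *: (f a * f a - (c ^+ 2)%:C *: 1) =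
       (1 - h * c ^+ 2)%:C *: 1 + h%:C *: (f a * f a).
      by rewrite scalerBr scalerA -rcM rcB rc1 scalerBl scale1r; abel.
    apply: le_trans (cnormD _ _) _; rewrite !cnormZr cnorm1 mulr1.
    have c2 : c ^+ 2 <= 1 by rewrite expr_le1 // ltW.
    have c3 : 0 <= c ^+ 2 by apply: sqr_ge0.
    have -> : `|1 - h * c ^+ 2| = 1 - h * c ^+ 2.
      by rewrite ger0_norm //; rewrite /h in h0 *; nra.
    rewrite ger0_norm ?(ltW h0) //.
    have : cnorm (f a * f a) <= c ^+ 2.
      apply: le_trans (cnormM _ _) _; rewrite expr2; apply: ler_pM => //; exact: cnorm_ge0.
    by nra.
have by0 : b = - y by apply: finj; rewrite fb raddfN.
have [|b' [sb' bb' _ bc']] := @csqrt_ex R A (1 - b) _ b1.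
  by rewrite starB star1 sb.
rewrite opprB addrCA subrr addr0 in bb'.
have ab' : a * b' = b' * a.
  apply: bc'; rewrite by0 /y; ncexp.
  congr (a + _); rewrite scaleMr scaleMl; congr (_ *: _).
  by rewrite mulrBr mulrBl scaleMr scaleMl mulr1 mul1r mulrA.
(* [g] is chosen so that the squares of [a / c] and of [g b'] add up to 1. *)
pose g : R := Num.sqrt 2 / c.
have gg : g * g = 2 / c ^+ 2.
  by rewrite /g mulrACA -expr2 sqr_sqrtr ?ler0n // -expr2 exprVn.
have : cnorm ((c^-1)%:C *: a) <= 1.
  apply: (@sa_norm_le1 _ _ _ (g%:C *: b')).
  - by rewrite starZr sa.
  - by rewrite starZr sb'.
  - by rewrite !scaleMl !scaleMr !scalerA mulrC ab'.
  - rewrite !scaleMl !scaleMr !scalerA -!rmorphM /= bb' by0 gg /y scalerN scalerA -rmorphM /=.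
    rewrite (_ : 2 / c ^+ 2 * h = c^-1 / c); last first.
      by rewrite /h; field; rewrite gt_eqF.
    rewrite scalerBr opprB addrCA subrr addr0 scalerA -rmorphM /=.
    by rewrite (_ : _ * _ = 1) ?scale1r //; field; rewrite gt_eqF.
by rewrite cnorm_invZ // a1 ler_pdivrMr // mul1r leNgt c1.
Qed.

End Morphisms.

(** * Ultrapowers *)

Section UltraLimit.
Variables (R : realType) (I : Type) (W : set_system I).
Context {WU : UltraFilter W}.

(** The image of [W] under [f] is an ultrafilter on a compact interval. *)
Lemma ultra_bounded_cvg (f : I -> R) (M : R) :
  (forall i, `|f i| <= M) -> exists l : R, f i @[i --> W] --> l.
Proof.
move=> fM; have FU : UltraFilter (f @ W).
  split=> [|G GP sub]; first exact: fmap_proper_filter.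
  apply/seteqP; split=> // S GS; have [WS|WnS] := in_ultra_setVsetC (f @^-1` S) WU.
    exact: WS.
  have /(filterI GS) : G (~` S) by apply: sub.
  by rewrite setICr => /filter_not_empty.
have := @segment_compact R (- M) M; rewrite compact_ultra => /(_ _ FU).
case.
  by apply: (@filterE _ W) => i; have := fM i; rewrite ler_norml /= in_itv.
by move=> l [_ fl]; exists l.
Qed.

End UltraLimit.

(** * Construction of the norm ultrapower *)

Section Ultrapower.
Local Open Scope quotient_scope.
Variables (R : realType) (I : Type) (W : set_system I).
Context {WU : UltraFilter W}.
Variable B : cstarAlgType R.
Implicit Types (x y : I -> B).

Local Notation bounded := (@bounded_family R I B).

Lemma bfam_cst (b : B) : bounded (fun=> b).
Proof. by exists (cnorm b). Qed.

Lemma bfamD x y : bounded x -> bounded y -> bounded (fun i => x i + y i).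
Proof.
move=> [M xM] [N yN]; exists (M + N) => i.
exact: le_trans (cnormD _ _) (lerD _ _).
Qed.

Lemma bfamM x y : bounded x -> bounded y -> bounded (fun i => x i * y i).
Proof.
move=> [M xM] [N yN]; exists (M * N) => i; apply: le_trans (cnormM _ _) _.
by apply: ler_pM => //; apply: cnorm_ge0.
Qed.

Lemma bfamZ c x : bounded x -> bounded (fun i => c *: x i).
Proof.
move=> [M xM]; exists (complex.Re `|c| * M) => i; rewrite cnormZ.
apply: ler_wpM2l => //.
by have := normr_ge0 c; rewrite lecE /= => /andP[].
Qed.

Lemma bfamN x : bounded x -> bounded (fun i => - x i).
Proof. by move=> [M xM]; exists M => i; rewrite cnormN. Qed.

Lemma bfamB x y : bounded x -> bounded y -> bounded (fun i => x i - y i).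
Proof. by move=> xb yb; apply: bfamD xb (bfamN yb). Qed.

Lemma bfam_star x : bounded x -> bounded (fun i => star (x i)).
Proof. by move=> [M xM]; exists M => i; rewrite cnorm_star. Qed.

Record bfam := BFam { bf :> I -> B; bfP : bounded bf }.

HB.instance Definition _ := gen_eqMixin bfam.
HB.instance Definition _ := gen_choiceMixin bfam.

Definition ueqv (x y : bfam) : bool := `[< ccvg W (fun i => x i - y i) 0 >].

Lemma ueqv_refl : reflexive ueqv.
Proof.
move=> x; apply/asboolP; apply: ccvg_ext (ccvg_cst 0) => i.
by rewrite subrr.
Qed.

Lemma ueqv_sym : symmetric ueqv.
Proof.
suff H (x y : bfam) : ueqv x y -> ueqv y x by move=> x y; apply/idP/idP; exact: H.
move=> /asboolP h; apply/asboolP; apply: (ccvg_eq (ccvgN h)) => [i|].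
  by rewrite opprB.
by rewrite oppr0.
Qed.

Lemma ueqv_trans : transitive ueqv.
Proof.
move=> y x z /asboolP h1 /asboolP h2; apply/asboolP; apply: (ccvg_eq (ccvgD h1 h2)) => [i|].
  by rewrite addrA subrK.
by rewrite addr0.
Qed.

Canonical ueqv_equiv := EquivRel ueqv ueqv_refl ueqv_sym ueqv_trans.

Definition upower := {eq_quot ueqv_equiv}.
HB.instance Definition _ := Choice.on upower.

(** Total on all families because [is_ultrapower] asks for a total map; unbounded families go to the
    class of 0. *)
Definition ucl x : upower :=
  \pi_upower (match pselect (bounded x) with
              | left xb => BFam xb
              | right _ => BFam (bfam_cst 0) end).
Definition urep (d : upower) : I -> B := repr d.

Lemma urepP d : bounded (urep d). Proof. exact: bfP. Qed.

Lemma ucl_urep d : ucl (urep d) = d.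
Proof.
rewrite /ucl; case: pselect => [b|nb]; last by case: nb; exact: urepP.
rewrite -[RHS]reprK; congr (\pi_upower _); rewrite /urep in b *.
by case: (repr d) b => x p b; congr BFam; apply: Prop_irrelevance.
Qed.

Lemma uclE x y : bounded x -> bounded y ->
  ucl x = ucl y <-> ccvg W (fun i => x i - y i) 0.
Proof.
move=> xb yb; rewrite /ucl; case: pselect => // xb'; case: pselect => // yb'.
split=> [/eqmodP/asboolP //|h]; apply/eqmodP/asboolP; exact: h.
Qed.

Lemma uclP d : exists2 x, bounded x & ucl x = d.
Proof. by exists (urep d); [exact: urepP|exact: ucl_urep]. Qed.

Lemma urep_ucl x : bounded x -> ccvg W (fun i => urep (ucl x) i - x i) 0.
Proof. by move=> xb; apply/uclE => //; [exact: urepP|rewrite ucl_urep]. Qed.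

Definition uadd d e := ucl (fun i => urep d i + urep e i).
Definition umul d e := ucl (fun i => urep d i * urep e i).
Definition uopp d := ucl (fun i => - urep d i).
Definition uscale c d := ucl (fun i => c *: urep d i).
Definition ustar d := ucl (fun i => star (urep d i)).

Lemma uadd_ucl x y : bounded x -> bounded y ->
  uadd (ucl x) (ucl y) = ucl (fun i => x i + y i).
Proof.
move=> xb yb; apply/uclE; [by apply: bfamD => //; apply: urepP|exact: bfamD|].
apply: (ccvg_eq (ccvgD (urep_ucl xb) (urep_ucl yb))) => [i|]; last by rewrite ?(addr0, oppr0, scaler0, star0).
by rewrite opprD addrACA.
Qed.

Lemma uopp_ucl x : bounded x -> uopp (ucl x) = ucl (fun i => - x i).
Proof.
move=> xb; apply/uclE; [by apply: bfamN => //; apply: urepP|exact: bfamN|].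
apply: (ccvg_eq (ccvgN (urep_ucl xb))) => [i|]; last by rewrite ?(addr0, oppr0, scaler0, star0).
by rewrite opprD.
Qed.

Lemma uscale_ucl c x : bounded x -> uscale c (ucl x) = ucl (fun i => c *: x i).
Proof.
move=> xb; apply/uclE; [by apply: bfamZ => //; apply: urepP|exact: bfamZ|].
apply: (ccvg_eq (ccvgZ c (urep_ucl xb))) => [i|]; last by rewrite ?(addr0, oppr0, scaler0, star0).
by rewrite scalerBr.
Qed.

Lemma ustar_ucl x : bounded x -> ustar (ucl x) = ucl (fun i => star (x i)).
Proof.
move=> xb; apply/uclE; [by apply: bfam_star => //; apply: urepP|exact: bfam_star|].
apply: (ccvg_eq (ccvg_star (urep_ucl xb))) => [i|]; last by rewrite ?(addr0, oppr0, scaler0, star0).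
by rewrite starB.
Qed.

Lemma ccvg0_mul x y : ccvg W x 0 -> bounded y -> ccvg W (fun i => x i * y i) 0.
Proof.
move=> x0 [M yM] e e0; pose N := `|M| + 1.
have N0 : 0 < N by rewrite /N; have := normr_ge0 M; lra.
apply: filterS (x0 _ (divr_gt0 e0 N0)) => i; rewrite !subr0.
rewrite ltr_pdivlMr //; apply: le_lt_trans; apply: le_trans (cnormM _ _) _.
apply: ler_wpM2l; rewrite ?cnorm_ge0 //; apply: le_trans (yM i) _.
by rewrite /N; have := ler_norm M; lra.
Qed.

Lemma ccvg0_mulr x y : ccvg W x 0 -> bounded y -> ccvg W (fun i => y i * x i) 0.
Proof.
move=> x0 yb; have x0s : ccvg W (fun i => star (x i)) 0.
  by rewrite -(star0 B); apply: ccvg_star.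
apply: (ccvg_eq (ccvg_star (ccvg0_mul x0s (bfam_star yb)))) => [i|].
  by rewrite starM !starK.
by rewrite star0.
Qed.

Lemma umul_ucl x y : bounded x -> bounded y ->
  umul (ucl x) (ucl y) = ucl (fun i => x i * y i).
Proof.
move=> xb yb; apply/uclE; [by apply: bfamM => //; apply: urepP|exact: bfamM|].
have h1 := ccvg0_mul (urep_ucl xb) (urepP (ucl y)).
have h2 := ccvg0_mulr (urep_ucl yb) xb.
apply: (ccvg_eq (ccvgD h1 h2)) => [i|]; last by rewrite ?(addr0, oppr0, scaler0, star0).
by ncr.
Qed.

Lemma uaddA : associative uadd.
Proof.
move=> a b c; have [x xb <-] := uclP a; have [y yb <-] := uclP b.
have [z zb <-] := uclP c; rewrite !uadd_ucl //; try exact: bfamD.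
by congr ucl; apply/funext => i; rewrite addrA.
Qed.
Lemma uaddC : commutative uadd.
Proof. by move=> a b; congr ucl; apply/funext => i; rewrite addrC. Qed.
Lemma uadd0 : left_id (ucl (fun=> 0)) uadd.
Proof.
move=> a; have [x xb <-] := uclP a; rewrite uadd_ucl //; last exact: bfam_cst.
by congr ucl; apply/funext => i; rewrite add0r.
Qed.
Lemma uaddN : left_inverse (ucl (fun=> 0)) uopp uadd.
Proof.
move=> a; have [x xb <-] := uclP a; rewrite uopp_ucl // uadd_ucl //.
  by congr ucl; apply/funext => i; rewrite addNr.
exact: bfamN.
Qed.
HB.instance Definition _ := GRing.isZmodule.Build upower uaddA uaddC uadd0 uaddN.

Lemma umulA : associative umul.
Proof.
move=> a b c; have [x xb <-] := uclP a; have [y yb <-] := uclP b.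
have [z zb <-] := uclP c; rewrite !umul_ucl //; try exact: bfamM.
by congr ucl; apply/funext => i; rewrite mulrA.
Qed.
Lemma umul1 : left_id (ucl (fun=> 1)) umul.
Proof.
move=> a; have [x xb <-] := uclP a; rewrite umul_ucl //; last exact: bfam_cst.
by congr ucl; apply/funext => i; rewrite mul1r.
Qed.
Lemma u1mul : right_id (ucl (fun=> 1)) umul.
Proof.
move=> a; have [x xb <-] := uclP a; rewrite umul_ucl //; last exact: bfam_cst.
by congr ucl; apply/funext => i; rewrite mulr1.
Qed.
Lemma umulDl : left_distributive umul uadd.
Proof.
move=> a b c; have [x xb <-] := uclP a; have [y yb <-] := uclP b.
have [z zb <-] := uclP c.
rewrite uadd_ucl // !umul_ucl //; try exact: bfamD.
rewrite uadd_ucl //; try exact: bfamM.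
by congr ucl; apply/funext => i; rewrite mulrDl.
Qed.
Lemma umulDr : right_distributive umul uadd.
Proof.
move=> a b c; have [x xb <-] := uclP a; have [y yb <-] := uclP b.
have [z zb <-] := uclP c.
rewrite uadd_ucl // !umul_ucl //; try exact: bfamD.
rewrite uadd_ucl //; try exact: bfamM.
by congr ucl; apply/funext => i; rewrite mulrDr.
Qed.
Lemma uone_neq0 : ucl (fun=> 1) != ucl (fun=> 0).
Proof.
apply/eqP => /uclE h; have := h (bfam_cst _) (bfam_cst _) _ ltr01.
by move=> /filter_ex[_]; rewrite !subr0 cnorm1 ltxx.
Qed.
HB.instance Definition _ := GRing.Zmodule_isNzRing.Build upower
  umulA umul1 u1mul umulDl umulDr uone_neq0.

Lemma uscaleA c d a : uscale c (uscale d a) = uscale (c * d) a.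
Proof.
have [x xb <-] := uclP a; rewrite !uscale_ucl //; last exact: bfamZ.
by congr ucl; apply/funext => i; rewrite scalerA.
Qed.
Lemma uscale1 : left_id 1 uscale.
Proof.
move=> a; have [x xb <-] := uclP a; rewrite !uscale_ucl //.
by congr ucl; apply/funext => i; rewrite scale1r.
Qed.
Lemma uscaleDr : right_distributive uscale uadd.
Proof.
move=> c a b; have [x xb <-] := uclP a; have [y yb <-] := uclP b.
rewrite uadd_ucl // !uscale_ucl //; try exact: bfamD.
rewrite uadd_ucl //; try exact: bfamZ.
by congr ucl; apply/funext => i; rewrite scalerDr.
Qed.
Lemma uscaleDl a : {morph uscale^~ a : c d / c + d >-> uadd c d}.
Proof.
move=> c d; have [x xb <-] := uclP a; rewrite !uscale_ucl //.
rewrite uadd_ucl //; try exact: bfamZ.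
by congr ucl; apply/funext => i; rewrite scalerDl.
Qed.
HB.instance Definition _ := GRing.Zmodule_isLmodule.Build R[i] upower
  uscaleA uscale1 uscaleDr uscaleDl.

Lemma uscaleAl (c : R[i]) (a b : upower) : c *: (a * b) = (c *: a) * b.
Proof.
have [x xb <-] := uclP a; have [y yb <-] := uclP b.
rewrite /GRing.scale /GRing.mul /= umul_ucl // !uscale_ucl //; last exact: bfamM.
rewrite umul_ucl //; last exact: bfamZ.
by congr ucl; apply/funext => i; rewrite scalerAl.
Qed.
HB.instance Definition _ := GRing.Lmodule_isLalgebra.Build R[i] upower uscaleAl.

Lemma uscaleAr (c : R[i]) (a b : upower) : c *: (a * b) = a * (c *: b).
Proof.
have [x xb <-] := uclP a; have [y yb <-] := uclP b.
rewrite /GRing.scale /GRing.mul /= umul_ucl // !uscale_ucl //; last exact: bfamM.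
rewrite umul_ucl //; last exact: bfamZ.
by congr ucl; apply/funext => i; rewrite scalerAr.
Qed.
HB.instance Definition _ := GRing.Lalgebra_isAlgebra.Build R[i] upower uscaleAr.

Definition unorm (d : upower) : R := lim (cnorm (urep d i) @[i --> W]).

Lemma unormP x : bounded x -> cnorm (x i) @[i --> W] --> unorm (ucl x).
Proof.
move=> xb; have [M hM] := urepP (ucl x).
have [|l hl] := @ultra_bounded_cvg R I W WU (fun i => cnorm (urep (ucl x) i)) M.
  by move=> i; rewrite ger0_norm ?cnorm_ge0.
have -> : unorm (ucl x) = l by apply/cvg_lim.
apply/cvgrPdist_lt => e e0; have e2 : 0 < e / 2 by lra.
move/cvgrPdist_lt : hl => /(_ _ e2) hl.
apply: filterS2 hl (urep_ucl xb e2) => i; rewrite subr0 => h1 h2.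
have := cnorm_dist (urep (ucl x) i) (x i).
by move: h1; rewrite !ltr_norml !ler_norml => /andP[? ?] /andP[? ?]; apply/andP; split; lra.
Qed.

Lemma ulim_unique (f : I -> R) (l m : R) :
  f i @[i --> W] --> l -> f i @[i --> W] --> m -> l = m.
Proof. by move=> fl fm; apply: (@norm_cvg_unique _ _ (f @ W)) fl fm. Qed.

Lemma ulim_le (f g : I -> R) (l m : R) : f i @[i --> W] --> l ->
  g i @[i --> W] --> m -> (forall i, f i <= g i) -> l <= m.
Proof.
move=> /cvgrPdist_lt fl /cvgrPdist_lt gm fg; apply/ler_addgt0Pr => e e0.
have e2 : 0 < e / 2 by lra.
have [i [h1 h2]] := filter_ex (filterI (fl _ e2) (gm _ e2)); have := fg i.
by move: h1 h2; rewrite !ltr_norml => /andP[? ?] /andP[? ?]; lra.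
Qed.

Lemma unorm_eq x (l : R) : bounded x -> cnorm (x i) @[i --> W] --> l -> unorm (ucl x) = l.
Proof. by move=> xb xl; apply: ulim_unique xl; apply: unormP. Qed.

Lemma unorm_le x (c : R) : bounded x -> (\forall i \near W, cnorm (x i) <= c) ->
  unorm (ucl x) <= c.
Proof.
move=> xb xc; apply/ler_addgt0Pr => e e0.
have /cvgrPdist_lt/(_ _ e0) h := unormP xb.
have [i [h1 h2]] := filter_ex (filterI h xc).
by move: h1; rewrite ltr_norml => /andP[? ?]; lra.
Qed.

Lemma unorm_lt x (c : R) : bounded x -> unorm (ucl x) < c ->
  \forall i \near W, cnorm (x i) < c.
Proof.
move=> xb xc; have /cvgrPdist_lt/(_ (c - unorm (ucl x))) h := unormP xb.
apply: filterS (h _) => [i|]; last by rewrite subr_gt0.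
by rewrite ltr_norml => /andP[? ?]; lra.
Qed.

Lemma unorm_ge0 d : 0 <= unorm d.
Proof.
have [x xb <-] := uclP d; rewrite leNgt; apply/negP => /(unorm_lt xb) h.
have [j] := filter_ex h.
by rewrite ltNge cnorm_ge0.
Qed.

Lemma unorm_eq0 d : unorm d = 0 -> d = 0.
Proof.
have [x xb <-] := uclP d => x0; apply/uclE => //; first exact: bfam_cst.
move=> e e0; have h : unorm (ucl x) < e by rewrite x0.
by apply: filterS (unorm_lt xb h) => i; rewrite !subr0.
Qed.

Lemma uaddE d e : d + e = uadd d e. Proof. by []. Qed.
Lemma umulE d e : d * e = umul d e. Proof. by []. Qed.
Lemma uscaleE c d : c *: d = uscale c d. Proof. by []. Qed.
Lemma uoppE d : - d = uopp d. Proof. by []. Qed.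

Lemma unormD d e : unorm (d + e) <= unorm d + unorm e.
Proof.
have [x xb <-] := uclP d; have [y yb <-] := uclP e; rewrite uaddE uadd_ucl //.
apply/ler_addgt0Pr => r r0; have r2 : 0 < r / 2 by lra.
apply: unorm_le; first exact: bfamD.
have hx : unorm (ucl x) < unorm (ucl x) + r / 2 by lra.
have hy : unorm (ucl y) < unorm (ucl y) + r / 2 by lra.
apply: filterS2 (unorm_lt xb hx) (unorm_lt yb hy) => i h1 h2.
apply: le_trans (cnormD _ _) _; lra.
Qed.

Lemma unormZ c d : unorm (c *: d) = complex.Re `|c| * unorm d.
Proof.
have [x xb <-] := uclP d; rewrite uscaleE uscale_ucl //.
apply: unorm_eq; first exact: bfamZ.
have -> : (fun i => cnorm (c *: x i)) = (fun i => complex.Re `|c| * cnorm (x i)).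
  by apply/funext => i; rewrite cnormZ.
by apply: cvgM; [exact: cvg_cst|exact: unormP].
Qed.

Lemma unormM d e : unorm (d * e) <= unorm d * unorm e.
Proof.
have [x xb <-] := uclP d; have [y yb <-] := uclP e; rewrite umulE umul_ucl //.
apply: ulim_le (unormP (bfamM xb yb)) (cvgM (unormP xb) (unormP yb)) _.
by move=> i; apply: cnormM.
Qed.

Lemma ustarD d e : ustar (d + e) = ustar d + ustar e.
Proof.
have [x xb <-] := uclP d; have [y yb <-] := uclP e.
rewrite !uaddE !(uadd_ucl, ustar_ucl) //; try exact: bfam_star; last exact: bfamD.
by congr ucl; apply/funext => i; rewrite starD.
Qed.

Lemma ustarZ c d : ustar (c *: d) = Num.conj c *: ustar d.
Proof.
have [x xb <-] := uclP d.
rewrite !uscaleE !(uscale_ucl, ustar_ucl) //; try exact: bfam_star; last exact: bfamZ.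
by congr ucl; apply/funext => i; rewrite starZ.
Qed.

Lemma ustarM d e : ustar (d * e) = ustar e * ustar d.
Proof.
have [x xb <-] := uclP d; have [y yb <-] := uclP e.
rewrite !umulE !(umul_ucl, ustar_ucl) //; try exact: bfam_star; last exact: bfamM.
by congr ucl; apply/funext => i; rewrite starM.
Qed.

Lemma ustarK d : ustar (ustar d) = d.
Proof.
have [x xb <-] := uclP d; rewrite !ustar_ucl //; last exact: bfam_star.
by congr ucl; apply/funext => i; rewrite starK.
Qed.

Lemma unorm_starM d : unorm (ustar d * d) = unorm d ^+ 2.
Proof.
have [x xb <-] := uclP d; rewrite umulE ustar_ucl // umul_ucl //; last exact: bfam_star.
apply: unorm_eq; first by apply: bfamM => //; apply: bfam_star.
have -> : (fun i => cnorm (star (x i) * x i)) = (fun i => cnorm (x i) * cnorm (x i)).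
  by apply/funext => i; rewrite cnorm_starM expr2.
by rewrite expr2; apply: cvgM; apply: unormP.
Qed.

(** A lift [z] of [d] may be replaced by [x] at the coordinates where it is far from [x]: the other
    coordinates form a set of [W], so the class is unchanged and the closeness becomes uniform. *)
Lemma ulift_near x d (r : R) : bounded x -> unorm (d - ucl x) < r ->
  exists y, [/\ bounded y, ucl y = d & forall i, cnorm (y i - x i) <= r].
Proof.
move=> xb; have [z zb <-] := uclP d; rewrite uaddE uoppE uopp_ucl // uadd_ucl //;
  last exact: bfamN.
move=> /(unorm_lt (bfamB zb xb)) h.
pose y i := if cnorm (z i - x i) < r then z i else x i.
have [M zM] := zb; have [N xN] := xb.
have yb : bounded y.
  exists (Num.max M N) => i; rewrite /y le_max; case: ifP => _; first by rewrite zM.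
  by rewrite xN orbT.
have r0 : 0 <= r.
  have [i hi] := filter_ex h; exact: le_trans (cnorm_ge0 _) (ltW hi).
exists y; split=> // [|i]; last first.
  by rewrite /y; case: ifPn => [/ltW //|_]; rewrite subrr cnorm0.
apply/uclE => // e e0; apply: filterS h => i hi.
by rewrite /y hi subrr subr0 cnorm0.
Qed.

Lemma half_exp_lt (e : R) : 0 < e -> exists k, (2^-1 : R) ^+ k < e.
Proof.
move=> e0; have /cvgrPdist_lt/(_ _ e0)[k _ hk] : (fun k => (2^-1 : R) ^+ k) @ \oo --> (0 : R).
  by apply: cvg_expr; rewrite ger0_norm ?invr_ge0 ?ler0n // invf_lt1 ?ltr0n // ltr1n.
by exists k; have := hk k (leqnn k); rewrite /= sub0r normrN ger0_norm.
Qed.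

(** Along a subsequence with increments below [2^-k] the classes are lifted one after the other by
    [ulift_near]. The lifts are Cauchy in every coordinate at a uniform rate, and the coordinatewise
    limits represent the limit. *)
Lemma unorm_complete (u : nat -> upower) :
  (forall eps : R, 0 < eps -> exists N : nat, forall m n : nat,
     (N <= m)%N -> (N <= n)%N -> unorm (u m - u n) < eps) ->
  exists l, unorm (u n - l) @[n --> \oo] --> (0 : R).
Proof.
move=> uc; pose h := 2^-1 : R.
have h0 k : 0 < h ^+ k by rewrite exprn_gt0 // invr_gt0 ltr0n.
have hS k : h ^+ k = 2 * h ^+ k.+1.
  by rewrite exprS mulrA mulfV ?mul1r.
have /choice[N hN] : forall k, exists N : nat, forall m n : nat,
     (N <= m)%N -> (N <= n)%N -> unorm (u m - u n) < h ^+ k by move=> k; apply: uc.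
(* Running maxima make the chosen ranks nondecreasing while keeping them beyond the threshold
   [N k]. *)
pose NN := fix F k := if k is j.+1 then maxn (F j) (N k) else N 0%N.
have NNS k : (NN k <= NN k.+1)%N by rewrite /= leq_maxl.
have NNN k : (N k <= NN k)%N by case: k => //= k; rewrite leq_maxr.
have /choice[f fP] : forall kx : nat * (I -> B), exists y,
    bounded kx.2 -> ucl kx.2 = u (NN kx.1) ->
    [/\ bounded y, ucl y = u (NN kx.1.+1) & forall i, cnorm (y i - kx.2 i) <= h ^+ kx.1].
  case=> k x /=; case: (pselect (bounded x /\ ucl x = u (NN k))) => [[xb xe]|nx]; last first.
    by exists x => xb xe; case: nx.
  have [|y yP] := @ulift_near x (u (NN k.+1)) (h ^+ k) xb; last by exists y.
  by rewrite xe; apply: hN; apply: leq_trans (NNN k) _.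
pose xs := fix F k := if k is j.+1 then f (j, F j) else urep (u (NN 0%N)).
have xsP k : bounded (xs k) /\ ucl (xs k) = u (NN k).
  elim: k => [|k [xb xe]]; first by split; [exact: urepP|exact: ucl_urep].
  by have [] := fP (k, xs k) xb xe.
have xsd k i : cnorm (xs k.+1 i - xs k i) <= h ^+ k.
  by have [xb xe] := xsP k; have [_ _] := fP (k, xs k) xb xe; apply.
have xsD k m i : cnorm (xs (m + k)%N i - xs k i) <= 2 * h ^+ k - 2 * h ^+ (m + k).
  elim: m => [|m IH]; first by rewrite add0n !subrr cnorm0.
  have := cnorm_triangle (xs (m + k)%N i) (xs (m.+1 + k)%N i) (xs k i).
  have := xsd (m + k)%N i; rewrite addSn (hS (m + k)%N).
  move: IH; rewrite (hS (m + k)%N); lra.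
have xsD2 k m i : (k <= m)%N -> cnorm (xs m i - xs k i) <= 2 * h ^+ k.
  by move=> km; have := xsD k (m - k)%N i; rewrite subnK //; have := h0 m; lra.
have /choice[l hl] : forall i, exists b : B, ccvg \oo (fun k => xs k i) b.
  move=> i; apply: ccauchy_cvg => e e0.
  have [k hk] := @half_exp_lt (e / 4) (divr_gt0 e0 (ltr0Sn _ 3)).
  exists k => m n km kn; have := cnorm_triangle (xs k i) (xs m i) (xs n i).
  rewrite (cnormBC (xs k i)); have := xsD2 _ _ i km; have := xsD2 _ _ i kn.
  rewrite -/h in hk; lra.
have xsl k i : cnorm (xs k i - l i) <= 2 * h ^+ k.
  have hc : ccvg \oo (fun m => xs k i - xs m i) (xs k i - l i).
    by apply: ccvgB (hl i); apply: ccvg_cst.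
  apply: (ccvg_norm_le hc); exists k => // m km; rewrite cnormBC; exact: xsD2.
have lb : bounded l.
  have [[M hM] _] := xsP 0%N; exists (M + 2) => i.
  have := cnormB (xs 0%N i) (xs 0%N i - l i).
  by rewrite opprB addrC subrK; have := xsl 0%N i; have := hM i; rewrite expr0; lra.
exists (ucl l); apply/cvgrPdist_lt => e e0.
have [k hk] := @half_exp_lt (e / 4) (divr_gt0 e0 (ltr0Sn _ 3)).
exists (NN k) => // n /= kn.
have ge0 : 0 <= unorm (u n - ucl l).
  exact: unorm_ge0.
rewrite sub0r normrN ger0_norm //.
have [xb xe] := xsP k.
have h1 : unorm (u n - u (NN k)) < h ^+ k.
  by apply: hN; [apply: leq_trans (NNN k) kn|apply: NNN].
have h2 : unorm (u (NN k) - ucl l) <= 2 * h ^+ k.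
  rewrite -xe uaddE uoppE uopp_ucl // uadd_ucl //; last exact: bfamN.
  by apply: unorm_le; [exact: bfamB|apply: filterE => i; exact: xsl].
have := unormD (u n - u (NN k)) (u (NN k) - ucl l); rewrite addrA subrK.
rewrite -/h in hk; lra.
Qed.

HB.instance Definition _ := Algebra_isCStarAlgebra.Build R upower
  unorm_eq0 unormD unormZ unormM unorm_complete ustarD ustarZ ustarM ustarK unorm_starM.

End Ultrapower.

Section UltrapowerSpec.
Variables (R : realType) (I : Type) (W : set_system I).
Context {WU : UltraFilter W}.

Lemma ultrapower_ex (B : cstarAlgType R) :
  exists (D : cstarAlgType R) (q : (I -> B) -> D), is_ultrapower W q.
Proof.
exists (@upower R I W WU B), (@ucl R I W WU B); split=> [a x y xb yb|].
  by rewrite uaddE uscaleE uscale_ucl // uadd_ucl //; apply: bfamZ.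
split=> [x y xb yb|]; first by rewrite umulE umul_ucl.
split=> [x xb|]; first by rewrite -[star _]/(ustar _) ustar_ucl.
split=> //; split=> [d|x xb]; first exact: uclP.
exact: unormP.
Qed.

End UltrapowerSpec.

Lemma lrmorphism_ex (R : realType) (A B : cstarAlgType R) (f : A -> B) :
  (forall c x y, f (c *: x + y) = c *: f x + f y) ->
  (forall x y, f (x * y) = f x * f y) -> f 1 = 1 ->
  exists g : {lrmorphism A -> B}, forall x, g x = f x.
Proof.
move=> fl fm f1.
pose lin := GRing.isLinear.Build R[i] A B _ f fl.
pose mul := GRing.isMonoidMorphism.Build A B f (f1, fm).
pose g : {lrmorphism A -> B} := HB.pack f lin mul.
by exists g.
Qed.

(** * Calculus in an arbitrary ultrapower *)

Section UltrapowerTheory.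
Variables (R : realType) (I : Type) (W : set_system I).
Context {WU : UltraFilter W}.
Variables (B D : cstarAlgType R) (q : (I -> B) -> D).
Hypothesis hq : is_ultrapower W q.
Implicit Types (x y : I -> B) (d : D).

Local Notation bd := (@bounded_family R I B).

Lemma uq_lin (a : R[i]) x y : bd x -> bd y -> q (fun i => a *: x i + y i) = a *: q x + q y.
Proof. by have [h _] := hq; exact: h. Qed.
Lemma uqM x y : bd x -> bd y -> q (fun i => x i * y i) = q x * q y.
Proof. by have [_ [h _]] := hq; exact: h. Qed.
Lemma uq_star x : bd x -> q (fun i => star (x i)) = star (q x).
Proof. by have [_ [_ [h _]]] := hq; exact: h. Qed.
Lemma uq1 : q (fun=> 1) = 1.
Proof. by have [_ [_ [_ [h _]]]] := hq. Qed.
Lemma uq_surj d : exists2 x, bd x & q x = d.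
Proof. by have [_ [_ [_ [_ [h _]]]]] := hq; exact: h. Qed.
Lemma uq_norm x : bd x -> cnorm (x i) @[i --> W] --> cnorm (q x).
Proof. by have [_ [_ [_ [_ [_ h]]]]] := hq; exact: h. Qed.

Lemma uqD x y : bd x -> bd y -> q (fun i => x i + y i) = q x + q y.
Proof.
move=> xb yb; rewrite -[q x]scale1r -uq_lin //.
by congr q; apply/funext => i; rewrite scale1r.
Qed.
Lemma uq0 : q (fun=> 0) = 0.
Proof.
have := uqD (bfam_cst I (0 : B)) (bfam_cst I (0 : B)); rewrite /= addr0 => /eqP.
by rewrite -subr_eq subrr => /eqP.
Qed.
Lemma uqZ a x : bd x -> q (fun i => a *: x i) = a *: q x.
Proof.
move=> xb; rewrite -[RHS]addr0 -uq0 -uq_lin //; last exact: bfam_cst.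
by congr q; apply/funext => i; rewrite addr0.
Qed.
Lemma uqN x : bd x -> q (fun i => - x i) = - q x.
Proof.
move=> xb; rewrite -scaleN1r -uqZ //.
by congr q; apply/funext => i; rewrite scaleN1r.
Qed.
Lemma uqB x y : bd x -> bd y -> q (fun i => x i - y i) = q x - q y.
Proof. by move=> xb yb; rewrite uqD ?uqN //; apply: bfamN. Qed.

Lemma uq_norm_lt x (c : R) : bd x -> cnorm (q x) < c -> \forall i \near W, cnorm (x i) < c.
Proof.
move=> xb xc; have /cvgrPdist_lt/(_ (c - cnorm (q x))) h := uq_norm xb.
apply: filterS (h _) => [i|]; last by rewrite subr_gt0.
by rewrite ltr_norml => /andP[? ?]; lra.
Qed.

Lemma uq_norm_le x (c : R) : bd x -> (\forall i \near W, cnorm (x i) <= c) -> cnorm (q x) <= c.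
Proof.
move=> xb xc; apply/ler_addgt0Pr => e e0.
have /cvgrPdist_lt/(_ _ e0) h := uq_norm xb.
have [i [h1 h2]] := filter_ex (filterI h xc).
by move: h1; rewrite ltr_norml => /andP[? ?]; lra.
Qed.

Lemma uq_eq x y : bd x -> bd y -> q x = q y <-> ccvg W (fun i => x i - y i) 0.
Proof.
move=> xb yb; have xyb := bfamB xb yb; split=> [h e e0|h].
  have hlt : cnorm (q (fun i => x i - y i)) < e by rewrite uqB // h subrr cnorm0.
  by apply: filterS (uq_norm_lt xyb hlt) => i; rewrite subr0.
apply/eqP; rewrite -subr_eq0 -uqB //; apply/eqP/cnorm_eq0P.
apply/ler_addgt0Pr => e e0; rewrite add0r; apply: uq_norm_le => //.
by apply: filterS (h _ e0) => i; rewrite subr0 => /ltW.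
Qed.

Lemma uq_near_eq x y : bd x -> bd y -> (\forall i \near W, x i = y i) -> q x = q y.
Proof.
move=> xb yb h; apply/uq_eq => // e e0; apply: filterS h => i ->.
by rewrite subrr subr0 cnorm0.
Qed.

(** Sorts are closed balls, so a lift has to stay in the ball of its class. Coordinates outside are
    scaled back to norm [k], a change that vanishes along [W]. *)
Lemma uq_lift_norm d (k : R) : 0 <= k -> cnorm d <= k ->
  exists x, (forall i, cnorm (x i) <= k) /\ q x = d.
Proof.
move=> k0; have [y yb <-] := uq_surj d => dk.
pose c i : R := if cnorm (y i) <= k then 1 else k / cnorm (y i).
pose x i := (c i)%:C *: y i.
have xk i : cnorm (x i) <= k.
  rewrite /x cnormZr /c; case: ifPn => [h|]; first by rewrite normr1 mul1r.
  rewrite -ltNge => h; have y0 : 0 < cnorm (y i) by apply: le_lt_trans h.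
  by rewrite ger0_norm ?divr_ge0 ?cnorm_ge0 // divfK // gt_eqF.
exists x; split=> //; have xb : bd x by exists k.
apply/uq_eq => // e e0.
have hlt : cnorm (q y) < k + e by lra.
apply: filterS (uq_norm_lt yb hlt) => i hi; rewrite subr0 /x /c.
case: ifPn => [h|]; first by rewrite scale1r subrr cnorm0.
rewrite -ltNge => h; have y0 : 0 < cnorm (y i) by apply: le_lt_trans h.
have -> : (k / cnorm (y i))%:C *: y i - y i = (k / cnorm (y i) - 1)%:C *: y i.
  by rewrite rcB scalerBl scale1r.
rewrite cnormZr -[cnorm (y i) in X in _ * X]ger0_norm ?cnorm_ge0 // -normrM mulrBl mul1r.
by rewrite divfK ?gt_eqF // distrC ger0_norm; lra.
Qed.

Lemma uq_diag : exists f : {lrmorphism B -> D},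
  [/\ star_preserving f, injective f & forall b, f b = q (fun=> b)].
Proof.
have [||| f fE] := @lrmorphism_ex R B D (fun b => q (fun=> b)).
- by move=> c x y; rewrite -uq_lin //; apply: bfam_cst.
- by move=> x y; rewrite -uqM //; apply: bfam_cst.
- exact: uq1.
exists f; split=> // [x|x y].
  by rewrite !fE -uq_star //; apply: bfam_cst.
rewrite !fE => /uq_eq h; apply/eqP; rewrite -subr_eq0; apply/eqP/cnorm_eq0P.
apply/ler_addgt0Pr => e e0; rewrite add0r.
have [j] := filter_ex (h (bfam_cst _ _) (bfam_cst _ _) e e0).
by rewrite subr0 => /ltW.
Qed.

End UltrapowerTheory.

(** * Formulas under embeddings and in ultrapowers *)

Section Semantics.
Variable R : realType.

Section Transfer.
Variables (A B : cstarAlgType R) (f : {lrmorphism A -> B}) (X : symbols).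
Hypothesis fs : star_preserving f.

Lemma term_val_morph (v : X -> A) k (t : term X k) :
  term_val (fun x => f (v x)) t = f (term_val v t).
Proof.
elim: t => //= [||k1 l1 t1 IH1 t2 IH2|k1 l1 t1 IH1 t2 IH2|k1 t1 IH|k1 l1 z h1 h2 t1 IH].
- by rewrite linear0.
- by rewrite rmorph1.
- by rewrite IH1 IH2 linearD.
- by rewrite IH1 IH2 rmorphM.
- by rewrite IH fs.
- by rewrite IH linearZ.
Qed.

Hypothesis fi : injective f.

Lemma qf_val_morph (K : connectives R) (v : X -> A) (phi : qf K X) :
  qf_val (fun x => f (v x)) phi = qf_val v phi.
Proof.
elim: phi => [k t u|c phis IH] /=.
  by rewrite !term_val_morph -linearB starhom_isometric.
by congr conn_fun; apply/rowP => j; rewrite !mxE IH.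
Qed.

Lemma interpretation_morph (v : X -> A) :
  interpretation v -> interpretation (fun x => f (v x)).
Proof. by move=> vi x; rewrite starhom_isometric. Qed.

End Transfer.

Lemma term_val_norm (A : cstarAlgType R) (X : symbols) (v : X -> A) k (t : term X k) :
  interpretation v -> cnorm (term_val v t) <= k%:R.
Proof.
move=> vi; elim: t => /= [x|||k1 l1 t1 IH1 t2 IH2|k1 l1 t1 IH1 t2 IH2|k1 t1 IH|k1 l1 z h1 h2 t1 IH|k1 l1 h t1 IH].
- exact: vi.
- by rewrite cnorm0 ler01.
- by rewrite cnorm1.
- by rewrite natrD; apply: le_trans (cnormD _ _) (lerD _ _).
- rewrite natrM; apply: le_trans (cnormM _ _) _.
  by apply: ler_pM => //; apply: cnorm_ge0.
- by rewrite cnorm_star.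
- rewrite cnormZ; set c := complex.Re _.
  have c0 : 0 <= c by have := normr_ge0 (rat_complex R z); rewrite lecE /= => /andP[].
  have c2 : c ^+ 2 * k1%:R ^+ 2 <= l1%:R ^+ 2.
    have -> : c ^+ 2 = ratr (z.1 ^+ 2 + z.2 ^+ 2).
      rewrite /c /rat_complex normc_def /= sqr_sqrtr ?addr_ge0 ?sqr_ge0 //.
      by rewrite rmorphD !rmorphXn.
    by have := h2; rewrite -(ler_rat R) rmorphM /= !rmorphXn /= !ratr_nat.
  apply: le_trans (_ : c * k1%:R <= _); first by rewrite ler_wpM2l.
  by rewrite -(ler_pXn2r (n := 2)) ?nnegrE ?mulr_ge0 ?ler0n // exprMn.
- by apply: le_trans IH _; rewrite ler_nat.
Qed.

Lemma row_cvg (I : Type) (W : set_system I) {FW : Filter W} n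
    (f : 'I_n -> I -> R) (l : 'I_n -> R) :
  (forall j, f j i @[i --> W] --> l j) ->
  (\row_j f j i) @[i --> W] --> (\row_j l j : 'rV[R]_n).
Proof.
move=> h S [P hP PS]; rewrite /nbhs /=.
have : \forall i \near W, forall j : 'I_n, P 0 j (f j i).
  apply: (filter_forall (f := fun j => [set i | P 0 j (f j i)])) => j.
  by apply: (h j (P 0 j)); have := hP 0 j; rewrite mxE.
apply: filterS => i Hi; apply: PS => a b; rewrite mxE (ord1 a); exact: Hi.
Qed.

(** Distances are the only atoms and connectives are continuous. The limit may live in another
    algebra, which covers ultrapowers as well as convergent interpretations. *)
Lemma qf_val_cvg (I : Type) (W : set_system I) {FW : Filter W} (A : I -> cstarAlgType R)
   (D : cstarAlgType R) (K : connectives R) (X : symbols)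
   (vs : forall i, X -> A i) (v : X -> D) (phi : qf K X) :
  (forall k (t u : term X k),
     cnorm (term_val (vs i) t - term_val (vs i) u) @[i --> W] -->
     cnorm (term_val v t - term_val v u)) ->
  qf_val (vs i) phi @[i --> W] --> qf_val v phi.
Proof.
move=> h; elim: phi => [k t u|c phis IH] /=; first exact: h.
apply: cvg_comp (row_cvg IH) _.
exact: conn_continuous.
Qed.

Section Los.
Variables (I : Type) (W : set_system I).
Context {WU : UltraFilter W}.
Variables (B D : cstarAlgType R) (q : (I -> B) -> D).
Hypothesis hq : is_ultrapower W q.
Variable X : symbols.

Lemma los_lift (v : X -> D) : interpretation v ->
  exists vs : I -> X -> B, (forall i, interpretation (vs i)) /\
    (forall x, q (fun i => vs i x) = v x).
Proof.
move=> vi; have /choice[f fP] : forall x : X, exists y : I -> B,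
    (forall i, cnorm (y i) <= (sym_sort x).+1%:R) /\ q y = v x.
  by move=> x; apply: (uq_lift_norm hq); rewrite ?ler0n //; apply: vi.
by exists (fun i x => f x i); split=> [i x|x]; have [h1 h2] := fP x.
Qed.

Lemma bfam_term (vs : I -> X -> B) k (t : term X k) :
  (forall i, interpretation (vs i)) -> bounded_family (fun i => term_val (vs i) t).
Proof. by move=> vi; exists k%:R => i; apply: term_val_norm. Qed.

Lemma los_term (vs : I -> X -> B) (v : X -> D) k (t : term X k) :
  (forall i, interpretation (vs i)) -> (forall x, q (fun i => vs i x) = v x) ->
  q (fun i => term_val (vs i) t) = term_val v t.
Proof.
move=> vi vq.
elim: t => //= [||k1 l1 t1 IH1 t2 IH2|k1 l1 t1 IH1 t2 IH2|k1 t1 IH|k1 l1 z h1 h2 t1 IH].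
- exact: (uq0 hq).
- exact: (uq1 hq).
- by rewrite (uqD hq) ?IH1 ?IH2 //; apply: bfam_term.
- by rewrite (uqM hq) ?IH1 ?IH2 //; apply: bfam_term.
- by rewrite (uq_star hq) ?IH //; apply: bfam_term.
- by rewrite (uqZ hq) ?IH //; apply: bfam_term.
Qed.

Lemma los_qf (K : connectives R) (vs : I -> X -> B) (v : X -> D) (phi : qf K X) :
  (forall i, interpretation (vs i)) -> (forall x, q (fun i => vs i x) = v x) ->
  qf_val (vs i) phi @[i --> W] --> qf_val v phi.
Proof.
move=> vi vq; apply: (qf_val_cvg (A := fun=> B)) => k t u.
rewrite -!(los_term _ vi vq) -(uqB hq); try exact: bfam_term.
by apply: (uq_norm hq); apply: bfamB; apply: bfam_term.
Qed.

End Los.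

Lemma filter_finite (T I : Type) (W : set_system I) (p : set T) (P : T -> I -> Prop) :
  Filter W -> finite_set p -> (forall e, p e -> \forall i \near W, P e i) ->
  \forall i \near W, forall e, p e -> P e i.
Proof.
move=> FW /(@finite_seqP {classic T})[s ->]; elim: s => [|a s IH] h.
  by apply: filterE => i e.
have hs : forall e : {classic T}, [set` s] e -> \forall i \near W, P e i.
  by move=> e es; apply: h; rewrite /= inE es orbT.
have ha : \forall i \near W, P a i by apply: h; rewrite /= inE eqxx.
apply: filterS2 ha (IH hs) => i h1 h2 e; rewrite /= inE => /orP[/eqP-> //|].
exact: h2.
Qed.

(** A condition consists of finitely many strict inequalities, so it holds in almost all coordinates
    once it holds in the ultrapower. This is how conditions descend from an ultrapower to the
    algebra. *)
Lemma los_models (K : connectives R) (I : Type) (W : set_system I)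
    {WU : UltraFilter W} (B D : cstarAlgType R) (q : (I -> B) -> D)
    (p : set (expression K)) (v : new_constants -> D) :
  is_ultrapower W q -> finite_set p -> models v p ->
  exists vs : I -> new_constants -> B,
    [/\ forall i, interpretation (vs i), forall x, q (fun i => vs i x) = v x
      & \forall i \near W, models (vs i) p].
Proof.
move=> hq pf [vi vp]; have [vs [vsi vsq]] := los_lift hq vi.
exists vs; split=> //.
have : \forall i \near W, forall e, p e -> qf_val (vs i) e.1 < e.2.
  apply: filter_finite pf _ => e pe.
  have h : qf_val (vs i) e.1 @[i --> W] --> qf_val v e.1 by exact: (@los_qf I W WU B D q hq new_constants K vs v e.1 vsi vsq).
  have e0 : 0 < e.2 - qf_val v e.1 by rewrite subr_gt0; apply: vp.
  move/cvgrPdist_lt: h => /(_ _ e0); apply: filterS => i.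
  by rewrite ltr_norml => /andP[? ?]; lra.
by apply: filterS => i h; split.
Qed.

End Semantics.

(** * Cuntz pairs *)

Section CuntzPairs.
Variables (R : realType) (Q : cstarAlgType R) (r1 r2 : Q).
Hypothesis r12 : cuntz2_rel r1 r2.

Lemma cuntz_11 : star r1 * r1 = 1. Proof. by case: r12. Qed.
Lemma cuntz_22 : star r2 * r2 = 1. Proof. by case: r12. Qed.
Lemma cuntz_sum : r1 * star r1 + r2 * star r2 = 1. Proof. by case: r12. Qed.
Lemma cuntz_12 : star r1 * r2 = 0.
Proof.
have h : star r1 * (r1 * star r1 + r2 * star r2) * r2 = star r1 * r2.
  by rewrite cuntz_sum mulr1.
move: h; rewrite mulrDr mulrDl !mulrA cuntz_11 mul1r -!mulrA cuntz_22 mulr1.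
by move/eqP; rewrite -subr_eq0 addrK => /eqP.
Qed.
Lemma cuntz_21 : star r2 * r1 = 0.
Proof. by rewrite -(starK r1) -starM cuntz_12 star0. Qed.
Lemma cuntz_11m x : x * star r1 * r1 = x. Proof. by rewrite -mulrA cuntz_11 mulr1. Qed.
Lemma cuntz_22m x : x * star r2 * r2 = x. Proof. by rewrite -mulrA cuntz_22 mulr1. Qed.
Lemma cuntz_12m x : x * star r1 * r2 = 0. Proof. by rewrite -mulrA cuntz_12 mulr0. Qed.
Lemma cuntz_21m x : x * star r2 * r1 = 0. Proof. by rewrite -mulrA cuntz_21 mulr0. Qed.

Definition cuntzE := (cuntz_11, cuntz_22, cuntz_12, cuntz_21,
  cuntz_11m, cuntz_22m, cuntz_12m, cuntz_21m).

Lemma pisom_r (p a : Q) : p * p = p -> star p = p -> star a * a = p -> a * p = a.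
Proof.
move=> pp ps aa; apply/eqP; rewrite -subr_eq0; apply/eqP; apply: starM_eq0.
by rewrite starB starM ps mulrBl !mulrBr !mulrA aa -!(mulrA p) aa !pp !subrr.
Qed.

Lemma pisom_l (q a : Q) : q * q = q -> star q = q -> a * star a = q -> q * a = a.
Proof.
move=> qq qs aa; rewrite -[RHS]starK -(@pisom_r q (star a)) ?starK //.
by rewrite starM qs starK.
Qed.

End CuntzPairs.

Ltac rsimp H :=
  do 2 rewrite ?(mulrDl, mulrDr, mulNr, mulrN, mulrA, cuntzE H, mulr0, mul0r, mulr1,
     mul1r, addr0, add0r, oppr0, starD, starM, starK, starN, star1, star0).

(* Families indexed by [J] supported by a projection, up to Murray-von Neumann
   equivalence; direct sums are formed with a fixed Cuntz pair. *)
Section Intertwiners.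
Variables (R : realType) (Q : cstarAlgType R) (J : Type) (r1 r2 : Q).
Hypothesis r12 : cuntz2_rel r1 r2.

Record pfam := PFam {
  pfu : Q;
  pff :> J -> Q;
  pfu_star : star pfu = pfu;
  pfu_idem : pfu * pfu = pfu;
  pff_l : forall j, pfu * pff j = pff j;
  pff_r : forall j, pff j * pfu = pff j
}.
Implicit Types X Y Z : pfam.

Definition pf_iso X Y := exists a : Q,
  [/\ star a * a = pfu X, a * star a = pfu Y & forall j, a * X j = Y j * a].

Lemma pf_refl X : pf_iso X X.
Proof.
exists (pfu X); rewrite pfu_star pfu_idem; split=> // j.
by rewrite pff_l pff_r.
Qed.

Lemma pf_iso_r X a : star a * a = pfu X -> a * pfu X = a.
Proof. exact: pisom_r (pfu_idem X) (pfu_star X). Qed.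

Lemma pf_iso_l X a : a * star a = pfu X -> pfu X * a = a.
Proof. exact: pisom_l (pfu_idem X) (pfu_star X). Qed.

Lemma pf_sym X Y : pf_iso X Y -> pf_iso Y X.
Proof.
move=> [a [h1 h2 h3]]; exists (star a); rewrite starK; split=> // j.
by rewrite -[Y j]pff_r -h2 !mulrA -(mulrA _ (Y j)) -h3 mulrA h1 pff_l.
Qed.

Lemma pf_trans Y X Z : pf_iso X Y -> pf_iso Y Z -> pf_iso X Z.
Proof.
move=> [a [a1 a2 a3]] [b [b1 b2 b3]]; exists (b * a); split=> [||j].
- by rewrite starM mulrA -(mulrA _ (star b)) b1 -mulrA (pf_iso_l a2).
- by rewrite starM mulrA -(mulrA b) a2 (pf_iso_r b1).
- by rewrite -mulrA a3 !mulrA b3.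
Qed.

Definition csum (x y : Q) : Q := r1 * x * star r1 + r2 * y * star r2.

Lemma csumM x y x' y' : csum x y * csum x' y' = csum (x * x') (y * y').
Proof. by rewrite /csum; rsimp r12. Qed.

Lemma csum_star x y : star (csum x y) = csum (star x) (star y).
Proof. by rewrite /csum; rsimp r12. Qed.

Program Definition pf_add X Y :=
  @PFam (csum (pfu X) (pfu Y)) (fun j => csum (X j) (Y j)) _ _ _ _.
Next Obligation. by move=> X Y; rewrite csum_star !pfu_star. Qed.
Next Obligation. by move=> X Y; rewrite csumM !pfu_idem. Qed.
Next Obligation. by move=> X Y j; rewrite csumM !pff_l. Qed.
Next Obligation. by move=> X Y j; rewrite csumM !pff_r. Qed.

(** The intertwiner is [r1 * star a + r2 * star b]: it carries the two orthogonal pieces of [Z] to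
    the two corners. *)
Lemma pf_split X Y Z a b :
  star a * a = pfu X -> star b * b = pfu Y -> star a * b = 0 ->
  a * star a + b * star b = pfu Z ->
  (forall j, Z j * a = a * X j) -> (forall j, Z j * b = b * Y j) ->
  pf_iso Z (pf_add X Y).
Proof.
move=> aa bb ab abz za zb; have ba : star b * a = 0 by rewrite -(starK a) -starM ab star0.
exists (r1 * star a + r2 * star b); split=> [||j] /=.
- by rsimp r12; exact: abz.
- rsimp r12; rewrite -!(mulrA _ (star a)) -!(mulrA _ (star b)) aa bb ab ba.
  by rsimp r12.
- have -> : Z j = a * X j * star a + b * Y j * star b.
    by rewrite -za -zb -!mulrA -mulrDr abz pff_r.
  rsimp r12; rewrite -!(mulrA _ (star a)) -!(mulrA _ (star b)) ?mulrA.
  rewrite -!(mulrA _ (star a) a) -!(mulrA _ (star b) b) -!(mulrA _ (star a) b) -!(mulrA _ (star b) a).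
  rewrite aa bb ab ba; rsimp r12; rewrite -!(mulrA _ (pfu _)) !pff_l /csum; rsimp r12.
  by [].
Qed.

Lemma pf_congr X X' Y Y' : pf_iso X X' -> pf_iso Y Y' -> pf_iso (pf_add X Y) (pf_add X' Y').
Proof.
move=> [a [a1 a2 a3]] [b [b1 b2 b3]]; exists (csum a b); split=> [||j] /=.
- by rewrite csum_star csumM a1 b1.
- by rewrite csum_star csumM a2 b2.
- by rewrite !csumM a3 b3.
Qed.

Lemma pf_comm X Y : pf_iso (pf_add X Y) (pf_add Y X).
Proof.
apply: (@pf_split _ _ _ (r2 * pfu Y) (r1 * pfu X)) => [||||j|j] /=.
- by rsimp r12; rewrite !(pfu_star, pfu_idem).
- by rsimp r12; rewrite !(pfu_star, pfu_idem).
- by rsimp r12.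
- by rewrite addrC /csum; rsimp r12; rewrite !pfu_star -!(mulrA _ (pfu _) (pfu _)) !pfu_idem.
- by rewrite /csum; rsimp r12; rewrite -!mulrA pff_l pff_r.
- by rewrite /csum; rsimp r12; rewrite -!mulrA pff_l pff_r.
Qed.

Lemma pf_assoc X Y Z : pf_iso (pf_add (pf_add X Y) Z) (pf_add X (pf_add Y Z)).
Proof.
apply: (@pf_split _ _ _ (r1 * r1 * pfu X)
   (r1 * r2 * pfu Y * star r1 + r2 * pfu Z * star r2)) => [||||j|j] /=.
- by rsimp r12; rewrite !(pfu_star, pfu_idem).
- by rewrite /csum; rsimp r12; rewrite !pfu_star -!(mulrA _ (pfu _) (pfu _)) !pfu_idem.
- by rsimp r12.
- rewrite /csum; rsimp r12; rewrite !pfu_star -!(mulrA _ (pfu _) (pfu _)) !pfu_idem.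
  by rewrite addrA.
- by rewrite /csum; rsimp r12; rewrite -!mulrA pff_l pff_r.
- rewrite /csum; rsimp r12.
  by rewrite -!(mulrA (r1 * r2)) -!(mulrA r2) !pff_l !pff_r.
Qed.

(** Intertwining the adjoints as well makes the range projection of [w] commute with [Y], so that
    [X] is a direct summand of [Y] up to equivalence. *)
Definition pf_le X Y := exists w : Q,
  [/\ star w * w = pfu X, pfu Y * w = w, forall j, w * X j = Y j * w
    & forall j, w * star (X j) = star (Y j) * w].

Lemma pf_le_add X Y : pf_le X Y -> exists Z, pf_iso Y (pf_add X Z).
Proof.
move=> [w [w1 w2 w3 w4]].
pose e := w * star w; have es : star e = e by rewrite /e starM starK.
have wx : w * pfu X = w by apply: pf_iso_r w1.
have ee : e * e = e by rewrite /e mulrA -(mulrA w) w1 wx.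
have qe : pfu Y * e = e by rewrite /e mulrA w2.
have eq : e * pfu Y = e by rewrite -[LHS]starK starM es pfu_star qe es.
have ej j : e * Y j = Y j * e.
  rewrite /e mulrA -w3 -!mulrA; congr (w * _).
  by have := congr1 (@star R Q) (w4 j); rewrite !starM !starK => ->.
have d1 : star (pfu Y - e) = pfu Y - e by rewrite starB pfu_star es.
have d2 : (pfu Y - e) * (pfu Y - e) = pfu Y - e.
  by rewrite mulrBl !mulrBr pfu_idem qe eq ee; abel.
have d3 j : (pfu Y - e) * ((pfu Y - e) * Y j) = (pfu Y - e) * Y j by rewrite mulrA d2.
have d4 j : (pfu Y - e) * Y j * (pfu Y - e) = (pfu Y - e) * Y j.
  have cm : (pfu Y - e) * Y j = Y j * (pfu Y - e).
    by rewrite mulrBl mulrBr pff_l pff_r ej.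
  by rewrite cm -mulrA d2.
exists (PFam d1 d2 d3 d4).
have sw : star w * pfu Y = star w by rewrite -[in RHS]w2 starM pfu_star.
have we : star w * e = star w.
  by rewrite /e mulrA w1 -[in RHS]wx starM pfu_star.
apply: (@pf_split _ _ _ w (pfu Y - e)) => //= [|||j].
- by rewrite d1 d2.
- by rewrite mulrBr sw we subrr.
- by rewrite d1 d2 addrC subrK.
- by rewrite mulrA d2 mulrBl mulrBr pff_l pff_r ej.
Qed.

(** From [V = U + Z] and [U = U + U] follows [V = U + V]. Applied in both directions this identifies
    [X] and [Y] with the same sum; absorbing doubles takes the place of the infinite iteration in
    the classical argument. *)
Lemma pf_CB X Y : pf_le X Y -> pf_le Y X ->
  pf_iso X (pf_add X X) -> pf_iso Y (pf_add Y Y) -> pf_iso X Y.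
Proof.
suff H U V : pf_le U V -> pf_iso U (pf_add U U) -> pf_iso V (pf_add U V).
  move=> xy yx xx yy; apply: pf_trans (H _ _ yx yy) _.
  by apply: pf_trans (pf_comm _ _) (pf_sym (H _ _ xy xx)).
move=> /pf_le_add[Z vz] uu; apply: (pf_trans vz).
apply: pf_trans (pf_congr uu (pf_refl _)) _.
apply: pf_trans (pf_assoc _ _ _) _.
exact: pf_congr (pf_refl _) (pf_sym vz).
Qed.

(** With [X = N + B], adding [B] to the hypothesis gives [2 X = 3 X]. With [X = 2 X + C] this
    becomes [X = 3 X + C = X + X]. *)
Lemma pf_absorb X N : pf_iso (pf_add X N) (pf_add (pf_add X X) N) ->
  pf_le N X -> pf_le (pf_add X X) X -> pf_iso X (pf_add X X).
Proof.
move=> h /pf_le_add[B xb] /pf_le_add[C xc].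
have h3 : pf_iso (pf_add X X) (pf_add (pf_add X X) X).
  apply: pf_trans (pf_congr (pf_refl _) xb) _.
  apply: pf_trans (pf_sym (pf_assoc _ _ _)) _.
  apply: pf_trans (pf_congr h (pf_refl _)) _.
  apply: pf_trans (pf_assoc _ _ _) _.
  exact: pf_congr (pf_refl _) (pf_sym xb).
apply: (pf_trans xc); apply: pf_trans (pf_congr h3 (pf_refl _)) _.
apply: pf_trans (pf_congr (pf_assoc _ _ _) (pf_refl _)) _.
apply: pf_trans (pf_assoc _ _ _) _.
exact: pf_congr (pf_refl _) (pf_sym xc).
Qed.

End Intertwiners.

(** * Approximate intertwiners between Cuntz pairs *)

Section CuntzIntertwiner.
Variables (R : realType) (B : cstarAlgType R) (s1 s2 t1 t2 : B).
Hypotheses (s12 : cuntz2_rel s1 s2) (t12 : cuntz2_rel t1 t2).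

(** A fixed point of this map intertwines the two pairs, since [cmix x * s1 = t1 * x] and likewise
    for the second generators. *)
Definition cmix x : B := t1 * x * star s1 + t2 * x * star s2.

Lemma cmix_s1 x : cmix x * s1 = t1 * x. Proof. by rewrite /cmix; rsimp s12. Qed.
Lemma cmix_s2 x : cmix x * s2 = t2 * x. Proof. by rewrite /cmix; rsimp s12. Qed.

Lemma iter_cmixE m x : star (t1 ^+ m) * iter m cmix x = x * star (s1 ^+ m).
Proof.
elim: m => [|m IH]; first by rewrite !expr0 star1 mul1r mulr1.
rewrite exprS starM /= -!mulrA.
have -> : star t1 * cmix (iter m cmix x) = iter m cmix x * star s1.
  by rewrite /cmix; rsimp t12.
by rewrite mulrA IH -mulrA -starM -exprS.
Qed.

Lemma cuntz_pow_iso m : star (t1 ^+ m) * t1 ^+ m = 1.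
Proof.
elim: m => [|m IH]; first by rewrite expr0 star1 mulr1.
by rewrite exprS starM mulrA -(mulrA _ (star t1)) (cuntz_11 t12) mulr1.
Qed.

Lemma cuntz_21_pow m : (0 < m)%N -> star t2 * t1 ^+ m = 0.
Proof. by case: m => // m _; rewrite exprS mulrA (cuntz_21 t12) mul0r. Qed.

Let a M := t1 ^+ M * t2.

(** [iter_cmixE] moves the iterations to a power of [star s1] on the right; what remains contains
    [star t2 * t1 ^+ m], which vanishes for [m > 0]. *)
Lemma cmix_orth M m : (0 < m <= M)%N -> star (a M) * iter m cmix (a M) = 0.
Proof.
move=> /andP[m0 mM]; rewrite /a starM -{1}(subnKC mM) exprD starM -!mulrA.
rewrite iter_cmixE !mulrA -(mulrA (star t2)).
have -> : star (t1 ^+ (M - m)) * t1 ^+ M = t1 ^+ m.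
  by rewrite -{2}(subnK mM) exprD mulrA cuntz_pow_iso mul1r.
by rewrite cuntz_21_pow // !mul0r.
Qed.

Lemma cmix_iso M : star (a M) * a M = 1.
Proof.
by rewrite /a starM !mulrA -(mulrA _ _ (t1 ^+ M)) cuntz_pow_iso mulr1 (cuntz_22 t12).
Qed.

Definition clam x : B := s1 * x * star s1 + s2 * x * star s2.

Lemma cmixM x y : star (cmix x) * cmix y = clam (star x * y).
Proof. by rewrite /cmix /clam; rsimp s12; rsimp t12. Qed.

Lemma iter_cmixM k m x y :
  star (iter k cmix x) * iter (k + m) cmix y = iter k clam (star x * iter m cmix y).
Proof. by elim: k => //= k IH; rewrite cmixM IH. Qed.

Lemma iter_clam1 k : iter k clam 1 = 1.
Proof.
by elim: k => //= k ->; rewrite /clam !mulr1; exact: cuntz_sum s12.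
Qed.

Lemma iter_clam0 k : iter k clam 0 = 0.
Proof. by elim: k => //= k ->; rewrite /clam !mulr0 !mul0r addr0. Qed.

Lemma iter_cmix_orth M k l : (k <= M)%N -> (l <= M)%N ->
  star (iter k cmix (a M)) * iter l cmix (a M) = if k == l then 1 else 0.
Proof.
suff H k' l' : (k' <= l')%N -> (l' <= M)%N ->
    star (iter k' cmix (a M)) * iter l' cmix (a M) = if k' == l' then 1 else 0.
  move=> kM lM; case/orP: (leq_total k l) => kl; first exact: H.
  by rewrite -[LHS]starK starM starK H // eq_sym; case: ifP; rewrite ?star1 ?star0.
move=> kl lM; rewrite -{1}(subnKC kl) iter_cmixM; case: eqP => [->|/eqP ne].
  by rewrite subnn /= cmix_iso iter_clam1.
rewrite cmix_orth ?iter_clam0 // subn_gt0 ltn_neqAle ne kl /=.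
exact: leq_trans (leq_subr _ _) lM.
Qed.

(* Summing [L] iterates of [cmix] telescopes the intertwining defect, while the
   iterates of [t1 ^+ M * t2] are orthonormal. *)
Lemma cuntz_approx_intertwiner (e : R) : 0 < e -> exists w : B,
  [/\ star w * w = 1, cnorm (w * s1 - t1 * w) < e & cnorm (w * s2 - t2 * w) < e].
Proof.
move=> e0; have [L0 hL] : exists L : nat, 2 / e < L.+1%:R.
  by exists (Num.truncn (2 / e)); apply: truncnS_gt.
(* [L] is a perfect square, so [r] is exactly its inverse root and [w] is an isometry. The
   telescoped defect has norm at most 2, whence the choice of [L0] with [2 r < e]. *)
pose L := (L0.+1 * L0.+1)%N; pose r : R := (L0.+1%:R)^-1.
have r0 : 0 < r by rewrite invr_gt0 ltr0n.
pose w0 := \sum_(k < L) iter k cmix (a L); pose w := r%:C *: w0.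
have ww0 : star w0 * w0 = L%:R.
  rewrite star_sum big_distrlr /=.
  transitivity (\sum_(k < L) (1 : B)); last by rewrite sumr_const card_ord.
  apply: eq_bigr => k _; rewrite (bigD1 k) //= iter_cmix_orth ?(ltnW (ltn_ord _)) //.
  rewrite eqxx big1 ?addr0 // => l /negbTE lk.
  by rewrite iter_cmix_orth ?(ltnW (ltn_ord _)) // eq_sym (lk : (l == k :> nat) = false).
have tel s t : (forall x, cmix x * s = t * x) ->
    w0 * s - t * w0 = a L * s - iter L cmix (a L) * s.
  move=> hst; rewrite /w0 mulr_suml mulr_sumr.
  have -> : \sum_(i < L) t * iter i cmix (a L) = \sum_(i < L) iter i.+1 cmix (a L) * s.
    by apply: eq_bigr => i _; rewrite /= hst.
  rewrite -sumrB -(big_mkord xpredT (fun i => iter i cmix (a L) * s - iter i.+1 cmix (a L) * s)).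
  rewrite (@telescope_sumr_eq _ 0 L (fun i => - (iter i cmix (a L) * s))) //=.
    by rewrite opprK addrC.
  by move=> k _; rewrite opprK addrC.
have nL : cnorm (iter L cmix (a L)) = 1.
  by apply: isometry_norm; rewrite iter_cmix_orth ?eqxx.
have na : cnorm (a L) = 1 by apply: isometry_norm; apply: cmix_iso.
have fin s t : star s * s = 1 -> (forall x, cmix x * s = t * x) ->
    cnorm (w * s - t * w) < e.
  move=> ss hst; rewrite /w scaleMl scaleMr -scalerBr cnormZr tel //.
  rewrite ger0_norm ?(ltW r0) //.
  have h : cnorm (a L * s - iter L cmix (a L) * s) <= 2.
    rewrite -mulrBl; apply: le_trans (cnormM _ _) _.
    by rewrite (isometry_norm ss) mulr1; apply: le_trans (cnormB _ _) _; rewrite nL na.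
  have : r * cnorm (a L * s - iter L cmix (a L) * s) <= r * 2 by rewrite ler_pM2l.
  move=> /le_lt_trans; apply; rewrite /r mulrC ltr_pdivrMr ?ltr0n //.
  by rewrite mulrC -ltr_pdivrMr.
exists w; split.
- rewrite /w starZr scaleMl scaleMr scalerA ww0 -rcM -scaler_nat scalerA.
  rewrite -(rmorph_nat (real_complex R)) -rcM /L natrM.
  by rewrite (_ : _ * _ = 1) ?scale1r // /r mulrACA mulVf ?mulr1.
- by apply: fin (cuntz_11 s12) cmix_s1.
- by apply: fin (cuntz_22 s12) cmix_s2.
Qed.

End CuntzIntertwiner.

(** * Block-diagonal elements along a Cuntz pair *)

Section Blocks.
Variables (R : realType) (B : cstarAlgType R) (s1 s2 : B).
Hypothesis s12 : cuntz2_rel s1 s2.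

(** There are [n + 1] blocks. Block 0 sits in the outermost corner [s2], so the first block splits
    off by computation, whereas the last one needs the unitary of [blk_last]. *)
Fixpoint blk n (x : nat -> B) : B :=
  if n is m.+1 then csum s1 s2 (blk m (fun j => x j.+1)) (x 0%N) else x 0%N.

Lemma blkM n x y : blk n x * blk n y = blk n (fun j => x j * y j).
Proof. by elim: n x y => //= n IH x y; rewrite csumM // IH. Qed.

Lemma blk_star n x : star (blk n x) = blk n (fun j => star (x j)).
Proof. by elim: n x => //= n IH x; rewrite csum_star // IH. Qed.

Lemma blkD n x y : blk n x + blk n y = blk n (fun j => x j + y j).
Proof.
elim: n x y => //= n IH x y; rewrite -IH /csum !mulrDr !mulrDl.
by rewrite addrACA.
Qed.

Lemma blkZ n c x : c *: blk n x = blk n (fun j => c *: x j).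
Proof.
elim: n x => //= n IH x; rewrite -IH /csum scalerDr.
by rewrite !scaleMr !scaleMl.
Qed.

Lemma blk_cst1 n : blk n (fun=> 1) = 1.
Proof. by elim: n => //= n ->; rewrite /csum !mulr1; exact: cuntz_sum s12. Qed.

Lemma blk_ext n x y : (forall j, (j <= n)%N -> x j = y j) -> blk n x = blk n y.
Proof.
elim: n x y => [|n IH] x y h /=; first exact: h.
by rewrite (IH _ (fun j => y j.+1)) ?h // => j jn; apply: h.
Qed.

Lemma blk_last n : exists a : B, [/\ star a * a = 1, a * star a = 1
  & forall y : nat -> B, a * blk n.+1 y = csum s1 s2 (blk n y) (y n.+1) * a].
Proof.
elim: n => [|n [a [a1 a2 a3]]].
  exists (s2 * star s1 + s1 * star s2); split=> [||y] /=.
  - by rsimp s12; exact: cuntz_sum s12.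
  - by rsimp s12; rewrite addrC; exact: cuntz_sum s12.
  - by rewrite /csum; rsimp s12; rewrite addrC.
(* [c] exchanges the corners [s1 s2] and [s2] and fixes the corner [s1 s1]. *)
pose c := s1 * s1 * star s1 * star s1 + s2 * star s2 * star s1 + s1 * s2 * star s2.
have c1 : star c * c = 1.
  by rewrite /c; rsimp s12; rewrite -(cuntz_sum s12) -[X in _ = X * _ + _]mulr1
    -[X in _ = _ * X * _ + _](cuntz_sum s12); rsimp s12; rewrite ?addrA.
have c2 : c * star c = 1.
  by rewrite /c; rsimp s12; rewrite -(cuntz_sum s12) -[X in _ = X * _ + _]mulr1
    -[X in _ = _ * X * _ + _](cuntz_sum s12); rsimp s12; rewrite addrAC.
exists (c * csum s1 s2 a 1); split=> [||y].
- rewrite starM mulrA -(mulrA _ (star c)) c1 mulr1 csum_star // csumM // a1 star1 mul1r.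
  by rewrite /csum !mulr1; exact: cuntz_sum s12.
- rewrite starM mulrA -(mulrA c) csum_star // csumM // a2 star1 mul1r.
  by rewrite /csum !mulr1 (cuntz_sum s12) mulr1 c2.
- have -> : blk n.+2 y = csum s1 s2 (blk n.+1 (fun j => y j.+1)) (y 0%N) by [].
  rewrite -mulrA csumM // a3 mul1r -[y 0%N in X in _ * X]mulr1 -csumM // mulrA.
  rewrite [RHS]mulrA; congr (_ * _) => /=.
  by rewrite /c /csum; rsimp s12; rewrite ?addrA // addrAC.
Qed.

Lemma blk_cuntz n x y : (forall j, cuntz2_rel (x j) (y j)) -> cuntz2_rel (blk n x) (blk n y).
Proof.
move=> h; split; rewrite !blk_star !blkM ?blkD -[RHS](blk_cst1 n); apply: blk_ext => j _.
- exact: cuntz_11 (h j).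
- exact: cuntz_22 (h j).
- exact: cuntz_sum (h j).
Qed.

End Blocks.

(** * Points of the unit circle *)

Section RootsOfUnity.
Variable R : realType.

Definition cis (t : R) : R[i] := cos t +i* sin t.

Lemma cisX t k : cis t ^+ k = cis (k%:R * t).
Proof.
elim: k => [|k IH]; first by rewrite expr0 mul0r /cis cos0 sin0.
rewrite exprS IH -natr1 mulrDl mul1r addrC /cis cosD sinD.
by apply/eqP; rewrite eq_complex /= eqxx /= addrC.
Qed.

Lemma cis_norm t : cis t * Num.conj (cis t) = 1.
Proof.
apply/eqP; rewrite eq_complex /= mulrN opprK -!expr2 cos2Dsin2 eqxx /=.
by rewrite mulrN [sin t * _]mulrC addNr.
Qed.

Lemma cis_near1 (e : R) : 0 < e -> exists N, forall m, (N <= m)%N ->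
  complex.Re `|1 - cis (pi / m.+2%:R)| < e.
Proof.
(* The squared modulus of [1 - cis t] is [2 (1 - cos t)], so [cos t] has to be within [e^2 / 2] of
   1. *)
move=> e0; have e2 : 0 < e ^+ 2 / 2 by rewrite divr_gt0 // exprn_gt0.
have /cvgrPdist_lt/(_ _ e2)[d /= d0 hd] : cos x @[x --> (0 : R)] --> (1 : R).
  by rewrite -[X in _ --> X]cos0; apply: continuous_cos.
have [N hN] : exists N : nat, pi / d < N%:R :> R.
  by exists (Num.truncn (pi / d : R)).+1; apply: truncnS_gt.
exists N => m Nm; set t := pi / _.
have t0 : 0 < t by rewrite divr_gt0 ?pi_gt0 ?ltr0n.
have td : t < d.
  rewrite /t ltr_pdivrMr ?ltr0n // mulrC -ltr_pdivrMr //.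
  by apply: lt_le_trans hN _; rewrite ler_nat; apply: leq_trans Nm _; apply: leqW.
have : `|1 - cos t| < e ^+ 2 / 2.
  by apply: hd; rewrite /= sub0r normrN gtr0_norm.
rewrite ltr_norml => /andP[_ h]; rewrite sub0r sqrrN.
rewrite -[ltRHS](ger0_norm (ltW e0)) -sqrtr_sqr ltr_sqrt ?exprn_gt0 //.
have := cos2Dsin2 t; rewrite sqrrB expr1n mul1r mulr2n; lra.
Qed.

End RootsOfUnity.

(** * Uniqueness of Cuntz pairs in an ultrapower *)

Section Uniqueness.
Variables (R : realType) (I : Type) (W : set_system I).
Context {WU : UltraFilter W}.
Variable n : I -> nat.
Hypothesis n_infty : forall N, \forall i \near W, (N <= n i)%N.
Variables (B D : cstarAlgType R) (q : (I -> B) -> D).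
Hypothesis hq : is_ultrapower W q.

Definition is_cz (A : cstarAlgType R) (V : bool -> A) := cuntz2_rel (V true) (V false).

Definition pf1 (A : cstarAlgType R) (J : Type) (x : J -> A) : pfam A J :=
  @PFam R A J 1 x (star1 A) (mulr1 1) (fun j => mul1r (x j)) (fun j => mulr1 (x j)).

Lemma bd_iso (w : I -> B) : (forall i, star (w i) * w i = 1) -> bounded_family w.
Proof. by move=> h; exists 1 => i; rewrite (isometry_norm (h i)). Qed.

Lemma bd_cz (V : I -> bool -> B) b : (forall i, is_cz (V i)) -> bounded_family (fun i => V i b).
Proof. by move=> h; apply: bd_iso => i; case: (h i) => h1 h2 _; case: b. Qed.

Lemma cz_q (V : I -> bool -> B) : (forall i, is_cz (V i)) ->
  is_cz (fun b => q (fun i => V i b)).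
Proof.
move=> h; have bV b := bd_cz b h; have sV b := bfam_star (bV b).
have V1 i := cuntz_11 (h i); have V2 i := cuntz_22 (h i); have V3 i := cuntz_sum (h i).
split; rewrite -!(uq_star hq) -?(uqM hq) -?(uqD hq) -?(uq1 hq) //;
  try (by apply: bfamM); by congr q; apply/funext.
Qed.

(** The ranges of [V true] and [V false] exhaust the unit, so [star (T b) * w] can be expanded along
    them. This provides the adjoint clause of [pf_le]. *)
Lemma cz_intertwine_star (A : cstarAlgType R) (V T : bool -> A) (w : A) :
  is_cz V -> is_cz T -> (forall b, w * V b = T b * w) ->
  forall b, w * star (V b) = star (T b) * w.
Proof.
move=> hV hT h b.
have V3 := cuntz_sum hV.
have -> : star (T b) * w = star (T b) * w * (V true * star (V true) + V false * star (V false)).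
  by rewrite V3 mulr1.
rewrite mulrDr !mulrA -!(mulrA (star (T b))) !h.
by case: b; rewrite !mulrA ?(cuntzE hT) ?mul1r ?mul0r ?add0r ?addr0.
Qed.

Lemma inv_succ_cvg (e : R) : 0 < e -> \forall i \near W, ((n i).+1%:R)^-1 < e.
Proof.
move=> e0; have [N hN] : exists N : nat, e^-1 < N%:R.
  by exists (Num.truncn (e^-1)).+1; apply: truncnS_gt.
apply: filterS (n_infty N) => i Ni.
rewrite -[ltRHS]invrK ltf_pV2 ?posrE ?ltr0n ?invr_gt0 //.
by apply: lt_le_trans hN _; rewrite ler_nat leqW.
Qed.

Lemma uq_norm0 (x y : I -> B) : bounded_family x -> bounded_family y ->
  (forall i, cnorm (x i - y i) <= ((n i).+1%:R)^-1) -> q x = q y.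
Proof.
move=> xb yb h; apply/(uq_eq hq) => // e e0.
by apply: filterS (inv_succ_cvg e0) => i; rewrite subr0; apply: le_lt_trans.
Qed.

Lemma cz_le (V T : I -> bool -> B) : (forall i, is_cz (V i)) -> (forall i, is_cz (T i)) ->
  pf_le (pf1 (fun b => q (fun i => V i b))) (pf1 (fun b => q (fun i => T i b))).
Proof.
move=> hV hT; have bV b := bd_cz b hV; have bT b := bd_cz b hT.
have /choice[w hw] : forall i, exists w : B, star w * w = 1 /\
    forall b, cnorm (w * V i b - T i b * w) <= ((n i).+1%:R)^-1.
  move=> i; have [|w [w1 w2 w3]] := @cuntz_approx_intertwiner R B _ _ _ _ (hV i) (hT i)
     ((n i).+1%:R)^-1; first by rewrite invr_gt0 ltr0n.
  by exists w; split=> // -[]; apply: ltW.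
have bw : bounded_family w by apply: bd_iso => i; case: (hw i).
have sw := bfam_star bw.
have wV b : q w * q (fun i => V i b) = q (fun i => T i b) * q w.
  rewrite -!(uqM hq) //; apply: uq_norm0; try exact: bfamM.
  by move=> i; case: (hw i).
exists (q w); split=> //=.
- rewrite -(uq_star hq) // -(uqM hq) // -(uq1 hq); congr q; apply/funext => i.
  by case: (hw i).
- by rewrite mul1r.
- exact: cz_intertwine_star (cz_q hV) (cz_q hT) wV.
Qed.

Section Flip.
Variable S : bool -> B.
Hypothesis hS : is_cz S.
Local Notation s1 := (S true).
Local Notation s2 := (S false).

(** The self-adjoint unitary exchanging the first two letters of a word. Multiplying the pair by it
    yields the doubled pair, see [cflipS]. *)
Definition cflip : B := s1 * s1 * star s1 * star s1 + s2 * s1 * star s2 * star s1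
   + (s1 * s2 * star s1 * star s2 + s2 * s2 * star s2 * star s2).

Lemma cflip_star : star cflip = cflip.
Proof. by rewrite /cflip; rsimp hS; abel. Qed.

Lemma cflipS b : cflip * S b = csum s1 s2 (S b) (S b).
Proof. by rewrite /cflip /csum; case: b; rsimp hS. Qed.

Lemma cflip2 : cflip * cflip = 1.
Proof.
have -> : 1 = s1 * (s1 * star s1 + s2 * star s2) * star s1
              + s2 * (s1 * star s1 + s2 * star s2) * star s2.
  by rewrite !(cuntz_sum hS) !mulr1 (cuntz_sum hS).
by rewrite /cflip; rsimp hS; abel.
Qed.

Let h : R[i] := (2^-1 : R)%:C.
(** The spectral projection of [cflip] at [-1]. It defines the path of unitaries [crot z] leading
    from 1 to [cflip] as [z] runs along a half circle. *)
Definition cprj : B := h *: (1 - cflip).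

Lemma hh : h + h = 1.
Proof.
have e : 2^-1 + 2^-1 = 1 :> R by field.
by rewrite /h -rcD e.
Qed.

Lemma cprj_star : star cprj = cprj.
Proof. by rewrite /cprj starZr starB star1 cflip_star. Qed.

Lemma cprj_idem : cprj * cprj = cprj.
Proof.
rewrite /cprj scaleMl scaleMr mulrBr mulrBl mulr1 mul1r mulrBl mul1r cflip2.
have -> : 1 - cflip - (cflip - 1) = (1 - cflip) + (1 - cflip) by abel.
by rewrite half_scale.
Qed.

Definition crot (z : R[i]) : B := 1 - (1 - z) *: cprj.

Lemma crot_mul z z' : crot z * crot z' = crot (z * z').
Proof.
rewrite /crot !(mulrBl, mulrBr) !mulr1 !mul1r scaleMl scaleMr cprj_idem scalerA.
rewrite (_ : 1 - z * z' = (1 - z) + (1 - z') - (1 - z) * (1 - z')); last by ring.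
by move: (1 - z) (1 - z') => a b; rewrite scalerBl scalerDl; abel.
Qed.

Lemma crot_star z : star (crot z) = crot (Num.conj z).
Proof. by rewrite /crot starB star1 starZ cprj_star rmorphB rmorph1. Qed.

Lemma crot1 : crot 1 = 1.
Proof. by rewrite /crot subrr scale0r subr0. Qed.

Lemma crotN1 : crot (-1) = cflip.
Proof.
rewrite /crot /cprj opprK scalerA mulrDl mul1r hh scale1r.
by rewrite opprB addrCA subrr addr0.
Qed.

Definition crotS z b : B := crot z * S b.

Lemma crotS_cz z : z * Num.conj z = 1 -> is_cz (crotS z).
Proof.
move=> zz; have u1 : star (crot z) * crot z = 1 by rewrite crot_star crot_mul mulrC zz crot1.
have u2 : crot z * star (crot z) = 1 by rewrite crot_star crot_mul zz crot1.
rewrite /is_cz /crotS; split.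
- by rewrite starM -mulrA (mulrA (star (crot z))) u1 mul1r (cuntz_11 hS).
- by rewrite starM -mulrA (mulrA (star (crot z))) u1 mul1r (cuntz_22 hS).
- have -> : crot z * s1 * star (crot z * s1) + crot z * s2 * star (crot z * s2) =
    crot z * (s1 * star s1 + s2 * star s2) * star (crot z) by rewrite !starM; ncr.
  by rewrite (cuntz_sum hS) mulr1 u2.
Qed.

Section Chain.
Variable m : nat.
(** A root of [-1] of order [m.+2], the number of blocks of [blk m.+1]: shifting the chain by one
    block makes it end at the flip. *)
Let w := cis (pi / m.+2%:R : R).

Lemma w_norm k : w ^+ k * Num.conj (w ^+ k) = 1.
Proof. by rewrite cisX cis_norm. Qed.

Lemma w_last : w ^+ m.+2 = -1.
Proof.
rewrite cisX mulrC divfK ?pnatr_eq0 // /cis cospi sinpi.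
by apply/eqP; rewrite eq_complex /= oppr0 !eqxx.
Qed.

(** The difference of the two chains is [1 - w] times the product of a block unitary, a projection
    and an isometry, so its norm does not grow with the number of blocks. *)
Lemma chain_dist b :
  cnorm (blk s1 s2 m.+1 (fun j => crotS (w ^+ j) b) -
         blk s1 s2 m.+1 (fun j => crotS (w ^+ j.+1) b)) <= complex.Re `|1 - w|.
Proof.
rewrite -scaleN1r blkZ blkD.
have -> : blk s1 s2 m.+1 (fun j => crotS (w ^+ j) b + -1 *: crotS (w ^+ j.+1) b) =
  (1 - w) *: (blk s1 s2 m.+1 (fun j => w ^+ j *: 1) *
    (blk s1 s2 m.+1 (fun=> cprj) * blk s1 s2 m.+1 (fun=> S b))).
  rewrite !(blkM hS) !blkZ; apply: blk_ext => j _.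
  have -> : crotS (w ^+ j) b + -1 *: crotS (w ^+ j.+1) b =
     (crot (w ^+ j) - crot (w ^+ j.+1)) * S b.
    by rewrite scaleN1r /crotS [RHS]mulrBl.
  have -> : crot (w ^+ j) - crot (w ^+ j.+1) = (w ^+ j - w ^+ j.+1) *: cprj.
    by rewrite /crot !scalerBl !scale1r; abel.
  rewrite !scaleMl mul1r !scalerA; congr (_ *: _).
  by rewrite exprS; ring.
rewrite cnormZ.
have pos : 0 <= complex.Re `|1 - w| by have := normr_ge0 (1 - w); rewrite lecE /= => /andP[].
apply: ler_piMr => //; apply: le_trans (cnormM _ _) _; apply: mulr_ile1; rewrite ?cnorm_ge0 //.
  rewrite isometry_norm // blk_star (blkM hS) -[RHS](blk_cst1 hS m.+1).
  apply: blk_ext => j _; rewrite starZ star1 scaleMl scaleMr mulr1 scalerA.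
  by rewrite mulrC w_norm scale1r.
apply: le_trans (cnormM _ _) _; apply: mulr_ile1; rewrite ?cnorm_ge0 //.
  apply: proj_norm; rewrite ?blk_star ?(blkM hS); apply: blk_ext => j _.
    exact: cprj_star.
  exact: cprj_idem.
rewrite isometry_norm // blk_star (blkM hS) -[RHS](blk_cst1 hS m.+1).
by apply: blk_ext => j _; case: b; [exact: cuntz_11 hS|exact: cuntz_22 hS].
Qed.

End Chain.

Let dS b : D := q (fun=> S b).

Lemma dS_cz : is_cz dS. Proof. exact: (cz_q (V := fun=> S)). Qed.

Lemma q_csum (x y : I -> B) : bounded_family x -> bounded_family y ->
  q (fun i => csum s1 s2 (x i) (y i)) = csum (dS true) (dS false) (q x) (q y).
Proof.
move=> xb yb; rewrite /csum /dS -!(uq_star hq) -?(uqM hq) -?(uqD hq) //;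
  repeat (apply: bfamM || apply: bfamD || apply: bfam_star || apply: bfam_cst || assumption).
Qed.

(** [Xf] follows the path starting at 1 and [Yf] the path shifted by one step, which ends at the
    flip; [Nf] is their common part. *)
Let w i := cis (pi / (n i).+2%:R : R).
Let Xf i b := blk s1 s2 (n i).+1 (fun j => crotS (w i ^+ j) b).
Let Yf i b := blk s1 s2 (n i).+1 (fun j => crotS (w i ^+ j.+1) b).
Let Nf i b := blk s1 s2 (n i) (fun j => crotS (w i ^+ j.+1) b).

Lemma Xf_cz i : is_cz (Xf i).
Proof. by apply: (blk_cuntz hS) => j; apply: crotS_cz; apply: w_norm. Qed.
Lemma Yf_cz i : is_cz (Yf i).
Proof. by apply: (blk_cuntz hS) => j; apply: crotS_cz; apply: w_norm. Qed.
Lemma Nf_cz i : is_cz (Nf i).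
Proof. by apply: (blk_cuntz hS) => j; apply: crotS_cz; apply: w_norm. Qed.

Lemma qXY b : q (fun i => Xf i b) = q (fun i => Yf i b).
Proof.
have bX := bd_cz b Xf_cz; have bY := bd_cz b Yf_cz.
apply/(uq_eq hq) => // e e0; have [N hN] := cis_near1 e0.
apply: filterS (n_infty N) => i Ni; rewrite subr0.
exact: le_lt_trans (chain_dist _ _) (hN _ Ni).
Qed.

Lemma pf_eq (A : cstarAlgType R) (J : Type) (X Y : pfam A J) :
  pfu X = pfu Y -> (forall j, X j = Y j) -> pf_iso X Y.
Proof.
move=> e1 e2; exists (pfu X); rewrite pfu_star pfu_idem; split=> // j.
by rewrite pff_l -e2 pff_r.
Qed.

Lemma csum11 (A : cstarAlgType R) (a b : A) : cuntz2_rel a b -> csum a b 1 1 = 1.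
Proof. by move=> ab; rewrite /csum !mulr1; exact: cuntz_sum ab. Qed.

Local Notation PS := (pf1 dS).
Local Notation PN := (pf1 (fun b => q (fun i => Nf i b))).

Lemma Yf_split : pf_iso (pf1 (fun b => q (fun i => Yf i b)))
  (pf_add dS_cz PN (pf_add dS_cz PS PS)).
Proof.
have /choice[a ha] := fun i => blk_last hS (n i).
have a1 i : star (a i) * a i = 1 by case: (ha i).
have a2 i : a i * star (a i) = 1 by case: (ha i).
have ba : bounded_family a by apply: bd_iso.
have bS b : bounded_family (fun _ : I => S b) by apply: bfam_cst.
exists (q a); split=> [||b].
- rewrite /= -(uq_star hq) // -(uqM hq) //; last exact: bfam_star.
  by rewrite -(uq1 hq); congr q; apply/funext.
- rewrite /= !(csum11 dS_cz) -(uq_star hq) // -(uqM hq) //; last exact: bfam_star.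
  by rewrite -(uq1 hq); congr q; apply/funext.
- have bY := bd_cz b Yf_cz; have bN := bd_cz b Nf_cz.
  have bSS : bounded_family (fun _ : I => csum s1 s2 (S b) (S b)) by apply: bfam_cst.
  have bNS : bounded_family (fun i => csum s1 s2 (Nf i b) (csum s1 s2 (S b) (S b))).
    by rewrite /csum; repeat (apply: bfamM || apply: bfamD || apply: bfam_star || apply: bfam_cst || assumption).
  rewrite /= -(q_csum (bS b) (bS b)) -(q_csum bN bSS) -!(uqM hq) //.
  congr q; apply/funext => i; have [_ _ ->] := ha i.
  by rewrite /w w_last /crotS crotN1 cflipS.
Qed.

(** [Xf] is [S + N], and [Yf] is [N + (S + S)] since the flip doubles the pair. Both agree in the
    ultrapower, where the steps become infinitely small, and [pf_absorb] removes [N]. *)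
Lemma PS_double : pf_iso PS (pf_add dS_cz PS PS).
Proof.
have bS b : bounded_family (fun _ : I => S b) by apply: bfam_cst.
apply: (@pf_absorb _ _ _ _ _ _ _ PN).
- apply: pf_trans (pf_comm _ _ _) _; apply: pf_trans (pf_comm _ _ _).
  apply: pf_trans Yf_split; apply: pf_eq => [|b] /=; first exact: csum11 dS_cz.
  rewrite -qXY /= -q_csum //; last exact: bd_cz Nf_cz.
  by congr q; apply/funext => i; rewrite /Xf /= expr0 {2}/crotS crot1 mul1r.
- by apply: (@cz_le Nf (fun=> S)) => // i; apply: Nf_cz.
- have hV (i : I) : is_cz (fun b => csum s1 s2 (S b) (S b)).
    split; rewrite !csum_star ?csumM //.
    + by rewrite (cuntz_11 hS) csum11.
    + by rewrite (cuntz_22 hS) csum11.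
    + have -> : csum s1 s2 (s1 * star s1) (s1 * star s1) + csum s1 s2 (s2 * star s2) (s2 * star s2)
        = csum s1 s2 (s1 * star s1 + s2 * star s2) (s1 * star s1 + s2 * star s2).
        by rewrite /csum; ncr.
      by rewrite (cuntz_sum hS) csum11.
  have [v [v1 v2 v3 v4]] := @cz_le (fun _ b => csum s1 s2 (S b) (S b)) (fun=> S) hV (fun=> hS).
  exists v; split=> //= [|b|b].
  + by rewrite v1 /= csum11 //; exact: dS_cz.
  + by have := v3 b; rewrite /= q_csum.
  + by have := v4 b; rewrite /= q_csum.
Qed.

End Flip.

(** [PS_double] forms the double with the pair itself; two pairs can be compared only after passing
    to a common way of forming sums. *)
Lemma pf_add_change (A : cstarAlgType R) (J : Type) (r1 r2 t1 t2 : A)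
   (hr : cuntz2_rel r1 r2) (ht : cuntz2_rel t1 t2) (X Y : pfam A J) :
  pf_iso (pf_add hr X Y) (pf_add ht X Y).
Proof.
apply: (@pf_split _ _ _ _ _ ht _ _ _ (r1 * pfu X) (r2 * pfu Y)) => [||||j|j] /=.
- by rsimp hr; rewrite pfu_star pfu_idem.
- by rsimp hr; rewrite pfu_star pfu_idem.
- by rsimp hr.
- by rewrite /csum; rsimp hr; rewrite !pfu_star -!(mulrA _ (pfu _) (pfu _)) !pfu_idem.
- by rewrite /csum; rsimp hr; rewrite -!mulrA pff_l pff_r.
- by rewrite /csum; rsimp hr; rewrite -!mulrA pff_l pff_r.
Qed.

Lemma cuntz_unique (S T : bool -> B) : is_cz S -> is_cz T ->
  exists u : D, [/\ star u * u = 1, u * star u = 1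
    & forall b, u * q (fun=> S b) = q (fun=> T b) * u].
Proof.
move=> hS hT; have hs := dS_cz hS; have ht := dS_cz hT.
have [||||u [u1 u2 u3]] := @pf_CB _ _ _ _ _ (dS_cz hS) (pf1 (fun b => q (fun=> S b)))
   (pf1 (fun b => q (fun=> T b))).
- exact: (@cz_le (fun=> S) (fun=> T)).
- exact: (@cz_le (fun=> T) (fun=> S)).
- exact: PS_double.
- by apply: pf_trans (PS_double hT) _; apply: pf_add_change.
- by exists u; split.
Qed.

End Uniqueness.

(** * Completely positive maps and Cuntz isometries *)

Section GramSchmidt.
Variables (R : realType) (E : lmodType R[i]) (phi : E -> E -> R[i]).
Hypothesis phi_conj : forall x y, phi y x = Num.conj (phi x y).
Hypothesis phi_lin : forall x a y z, phi x (a *: y + z) = a * phi x y + phi x z.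
Hypothesis phi_ge0 : forall x, 0 <= phi x x.

Lemma phiD x y z : phi x (y + z) = phi x y + phi x z.
Proof. by rewrite -[y]scale1r phi_lin mul1r scale1r. Qed.
Lemma phi0 x : phi x 0 = 0.
Proof. by have /eqP := phiD x 0 0; rewrite addr0 -subr_eq0 opprD addNKr oppr_eq0 => /eqP. Qed.
Lemma phiZ x a y : phi x (a *: y) = a * phi x y.
Proof. by rewrite -[a *: y]addr0 phi_lin phi0 addr0. Qed.
Lemma phiDl x y z : phi (x + y) z = phi x z + phi y z.
Proof. by rewrite phi_conj phiD cjD -!phi_conj. Qed.
Lemma phiZl a x y : phi (a *: x) y = Num.conj a * phi x y.
Proof. by rewrite phi_conj phiZ cjM -phi_conj. Qed.
Lemma phi_sum (I : Type) (r : seq I) (P : pred I) (F : I -> E) x :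
  phi x (\sum_(i <- r | P i) F i) = \sum_(i <- r | P i) phi x (F i).
Proof. by apply: (big_morph (phi x)); [exact: phiD|exact: phi0]. Qed.
Lemma phi0l x : phi 0 x = 0.
Proof. by rewrite phi_conj phi0 cj0. Qed.
Lemma phi_suml (I : Type) (r : seq I) (P : pred I) (F : I -> E) x :
  phi (\sum_(i <- r | P i) F i) x = \sum_(i <- r | P i) phi (F i) x.
Proof. by apply: (big_morph (phi ^~ x)) => [y z|]; [exact: phiDl|exact: phi0l]. Qed.

(** Otherwise a suitable multiple of [x] could be subtracted from [y] so as to make the form
    negative. *)
Lemma phi_null x y : phi x x = 0 -> phi y x = 0.
Proof.
move=> x0; apply/eqP; apply: contraT => c0; set c := phi y x in c0.
pose d := c * Num.conj c.
have d0 : 0 < d by rewrite /d mul_conjC_gt0.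
(* With this [r] the form at the shifted vector equals [- (phi y y + 2)]. *)
pose r : R[i] := (phi y y + 1) / d.
have r0 : 0 < r by rewrite divr_gt0 // ltr_wpDl ?phi_ge0 ?ltr01.
have := phi_ge0 (y + (- (r * Num.conj c)) *: x).
rewrite phiD !phiDl !phiZ !phiZl x0 -/c !mulr0 addr0 cjN cjM cjK.
rewrite (phi_conj y x) -/c (conj_Creal (gtr0_real r0)) !mulNr.
have e1 : r * c * Num.conj c = phi y y + 1 by rewrite -mulrA -/d /r divfK ?gt_eqF.
have e2 : r * Num.conj c * c = phi y y + 1.
  by rewrite -mulrA [_ * c]mulrC -/d /r divfK ?gt_eqF.
rewrite e1 e2.
have : phi y y >= 0 by apply: phi_ge0.
set t := phi y y => t0.
rewrite (_ : t - (t + 1) - (t + 1) = - (t + 2)); last by ring.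
by rewrite oppr_ge0 lt_geF // ltr_wpDl.
Qed.

(** [v] equals its projection onto [es] modulo the radical of [phi]. *)
Definition spans (es : seq E) v := forall w, phi w v = \sum_(e <- es) phi w e * phi e v.
Definition orthon (es : seq E) :=
  all (fun e => phi e e == 1) es && pairwise (fun x y => phi x y == 0) es.

Lemma orthon_rcons es e : orthon (rcons es e) =
  [&& orthon es, phi e e == 1 & all (fun x => phi x e == 0) es].
Proof.
rewrite /orthon all_rcons pairwise_rcons -!andbA; do !bool_congr.
Qed.

Lemma orthon_nth es i j : orthon es -> (i < size es)%N -> (j < size es)%N ->
  phi (nth 0 es i) (nth 0 es j) = (i == j)%:R.
Proof.
move=> /andP[/allP h1 /(pairwiseP 0) h2] iN jN.
case: ltngtP => [ij|ij|->]; last by apply/eqP; apply: h1; rewrite mem_nth.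
  by apply/eqP/h2.
by rewrite phi_conj (eqP (h2 j i jN iN ij)) cj0.
Qed.

Lemma orthon_sum es (c : E -> R[i]) e : orthon es -> e \in es ->
  \sum_(x <- es) c x * phi e x = c e.
Proof.
move=> eso /(nthP 0)[i iN <-]; rewrite (big_nth 0) big_mkord (bigD1 (Ordinal iN)) //=.
rewrite orthon_nth // eqxx mulr1 big1 ?addr0 // => j ji.
rewrite orthon_nth // (_ : (i == j) = false) ?mulr0 //.
by apply/negbTE; apply: contra ji => /eqP ij; apply/eqP/val_inj.
Qed.

Lemma spans_extend es new u : spans es u -> (forall e, e \in new -> phi e u = 0) ->
  spans (es ++ new) u.
Proof.
move=> h1 h2 w; rewrite big_cat /= -h1 [X in _ + X]big1_seq ?addr0 // => e /andP[_ en].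
by rewrite h2 // mulr0.
Qed.

Lemma gs_step es v : orthon es -> exists new,
  [/\ (size new <= 1)%N, orthon (es ++ new), spans (es ++ new) v
    & forall u, spans es u -> forall e, e \in new -> phi e u = 0].
Proof.
move=> eso; pose v' := v - \sum_(e <- es) phi e v *: e.
have v'E w : phi w v = phi w v' + \sum_(e <- es) phi w e * phi e v.
  rewrite /v' phiD -scaleN1r phiZ phi_sum mulN1r addrAC -addrA.
  rewrite -sumrN -big_split /= big1 ?addr0 // => e _.
  by rewrite phiZ mulrC subrr.
have v'0 e : e \in es -> phi e v' = 0.
  move=> ee; have := v'E e; rewrite [X in _ = _ + X](_ : _ = phi e v); last first.
    by under eq_bigr do rewrite mulrC; rewrite (orthon_sum (fun x => phi x v)).
  by move/eqP; rewrite -subr_eq subrr => /eqP <-.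
have [n0|nn0] := eqVneq (phi v' v') 0.
  exists [::]; rewrite cats0; split=> // w.
  by rewrite v'E phi_null // add0r.
pose s := sqrtC (phi v' v').
have s2 : s * s = phi v' v' by rewrite -expr2 sqrtCK.
have sr : Num.conj s = s by rewrite conj_Creal // ger0_real // sqrtC_ge0 phi_ge0.
have s0 : s != 0 by rewrite sqrtC_eq0.
pose e := s^-1 *: v'.
have v'v : phi v' v = phi v' v'.
  rewrite v'E big1_seq ?addr0 // => x /andP[_ xes].
  by rewrite phi_conj v'0 // cj0 mul0r.
exists [:: e]; split=> //.
- rewrite cats1 orthon_rcons eso /=; apply/andP; split.
    rewrite /e phiZ phiZl cjV sr mulrA -s2.
    by rewrite mulrACA mulVf // mulr1.
  by apply/allP => x xes; rewrite /e phiZ v'0 // mulr0.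
- move=> w; rewrite big_cat big_seq1 /= v'E addrC; congr (_ + _).
  by rewrite /e phiZ phiZl cjV sr v'v -s2 mulKf // mulrAC mulVf // mul1r.
- move=> u us x; rewrite inE => /eqP ->; rewrite us big1_seq // => y /andP[_ yes].
  by rewrite /e phiZl (phi_conj y) v'0 // cj0 mulr0 mul0r.
Qed.

Lemma gram_schmidt es vs : orthon es -> exists new,
  [/\ (size new <= size vs)%N, orthon (es ++ new), forall v, v \in vs -> spans (es ++ new) v
    & forall u, spans es u -> forall e, e \in new -> phi e u = 0].
Proof.
elim: vs es => [|v vs IH] es eso; first by exists [::]; rewrite cats0.
have [n1 [h1 h2 h3 h4]] := gs_step v eso.
have [n2 [k1 k2 k3 k4]] := IH _ h2.
exists (n1 ++ n2); rewrite catA; split=> //.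
- by rewrite size_cat /= -add1n leq_add.
- move=> x; rewrite inE => /orP[/eqP->|]; last exact: k3.
  exact: spans_extend h3 (k4 _ h3).
- move=> u us e; rewrite mem_cat => /orP[/(h4 u us) //|en2].
  by apply: k4 en2; apply: spans_extend us (h4 u us).
Qed.

(** The coordinates in an orthonormal system of at most [#|T|] vectors, completed by zero rows, form
    a square factor of the Gram matrix. *)
Lemma gram_factor (T : finType) (v : T -> E) : exists Z : T -> T -> R[i],
  forall s t, phi (v s) (v t) = \sum_r Num.conj (Z r s) * Z r t.
Proof.
have [|es [h1 h2 h3 _]] := @gram_schmidt [::] [seq v t | t <- enum T]; first by [].
rewrite size_map -cardE in h1; rewrite /= in h2 h3.
pose Z (r t : T) := if (enum_rank r < size es)%N then phi (nth 0 es (enum_rank r)) (v t) else 0.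
exists Z => s t; have -> : phi (v s) (v t) = \sum_(e <- es) phi (v s) e * phi e (v t).
  by apply: h3; apply: map_f; rewrite mem_enum.
rewrite (big_nth 0) big_mkord (reindex (enum_val (A := T))) /=; last first.
  by exists enum_rank => i _; [exact: enum_valK|exact: enum_rankK].
rewrite (big_ord_widen_cond _ xpredT (fun i => phi (v s) (nth 0 es i) * phi (nth 0 es i) (v t)) h1).
rewrite big_mkcond; apply: eq_bigr => i _; rewrite /Z enum_valK.
by rewrite /=; case: ifP => _; rewrite ?mulr0 // -phi_conj.
Qed.

(* Orthonormal vectors sorted by level, such that each operator of [F] raises
   the level by at most one and is exactly represented below level [K]. *)
Lemma gs_levels (V0 : seq E) (F : seq (E -> E)) K : exists ls : seq (E * nat),
  [/\ orthon (map fst ls), forall p, p \in ls -> (p.2 <= K)%N,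
      forall v, v \in V0 -> spans (map fst ls) v /\
         forall p, p \in ls -> p.2 != 0%N -> phi p.1 v = 0
    & forall i p, (i < size F)%N -> p \in ls -> (p.2 < K)%N ->
        spans (map fst ls) (nth id F i p.1) /\
        forall p', p' \in ls -> (p.2.+1 < p'.2)%N -> phi p'.1 (nth id F i p.1) = 0].
Proof.
elim: K => [|K [ls [h1 h2 h3 h4]]].
  have [|es [k1 k2 k3 k4]] := @gram_schmidt [::] V0; first by [].
  exists [seq (e, 0%N) | e <- es]; rewrite -map_comp map_id_in //; split=> //.
  - by move=> p /mapP[e _ ->].
  - by move=> v vV; split=> [|p /mapP[e _ ->] //]; exact: k3.
pose vs := flatten [seq [seq nth id F i p.1 | i <- iota 0 (size F)] | p <- ls].
have [new [k1 k2 k3 k4]] := @gram_schmidt (map fst ls) vs h1.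
have mapE : [seq q.1 | q <- ls ++ [seq (e, K.+1) | e <- new]] = map fst ls ++ new.
  by rewrite map_cat -map_comp [map _ new]map_id_in.
have newP p : p \in [seq (e, K.+1) | e <- new] -> p.1 \in new /\ p.2 = K.+1.
  by move=> /mapP[e en ->].
exists (ls ++ [seq (e, K.+1) | e <- new]); rewrite mapE; split=> //.
- move=> p; rewrite mem_cat => /orP[/h2 /leqW //|/newP[_ -> //]].
- move=> v vV; have [hs hz] := h3 v vV; split; first exact: spans_extend hs (k4 _ hs).
  move=> p; rewrite mem_cat => /orP[/hz //|/newP[pn _] _]; exact: k4 hs _ pn.
- move=> i p iF; rewrite mem_cat => /orP[pls|/newP[_ ->]]; last by rewrite ltnn.
  move=> _; split.
    apply: k3; apply/flattenP; exists [seq nth id F i p.1 | i <- iota 0 (size F)].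
      by apply/mapP; exists p.
    by apply/mapP; exists i; rewrite ?mem_iota.
  move=> p'; rewrite mem_cat => /orP[p'ls|/newP[pn ->]] lt.
    have pK : (p.2 < K)%N.
      exact: leq_trans (ltnW lt) (h2 _ p'ls).
    by have [_] := h4 i p iF pls pK; apply.
  by have [hs _] := h4 i p iF pls lt; apply: k4 hs _ pn.
Qed.

End GramSchmidt.

(** * Matrices over orthonormal isometries *)

Section Iota.
Variables (R : realType) (Q : cstarAlgType R) (T : finType) (e : T -> Q).
Hypothesis e_orth : forall s t, star (e s) * e t = (s == t)%:R.
Implicit Types (X Y : T -> T -> R[i]) (v w : T -> R[i]).

Definition vec v : Q := \sum_t v t *: e t.
Definition iota_mx X : Q := \sum_s \sum_t X s t *: (e s * star (e t)).

Lemma iotaE X : iota_mx X = \sum_t vec (X ^~ t) * star (e t).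
Proof.
rewrite /iota_mx exchange_big; apply: eq_bigr => t _; rewrite /vec mulr_suml.
by apply: eq_bigr => s _; rewrite scaleMl.
Qed.

Lemma vec_ext v w : v =1 w -> vec v = vec w.
Proof. by move=> vw; apply: eq_bigr => t _; rewrite vw. Qed.

Lemma iota_ext X Y : (forall s t, X s t = Y s t) -> iota_mx X = iota_mx Y.
Proof. by move=> XY; do 2!apply: eq_bigr => ? _; rewrite XY. Qed.

Lemma vecZ c v : c *: vec v = vec (fun t => c * v t).
Proof. by rewrite /vec scaler_sumr; apply: eq_bigr => t _; rewrite scalerA. Qed.

Lemma vec_delta t : vec (fun s => (s == t)%:R) = e t.
Proof.
rewrite /vec (bigD1 t) //= eqxx scale1r big1 ?addr0 // => s st.
by rewrite (negbTE st) scale0r.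
Qed.

Lemma e_vec v t : star (e t) * vec v = v t *: 1.
Proof.
rewrite /vec mulr_sumr (bigD1 t) //= scaleMr e_orth eqxx big1 ?addr0 // => s st.
by rewrite scaleMr e_orth eq_sym (negbTE st) scaler0.
Qed.

Lemma vec_vec v w : star (vec v) * vec w = (\sum_t Num.conj (v t) * w t) *: 1.
Proof.
rewrite {1}/vec star_sum mulr_suml scaler_suml; apply: eq_bigr => t _.
by rewrite starZ scaleMl e_vec scalerA.
Qed.

Lemma iota_e X t : iota_mx X * e t = vec (X ^~ t).
Proof.
rewrite iotaE mulr_suml (bigD1 t) //= -mulrA e_orth eqxx mulr1 big1 ?addr0 // => s st.
by rewrite -mulrA e_orth (negbTE st) mulr0.
Qed.

Lemma iota_vec X v : iota_mx X * vec v = vec (fun s => \sum_t X s t * v t).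
Proof.
rewrite {1}/vec mulr_sumr (eq_bigr (fun t => v t *: vec (X ^~ t))).
  rewrite /vec; under eq_bigr do rewrite scaler_sumr.
  rewrite exchange_big; apply: eq_bigr => s _; rewrite scaler_suml.
  by apply: eq_bigr => t _; rewrite scalerA mulrC.
by move=> t _; rewrite scaleMr iota_e.
Qed.

Lemma iotaM X Y : iota_mx X * iota_mx Y = iota_mx (fun s t => \sum_r X s r * Y r t).
Proof.
rewrite [in LHS](iotaE Y) mulr_sumr [in RHS]iotaE; apply: eq_bigr => t _.
by rewrite mulrA iota_vec.
Qed.

Lemma iota_star X : star (iota_mx X) = iota_mx (fun s t => Num.conj (X t s)).
Proof.
rewrite /iota_mx star_sum exchange_big; apply: eq_bigr => s _.
rewrite star_sum; apply: eq_bigr => t _.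
by rewrite starZ starM starK.
Qed.

Lemma iotaD X Y : iota_mx X + iota_mx Y = iota_mx (fun s t => X s t + Y s t).
Proof.
rewrite /iota_mx -big_split; apply: eq_bigr => s _; rewrite -big_split.
by apply: eq_bigr => t _; rewrite scalerDl.
Qed.

Lemma iotaZ c X : c *: iota_mx X = iota_mx (fun s t => c * X s t).
Proof.
rewrite /iota_mx scaler_sumr; apply: eq_bigr => s _; rewrite scaler_sumr.
by apply: eq_bigr => t _; rewrite scalerA.
Qed.

Definition diag_fun (k : T -> R[i]) s t : R[i] := if s == t then k s else 0.

Lemma diag_mull k X s t : \sum_r diag_fun k s r * X r t = k s * X s t.
Proof.
rewrite (bigD1 s) //= /diag_fun eqxx big1 ?addr0 // => r rs.
by rewrite eq_sym (negbTE rs) mul0r.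
Qed.

Lemma diag_mulr k X s t : \sum_r X s r * diag_fun k r t = X s t * k t.
Proof.
rewrite (bigD1 t) //= /diag_fun eqxx big1 ?addr0 // => r rt.
by rewrite (negbTE rt) mulr0.
Qed.

Lemma iota_diagl k X : iota_mx (diag_fun k) * iota_mx X = iota_mx (fun s t => k s * X s t).
Proof. by rewrite iotaM; apply: iota_ext => s t; rewrite diag_mull. Qed.

Lemma iota_diagr k X : iota_mx X * iota_mx (diag_fun k) = iota_mx (fun s t => X s t * k t).
Proof. by rewrite iotaM; apply: iota_ext => s t; rewrite diag_mulr. Qed.

Lemma iota_diag_vec k v : iota_mx (diag_fun k) * vec v = vec (fun s => k s * v s).
Proof. by rewrite iota_vec; apply: vec_ext => s; exact: (diag_mull k (fun r _ => v r) s s). Qed.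

Lemma iotaB X Y : iota_mx X - iota_mx Y = iota_mx (fun s t => X s t - Y s t).
Proof.
by rewrite -scaleN1r iotaZ iotaD; apply: iota_ext => s t; rewrite mulN1r.
Qed.

Lemma iota_proj : iota_mx (diag_fun (fun=> 1)) = \sum_t e t * star (e t).
Proof.
rewrite iotaE; apply: eq_bigr => t _; congr (_ * _).
by rewrite -[RHS]vec_delta; apply: vec_ext => s; rewrite /diag_fun; case: eqP.
Qed.

Lemma iota_projE (P : Q := iota_mx (diag_fun (fun=> 1))) : star P = P /\ P * P = P.
Proof.
rewrite /P iota_star iotaM; split; apply: iota_ext => s t; rewrite ?diag_mull ?mul1r //.
by rewrite /diag_fun eq_sym; case: eqP => _; rewrite ?cj1 ?cj0.
Qed.

Variables (r1 r2 : Q).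
Hypothesis r12 : cuntz2_rel r1 r2.

(** The matrix of [c^2 - X^* X] is positive semidefinite, hence equal to some [Z^* Z]. Stacking [X]
    and [Z] with the Cuntz pair gives [y] with [star y * y] equal to [c^2] times a projection, and
    [X] is recovered as [star r1 * y]. *)
Lemma iota_norm X (c : R) : 0 <= c ->
  (forall v, \sum_s `|\sum_t X s t * v t| ^+ 2 <= (c ^+ 2)%:C * \sum_t `|v t| ^+ 2) ->
  cnorm (iota_mx X) <= c.
Proof.
move=> c0 Xc; pose E := {ffun T -> R[i]^o} : lmodType R[i].
pose ip (I : finType) (v w : I -> R[i]) : R[i] := \sum_t Num.conj (v t) * w t.
pose op (v : E) s : R[i] := \sum_t X s t * v t.
pose phi (v w : E) : R[i] := (c ^+ 2)%:C * ip T v w - ip T (op v) (op w).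
have ipC (v w : T -> R[i]) : ip T w v = Num.conj (ip T v w).
  by rewrite /ip cj_sum; apply: eq_bigr => t _; rewrite cjM cjK mulrC.
have ip_lin (x : T -> R[i]) a (y z : T -> R[i]) :
    ip T x (fun t => a * y t + z t) = a * ip T x y + ip T x z.
  rewrite /ip mulr_sumr -big_split; apply: eq_bigr => t _ /=.
  by rewrite mulrDr mulrCA.
have ipN (v : T -> R[i]) : ip T v v = \sum_t `|v t| ^+ 2.
  by apply: eq_bigr => t _; rewrite normCK mulrC.
have phiC (v w : E) : phi w v = Num.conj (phi v w).
  by rewrite /phi cjB cjM cjr -!ipC.
have phi_lin (x : E) a (y z : E) : phi x (a *: y + z) = a * phi x y + phi x z.
  have opl : op (a *: y + z) =1 (fun t => a * op y t + op z t).
    move=> s; rewrite /op mulr_sumr -big_split; apply: eq_bigr => t _ /=.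
    by rewrite !ffunE mulrDr /GRing.scale /= mulrCA.
  rewrite /phi (_ : ip T (op x) (op _) = ip T (op x) (fun t => a * op y t + op z t)).
    rewrite (_ : ip T x (a *: y + z) = ip T x (fun t => a * y t + z t)).
      by rewrite !ip_lin; ring.
    by apply: eq_bigr => t _; rewrite !ffunE.
  by apply: eq_bigr => t _; rewrite opl.
have phi0 (v : E) : 0 <= phi v v by rewrite /phi !ipN subr_ge0; exact: Xc.
have [Z ZE] := gram_factor phiC phi_lin phi0 (fun t : T => [ffun s => (s == t)%:R] : E).
have sumE s t : \sum_r Num.conj (X r s) * X r t + \sum_r Num.conj (Z r s) * Z r t
    = diag_fun (fun=> (c ^+ 2)%:C) s t.
  rewrite -ZE /phi.
  have opE u r : op [ffun s => (s == u)%:R] r = X r u.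
    rewrite /op (bigD1 u) //= ffunE eqxx mulr1 big1 ?addr0 // => k ku.
    by rewrite ffunE (negbTE ku) mulr0.
  rewrite {2}/ip; under [X in _ - X]eq_bigr do rewrite !opE.
  rewrite addrC subrK /ip (bigD1 t) //= !ffunE eqxx big1 ?addr0 => [|k kt].
    by rewrite /diag_fun eq_sym; case: eqP => _; rewrite ?cj1 ?cj0 ?mulr1 ?mulr0.
  by rewrite !ffunE (negbTE kt) mulr0.
have key : star (iota_mx X) * iota_mx X + star (iota_mx Z) * iota_mx Z
    = (c ^+ 2)%:C *: iota_mx (diag_fun (fun=> 1)).
  rewrite !iota_star !iotaM iotaD iotaZ; apply: iota_ext => s t; rewrite sumE /diag_fun.
  by case: eqP => _; rewrite ?mulr1 ?mulr0.
pose y := r1 * iota_mx X + r2 * iota_mx Z.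
have y2 : star y * y = (c ^+ 2)%:C *: iota_mx (diag_fun (fun=> 1)).
  by rewrite -key /y starD !starM; rsimp r12.
have [Ps PP] := iota_projE.
have yc : cnorm y <= c.
  apply: cnorm_le_sqr => //; rewrite y2 cnormZr ger0_norm ?sqr_ge0 //.
  by rewrite ler_piMr ?sqr_ge0 // proj_norm.
have -> : iota_mx X = star r1 * y by rewrite /y; rsimp r12.
apply: le_trans (cnormM _ _) _.
by rewrite cnorm_star isometry_norm ?(cuntz_11 r12) // mul1r.
Qed.

End Iota.

(** * From the cone to the algebra *)

Section Doubling.
Variables (R : realType) (A Q : cstarAlgType R).

Lemma pf1_double (J : Type) (r1 r2 : Q) (r12 : cuntz2_rel r1 r2) (X : J -> Q) :
  (forall j, X j * r1 = r1 * X j) -> (forall j, X j * r2 = r2 * X j) ->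
  pf_iso (pf1 X) (pf_add r12 (pf1 X) (pf1 X)).
Proof.
move=> h1 h2; apply: (@pf_split _ _ _ _ _ _ _ _ _ r1 r2) => //=.
- exact: cuntz_11 r12.
- exact: cuntz_22 r12.
- exact: cuntz_12 r12.
- exact: cuntz_sum r12.
Qed.

(* [g i j x] stands for [c^i s^j b x], where [c^2 + s^2 = 1] and [b] is a linear
   map which is multiplicative modulo elements killed by [c]. *)
Variables (g : nat -> nat -> A -> Q) (r1 r2 V : Q).
Hypothesis g_lin : forall i j c x y, g i j (c *: x + y) = c *: g i j x + g i j y.
Hypothesis gM : forall i j k l x y, (0 < i + k)%N -> g i j x * g k l y = g (i + k) (j + l) (x * y).
Hypothesis g_star : forall i j x, star (g i j x) = g i j (star x).
Hypothesis g_sum : forall i j x, g i.+2 j x + g i j.+2 x = g i j x.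
Hypothesis r12 : cuntz2_rel r1 r2.
Hypothesis gr1 : forall i j x, g i j x * r1 = r1 * g i j x.
Hypothesis gr2 : forall i j x, g i j x * r2 = r2 * g i j x.
Hypothesis V_iso : star V * V = 1.
Hypothesis V_swap : forall i j x, (0 < i)%N -> (0 < j)%N -> star V * g i j x * V = g j i x.

(** Multiplicativity upgrades the compression identity [V_swap] to an intertwining relation:
    expanding [star d * d] for the difference [d] of the two sides gives four equal terms with
    cancelling signs. *)
Lemma g_swap i j x : (0 < i)%N -> (0 < j)%N -> g i j x * V = V * g j i x.
Proof.
move=> i0 j0; apply/eqP; rewrite -subr_eq0; apply/eqP/starM_eq0.
rewrite starB !starM !g_star !(mulrBl, mulrBr) !mulrA.
rewrite -(mulrA (star V) _ (g i j x)) gM ?addn_gt0 ?i0 //.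
rewrite V_swap ?addn_gt0 ?i0 ?j0 // V_swap // -(mulrA (g j i _) (star V)).
rewrite -(mulrA (g j i _) _ V) V_swap // -(mulrA (g j i _) (star V)) V_iso mulr1 !gM ?addn_gt0 ?j0 //.
by rewrite subrr.
Qed.

(** Exchanging exponents swaps [g 1 3] with [g 3 1] and fixes [g 1 1], so the same [V] gives both
    inequalities. Carrying [g 1 1] along in both families forces [u] to commute with it. *)
Lemma g_unitary : exists u, [/\ star u * u = 1, u * star u = 1,
  forall x, u * g 1 1 x = g 1 1 x * u & forall x, u * g 1 3 x = g 3 1 x * u].
Proof.
pose X (k : bool * A) := if k.1 then g 1 1 k.2 else g 1 3 k.2.
pose Y (k : bool * A) := if k.1 then g 1 1 k.2 else g 3 1 k.2.
have [||||u [u1 u2 u3]] := @pf_CB _ _ _ _ _ r12 (pf1 X) (pf1 Y).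
- exists V; split=> //= [|[[] x]|[[] x]]; rewrite ?mul1r // /X /Y /= ?g_star g_swap //.
- exists V; split=> //= [|[[] x]|[[] x]]; rewrite ?mul1r // /X /Y /= ?g_star g_swap //.
- by apply: pf1_double => -[[] x]; rewrite /X /= ?gr1 ?gr2.
- by apply: pf1_double => -[[] x]; rewrite /Y /= ?gr1 ?gr2.
by exists u; split=> // x; [exact: (u3 (true, x))|exact: (u3 (false, x))].
Qed.

(* The 2x2 matrix [[c^2 b, c s b u^*], [u c s b, c^2 b]] is multiplicative in [b],
   since [u] turns the weight [s^2] into [c^2] and [c^2 + s^2 = 1]. *)
Lemma doubling_hom : exists psi : A -> Q,
  [/\ (forall c x y, psi (c *: x + y) = c *: psi x + psi y),
      (forall x y, psi (x * y) = psi x * psi y),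
      (forall x, psi (star x) = star (psi x)),
      (forall x, star r1 * psi x * r1 = g 2 0 x)
    & forall eta, g 2 0 1 * eta = eta -> g 1 1 1 * eta = 0 ->
        psi 1 * (r1 * eta) = r1 * eta].
Proof.
have [u [u1 u2 u3 u4]] := g_unitary.
have u3' x : star u * g 1 1 x = g 1 1 x * star u.
  by rewrite -[LHS]mulr1 -u2 mulrA -(mulrA (star u)) -u3 mulrA u1 mul1r.
have u4' x : star u * g 3 1 x = g 1 3 x * star u.
  by rewrite -[LHS]mulr1 -u2 mulrA -(mulrA (star u)) -u4 mulrA u1 mul1r.
pose psi x := r1 * g 2 0 x * star r1 + r2 * g 2 0 x * star r2
  + r2 * (u * g 1 1 x) * star r1 + r1 * (g 1 1 x * star u) * star r2.
exists psi; split.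
- move=> c x y; rewrite /psi !g_lin; do 3 rewrite ?(mulrDl, mulrDr, scaleMl, scaleMr, scalerDr).
  by abel.
- move=> x y.
  have e1 : g 2 0 x * g 2 0 y + g 1 1 x * star u * (u * g 1 1 y) = g 2 0 (x * y).
    rewrite mulrA -(mulrA (g 1 1 x)) u1 mulr1 !gM //; exact: (g_sum 2 0).
  have e2 : u * g 1 1 x * (g 1 1 y * star u) + g 2 0 x * g 2 0 y = g 2 0 (x * y).
    rewrite u3 -mulrA (mulrA u) u3 -(mulrA (g 1 1 y)) u2 mulr1 !gM // addrC; exact: (g_sum 2 0).
  have e3 : u * g 1 1 x * g 2 0 y + g 2 0 x * (u * g 1 1 y) = u * g 1 1 (x * y).
    rewrite -mulrA gM // u3 mulrA gM // -u4 -mulrDr; congr (_ * _); exact: (g_sum 1 1).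
  have e4 : g 2 0 x * (g 1 1 y * star u) + g 1 1 x * star u * g 2 0 y = g 1 1 (x * y) * star u.
    rewrite mulrA gM // -u3' -mulrA gM // u4' -mulrDl; congr (_ * _); exact: (g_sum 1 1).
  rewrite /psi -{1}e1 -e2 -e3 -e4.
  set a := g 2 0 x; set a' := g 2 0 y; set m := u * g 1 1 x; set m' := u * g 1 1 y.
  set n := g 1 1 x * star u; set n' := g 1 1 y * star u.
  clearbody a a' m m' n n'; rsimp r12; abel.
- move=> x; rewrite /psi !starD !starM !starK !g_star -!u3' u3 !mulrA; abel.
- by move=> x; rewrite /psi; rsimp r12.
move=> eta h1 h2; rewrite /psi.
rsimp r12; rewrite -!(mulrA _ _ eta) h1 h2 mulr0; rsimp r12.
by [].
Qed.

End Doubling.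

(** * Absorption of doubles and unital corners *)

Section Absorption.
Variables (R : realType).

(** Each element is approximately conjugate to its double. Stated with tolerances, the property
    passes from an algebra to its ultrapowers. *)
Definition self_absorbing (B : cstarAlgType R) := exists2 s : B * B, cuntz2_rel s.1 s.2 &
  forall (x : B) (e : R), 0 < e -> exists u : B,
    [/\ cnorm (star u * u - 1) < e, cnorm (u * star u - 1) < e
      & cnorm (u * x - clam s.1 s.2 x * u) < e].

Lemma near_unitary_norm (B : cstarAlgType R) (u : B) e : e < 1 ->
  cnorm (star u * u - 1) < e -> cnorm u <= 2.
Proof.
move=> e1 ue; apply: cnorm_le_sqr => //.
have := cnormD (star u * u - 1) 1; rewrite subrK cnorm1; lra.
Qed.

Section Transfer.
Variables (I : Type) (W : set_system I).
Context {WU : UltraFilter W}.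
Variables (B D : cstarAlgType R) (q : (I -> B) -> D).
Hypothesis hq : is_ultrapower W q.

Lemma uq_pair (s1 s2 : B) : cuntz2_rel s1 s2 -> cuntz2_rel (q (fun=> s1)) (q (fun=> s2)).
Proof.
move=> h; have := @cz_q R I W B D q hq (fun _ b => if b then s1 else s2).
by apply => i; exact: h.
Qed.

Lemma uq_clam (s1 s2 : B) (x : I -> B) : bounded_family x ->
  clam (q (fun=> s1)) (q (fun=> s2)) (q x) = q (fun i => clam s1 s2 (x i)).
Proof.
move=> xb; have c (s : B) : bounded_family (fun _ : I => s) by exact: bfam_cst.
rewrite /clam.
rewrite (uqD hq) ?(uqM hq) ?(uq_star hq) //; do ?apply: bfamM => //; exact: bfam_star.
Qed.

Lemma self_absorbing_seq (n : I -> nat) (s1 s2 : B) :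
  (forall N, \forall i \near W, (N <= n i)%N) ->
  (forall (x : B) (e : R), 0 < e -> exists u : B,
    [/\ cnorm (star u * u - 1) < e, cnorm (u * star u - 1) < e
      & cnorm (u * x - clam s1 s2 x * u) < e]) ->
  forall x : D, exists u : D, [/\ star u * u = 1, u * star u = 1
    & u * x = clam (q (fun=> s1)) (q (fun=> s2)) x * u].
Proof.
move=> n_infty h x'; have [x xb <-] := uq_surj hq x'.
have /choice[u hu] : forall i, exists u : B,
    [/\ cnorm (star u * u - 1) < (n i).+2%:R^-1, cnorm (u * star u - 1) < (n i).+2%:R^-1
      & cnorm (u * x i - clam s1 s2 (x i) * u) < (n i).+2%:R^-1].
  by move=> i; apply: h; rewrite invr_gt0 ltr0n.
have le i : ((n i).+2%:R)^-1 <= ((n i).+1%:R)^-1 :> R.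
  by rewrite lef_pV2 ?posrE ?ltr0n // ler_nat.
have ub : bounded_family u.
  exists 2 => i; have [h1 _ _] := hu i; apply: near_unitary_norm h1.
  by rewrite invf_lt1 ?ltr0n // ltr1n.
have sub := bfam_star ub; have c (s : B) : bounded_family (fun _ : I => s) by exact: bfam_cst.
have lb : bounded_family (fun i => clam s1 s2 (x i)).
  by rewrite /clam; apply: bfamD; do ?apply: bfamM.
have lim (y z : I -> B) : bounded_family y -> bounded_family z ->
    (forall i, cnorm (y i - z i) < (n i).+2%:R^-1) -> q y = q z.
  move=> yb zb hyz; apply: (@uq_norm0 R I W WU n n_infty B D q hq) => // i.
  exact: le_trans (ltW (hyz i)) (le i).
exists (q u); rewrite (uq_clam _ _ xb) -(uq_star hq) // -!(uqM hq) // -(uq1 hq).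
by split; apply: lim => //; do ?apply: bfamM => //; move=> i; case: (hu i).
Qed.

Lemma self_absorbing_uq : self_absorbing B -> self_absorbing D.
Proof.
case=> -[s1 s2] /= hs h; exists (q (fun=> s1), q (fun=> s2)); first exact: uq_pair.
move=> y e e0 /=; have [x xb <-] := uq_surj hq y.
(* In the limit strict bounds by [d] become weak ones, hence [d < e]; and [d < 1] keeps the
   approximate unitaries bounded. *)
have d0 : 0 < Num.min (e / 2) 2^-1 by rewrite lt_min divr_gt0 // invr_gt0 ltr0n.
set d := Num.min _ _ in d0; have de : d < e by rewrite gt_min; apply/orP; left; lra.
have d1 : d < 1 by rewrite gt_min; apply/orP; right; lra.
have /choice[u hu] := fun i => h (x i) d d0.
have ub : bounded_family u.
  by exists 2 => i; have [h1 _ _] := hu i; apply: near_unitary_norm h1.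
have sub := bfam_star ub.
have c (s : B) : bounded_family (fun _ : I => s) by exact: bfam_cst.
have lb : bounded_family (fun i => clam s1 s2 (x i)).
  by rewrite /clam; apply: bfamD; do ?apply: bfamM.
have lim (z w : I -> B) : bounded_family z -> bounded_family w ->
    (forall i, cnorm (z i - w i) < d) -> cnorm (q z - q w) < e.
  move=> zb wb hzw; apply: le_lt_trans de; rewrite -(uqB hq) //.
  apply: (uq_norm_le hq); first exact: bfamB.
  by apply: nearW => i; apply: ltW.
exists (q u); rewrite (uq_clam _ _ xb) -(uq_star hq) // -!(uqM hq) // -(uq1 hq).
by split; apply: lim => //; do ?apply: bfamM => //; move=> i; case: (hu i).
Qed.


(** The projection [e] and the unit are each below the other, the unit through the isometry [y], and
    both are equivalent to their doubles. Cantor-Bernstein yields [a] with [star a * a = e] and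
    [a * star a = 1], and conjugation by [a] makes [psi] unital. *)
Lemma unital_corner (n : I -> nat) (A : cstarAlgType R) (psi : A -> B) (y : B) :
  (forall N, \forall i \near W, (N <= n i)%N) -> self_absorbing B ->
  (forall c x y, psi (c *: x + y) = c *: psi x + psi y) ->
  (forall x y, psi (x * y) = psi x * psi y) ->
  (forall x, psi (star x) = star (psi x)) ->
  star y * y = 1 -> psi 1 * y = y ->
  exists Phi : {lrmorphism A -> D},
    star_preserving Phi /\ forall x, Phi x = 0 -> psi x = 0.
Proof.
move=> n_infty [[s1 s2] /= hs habs] psi_lin psiM psi_star y1 psiy.
have hr := uq_pair hs; have [f [fs finj fE]] := uq_diag hq.
pose e := f (psi 1).
have es : star e = e by rewrite /e -fs -psi_star star1.
have ee : e * e = e by rewrite /e -rmorphM -psiM mulr1.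
have [u [u1 u2 ue]] := self_absorbing_seq n_infty habs e.
(* Families over the empty type are bare projections. *)
pose P1 : pfam D void := @PFam R D void e (fun=> 0) es ee (fun j => mulr0 e) (fun j => mul0r e).
pose P2 : pfam D void := pf1 (fun=> 0).
have [||||a [/= a1 a2 _]] := @pf_CB _ _ _ _ _ hr P1 P2.
- by exists e; rewrite es ee /= mul1r.
- by exists (f y); split=> //=; rewrite -?fs -?rmorphM ?y1 ?rmorph1 // psiy.
- exists (u * e); split=> //=.
    by rewrite starM es -mulrA (mulrA _ u) u1 mul1r ee.
  rewrite starM es mulrA -(mulrA u) ee ue -mulrA u2 mulr1; reflexivity.
- by apply: pf1_double => -[].
have ae : a * e = a by apply: pisom_r a1.
have [||| Phi PhiE] := @lrmorphism_ex R A D (fun x => a * f (psi x) * star a).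
- by move=> c x z; rewrite psi_lin linearP mulrDr mulrDl scaleMr scaleMl.
- move=> x z; rewrite !mulrA -(mulrA _ (star a) a) a1 -(mulrA _ e) /e -rmorphM -psiM mul1r.
  by rewrite psiM rmorphM !mulrA.
- by rewrite -/e ae a2.
exists Phi; split=> [x|x]; first by rewrite !PhiE psi_star fs !starM starK mulrA.
rewrite PhiE => x0; apply: finj; rewrite rmorph0.
have -> : f (psi x) = star a * (a * f (psi x) * star a) * a.
  rewrite !mulrA a1 -!mulrA a1 /e -!rmorphM -!psiM mul1r mulr1; reflexivity.
by rewrite x0 mulr0 mul0r.
Qed.

End Transfer.
End Absorption.

(** * The GNS form of a completely positive map *)

Section CompletelyPositive.
Variables (R : realType) (A : cstarAlgType R) (n : nat) (f : {linear A -> 'M[R[i]]_n}).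
Hypothesis f_cp : completely_positive (@star R A) (@cmxstar R n) f.

Lemma cmxstarM_entry (Z Y : 'M[R[i]]_n) k l :
  (cmxstar Z * Y) k l = \sum_m Num.conj (Z m k) * Y m l.
Proof. by rewrite mxE; apply: eq_bigr => m _; rewrite !mxE. Qed.

Lemma cp_sqr_sa y k l : f (star y * y) k l = Num.conj (f (star y * y) l k).
Proof.
have [|Z] := f_cp (k := 1) (X := (star y * y)%:M); first exists y%:M.
  apply/matrixP => i j; rewrite !ord1 !mxE eqxx mulr1n big_ord1 !mxE eqxx !mulr1n.
  by [].
move=> /matrixP/(_ 0 0); rewrite !mxE eqxx mulr1n big_ord1 !mxE => ->.
rewrite !cmxstarM_entry cj_sum; apply: eq_bigr => m _.
by rewrite cjM cjK mulrC.
Qed.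

(** Polarization: the identities given by [cp_sqr_sa] at [1 + x] and at [1 + 'i *: x] combine to the
    claim. *)
Lemma cp_star x k l : f (star x) k l = Num.conj (f x l k).
Proof.
have h1 := cp_sqr_sa (1 + x) k l; have h2 := cp_sqr_sa (1 + 'i *: x) k l.
have a1 := cp_sqr_sa 1 k l; have a2 := cp_sqr_sa x k l.
move: h1 h2 a1 a2; rewrite !starD !starZi star1 !(mulrDl, mulrDr, mul1r, mulr1, mulNr).
rewrite scaleMl scaleMr scale_ii opprK !linearD !linearN !linearZ !mxE.
rewrite !(cjD, cjM, cjN).
set F := f x; set F' := f (star x); set a := f 1; set s := f (star x * x).
have -> : Num.conj ('i : R[i]) = - 'i by exact: conjCi.
move=> h1 h2 a1 a2.
have e1 : F k l + F' k l = Num.conj (F l k) + Num.conj (F' l k).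
  move: h1; rewrite a1 a2 => h; apply: (@addrI _ (Num.conj (a l k) + Num.conj (s l k))).
  rewrite [LHS](_ : _ = Num.conj (a l k) + F k l + (F' k l + Num.conj (s l k))).
    by rewrite h; ring.
  by ring.
have e2 : 'i * (F k l - F' k l) = - 'i * (Num.conj (F l k) - Num.conj (F' l k)).
  move: h2; rewrite a1 a2 => h; apply: (@addrI _ (Num.conj (a l k) + Num.conj (s l k))).
  rewrite [LHS](_ : _ = Num.conj (a l k) + 'i * F k l + ('i * - F' k l + Num.conj (s l k))).
    by rewrite h; ring.
  by ring.
have e3 : F k l - F' k l = - (Num.conj (F l k) - Num.conj (F' l k)).
  by apply: (mulfI (neq0Ci R[i])); rewrite e2; ring.
have e4 : 2 * F' k l = 2 * Num.conj (F l k).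
  have -> : 2 * F' k l = (F k l + F' k l) - (F k l - F' k l) by ring.
  by rewrite e1 e3; ring.
by apply: (mulfI _ e4); rewrite pnatr_eq0.
Qed.

Local Notation E := {ffun 'I_n -> A}.
(** The Stinespring form on [A] tensor [C^n]. [lmul_op] is the representation of [A] on it, and the
    vectors [unit_at] recover [f], see [cpform_unit]. *)
Definition cpform (x y : E) : R[i] := \sum_k \sum_l f (star (x k) * y l) k l.
Definition lmul_op (a : A) (x : E) : E := [ffun k => a * x k].
Definition unit_at (k : 'I_n) : E := [ffun l => if l == k then 1 else 0].

Lemma cpform_conj x y : cpform y x = Num.conj (cpform x y).
Proof.
rewrite /cpform exchange_big cj_sum; apply: eq_bigr => l _.
rewrite cj_sum; apply: eq_bigr => k _.
by rewrite -cp_star starM starK.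
Qed.

Lemma cpform_lin x a y z : cpform x (a *: y + z) = a * cpform x y + cpform x z.
Proof.
rewrite /cpform mulr_sumr -big_split; apply: eq_bigr => k _ /=.
rewrite mulr_sumr -big_split; apply: eq_bigr => l _ /=.
by rewrite !ffunE mulrDr scaleMr linearP !mxE.
Qed.

Lemma cpform_ge0 x : 0 <= cpform x x.
Proof.
rewrite /cpform; case: n f f_cp x => [|m] g g_cp x; first by rewrite big_ord0.
(* With [x] in row 0 and zeros elsewhere, [Y^* Y] is the matrix of all [star (x k) * x l]; the size
   is a successor so that row 0 exists. *)
pose Y : 'M[A]_m.+1 := \matrix_(i, j) if i == 0 then x j else 0.
have [|Z hZ] := g_cp m.+1 (mxadj (@star R A) Y *m Y); first by exists Y.
have entry k l : g (star (x k) * x l) = \sum_r cmxstar (Z r k) * Z r l.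
  have /matrixP/(_ k l) := hZ; rewrite !mxE => h; transitivity (g (\sum_j mxadj (@star R A) Y k j * Y j l)).
    congr (g _); rewrite (bigD1 0) //= !mxE eqxx big1 ?addr0 // => j j0.
    by rewrite !mxE (negbTE j0) mulr0.
  by rewrite h; apply: eq_bigr => r _; rewrite !mxE.
pose w r i := \sum_k (Z r k) i k.
rewrite (eq_bigr (fun k => \sum_l \sum_r \sum_i Num.conj (Z r k i k) * Z r l i l)); last first.
  move=> k _; apply: eq_bigr => l _; rewrite entry summxE; apply: eq_bigr => r _.
  by rewrite mxE; apply: eq_bigr => i _; rewrite !mxE.
rewrite (eq_bigr (fun k => \sum_r \sum_i \sum_l Num.conj (Z r k i k) * Z r l i l)); last first.
  move=> k _; rewrite exchange_big; apply: eq_bigr => r _.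
  by rewrite exchange_big.
rewrite exchange_big; apply: sumr_ge0 => r _; rewrite exchange_big; apply: sumr_ge0 => i _.
rewrite (_ : \sum_k _ = Num.conj (w r i) * w r i); first by rewrite mulrC mul_conjC_ge0.
rewrite /w cj_sum mulr_suml; apply: eq_bigr => k _.
by rewrite mulr_sumr.
Qed.

Lemma lmul_op_adj a x y : cpform x (lmul_op a y) = cpform (lmul_op (star a) x) y.
Proof.
rewrite /cpform; apply: eq_bigr => k _; apply: eq_bigr => l _.
by rewrite !ffunE starM starK mulrA.
Qed.

Lemma lmul_opM a b x : lmul_op (a * b) x = lmul_op a (lmul_op b x).
Proof. by apply/ffunP => k; rewrite !ffunE mulrA. Qed.

Lemma lmul_op1 x : lmul_op 1 x = x.
Proof. by apply/ffunP => k; rewrite !ffunE mul1r. Qed.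

Lemma lmul_op_lin c a b x : lmul_op (c *: a + b) x = c *: lmul_op a x + lmul_op b x.
Proof. by apply/ffunP => k; rewrite !ffunE mulrDl scaleMl. Qed.

(** After scaling, [1 - star a * a] is a square [c * c] with [c] self-adjoint, and the form is
    nonnegative at [lmul_op c x]. *)
Lemma lmul_op_norm a x :
  cpform (lmul_op a x) (lmul_op a x) <= (cnorm a ^+ 2)%:C * cpform x x.
Proof.
have [->|/eqP a0] := eqVneq a 0.
  rewrite (_ : lmul_op 0 x = 0); last by apply/ffunP => k; rewrite !ffunE mul0r.
  rewrite (phi0 cpform_lin) mulr_ge0 ?cpform_ge0 //.
  by rewrite lecR sqr_ge0.
have n0 := cnorm_gt0 a0; have n20 : 0 < cnorm a ^+ 2 by rewrite exprn_gt0.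
have [||c [cs cc _ _]] := @csqrt_ex R A ((cnorm a ^+ 2)^-1%:C *: (star a * a)).
- by rewrite starZr starM starK.
- by rewrite cnorm_invZ // cnorm_starM divff ?gt_eqF.
have e : (cnorm a ^+ 2)%:C *: star c * c + star a * a = (cnorm a ^+ 2)%:C *: 1.
  rewrite cs scaleMl cc scalerBr scalerA -rcM divff ?gt_eqF // scale1r.
  by rewrite subrK.
have := cpform_ge0 (lmul_op c x); rewrite lmul_op_adj -lmul_opM => h.
rewrite lmul_op_adj -lmul_opM -subr_ge0.
have -> : (cnorm a ^+ 2)%:C * cpform x x - cpform (lmul_op (star a * a) x) x =
    (cnorm a ^+ 2)%:C * cpform (lmul_op (star c * c) x) x.
  have := congr1 (fun z => cpform (lmul_op z x) x) e.
  rewrite scaleMl lmul_op_lin (phiDl cpform_conj cpform_lin) (phiZl cpform_conj cpform_lin).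
  rewrite -[_ *: 1]addr0 lmul_op_lin (phiDl cpform_conj cpform_lin) (phiZl cpform_conj cpform_lin).
  rewrite lmul_op1 cjr (_ : lmul_op 0 x = 0); last by apply/ffunP => k; rewrite !ffunE mul0r.
  by rewrite (phi0l cpform_conj cpform_lin) addr0 => <-; rewrite addrK.
by rewrite mulr_ge0 // lecR ltW.
Qed.

Lemma cpform_unit a k l : cpform (unit_at k) (lmul_op a (unit_at l)) = f a k l.
Proof.
rewrite /cpform (bigD1 k) //= (bigD1 l) //= !ffunE !eqxx star1 mul1r mulr1.
rewrite !big1 ?addr0 // => [i ik|i il].
  by rewrite big1 // => j _; rewrite !ffunE (negbTE ik) star0 mul0r linear0 mxE.
by rewrite !ffunE (negbTE il) !mulr0 linear0 mxE.
Qed.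

End CompletelyPositive.

Lemma normCr (R : realType) (r : R) : `|r%:C| = `|r|%:C :> R[i].
Proof. by rewrite normc_def /= expr0n /= addr0 sqrtr_sqr. Qed.

Lemma cjX (R : realType) (x : R[i]) m : Num.conj (x ^+ m) = Num.conj x ^+ m.
Proof. exact: rmorphXn. Qed.

(** * Matrix units and their commutant *)

Section OrthonormalIsometries.
Variables (R : realType) (B : cstarAlgType R) (s1 s2 : B).
Hypothesis s12 : cuntz2_rel s1 s2.

Definition csig m : B := s1 ^+ m * s2.

Lemma csig_orth m l : star (csig m) * csig l = (m == l)%:R.
Proof.
suff H k i : star (csig k) * csig (k + i) = (i == 0%N)%:R.
  case/orP: (leq_total m l) => ml; first by rewrite -{1}(subnKC ml) H subn_eq0 eqn_leq ml.
  rewrite -[LHS]starK starM starK -{1}(subnKC ml) H subn_eq0 eqn_leq ml andbT.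
  by case: leqP; rewrite ?star1 ?star0.
rewrite /csig starM exprD -!mulrA (mulrA (star (s1 ^+ k))) (cuntz_pow_iso s12) mul1r.
case: i => [|i]; first by rewrite expr0 mul1r (cuntz_22 s12).
by rewrite mulrA (cuntz_21_pow s12) // mul0r.
Qed.

Lemma csig_pow m M : (m < M)%N -> star (s1 ^+ M) * csig m = 0.
Proof.
move=> mM; rewrite -(subnKC mM) addSnnS exprD starM /csig -!mulrA.
rewrite (mulrA (star (s1 ^+ m))) (cuntz_pow_iso s12) mul1r.
by rewrite -[LHS]starK starM starK (cuntz_21_pow s12) ?star0.
Qed.

Lemma csig_sum M : \sum_(m < M) csig m * star (csig m) = 1 - s1 ^+ M * star (s1 ^+ M).
Proof.
elim: M => [|M IH]; first by rewrite big_ord0 expr0 star1 mulr1 subrr.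
rewrite big_ord_recr /= IH /csig exprSr !starM.
rewrite -[in RHS](mulrA (s1 ^+ M)) (mulrA s1).
have -> : s1 * star s1 = 1 - s2 * star s2 by rewrite -(cuntz_sum s12) addrK.
rewrite !(mulrBl, mulrBr) !mulrA mulr1; abel.
Qed.

(** [tau] is [s1 ^+ #|T|], whose range is the complement of the ranges of the first [#|T|]
    isometries [csig]. *)
Lemma csigT_ex (T : finType) : exists (e : T -> B) (tau : B),
  [/\ forall s t, star (e s) * e t = (s == t)%:R, star tau * tau = 1,
      forall t, star tau * e t = 0 & \sum_t e t * star (e t) = 1 - tau * star tau].
Proof.
exists (fun t => csig (enum_rank t)), (s1 ^+ #|T|); split.
- move=> s t; rewrite csig_orth; congr (_%:R); congr nat_of_bool.
  by rewrite -(inj_eq enum_rank_inj).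
- exact: (cuntz_pow_iso s12).
- by move=> t; apply: csig_pow; exact: ltn_ord.
- rewrite -csig_sum (reindex (enum_val (A := T))) /=; last first.
    by exists enum_rank => i _; [exact: enum_valK|exact: enum_rankK].
  by apply: eq_bigr => i _; rewrite enum_valK.
Qed.

Section Amplification.
Variables (T : finType) (e : T -> B) (tau : B).
Hypothesis e_orth : forall s t, star (e s) * e t = (s == t)%:R.
Hypothesis tau_iso : star tau * tau = 1.
Hypothesis tau_e : forall t, star tau * e t = 0.
Hypothesis e_sum : \sum_t e t * star (e t) = 1 - tau * star tau.

(** A copy of [B] in the commutant of the matrices [iota_mx], made unital by the summand with [tau].
    It supplies the Cuntz pairs commuting with a cylinder, hence the doubling of families in
    [g_unitary]. *)
Definition camp (x : B) : B := \sum_t e t * x * star (e t) + tau * x * star tau.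

Lemma camp_sig x t : camp x * e t = e t * x.
Proof.
rewrite /camp mulrDl -mulrA tau_e mulr0 addr0 mulr_suml (bigD1 t) //=.
rewrite -mulrA e_orth eqxx mulr1 big1 ?addr0 // => s /negbTE st.
by rewrite -mulrA e_orth st mulr0.
Qed.

Lemma camp_tau x : camp x * tau = tau * x.
Proof.
have tl t : star (e t) * tau = 0.
  by rewrite -(starK tau) -starM tau_e star0.
rewrite /camp mulrDl -(mulrA _ (star tau)) tau_iso mulr1 mulr_suml.
by rewrite big1 ?add0r // => t _; rewrite -mulrA tl mulr0.
Qed.

Lemma campM x y : camp x * camp y = camp (x * y).
Proof.
rewrite [camp y]/camp mulrDr !mulrA camp_tau mulr_sumr /camp !mulrA; congr (_ + _).
by apply: eq_bigr => t _; rewrite !mulrA camp_sig.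
Qed.

Lemma camp_star x : star (camp x) = camp (star x).
Proof.
rewrite /camp starD star_sum !starM starK mulrA; congr (_ + _).
by apply: eq_bigr => t _; rewrite !starM starK mulrA.
Qed.

Lemma campD x y : camp (x + y) = camp x + camp y.
Proof.
rewrite /camp mulrDr mulrDl addrACA; congr (_ + _); rewrite -big_split.
by apply: eq_bigr => t _; rewrite mulrDr mulrDl.
Qed.

Lemma camp1 : camp 1 = 1.
Proof.
rewrite /camp mulr1; under eq_bigr do rewrite mulr1.
by rewrite e_sum subrK.
Qed.

Lemma camp_cuntz : cuntz2_rel (camp s1) (camp s2).
Proof.
by split; rewrite !camp_star !campM -?campD ?(cuntz_11 s12) ?(cuntz_22 s12) ?(cuntz_sum s12) camp1.
Qed.

Lemma camp_iota x X : camp x * iota_mx e X = iota_mx e X * camp x.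
Proof.
rewrite /iota_mx mulr_sumr mulr_suml; apply: eq_bigr => s _.
rewrite mulr_sumr mulr_suml; apply: eq_bigr => t _.
rewrite scaleMl scaleMr; congr (_ *: _); rewrite mulrA camp_sig -!mulrA.
by congr (_ * _); rewrite -[RHS]starK starM starK camp_star camp_sig starM starK.
Qed.

Lemma iota_diag_norm (k : T -> R[i]) (c : R) : 0 <= c -> (forall t, `|k t| <= c%:C) ->
  cnorm (iota_mx e (diag_fun k)) <= c.
Proof.
move=> c0 kc; apply: (iota_norm e_orth s12) => // v.
rewrite mulr_sumr; apply: ler_sum => s _.
rewrite (bigD1 s) //= /diag_fun eqxx big1 ?addr0 => [|t ts]; last first.
  by rewrite eq_sym (negbTE ts) mul0r.
rewrite normrM exprMn; apply: ler_wpM2r; first by rewrite exprn_ge0.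
by rewrite rmorphXn /= lerXn2r ?nnegrE // lecR.
Qed.

End Amplification.
End OrthonormalIsometries.

(** * Cylinders: truncated GNS maps with a weight *)

Section Cylinder.
Variables (R : realType).

Definition bounded01 (k : R -> R) := exists c, forall t, 0 <= t <= 1 -> `|k t| <= c.

(* [b] is a linear map and [D] a functional calculus for a contraction [D id]
   commuting with the range of [b] up to [d], [b] being multiplicative modulo
   elements killed by [D id]; [F] bounds the elements for which this holds. *)
Record cyl (A Q : cstarAlgType R) (F : set A) (d : R) (b : A -> Q)
    (D : (R -> R) -> Q) (tau r1 r2 : Q) : Prop := Cyl {
  cyl_lin : forall c x y, b (c *: x + y) = c *: b x + b y;
  cyl_star : forall x, b (star x) = star (b x);
  cyl_norm : forall x, cnorm (b x) <= cnorm x;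
  cyl_b1 : b 1 = D (fun=> 1);
  cyl_1b : forall x, D (fun=> 1) * b x = b x;
  cyl_Dlin : forall a k k', bounded01 k -> bounded01 k' ->
    D (fun t => a * k t + k' t) = a%:C *: D k + D k';
  cyl_DM : forall k k', bounded01 k -> bounded01 k' -> D (fun t => k t * k' t) = D k * D k';
  cyl_Dstar : forall k, bounded01 k -> star (D k) = D k;
  cyl_Dnorm : forall k c, 0 <= c -> (forall t, 0 <= t <= 1 -> `|k t| <= c) -> cnorm (D k) <= c;
  cyl_comm : forall x, F x -> cnorm (D id * b x - b x * D id) <= d * cnorm x;
  cyl_bM : forall x y k, F y -> bounded01 k -> k 0 = 0 -> b x * b y * D k = b (x * y) * D k;
  cyl_tau : star tau * tau = 1;
  cyl_tau_proj : tau * star tau = 1 - D (fun=> 1);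
  cyl_r : cuntz2_rel r1 r2;
  cyl_r1b : forall x, b x * r1 = r1 * b x;
  cyl_r2b : forall x, b x * r2 = r2 * b x;
  cyl_r1D : forall k, bounded01 k -> D k * r1 = r1 * D k;
  cyl_r2D : forall k, bounded01 k -> D k * r2 = r2 * D k
}.

Section Construction.
Variables (A B : cstarAlgType R) (n : nat) (f : {linear A -> 'M[R[i]]_n}).
Hypothesis f_cp : completely_positive (@star R A) (@cmxstar R n) f.
Variables (s1 s2 : B) (s12 : cuntz2_rel s1 s2) (J K : nat) (F : seq A).

Local Notation E := {ffun 'I_n -> A}.
Local Notation phi := (cpform f).
Let phC := cpform_conj f_cp.
Let phL := cpform_lin f.

Variable ls : seq (E * nat).
Let es := map fst ls.
Let xs := 1 :: F ++ map (@star R A) F.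
Hypothesis es_orth : orthon phi es.
Hypothesis lev_le : forall p, p \in ls -> (p.2 <= K.+1)%N.
Hypothesis unit_span : forall k, spans phi es (unit_at A k) /\
  forall p, p \in ls -> p.2 != 0%N -> phi p.1 (unit_at A k) = 0.
Hypothesis op_span : forall x p, x \in xs -> p \in ls -> (p.2 < K.+1)%N ->
  spans phi es (lmul_op x p.1) /\
  forall p', p' \in ls -> (p.2.+1 < p'.2)%N -> phi p'.1 (lmul_op x p.1) = 0.

Let N := size ls.
(** There are [J.+1] copies of the graded orthonormal system, one for each starting weight
    [j / J]. *)
Let T : finType := ('I_J.+1 * 'I_N)%type.
Let ea (a : 'I_N) : E := (nth (0, 0%N) ls a).1.
Let la (a : 'I_N) : nat := (nth (0, 0%N) ls a).2.
Let tj (j : nat) : R := j%:R / J%:R.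
(** In copy [j] the weight starts at [j / J] on level 0 and falls linearly to 0 on level [K.+1], the
    level at which the truncation need not be exact. *)
Let ht (t : T) : R := tj t.1 * (1 - (la t.2)%:R / K.+1%:R).
Let X x a b : R[i] := phi (ea a) (lmul_op x (ea b)).
Let bm x (s t : T) : R[i] := if s.1 == t.1 then X x s.2 t.2 else 0.
Variables (e : T -> B) (tau : B).
Hypothesis eo : forall s t, star (e s) * e t = (s == t)%:R.
Hypothesis tau_iso : star tau * tau = 1.
Hypothesis tau_e : forall t, star tau * e t = 0.
Hypothesis e_sum : \sum_t e t * star (e t) = 1 - tau * star tau.
Let b x := iota_mx e (bm x).
Let D (k : R -> R) := iota_mx e (diag_fun (fun t => (k (ht t))%:C)).
Let xi (j : nat) l := vec e (fun t : T => if t.1 == j :> nat then phi (ea t.2) (unit_at A l) else 0).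

Lemma ea_orth a c : phi (ea a) (ea c) = (a == c)%:R.
Proof.
rewrite /ea -!(nth_map _ 0 fst) //; apply: (orthon_nth phC) => //; by rewrite size_map.
Qed.

Lemma mem_ls a : (ea a, la a) \in ls.
Proof. by rewrite /ea /la -surjective_pairing mem_nth. Qed.

Lemma spansE v w : spans phi es v -> phi w v = \sum_a phi w (ea a) * phi (ea a) v.
Proof.
move=> ->; rewrite /es big_map (big_nth (0, 0%N)) big_mkord; reflexivity.
Qed.

Lemma tj01 (j : 'I_J.+1) : 0 <= tj j <= 1.
Proof.
rewrite /tj divr_ge0 ?ler0n //=; case: (posnP J) => [J0|J0].
  (* Division by zero gives 0, so the bound also holds for [J = 0]. *)
  by rewrite [X in _ / X](_ : _ = 0) ?invr0 ?mulr0 // J0.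
by rewrite ler_pdivrMr ?ltr0n // mul1r ler_nat -ltnS.
Qed.

Lemma ht01 t : 0 <= ht t <= 1.
Proof.
have h1 := tj01 t.1.
pose r : R := (la t.2)%:R / K.+1%:R.
have h2 : 0 <= r <= 1.
  rewrite /r divr_ge0 ?ler0n //= ler_pdivrMr ?ltr0n // mul1r ler_nat.
  exact: (lev_le (mem_ls t.2)).
rewrite /ht -/r; case/andP: h1 => h1 h1'; case/andP: h2 => h2 h2'.
rewrite mulr_ge0 ?subr_ge0 //= mulr_ile1 ?subr_ge0 //; lra.
Qed.

Lemma bessel v : \sum_a `|phi (ea a) v| ^+ 2 <= phi v v.
Proof.
pose v' := v - \sum_a phi (ea a) v *: ea a.
have o a : phi (ea a) v' = 0.
  rewrite /v' (phiD phL) -scaleN1r (phiZ phL) (phi_sum phL) (bigD1 a) //= (phiZ phL).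
  rewrite ea_orth eqxx big1 ?addr0 => [|c ca]; last by rewrite (phiZ phL) ea_orth eq_sym (negbTE ca) mulr0.
  by rewrite mulr1 mulN1r subrr.
pose u := \sum_a phi (ea a) v *: ea a.
have uv : v = v' + u by rewrite subrK.
have o' a : phi v' (ea a) = 0 by rewrite phC o cj0.
have uo : phi v' u = 0.
  by rewrite /u (phi_sum phL) big1 // => a _; rewrite (phiZ phL) o' mulr0.
have ua a : phi (ea a) u = phi (ea a) v.
  rewrite /u (phi_sum phL) (bigD1 a) //= (phiZ phL) ea_orth eqxx mulr1 big1 ?addr0 // => c ca.
  by rewrite (phiZ phL) ea_orth eq_sym (negbTE ca) mulr0.
have uu : phi u u = \sum_a `|phi (ea a) v| ^+ 2.
  rewrite {1}/u (phi_suml phC phL); apply: eq_bigr => a _.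
  by rewrite (phiZl phC phL) ua normCK mulrC.
rewrite -uu; clearbody u v'.
have -> : phi v v = phi v' v' + phi u u.
  by rewrite uv (phiD phL) !(phiDl phC phL) uo (phC v' u) uo cj0 addr0 add0r.
by rewrite lerDr cpform_ge0.
Qed.

Lemma sum_pair (g : T -> R[i]) : \sum_t g t = \sum_j \sum_a g (j, a).
Proof. by rewrite pair_bigA; apply: eq_bigr => -[]. Qed.

Lemma sum_block (s : 'I_J.+1) (g : T -> R[i]) :
  \sum_t (if s == t.1 then g t else 0) = \sum_a g (s, a).
Proof.
rewrite sum_pair (bigD1 s) //= eqxx [X in _ + X]big1 ?addr0 // => j js.
by rewrite big1 // => a _ /=; rewrite eq_sym (negbTE js).
Qed.

(** [b x] is the compression of left multiplication by [x] to an orthonormal system in each copy, so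
    Bessel's inequality reduces the bound to [lmul_op_norm]. *)
Lemma cyl_b_norm x : cnorm (b x) <= cnorm x.
Proof.
apply: (iota_norm eo s12) => [|v]; first exact: cnorm_ge0.
pose eta j := \sum_a v (j, a) *: ea a.
rewrite !sum_pair mulr_sumr; apply: ler_sum => j _.
have -> : \sum_a `|v (j, a)| ^+ 2 = phi (eta j) (eta j).
  rewrite {1}/eta (phi_suml phC phL); apply: eq_bigr => a _.
  rewrite (phiZl phC phL) (phi_sum phL) (bigD1 a) //= (phiZ phL) ea_orth eqxx mulr1.
  rewrite big1 ?addr0 ?normCK 1?mulrC // => c ca.
  by rewrite (phiZ phL) ea_orth eq_sym (negbTE ca) mulr0.
apply: le_trans (lmul_op_norm f_cp x (eta j)); apply: le_trans (bessel _).
apply: ler_sum => a _; rewrite (_ : \sum_t _ = phi (ea a) (lmul_op x (eta j))) //.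
rewrite (eq_bigr (fun t => if j == t.1 then X x a t.2 * v t else 0)); last first.
  by move=> t _; rewrite /bm /=; case: ifP => _; rewrite ?mul0r.
rewrite sum_block /= (lmul_op_adj f) (phi_sum phL); apply: eq_bigr => c _.
by rewrite (phiZ phL) /X (lmul_op_adj f) mulrC.
Qed.

Lemma cb_lin c x y : b (c *: x + y) = c *: b x + b y.
Proof.
rewrite iotaZ iotaD; apply: iota_ext => s t; rewrite /bm; case: ifP => _.
  by rewrite /X lmul_op_lin phL.
by rewrite mulr0 addr0.
Qed.

Lemma cb_star x : b (star x) = star (b x).
Proof.
rewrite /b iota_star; apply: iota_ext => s t; rewrite /bm eq_sym; case: ifP => _.
  by rewrite /X (lmul_op_adj f) starK phC.
by rewrite cj0.
Qed.

Lemma cb_1 : b 1 = D (fun=> 1).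
Proof.
apply: iota_ext => -[j a] [j' a']; rewrite /bm /diag_fun /X /= lmul_op1 ea_orth xpair_eqE.
by case: eqP => //= _; case: eqP.
Qed.

Lemma cb_1b x : D (fun=> 1) * b x = b x.
Proof. by rewrite /D iotaM //; apply: iota_ext => s t; rewrite diag_mull mul1r. Qed.

Lemma cD_lin a k k' : D (fun t => a * k t + k' t) = a%:C *: D k + D k'.
Proof.
rewrite /D iotaZ iotaD; apply: iota_ext => s t; rewrite /diag_fun; case: ifP => _.
  by rewrite rcD rcM.
by rewrite mulr0 addr0.
Qed.

Lemma cD_mul k k' : D (fun t => k t * k' t) = D k * D k'.
Proof.
rewrite /D iotaM //; apply: iota_ext => s t; rewrite diag_mull /diag_fun; case: ifP => _.
  by rewrite rcM.
by rewrite mulr0.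
Qed.

Lemma cD_star k : star (D k) = D k.
Proof.
rewrite /D iota_star; apply: iota_ext => s t; rewrite /diag_fun eq_sym.
by case: eqP => [->|_]; rewrite ?cjr ?cj0.
Qed.

Lemma cD_norm k c : 0 <= c -> (forall t, 0 <= t <= 1 -> `|k t| <= c) -> cnorm (D k) <= c.
Proof.
move=> c0 kc; apply: (iota_diag_norm s12 eo) => // t.
by rewrite normCr lecR kc // ht01.
Qed.

(** An operator of [F] raises the level by at most one, and so does its adjoint, since [xs] contains
    the adjoints; [b x] is thus tridiagonal in the level. *)
Lemma lev_adj x s t : x \in F -> bm x s t != 0 ->
  s.1 = t.1 /\ ((la s.2 <= (la t.2).+1)%N /\ (la t.2 <= (la s.2).+1)%N).
Proof.
move=> xF; rewrite /bm; case: (s.1 =P t.1) => [st|_]; last by rewrite eqxx.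
move=> nz; split=> //.
have H y a c : y \in xs -> phi (ea a) (lmul_op y (ea c)) != 0 -> (la a <= (la c).+1)%N.
  move=> yx; apply: contraNT; rewrite -ltnNge => lt.
  have lK : (la c < K.+1)%N.
    by apply: leq_trans (lev_le (mem_ls a)); exact: ltnW.
  have [_ h] := op_span yx (mem_ls c) lK; apply/eqP.
  exact: (h _ (mem_ls a) lt).
split; first by apply: (H x) nz; rewrite /xs inE mem_cat xF orbT.
apply: (H (star x)); first by rewrite /xs inE mem_cat map_f ?orbT.
apply: contra nz => /eqP h; apply/eqP.
by rewrite /X (lmul_op_adj f) phC h cj0.
Qed.

(* Conjugating by [i^level] turns the off-diagonal parts of [b x] into [i] and
   [-i] times themselves, which expresses the commutator with the level. *)
Lemma cb_comm x : x \in F -> cnorm (D id * b x - b x * D id) <= K.+1%:R^-1 * cnorm x.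
Proof.
move=> xF; pose w (t : T) : R[i] := 'i ^+ la t.2.
pose V := iota_mx e (diag_fun w).
(* For entries one level apart, [w s * conj (w t)] minus its conjugate is plus or minus [2 'i]; for
   equal levels it is 0. The factor [c] turns these values into the differences of weights. *)
pose c (t : T) : R[i] := (tj t.1 / K.+1%:R / 2)%:C * 'i.
have ci : Num.conj ('i : R[i]) = - 'i by exact: conjCi.
have ii : 'i * 'i = -1 :> R[i] by rewrite -expr2 sqrCi.
have ww t : w t * Num.conj (w t) = 1.
  by rewrite /w cjX -exprMn ci mulrN ii opprK expr1n.
have w1 t : `|w t| = 1 by rewrite /w normrX normCi expr1n.
have Vs : star V = iota_mx e (diag_fun (fun t => Num.conj (w t))).
  rewrite /V iota_star; apply: iota_ext => s t; rewrite /diag_fun eq_sym.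
  by case: eqP => [->|_]; rewrite ?cj0.
have -> : D id * b x - b x * D id = iota_mx e (diag_fun c) * (V * b x * star V - star V * b x * V).
  rewrite Vs /V /D /b !iota_diagl // !iota_diagr // !iotaB iota_diagl //.
  apply: iota_ext => s t /=.
  have [b0|b0] := eqVneq (bm x s t) 0; first by rewrite b0; ring.
  have [st [l1 l2]] := lev_adj xF b0.
  have key : (ht s)%:C - (ht t)%:C = c s * (w s * Num.conj (w t) - Num.conj (w s) * w t).
    rewrite /ht /c -st -rcB.
    have [h0|[hs|ht']] : la s.2 = la t.2 \/ (la s.2 = (la t.2).+1 \/ la t.2 = (la s.2).+1).
    - move: l1; rewrite leq_eqVlt ltnS => /orP[/eqP->|l1]; first by right; left.
      move: l2; rewrite leq_eqVlt ltnS => /orP[/eqP->|l2]; first by right; right.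
      by left; apply/eqP; rewrite eqn_leq l1.
    - have -> : w s = w t by rewrite /w h0.
      by rewrite h0 subrr [Num.conj _ * _]mulrC subrr mulr0.
    - have -> : w s = 'i * w t by rewrite /w hs exprS.
      have -> : 'i * w t * Num.conj (w t) - Num.conj ('i * w t) * w t
          = 'i * (w t * Num.conj (w t)) + 'i * (w t * Num.conj (w t)).
        by rewrite cjM ci; ring.
      rewrite ww mulr1 hs -natr1; set r := _ / 2.
      have -> : r%:C * 'i * ('i + 'i) = - (r%:C + r%:C) by rewrite -mulrA mulrDr ii; ring.
      by rewrite -rcD -rcN; congr (_%:C); rewrite /r; field; rewrite gt_eqF ?ltr0n.
    - have -> : w t = 'i * w s by rewrite /w ht' exprS.
      have -> : w s * Num.conj ('i * w s) - Num.conj (w s) * ('i * w s)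
          = - ('i * (w s * Num.conj (w s)) + 'i * (w s * Num.conj (w s))).
        by rewrite cjM ci; ring.
      rewrite ww mulr1 ht' -natr1; set r := _ / 2.
      have -> : r%:C * 'i * - ('i + 'i) = r%:C + r%:C by rewrite mulrN -mulrA mulrDr ii; ring.
      by rewrite -rcD; congr (_%:C); rewrite /r; field; rewrite gt_eqF ?ltr0n.
  rewrite /=; move: key; set p := (ht s)%:C; set r := (ht t)%:C => key.
  transitivity ((p - r) * bm x s t); first by ring.
  by rewrite key; ring.
apply: le_trans (cnormM _ _) _.
have Vn : cnorm V <= 1 by apply: (iota_diag_norm s12 eo) => // t; rewrite w1.
have cn : cnorm (iota_mx e (diag_fun c)) <= K.+1%:R^-1 / 2.
  apply: (iota_diag_norm s12 eo) => [|t]; first by rewrite divr_ge0 // invr_ge0 ler0n.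
  rewrite /c normrM normCi mulr1 normCr lecR.
  have /andP[j0 j1] : 0 <= tj t.1 <= 1 by exact: tj01.
  rewrite ger0_norm; last by rewrite !divr_ge0 ?ler0n.
  by rewrite ler_pM2r ?invr_gt0 // -[leRHS]mul1r ler_wpM2r ?invr_ge0 ?ler0n.
apply: le_trans (ler_pM (cnorm_ge0 _) (cnorm_ge0 _) cn (cnormB _ _)) _.
have h1 : cnorm (V * b x * star V) <= cnorm x.
  apply: le_trans (cnormM _ _) _; rewrite cnorm_star.
  apply: le_trans (ler_pM (cnorm_ge0 _) (cnorm_ge0 _) (cnormM _ _) Vn) _; rewrite mulr1.
  by rewrite -[leRHS]mul1r ler_pM ?cnorm_ge0 ?cyl_b_norm.
have h2 : cnorm (star V * b x * V) <= cnorm x.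
  apply: le_trans (cnormM _ _) _.
  apply: le_trans (ler_pM (cnorm_ge0 _) (cnorm_ge0 _) (cnormM _ _) Vn) _; rewrite mulr1 cnorm_star.
  by rewrite -[leRHS]mul1r ler_pM ?cnorm_ge0 ?cyl_b_norm.
rewrite -(mulrA K.+1%:R^-1) ler_pM2l ?invr_gt0 ?ltr0n //; lra.
Qed.

(** Below the top level [y] maps the system into its span, so the projection inserted between [x]
    and [y] has no effect; on the top level the weight is 0 and [k] vanishes. *)
Lemma cb_mul x y k : y \in F -> k 0 = 0 -> b x * b y * D k = b (x * y) * D k.
Proof.
move=> yF k0; rewrite /D !iota_diagr // /b iotaM // iota_diagr //; apply: iota_ext => s t.
have [lt|ge] := ltnP (la t.2) K.+1; last first.
  have -> : ht t = 0.
    rewrite /ht (_ : la t.2 = K.+1) ?divff ?subrr ?mulr0 //.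
    by apply/eqP; rewrite eqn_leq ge (lev_le (mem_ls _)).
  by rewrite k0 !mulr0.
congr (_ * _); rewrite {1 3}/bm.
rewrite (eq_bigr (fun r : T => if s.1 == r.1 then X x s.2 r.2 * bm y r t else 0)); last first.
  by move=> r _; rewrite /bm; case: ifP => _; rewrite ?mul0r.
rewrite sum_block /bm /=; case: eqP => _; last by rewrite big1 // => a _; rewrite mulr0.
rewrite /X lmul_opM (lmul_op_adj f) (spansE _ (proj1 (op_span _ (mem_ls t.2) lt))).
  by apply: eq_bigr => a _; rewrite (lmul_op_adj f).
by rewrite /xs inE mem_cat yF orbT.
Qed.

(** The vectors [unit_at] are spanned exactly, so compressing [b x] to copy [j] returns [f x];
    distinct copies are orthogonal. *)
Lemma xi_b x j j' k l : (j <= J)%N -> (j' <= J)%N ->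
  star (xi j k) * b x * xi j' l = (if j == j' then f x k l else 0) *: 1.
Proof.
move=> jJ jJ'; rewrite -mulrA iota_vec // vec_vec //; congr (_ *: _).
pose i : 'I_J.+1 := Ordinal (jJ : (j < J.+1)%N).
pose i' : 'I_J.+1 := Ordinal (jJ' : (j' < J.+1)%N).
pose u l' a := phi (ea a) (unit_at A l').
have uE l' j1 (j1J : (j1 < J.+1)%N) (g : T -> R[i]) :
    \sum_t g t * (if t.1 == j1 :> nat then u l' t.2 else 0) = \sum_a g (Ordinal j1J, a) * u l' a.
  rewrite -(sum_block (Ordinal j1J) (fun t => g t * u l' t.2)); apply: eq_bigr => t _.
  by rewrite -(inj_eq val_inj) eq_sym /=; case: ifP => _; rewrite ?mulr0.
rewrite (eq_bigr (fun t : T => Num.conj (if t.1 == j :> nat then u k t.2 else 0) *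
    \sum_a bm x t (i', a) * u l a)); last first.
  by move=> t _; congr (_ * _); rewrite uE.
rewrite (eq_bigr (fun t : T => if i == t.1 then Num.conj (u k t.2) *
    \sum_a bm x t (i', a) * u l a else 0)); last first.
  move=> t _; rewrite -(inj_eq val_inj) eq_sym /=; case: ifP => _ //.
  by rewrite cj0 mul0r.
rewrite sum_block /bm /= -(inj_eq val_inj) /=; case: eqP => _; last first.
  by rewrite big1 // => a _; rewrite big1 ?mulr0 // => c _; rewrite mul0r.
rewrite -(cpform_unit f) -[RHS](@cjK R) -phC (spansE _ (proj1 (unit_span k))) cj_sum.
apply: eq_bigr => a _; rewrite cjM mulrC; congr (_ * _).
rewrite -phC /X (lmul_op_adj f) (spansE _ (proj1 (unit_span l))).
by apply: eq_bigr => c _; rewrite (lmul_op_adj f).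
Qed.

Lemma D_xi k j l : (j <= J)%N -> D k * xi j l = (k (j%:R / J%:R))%:C *: xi j l.
Proof.
move=> jJ; rewrite /D iota_diag_vec // vecZ; apply: vec_ext => t.
case: eqP => [tj'|_]; last by rewrite !mulr0.
have [l0|l0] := eqVneq (la t.2) 0%N.
  by rewrite /ht l0 mul0r subr0 mulr1 tj'.
have [_ h] := unit_span l; rewrite (h _ (mem_ls t.2) l0) !mulr0; reflexivity.
Qed.

Lemma cyl_prop : cyl [set x | x \in F] K.+1%:R^-1 b D tau (camp e tau s1) (camp e tau s2).
Proof.
have ci x : camp e tau x * tau = tau * x by exact: camp_tau.
split.
- exact: cb_lin.
- exact: cb_star.
- exact: cyl_b_norm.
- exact: cb_1.
- exact: cb_1b.
- by move=> *; exact: cD_lin.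
- by move=> *; exact: cD_mul.
- by move=> *; exact: cD_star.
- exact: cD_norm.
- exact: cb_comm.
- by move=> x y k yF _; exact: cb_mul.
- exact: tau_iso.
- have -> : D (fun=> 1) = \sum_t e t * star (e t) by rewrite -iota_proj.
  by rewrite e_sum opprB addrC subrK.
- exact: camp_cuntz.
- by move=> x; rewrite camp_iota.
- by move=> x; rewrite camp_iota.
- by move=> k _; rewrite camp_iota.
- by move=> k _; rewrite camp_iota.
Qed.

End Construction.

Lemma cyl_ex (A B : cstarAlgType R) (n : nat) (f : {linear A -> 'M[R[i]]_n}) (s1 s2 : B)
    (J K : nat) (F : seq A) :
  completely_positive (@star R A) (@cmxstar R n) f -> cuntz2_rel s1 s2 ->
  exists (b : A -> B) (D : (R -> R) -> B) (tau r1 r2 : B) (xi : nat -> 'I_n -> B),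
  [/\ cyl [set x | x \in F] K.+1%:R^-1 b D tau r1 r2,
      forall x j j' k l, (j <= J)%N -> (j' <= J)%N ->
        star (xi j k) * b x * xi j' l = (if j == j' then f x k l else 0) *: 1
    & forall k j l, (j <= J)%N -> D k * xi j l = (k (j%:R / J%:R))%:C *: xi j l].
Proof.
move=> fcp s12.
pose xs := 1 :: F ++ map (@star R A) F.
have [ls [h1 h2 h3 h4]] := gs_levels (cpform_conj fcp) (cpform_lin f) (cpform_ge0 fcp)
  [seq unit_at A k | k <- enum 'I_n] [seq @lmul_op R A n x | x <- xs] K.+1.
have h3' k : spans (cpform f) (map fst ls) (unit_at A k) /\
  forall p, p \in ls -> p.2 != 0%N -> cpform f p.1 (unit_at A k) = 0.
  by apply: h3; rewrite map_f ?mem_enum.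
have h4' x p : x \in xs -> p \in ls -> (p.2 < K.+1)%N ->
  spans (cpform f) (map fst ls) (lmul_op x p.1) /\
  forall p', p' \in ls -> (p.2.+1 < p'.2)%N -> cpform f p'.1 (lmul_op x p.1) = 0.
  move=> xxs pls pK; have := h4 (index x xs) p.
  rewrite size_map index_mem xxs pls pK (nth_map 0) ?index_mem // nth_index //.
  by apply.
have [e [tau [e1 e2 e3 e4]]] := csigT_ex s12 ('I_J.+1 * 'I_(size ls))%type.
have hc := cyl_prop fcp s12 (J := J) h1 h2 h4' e1 e2 e3 e4.
match type of hc with cyl _ _ ?b ?D ?tau ?r1 ?r2 => exists b, D, tau, r1, r2 end.
exists (fun j l => vec e (fun t : 'I_J.+1 * 'I_(size ls) =>
  if t.1 == j :> nat then cpform f (nth (0, 0%N) ls t.2).1 (unit_at A l) else 0)); split.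
- exact: hc.
- by move=> x j j' k l jJ jJ'; apply: (xi_b fcp h3' e1).
- by move=> k j l jJ; apply: (D_xi K h3' e1 k).
Qed.

End Cylinder.

(** * Nuclear algebras *)

Section CylinderLimit.
Variables (R : realType) (I : Type) (W : set_system I).
Context {WU : UltraFilter W}.
Variables (A Q D : cstarAlgType R) (q : (I -> Q) -> D).
Hypothesis hq : is_ultrapower W q.
Variables (F : I -> set A) (d : I -> R) (b : I -> A -> Q) (Df : I -> (R -> R) -> Q).
Variables (tau r1 r2 : I -> Q).
Hypothesis hc : forall i, cyl (F i) (d i) (b i) (Df i) (tau i) (r1 i) (r2 i).
Hypothesis F_cvg : forall x, \forall i \near W, F i x.
Hypothesis d_cvg : forall e, 0 < e -> \forall i \near W, d i < e.

Lemma cyl_bd_b x : bounded_family (fun i => b i x).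
Proof. by exists (cnorm x) => i; apply: (cyl_norm (hc i)). Qed.

Lemma cyl_bd_D k : bounded01 k -> bounded_family (fun i => Df i k).
Proof.
move=> [c hk]; exists `|c| => i; apply: (cyl_Dnorm (hc i)) => // t t01.
exact: le_trans (hk t t01) (ler_norm c).
Qed.

Lemma bounded01_id : bounded01 (@id R).
Proof. by exists 1 => t /andP[t0 t1]; rewrite ger0_norm. Qed.

Lemma bounded01_cst (c : R) : bounded01 (fun=> c).
Proof. by exists `|c|. Qed.

Lemma bounded01_lin (a : R) (k k' : R -> R) : bounded01 k -> bounded01 k' ->
  bounded01 (fun t => a * k t + k' t).
Proof.
move=> [c hc'] [c' hc'']; exists (`|a| * c + c') => t t01.
apply: le_trans (ler_normD _ _) _; rewrite normrM lerD ?hc'' //.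
by rewrite ler_wpM2l ?hc'.
Qed.

Lemma bounded01_M (k k' : R -> R) : bounded01 k -> bounded01 k' -> bounded01 (fun t => k t * k' t).
Proof.
move=> [c hc'] [c' hc'']; exists (c * c') => t t01.
by rewrite normrM ler_pM ?hc' ?hc''.
Qed.

(** The commutator bound tends to 0 and every element eventually enters [F i]: the weight becomes
    exactly central, and the relations hold on all of [A]. *)
Lemma cyl_lim : cyl setT 0 (fun x => q (fun i => b i x)) (fun k => q (fun i => Df i k))
  (q tau) (q r1) (q r2).
Proof.
have bb := cyl_bd_b; have bD := cyl_bd_D; have b1 := bounded01_cst 1.
have bt : bounded_family tau by apply: bd_iso => i; apply: (cyl_tau (hc i)).
have br1 : bounded_family r1 by apply: bd_iso => i; case: (cyl_r (hc i)).
have br2 : bounded_family r2 by apply: bd_iso => i; case: (cyl_r (hc i)).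
have bdM x y (hx : bounded_family x) (hy : bounded_family y) := bfamM hx hy.
have qe x y : (forall i : I, x i = y i) -> q x = q y by move=> h; congr q; apply/funext.
split.
- by move=> c x y; rewrite -(uq_lin hq) //; apply: qe => i; apply: (cyl_lin (hc i)).
- by move=> x; rewrite -(uq_star hq) //; apply: qe => i; apply: (cyl_star (hc i)).
- move=> x; apply: (uq_norm_le hq) => //; apply: nearW => i; exact: (cyl_norm (hc i)).
- by apply: qe => i; apply: (cyl_b1 (hc i)).
- by move=> x; rewrite -(uqM hq) //; [apply: qe => i; apply: (cyl_1b (hc i))|exact: bD].
- move=> a k k' hk hk'; rewrite -(uq_lin hq); [|exact: bD|exact: bD].
  by apply: qe => i; apply: (cyl_Dlin (hc i)).
- move=> k k' hk hk'; rewrite -(uqM hq); [|exact: bD|exact: bD].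
  by apply: qe => i; apply: (cyl_DM (hc i)).
- by move=> k hk; rewrite -(uq_star hq); [apply: qe => i; apply: (cyl_Dstar (hc i))|exact: bD].
- move=> k c c0 hk; apply: (uq_norm_le hq); first by apply: bD; exists c.
  by apply: nearW => i; exact: (cyl_Dnorm (hc i)).
- move=> x _; have bi := bD _ bounded01_id; rewrite -!(uqM hq) // -(uqB hq); [|exact: bdM|exact: bdM].
  rewrite mul0r; apply/ler_addgt0Pr => e e0; rewrite add0r.
  apply: (uq_norm_le hq); first by apply: bfamB; exact: bdM.
  have e1 : 0 < e / (cnorm x + 1) by rewrite divr_gt0 // ltr_wpDl ?cnorm_ge0.
  apply: filterS2 (F_cvg x) (d_cvg e1) => i Fx di.
  apply: le_trans (cyl_comm (hc i) Fx) _.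
  apply: le_trans (ler_wpM2r (cnorm_ge0 x) (ltW di)) _.
  rewrite mulrAC ler_pdivrMr ?ltr_wpDl ?cnorm_ge0 //.
  by rewrite ler_pM2l // lerDl.
- move=> x y k _ hk k0; have bk := bD _ hk; rewrite -!(uqM hq) //; [|exact: bdM].
  apply: (@uq_near_eq R I W WU Q D q hq (fun i => b i x * b i y * Df i k)
    (fun i => b i (x * y) * Df i k)).
  - apply: bfamM => //; exact: bdM.
  - exact: bdM.
  by apply: filterS (F_cvg y) => i Fy; apply: (cyl_bM (hc i)).
- rewrite -(uq_star hq) // -(uqM hq) //; last exact: bfam_star.
  by rewrite -(uq1 hq); apply: qe => i; apply: (cyl_tau (hc i)).
- rewrite -(uq_star hq) // -(uqM hq) //; last exact: bfam_star.
  rewrite -(uq1 hq) -(uqB hq); [|exact: bfam_cst|exact: bD].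
  by apply: qe => i; apply: (cyl_tau_proj (hc i)).
- have := @cz_q R I W Q D q hq (fun i c => if c then r1 i else r2 i).
  by apply => i; apply: (cyl_r (hc i)).
- by move=> x; rewrite -!(uqM hq) //; apply: qe => i; apply: (cyl_r1b (hc i)).
- by move=> x; rewrite -!(uqM hq) //; apply: qe => i; apply: (cyl_r2b (hc i)).
- move=> k hk; have bk := bD _ hk; rewrite -!(uqM hq) //.
  by apply: qe => i; apply: (cyl_r1D (hc i)).
- move=> k hk; have bk := bD _ hk; rewrite -!(uqM hq) //.
  by apply: qe => i; apply: (cyl_r2D (hc i)).
Qed.

End CylinderLimit.

(** * Functions of the weight commuting with the range *)

Section CylinderCalculus.
Variables (R : realType) (A Q : cstarAlgType R) (b : A -> Q) (D : (R -> R) -> Q) (tau r1 r2 : Q).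
Hypothesis hc : cyl setT 0 b D tau r1 r2.

(** The class contains [id] and is closed under linear combinations, products, square roots and
    absolute values; the functions used below are built by these operations. *)
Definition central01 (k : R -> R) := bounded01 k /\ forall x, D k * b x = b x * D k.

Lemma cyl_ext (k k' : R -> R) : bounded01 k -> bounded01 k' ->
  (forall t, 0 <= t <= 1 -> k t = k' t) -> D k = D k'.
Proof.
move=> hk hk' e; apply/eqP; rewrite -subr_eq0; apply/eqP/cnorm_eq0P.
have -> : D k - D k' = D (fun t => -1 * k' t + k t).
  by rewrite (cyl_Dlin hc) // rcN scaleN1r addrC.
apply: (cyl_Dnorm hc) => // t t01.
by rewrite e // mulN1r addNr normr0.
Qed.

Lemma central01_id : central01 id.
Proof.
split; first exact: bounded01_id.
move=> x; apply/eqP; rewrite -subr_eq0; apply/eqP/cnorm_eq0P.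
by have := cyl_comm hc (x := x) I; rewrite mul0r.
Qed.

Lemma cyl_D1 : D (fun=> 1) = b 1. Proof. by rewrite (cyl_b1 hc). Qed.
Lemma cyl_b1r x : b x * b 1 = b x.
Proof.
have := congr1 (@star R Q) (cyl_1b hc (star x)).
rewrite starM (cyl_star hc) starK (cyl_Dstar hc) ?cyl_D1 //; exact: bounded01_cst.
Qed.

Lemma central01_lin a k k' : central01 k -> central01 k' -> central01 (fun t => a * k t + k' t).
Proof.
move=> [h1 h2] [h3 h4]; split; first exact: bounded01_lin.
by move=> x; rewrite (cyl_Dlin hc) // mulrDl mulrDr scaleMl scaleMr h2 h4.
Qed.

Lemma central01_M k k' : central01 k -> central01 k' -> central01 (fun t => k t * k' t).
Proof.
move=> [h1 h2] [h3 h4]; split; first exact: bounded01_M.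
by move=> x; rewrite (cyl_DM hc) // -mulrA h4 mulrA h2 mulrA.
Qed.

Lemma central01_cst c : central01 (fun=> c).
Proof.
have -> : (fun=> c) = (fun t : R => c * (fun=> 1 : R) t + (fun=> 0 : R) t).
  by apply/funext => t; rewrite mulr1 addr0.
have h0 : D (fun=> 0) = 0.
  by apply: cnorm_eq0P; apply: (cyl_Dnorm hc) => // t _; rewrite normr0.
apply: central01_lin; split; try exact: bounded01_cst; move=> x.
  by rewrite cyl_D1 cyl_b1r -cyl_D1 (cyl_1b hc).
by rewrite h0 mul0r mulr0.
Qed.

Lemma central01_ext k k' : (forall t, 0 <= t <= 1 -> k t = k' t) -> central01 k -> central01 k'.
Proof.
move=> e [h1 h2]; have hk' : bounded01 k'.
  by case: h1 => c h; exists c => t t01; rewrite -e // h.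
by split=> // x; rewrite -(cyl_ext h1 hk' e).
Qed.

(* [D (sqrt k)] is the square root of [D k] produced by [csqrt_ex], which lies
   in the bicommutant of [D k]. *)
Lemma central01_sqrt1 k : (forall t, 0 <= t <= 1 -> 0 <= k t <= 1) -> central01 k ->
  central01 (fun t => Num.sqrt (k t)).
Proof.
move=> k01 [kb kc].
have s01 (u : R) : 0 <= u <= 1 -> 0 <= Num.sqrt u <= 1.
  by move=> /andP[u0 u1]; rewrite sqrtr_ge0 -[leRHS]sqrtr1 ler_wsqrtr.
(* The fourth root [r] of [k], through [D s = D r * D r], gives the norm bound on [1 - D s] that
   [sqrt_unique] asks for. *)
pose s t := Num.sqrt (k t); pose r t := Num.sqrt (s t).
have h01 (g : R -> R) : (forall t, 0 <= t <= 1 -> 0 <= g t <= 1) ->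
    bounded01 g /\ (forall t, 0 <= t <= 1 -> `|g t| <= 1).
  move=> h; suff h' t : 0 <= t <= 1 -> `|g t| <= 1 by split=> //; exists 1.
  by move=> /h /andP[g0 g1]; rewrite ger0_norm.
have [sb s1] : bounded01 s /\ (forall t, 0 <= t <= 1 -> `|s t| <= 1).
  by apply: h01 => t /k01/s01.
have [rb r1'] : bounded01 r /\ (forall t, 0 <= t <= 1 -> `|r t| <= 1).
  by apply: h01 => t /k01/s01/s01.
have Ds : star (D s) = D s by exact: (cyl_Dstar hc).
have Dr : star (D r) = D r by exact: (cyl_Dstar hc).
have ss : D s * D s = D k.
  rewrite -(cyl_DM hc) //; apply: cyl_ext => //; first exact: bounded01_M.
  by move=> t /k01/andP[k0 _]; rewrite /s -expr2 sqr_sqrtr.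
have rr : D r * D r = D s.
  rewrite -(cyl_DM hc) //; apply: cyl_ext => //; first exact: bounded01_M.
  by move=> t /k01/s01/andP[k0 _]; rewrite /r -expr2 sqr_sqrtr.
have Dr1 : cnorm (D r) <= 1 by apply: (cyl_Dnorm hc).
have Ds1 : cnorm (D s) <= 1 by apply: (cyl_Dnorm hc).
have n1 := sa_sqr_compl Dr Dr1; rewrite rr in n1.
have n2 := sa_sqr_compl Ds Ds1; rewrite ss in n2.
have [|c [c1 c2 c3 c4]] := csqrt_ex _ n2.
  by rewrite starB star1 (cyl_Dstar hc).
rewrite opprB addrCA subrr addr0 in c2.
split=> // x; have -> : D (fun t => Num.sqrt (k t)) = c.
  symmetry; apply: sqrt_unique => //; last by rewrite c2 ss.
  by apply/esym/c4; rewrite mulrBr mulrBl mulr1 mul1r -ss mulrA.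
by apply/esym/c4; rewrite mulrBr mulrBl mulr1 mul1r kc.
Qed.

Lemma central01_sqrt k : (forall t, 0 <= t <= 1 -> 0 <= k t) -> central01 k ->
  central01 (fun t => Num.sqrt (k t)).
Proof.
move=> k0 kc; have [[c hk] _] := kc.
have c1 : 0 < `|c| + 1 by rewrite ltr_wpDl.
pose C := `|c| + 1.
have hC : central01 (fun t => C^-1 * k t + (fun=> 0) t).
  by apply: central01_lin => //; exact: central01_cst.
have [|kb kk] := central01_sqrt1 _ hC.
  move=> t t01; rewrite addr0 mulr_ge0 ?invr_ge0 ?k0 ?(ltW c1) //=.
  rewrite mulrC ler_pdivrMr // mul1r; apply: le_trans (ler_norm _) _.
  by apply: le_trans (hk t t01) _; rewrite /C; have := ler_norm c; lra.
have h2 := central01_lin (Num.sqrt C) (conj kb kk) (central01_cst 0).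
apply: central01_ext h2 => t t01 /=.
rewrite !addr0 sqrtrM ?invr_ge0 ?(ltW c1) // mulrA -sqrtrM ?(ltW c1) //.
by rewrite divff ?gt_eqF // sqrtr1 mul1r.
Qed.

Lemma central01_norm k : central01 k -> central01 (fun t => `|k t|).
Proof.
move=> kc; apply: (central01_ext (k := fun t => Num.sqrt (k t * k t))).
  by move=> t _; rewrite -expr2 sqrtr_sqr.
apply: central01_sqrt => [t _|]; last exact: central01_M.
by rewrite -expr2 sqr_ge0.
Qed.

End CylinderCalculus.

(** * Monomials in the roots of [t] and [1 - t], and hat functions *)

Section RealFunctions.
Variable R : realType.
Implicit Types (t u e : R) (k : R -> R).

(* the monomial [c^i s^j], where [c t = sqrt t] and [s t = sqrt (1 - t)] *)
Definition cs_mon (i j : nat) t : R := Num.sqrt t ^+ i * Num.sqrt (1 - t) ^+ j.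

Lemma cs_mon01 i j t : 0 <= t <= 1 -> 0 <= cs_mon i j t <= 1.
Proof.
move=> /andP[t0 t1]; have h u : 0 <= u <= 1 -> 0 <= Num.sqrt u <= 1.
  by move=> /andP[u0 u1]; rewrite sqrtr_ge0 -[leRHS]sqrtr1 ler_wsqrtr.
have /andP[c0 c1] : 0 <= Num.sqrt t <= 1 by apply: h; rewrite t0.
have /andP[s0 s1] : 0 <= Num.sqrt (1 - t) <= 1 by apply: h; lra.
by rewrite mulr_ge0 ?exprn_ge0 //= mulr_ile1 ?exprn_ge0 // exprn_ile1.
Qed.

Lemma cs_monM i j i' j' t : cs_mon i j t * cs_mon i' j' t = cs_mon (i + i') (j + j') t.
Proof. by rewrite /cs_mon !exprD mulrACA. Qed.

Lemma cs_mon_sum i j t : 0 <= t <= 1 -> cs_mon i.+2 j t + cs_mon i j.+2 t = cs_mon i j t.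
Proof.
move=> /andP[t0 t1].
have e0 : cs_mon 2 0 t + cs_mon 0 2 t = 1.
  by rewrite /cs_mon !expr0 mulr1 mul1r !sqr_sqrtr ?subr_ge0 // addrC subrK.
by rewrite -[RHS]mulr1 -e0 mulrDr !cs_monM !addn0 !addn2.
Qed.

Lemma cs_mon_rev i j t : cs_mon i j (1 - t) = cs_mon j i t.
Proof. by rewrite /cs_mon opprB addrCA subrr addr0 mulrC. Qed.

Lemma cs_mon0 i j : (0 < i)%N -> cs_mon i j 0 = 0.
Proof. by move=> i0; rewrite /cs_mon sqrtr0 expr0n gtn_eqF // mul0r. Qed.

Lemma cs_mon1 i : cs_mon i 0 1 = 1.
Proof. by rewrite /cs_mon sqrtr1 expr1n mul1r. Qed.

Lemma cs_mon1_0 i j : (0 < j)%N -> cs_mon i j 1 = 0.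
Proof. by move=> j0; rewrite /cs_mon subrr sqrtr0 expr0n gtn_eqF // mulr0. Qed.

Definition ucont01 k := forall e, 0 < e -> exists2 d, 0 < d &
  forall t u, 0 <= t <= 1 -> 0 <= u <= 1 -> `|t - u| <= d -> `|k t - k u| <= e.

Lemma sqrt_dist t u : 0 <= t -> 0 <= u -> `|Num.sqrt t - Num.sqrt u| ^+ 2 <= `|t - u|.
Proof.
move=> t0 u0; have h0 := sqrtr_ge0 t; have h1 := sqrtr_ge0 u.
have -> : t - u = (Num.sqrt t - Num.sqrt u) * (Num.sqrt t + Num.sqrt u).
  by rewrite -[t in LHS]sqr_sqrtr // -[u in LHS]sqr_sqrtr // subr_sqr.
rewrite normrM expr2 ler_wpM2l // [leRHS]ger0_norm ?addr_ge0 //.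
by rewrite ler_norml; apply/andP; split; lra.
Qed.

Lemma ucont01_sqrt : ucont01 Num.sqrt.
Proof.
move=> e e0; exists (e ^+ 2) => [|t u /andP[t0 _] /andP[u0 _] tu].
  by rewrite exprn_gt0.
rewrite -(ler_pXn2r (n := 2)) ?nnegrE ?(ltW e0) //.
exact: le_trans (sqrt_dist t0 u0) tu.
Qed.

Lemma ucont01_sqrt_rev : ucont01 (fun t => Num.sqrt (1 - t)).
Proof.
move=> e /ucont01_sqrt[d d0 h]; exists d => // t u t01 u01 tu.
apply: h; try lra; rewrite distrC in tu; rewrite (_ : 1 - t - (1 - u) = u - t) //; ring.
Qed.

Lemma ucont01_M k k' : (forall t, 0 <= t <= 1 -> `|k t| <= 1) ->
  (forall t, 0 <= t <= 1 -> `|k' t| <= 1) -> ucont01 k -> ucont01 k' ->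
  ucont01 (fun t => k t * k' t).
Proof.
move=> k1 k1' hk hk' e e0; have e2 : 0 < e / 2 by rewrite divr_gt0.
have [d d0 h] := hk _ e2; have [d' d0' h'] := hk' _ e2.
exists (Num.min d d') => [|t u t01 u01]; first by rewrite lt_min d0.
rewrite le_min => /andP[td td'].
have -> : k t * k' t - k u * k' u = (k t - k u) * k' t + k u * (k' t - k' u) by ring.
apply: le_trans (ler_normD _ _) _; rewrite !normrM.
have a1 := h t u t01 u01 td; have a2 := h' t u t01 u01 td'.
have a3 : `|k t - k u| * `|k' t| <= e / 2 * 1 by rewrite ler_pM ?k1'.
have a4 : `|k u| * `|k' t - k' u| <= 1 * (e / 2) by rewrite ler_pM ?k1.
lra.
Qed.

Lemma ucont01_mon i j : ucont01 (cs_mon i j).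
Proof.
have b1 k : (forall t, 0 <= t <= 1 -> 0 <= k t <= 1) -> forall t, 0 <= t <= 1 -> `|k t| <= 1.
  by move=> h t /h/andP[h0 h1]; rewrite ger0_norm.
have hX k n : (forall t, 0 <= t <= 1 -> 0 <= k t <= 1) -> ucont01 k -> ucont01 (fun t => k t ^+ n).
  move=> k01 kc; elim: n => [|n IH].
    by move=> e e0; exists 1 => // t u _ _ _; rewrite !expr0 subrr normr0 ltW.
  rewrite (_ : (fun t => _) = fun t => k t * k t ^+ n); last by apply/funext => t; rewrite exprS.
  apply: ucont01_M => //; apply: b1 => // t /k01/andP[k0 k1].
  by rewrite exprn_ge0 //= exprn_ile1.
have hc t : 0 <= t <= 1 -> 0 <= Num.sqrt t <= 1.
  by move=> /(cs_mon01 1 0); rewrite /cs_mon expr0 mulr1 expr1.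
have hs t : 0 <= t <= 1 -> 0 <= Num.sqrt (1 - t) <= 1.
  by move=> /(cs_mon01 0 1); rewrite /cs_mon expr0 mul1r expr1.
apply: ucont01_M.
- by apply: b1 => t /(cs_mon01 i 0); rewrite /cs_mon expr0 mulr1.
- by apply: b1 => t /(cs_mon01 0 j); rewrite /cs_mon expr0 mul1r.
- exact: hX ucont01_sqrt.
- exact: hX ucont01_sqrt_rev.
Qed.

(** Truncation to [[0, 1]], written with absolute values so that [central01_norm] applies to it. *)
Definition clamp u : R := (1 + `|u| - `|u - 1|) / 2.

Lemma clamp_le0 u : u <= 0 -> clamp u = 0.
Proof. by move=> u0; rewrite /clamp !ler0_norm; lra. Qed.
Lemma clamp_ge1 u : 1 <= u -> clamp u = 1.
Proof. by move=> u0; rewrite /clamp !ger0_norm; lra. Qed.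
Lemma clamp_le u v : u <= v -> clamp u <= clamp v.
Proof.
move=> uv; rewrite /clamp; case: (ger0P u) => h0; case: (ger0P (u - 1)) => h1;
case: (ger0P v) => h2; case: (ger0P (v - 1)) => h3; lra.
Qed.

Section Partition.
Variable J : nat.

(* [chi m] is the [m]-th hat function of the subdivision of [0, 1] into [J] parts. *)
Definition chi_cut (m : nat) t : R := if m is m'.+1 then clamp (J%:R * t - m'%:R) else 1.
Definition chi (m : nat) t : R := chi_cut m t - chi_cut m.+1 t.

Lemma chi_ge0 m t : 0 <= chi m t.
Proof.
rewrite subr_ge0; case: m => [|m] /=; last by apply: clamp_le; rewrite -natr1; lra.
rewrite subr0 /clamp; case: (ger0P (J%:R * t)) => h0; case: (ger0P (J%:R * t - 1)) => h1; lra.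
Qed.

Lemma chi_sum t : t <= 1 -> \sum_(m < J.+1) chi m t = 1.
Proof.
move=> t1; rewrite -(big_mkord xpredT (fun m => chi m t)) (telescope_sumr_eq (fun m => - chi_cut m t)) //.
  rewrite /= clamp_le0 ?oppr0 ?sub0r ?opprK //.
  by rewrite subr_le0 -[leRHS]mulr1 ler_wpM2l.
by move=> m _; rewrite opprK addrC.
Qed.

Lemma chi_support m t : (0 < J)%N -> 0 <= t -> chi m t != 0 -> `|m%:R / J%:R - t| <= J%:R^-1.
Proof.
move=> J0 t0 nz; have J0' : 0 < J%:R :> R by rewrite ltr0n.
have Jt0 : 0 <= J%:R * t by rewrite mulr_ge0 // ltW.
have h1 : J%:R * t <= m%:R + 1.
  rewrite leNgt; apply/negP => h; move/eqP: nz; apply.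
  rewrite /chi /= clamp_ge1; last by lra.
  case: m h => [|m] h /=; first by rewrite subrr.
  by rewrite clamp_ge1 ?subrr //; rewrite -natr1 in h; lra.
have h2 : m%:R - 1 <= J%:R * t.
  case: m nz {h1} => [|m] nz; first by lra.
  rewrite leNgt; apply/negP => h; move/eqP: nz; apply.
  rewrite -natr1 in h; rewrite /chi /= !clamp_le0 ?subrr // -?natr1; lra.
have -> : m%:R / J%:R - t = (m%:R - J%:R * t) / J%:R by field; rewrite gt_eqF.
rewrite normrM normfV [`|J%:R|]gtr0_norm // -[leRHS]mul1r ler_pM2r ?invr_gt0 //.
by rewrite ler_norml; apply/andP; split; lra.
Qed.

Lemma chi0 m : chi m.+1 0 = 0.
Proof.
by rewrite /chi /= !mulr0 !sub0r !clamp_le0 ?subrr // oppr_le0.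
Qed.

(** The sum is the piecewise linear interpolation of [k]; node 0 contributes nothing since
    [k 0 = 0]. *)
Lemma chi_approx k e t : (0 < J)%N -> 0 <= t <= 1 -> k 0 = 0 ->
  (forall t u, 0 <= t <= 1 -> 0 <= u <= 1 -> `|t - u| <= J%:R^-1 -> `|k t - k u| <= e) ->
  `|\sum_(m < J) k (m.+1%:R / J%:R) * chi m.+1 t - k t| <= e.
Proof.
move=> J0 /andP[t0 t1] k0 hk.
have cE c : c = \sum_(m < J.+1) c * chi m t by rewrite -mulr_sumr chi_sum // mulr1.
have e1 : \sum_(m < J) k (m.+1%:R / J%:R) * chi m.+1 t - k t =
    \sum_(m < J.+1) (k (m%:R / J%:R) - k t) * chi m t.
  rewrite [X in _ - X = _]cE; under [RHS]eq_bigr do rewrite mulrBl; rewrite sumrB; congr (_ - _).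
  by rewrite big_ord_recl /= mul0r k0 mul0r add0r.
rewrite e1; apply: le_trans (ler_norm_sum _ _ _) _.
rewrite [leRHS]cE; apply: ler_sum => m _.
rewrite normrM [`|chi m t|]ger0_norm ?chi_ge0 //.
have [->|nz] := eqVneq (chi m t) 0; first by rewrite !mulr0.
apply: ler_wpM2r; first exact: chi_ge0.
apply: hk; rewrite ?t0 //; last exact: chi_support.
by rewrite divr_ge0 // ler_pdivrMr ?ltr0n // mul1r ler_nat -ltnS ltn_ord.
Qed.

End Partition.
End RealFunctions.

(** * Kraus form of a map defined on matrices *)

Section Kraus.
Variables (R : realType) (A : cstarAlgType R) (n : nat) (g : {linear 'M[R[i]]_n -> A}).
Hypothesis g_cp : completely_positive (@cmxstar R n) (@star R A) g.

(** Complete positivity is applied to the block matrix of all matrix units, which is positive as the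
    square of a single row of them. Its image is the Choi matrix of [g], and a factorization of this
    matrix gives the operators [Y]. *)
Lemma kraus : exists Y : 'I_n -> 'I_n -> A, forall X,
  g X = \sum_r \sum_k \sum_l X k l *: (star (Y r k) * Y r l).
Proof.
case: n g g_cp => [|m] h h_cp.
  by exists (fun _ _ => 0) => X; rewrite big_ord0 (_ : X = 0) ?linear0 //; apply/matrixP => -[].
pose Y0 : 'M['M[R[i]]_m.+1]_m.+1 := \matrix_(r, l) if r == 0 then delta_mx 0 l else 0.
have [|Y hY] := h_cp m.+1 (mxadj (@cmxstar R m.+1) Y0 *m Y0); first by exists Y0.
have cmE k : cmxstar (delta_mx 0 k : 'M[R[i]]_m.+1) = delta_mx k 0.
  apply/matrixP => i j; rewrite !mxE andbC; case: (_ && _); [exact: cj1|exact: cj0].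
have hE k l : h (delta_mx k l) = \sum_r star (Y r k) * Y r l.
  have /matrixP/(_ k l) := hY; rewrite !mxE => e.
  transitivity (h (\sum_j mxadj (@cmxstar R m.+1) Y0 k j * Y0 j l)).
    congr (h _); rewrite (bigD1 0) //= !mxE eqxx big1 ?addr0 => [|j j0]; last first.
      by rewrite !mxE (negbTE j0) mulr0.
    by rewrite cmE -[RHS]/(delta_mx k 0 *m delta_mx 0 l) mul_delta_mx.
  by rewrite e; apply: eq_bigr => r _; rewrite !mxE.
exists Y => X; rewrite {1}[X]matrix_sum_delta linear_sum /=.
under eq_bigr do rewrite linear_sum /=.
rewrite [RHS]exchange_big; apply: eq_bigr => k _; rewrite exchange_big; apply: eq_bigr => l _.
by rewrite linearZ /= hE scaler_sumr.
Qed.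

End Kraus.

(** * Centrality of the monomials and of the hat functions *)

Section Central.
Variables (R : realType) (A Q : cstarAlgType R) (b : A -> Q) (D : (R -> R) -> Q) (tau r1 r2 : Q).
Hypothesis hc : cyl setT 0 b D tau r1 r2.
Local Notation central := (central01 b D).

Lemma central_mon i j : central (cs_mon i j).
Proof.
have hX k m : central k -> central (fun t => k t ^+ m).
  move=> hk; elim: m => [|m IH]; first exact: (central01_cst hc 1).
  rewrite (_ : (fun t => _) = fun t => k t * k t ^+ m); last by apply/funext => t; rewrite exprS.
  exact: (central01_M hc).
apply: (central01_M hc); apply: hX.
  by apply: (central01_sqrt hc) => [t /andP[]//|]; exact: (central01_id hc).
apply: (central01_sqrt hc) => [t /andP[_ t1]|]; first by rewrite subr_ge0.
have := central01_lin hc (-1) (central01_id hc) (central01_cst hc 1).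
by apply: (central01_ext hc) => t _ /=; rewrite mulN1r addrC.
Qed.

Lemma central_chi J m : central (chi J m).
Proof.
have hcut m' : central (chi_cut J m').
  case: m' => [|m']; first exact: (central01_cst hc 1).
  have ha c : central (fun t => J%:R * t - c).
    exact: (central01_lin hc _ (central01_id hc) (central01_cst hc (- c))).
  have h1 := central01_norm hc (ha m'%:R).
  have h2 := central01_norm hc (ha (m'%:R + 1)).
  have h3 := central01_lin hc (- 2^-1) h2 (central01_lin hc 2^-1 h1 (central01_cst hc 2^-1)).
  apply: (central01_ext hc) h3 => t _ /=; rewrite /clamp.
  rewrite (_ : J%:R * t - (m'%:R + 1) = J%:R * t - m'%:R - 1); last by ring.
  by lra.
have := central01_lin hc (-1) (hcut m.+1) (hcut m).
by apply: (central01_ext hc) => t _; rewrite /chi mulN1r addrC.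
Qed.

Lemma central_sqrt_chi J m : central (fun t => Num.sqrt (chi J m t)).
Proof. by apply: (central01_sqrt hc) => [t _|]; [exact: chi_ge0|exact: central_chi]. Qed.

Lemma cyl_D0 : D (fun=> 0) = 0.
Proof. by apply: cnorm_eq0P; apply: (cyl_Dnorm hc) => // t _; rewrite normr0. Qed.

Lemma cyl_Dsum N (c : 'I_N -> R) (k : 'I_N -> R -> R) : (forall m, bounded01 (k m)) ->
  bounded01 (fun t => \sum_m c m * k m t) /\
  D (fun t => \sum_m c m * k m t) = \sum_m (c m)%:C *: D (k m).
Proof.
elim: N c k => [|N IH] c k hk.
  rewrite (_ : (fun t => _) = fun=> 0); last by apply/funext => t; rewrite big_ord0.
  by rewrite big_ord0 cyl_D0; split => //; exact: bounded01_cst.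
have [h1 h2] := IH (fun m => c (lift ord0 m)) (fun m => k (lift ord0 m)) (fun m => hk _).
rewrite (_ : (fun t => _) = fun t => c ord0 * k ord0 t +
    \sum_m c (lift ord0 m) * k (lift ord0 m) t); last first.
  by apply/funext => t; rewrite big_ord_recl.
split; first exact: bounded01_lin.
by rewrite (cyl_Dlin hc) // h2 big_ord_recl.
Qed.

End Central.

(** Orthonormal isometries assemble a family into a single column. *)
Lemma orth_sumM (R : realType) (Q : cstarAlgType R) (sg : nat -> Q) N (X X' : 'I_N -> Q) :
  (forall m l, star (sg m) * sg l = (m == l)%:R) ->
  star (\sum_(m < N) sg m * X m) * (\sum_(m < N) sg m * X' m) = \sum_(m < N) star (X m) * X' m.
Proof.
move=> so; rewrite star_sum mulr_suml; apply: eq_bigr => i _.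
rewrite mulr_sumr (bigD1 i) //= big1 ?addr0 => [|j ji].
  by rewrite starM !mulrA -(mulrA (star (X i))) so eqxx mulr1.
rewrite starM !mulrA -(mulrA (star (X i))) so [_ == _](_ : _ = false) ?mulr0 ?mul0r //.
by apply/negbTE; apply: contra ji => /eqP e; apply/eqP/val_inj.
Qed.

(** * Exchanging the weight [t] with [1 - t] *)

Section Swap.
Variables (R : realType) (A Q : cstarAlgType R) (b : A -> Q) (D : (R -> R) -> Q) (tau r1 r2 : Q).
Hypothesis hc : cyl setT 0 b D tau r1 r2.
Variables (s1 s2 : Q) (s12 : cuntz2_rel s1 s2).
Variables (n : nat) (f : {linear A -> 'M[R[i]]_n}) (g : {linear 'M[R[i]]_n -> A}).
Hypothesis f_cp : completely_positive (@star R A) (@cmxstar R n) f.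
Hypothesis g_cp : completely_positive (@cmxstar R n) (@star R A) g.
Hypothesis gf1 : cnorm (g (f 1)) <= 1.
Variables (J : nat) (xi : nat -> 'I_n -> Q).
Hypothesis J0 : (0 < J)%N.
Hypothesis xi_b : forall x j j' k l, (j <= J)%N -> (j' <= J)%N ->
  star (xi j k) * b x * xi j' l = (if j == j' then f x k l else 0) *: 1.
Hypothesis D_xi : forall k j l, bounded01 k -> (j <= J)%N ->
  D k * xi j l = (k (j%:R / J%:R))%:C *: xi j l.

(** Near weight [(j + 1) / J], selected by a hat function, [w] maps into the vectors [xi] of weight
    [1 - (j + 1) / J]. Compressing by [w] therefore reads off [f x] at the reflected weight, and the
    Kraus operators of [g] turn it back into [b (g (f x))]. Adding a part with values in the range
    of [tau], which [b] annihilates, makes [w] an isometry without affecting the compression. *)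
Lemma swap_isometry : exists V : Q, star V * V = 1 /\
  forall i j x e, (0 < i)%N -> (0 < j)%N ->
    (forall t u, 0 <= t <= 1 -> 0 <= u <= 1 -> `|t - u| <= J%:R^-1 ->
       `|cs_mon j i t - cs_mon j i u| <= e) ->
    cnorm (star V * (D (cs_mon i j) * b x) * V - D (cs_mon j i) * b x)
      <= e * cnorm x + cnorm (g (f x) - x).
Proof.
have [Y hY] := kraus g_cp; have so := csig_orth s12; move: (csig s1 s2) so => sg so.
have gsa : star (g (f 1)) = g (f 1).
  rewrite !hY star_sum; apply: eq_bigr => r _; rewrite star_sum exchange_big; apply: eq_bigr => l _.
  rewrite star_sum; apply: eq_bigr => k _.
  by rewrite starZ starM starK -(cp_star f_cp) star1.
(* [y] is the root of [1 - g (f 1)], the defect of unitality of the factorization. *)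
have [y [ys yy _ _]] := csqrt_ex gsa gf1.
pose p := b 1; have pE : p = D (fun=> 1) by rewrite /p (cyl_b1 hc).
have b1 : bounded01 (fun=> 1 : R) by exact: bounded01_cst.
have ps : star p = p by rewrite /p -(cyl_star hc) star1.
have pp : p * p = p by rewrite {1}pE (cyl_1b hc).
have taup : star tau * p = 0.
  have : star tau * (tau * star tau) = star tau by rewrite mulrA (cyl_tau hc) mul1r.
  rewrite (cyl_tau_proj hc) -pE mulrBr mulr1 => /eqP.
  by rewrite subr_eq addrC -subr_eq subrr eq_sym => /eqP.
pose rho m := D (fun t => Num.sqrt (chi J m t)).
have rc m := central_sqrt_chi hc J m; have rb m := (rc m).1.
have rs m : star (rho m) = rho m by exact: (cyl_Dstar hc).
have rr m : rho m * rho m = D (chi J m).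
  rewrite -(cyl_DM hc) //; apply: (cyl_ext hc); first exact: bounded01_M.
    by case: (central_chi hc J m).
  by move=> t _; rewrite -expr2 sqr_sqrtr // chi_ge0.
have rbc m x : rho m * b x = b x * rho m by case: (rc m).
have rbM m x z : b x * b z * rho m.+1 = b (x * z) * rho m.+1.
  by apply: (cyl_bM hc) => //; rewrite chi0 sqrtr0.
have b0 : b 0 = 0 by have := cyl_lin hc (-1) 0 0; rewrite scaler0 addr0 scaleN1r addNr.
have bD x z : b (x + z) = b x + b z by have := cyl_lin hc 1 x z; rewrite !scale1r.
have bZ c x : b (c *: x) = c *: b x by have := cyl_lin hc c x 0; rewrite b0 !addr0.
have bB x z : b (x - z) = b x - b z by rewrite bD -scaleN1r bZ scaleN1r.
have b_sum := big_morph b bD b0.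
have Dp k : bounded01 k -> D k * p = D k.
  move=> hk; rewrite pE -(cyl_DM hc) //; apply: (cyl_ext hc) => //; first exact: bounded01_M.
  by move=> t _; rewrite mulr1.
have pD k : bounded01 k -> p * D k = D k.
  by move=> hk; rewrite -[LHS]starK starM ps (cyl_Dstar hc) // Dp // (cyl_Dstar hc).
have pxi a l : (a <= J)%N -> p * xi a l = xi a l.
  by move=> aJ; rewrite pE D_xi // scale1r.
have xi_M k x a a' l l' : bounded01 k -> (a <= J)%N -> (a' <= J)%N ->
    star (xi a l) * (D k * b x) * xi a' l' =
    (if a == a' then (k (a%:R / J%:R))%:C * f x l l' else 0) *: 1.
  move=> hk aJ aJ'; have -> : star (xi a l) * (D k * b x) = star (D k * xi a l) * b x.
    by rewrite starM (cyl_Dstar hc) // mulrA.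
  rewrite D_xi // starZr !scaleMl xi_b //; case: ifP => _; first by rewrite scalerA.
  by rewrite !scale0r scaler0.
pose v l := \sum_r sg (r : 'I_n) * b (Y r l).
have vv l l' : star (v l) * v l' = \sum_r star (b (Y r l)) * b (Y r l').
  by rewrite /v orth_sumM.
pose u j := \sum_l xi (J - j.+1)%N l * v l.
pose S x := \sum_l \sum_l' f x l l' *: (star (v l) * v l').
have uu k x j j' : bounded01 k -> (j < J)%N -> (j' < J)%N ->
    star (u j) * (D k * b x) * u j' =
    if j == j' then (k ((J - j.+1)%:R / J%:R))%:C *: S x else 0.
  move=> hk jJ jJ'; have -> : star (u j) * (D k * b x) * u j' = \sum_l \sum_l'
      star (v l) * (star (xi (J - j.+1)%N l) * (D k * b x) * xi (J - j'.+1)%N l') * v l'.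
    rewrite /u star_sum !mulr_suml; apply: eq_bigr => l _; rewrite mulr_sumr.
    by apply: eq_bigr => l' _; rewrite starM !mulrA.
  have jj : (J - j.+1 == J - j'.+1)%N = (j == j').
    by apply/eqP/eqP => [h|->] //; apply: succn_inj; rewrite -(subKn jJ) h subKn.
  case: ifP => h.
    rewrite /S scaler_sumr; apply: eq_bigr => l _; rewrite scaler_sumr; apply: eq_bigr => l' _.
    by rewrite xi_M ?leq_subr // jj h scaleMr mulr1 scaleMl scalerA.
  rewrite big1 // => l _; rewrite big1 // => l' _.
  by rewrite xi_M ?leq_subr // jj h scale0r mulr0 mul0r.
have S_rho x m : S x * rho m.+1 = b (g (f x)) * rho m.+1.
  rewrite /S hY b_sum.
  transitivity (\sum_l \sum_l' \sum_r f x l l' *: (b (star (Y r l) * Y r l') * rho m.+1)).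
    rewrite mulr_suml; apply: eq_bigr => l _; rewrite mulr_suml; apply: eq_bigr => l' _.
    rewrite vv scaler_sumr mulr_suml; apply: eq_bigr => r _.
    by rewrite -(cyl_star hc) scaleMl rbM.
  rewrite exchange_big mulr_suml /=.
  transitivity (\sum_l' \sum_r \sum_l f x l l' *: (b (star (Y r l) * Y r l') * rho m.+1)).
    by apply: eq_bigr => l _; rewrite exchange_big.
  rewrite exchange_big; apply: eq_bigr => r _; rewrite exchange_big b_sum mulr_suml.
  apply: eq_bigr => l _; rewrite b_sum mulr_suml; apply: eq_bigr => l' _.
  by rewrite bZ scaleMl.
(* Hat 0 is left out: [b] is multiplicative only against functions vanishing at 0. *)
pose w := \sum_(j < J) u j * rho j.+1.
have ww k x : bounded01 k -> star w * (D k * b x) * w =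
    (\sum_(j < J) (k ((J - j.+1)%:R / J%:R))%:C *: D (chi J j.+1)) * b (g (f x)).
  move=> hk; have tri j j' : star (u j * rho j.+1) * (D k * b x) * (u j' * rho j'.+1) =
      rho j.+1 * (star (u j) * (D k * b x) * u j') * rho j'.+1 by rewrite starM rs !mulrA.
  rewrite {1}/w star_sum !mulr_suml; apply: eq_bigr => j _.
  rewrite /w mulr_sumr (bigD1 j) //= big1 ?addr0 => [|j' jj']; last first.
    by rewrite tri uu // -(inj_eq val_inj) /= eq_sym in jj' *; rewrite (negbTE jj') mulr0 mul0r.
  rewrite tri uu // eqxx scaleMr !scaleMl -mulrA S_rho -rbc mulrA rr.
  by [].
have wp : p * w = w.
  rewrite /w mulr_sumr; apply: eq_bigr => j _; rewrite mulrA; congr (_ * _).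
  by rewrite /u mulr_sumr; apply: eq_bigr => l _; rewrite mulrA pxi // leq_subr.
have tw : star tau * w = 0 by rewrite -wp mulrA taup mul0r.
have wt : star w * tau = 0 by rewrite -(starK tau) -starM tw star0.
(* The missing pieces of the unit: the complement of the support of [b], hat 0, and on every other
   hat the defect of [g (f 1)]. *)
pose X m := match m with 0%N => 1 - p | 1%N => rho 0%N | m'.+2 => b y * rho m'.+1 end.
pose z := \sum_(m < J.+2) sg m * X m.
pose V := w + tau * z.
have chi_b m : bounded01 (chi J m) := (central_chi hc J m).1.
have zz : star z * z = 1 - p + D (chi J 0) + \sum_(m < J) D (chi J m.+1) * (p - b (g (f 1))).
  rewrite /z orth_sumM // !big_ord_recl /= addrA; congr (_ + _ + _).
  - by rewrite starB star1 ps mulrBr mulr1 mulrBl mul1r pp subrr subr0.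
  - by rewrite rs rr.
  apply: eq_bigr => m _; have -> : p - b (g (f 1)) = b (y * y) by rewrite yy bB.
  rewrite starM rs -(cyl_star hc) ys -!mulrA (mulrA (b y)) rbM -rbc mulrA rr.
  by [].
have V1 : star V * V = 1.
  have -> : star V * V = star w * w + star z * z.
    rewrite /V starD starM !(mulrDl, mulrDr) mulrA wt mul0r addr0 -(mulrA (star z)) tw mulr0 add0r.
    by rewrite -(mulrA (star z)) (mulrA (star tau)) (cyl_tau hc) mul1r.
  have -> : star w * w = star w * (D (fun=> 1) * b 1) * w.
    by rewrite (cyl_1b hc) -/p -mulrA wp.
  rewrite ww // zz -mulr_suml.
  have -> : \sum_(m < J) (1 : R)%:C *: D (chi J m.+1) = \sum_(m < J) D (chi J m.+1).
    by apply: eq_bigr => m _; rewrite scale1r.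
  have Sp : (\sum_(m < J) D (chi J m.+1)) * p = \sum_(m < J) D (chi J m.+1).
    by rewrite mulr_suml; apply: eq_bigr => m _; rewrite Dp.
  have S1 : D (chi J 0) + \sum_(m < J) D (chi J m.+1) = p.
    have [sb SE] := cyl_Dsum hc (fun=> 1) (fun m : 'I_J.+1 => chi_b m).
    have -> : D (chi J 0) + \sum_(m < J) D (chi J m.+1) = \sum_(m < J.+1) (1 : R)%:C *: D (chi J m).
      by rewrite big_ord_recl scale1r; congr (_ + _); apply: eq_bigr => m _; rewrite scale1r.
    rewrite -SE pE; apply: (cyl_ext hc) => // t /andP[_ t1].
    by rewrite -[RHS](chi_sum J t1); apply: eq_bigr => m _; rewrite mul1r.
  have fin (S' T d0 : Q) : d0 + S' = p -> T + (1 - p + d0 + (S' - T)) = 1 by move=> <-; abel.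
  by rewrite mulrBr Sp; exact: fin.
have Db k x : bounded01 k -> star V * (D k * b x) * V = star w * (D k * b x) * w.
  move=> hk; have tD : star tau * D k = 0 by rewrite -pD // mulrA taup mul0r.
  have bt : b x * tau = 0.
    have pt : p * tau = 0 by rewrite -(starK tau) -ps -starM taup star0.
    by rewrite -(cyl_b1r hc) -mulrA -/p pt mulr0.
  rewrite /V starD starM mulrDl mulrDr !mulrDl -!mulrA !(mulrA (star tau)) tD !mul0r !mulr0.
  by rewrite (mulrA (b x) tau) bt !mul0r !mulr0 !addr0.
exists V; split=> // i j x e i0 j0 he.
have [mb mc] := central_mon hc i j; have [mb' mc'] := central_mon hc j i.
rewrite Db // ww //.
have [kb <-] := cyl_Dsum hc (fun m : 'I_J => cs_mon i j ((J - m.+1)%:R / J%:R)) (fun m => chi_b m.+1).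
set kap := (X in D X) in kb *.
(* The first summand is the error of the factorization, the second that of the interpolation. *)
have -> : D kap * b (g (f x)) - D (cs_mon j i) * b x =
    D kap * b (g (f x) - x) + D (fun t => -1 * cs_mon j i t + kap t) * b x.
  rewrite (cyl_Dlin hc) // rcN scaleN1r bB mulrBr mulrDl mulNr; abel.
have kapE t : kap t = \sum_(m < J) cs_mon j i (m.+1%:R / J%:R) * chi J m.+1 t.
  apply: eq_bigr => m _; rewrite -cs_mon_rev natrB //; congr (cs_mon _ _ _ * _).
  by field; rewrite gt_eqF ?ltr0n.
have tm (m : 'I_J) : 0 <= (m.+1%:R / J%:R : R) <= 1.
  by rewrite divr_ge0 ?ler0n //= ler_pdivrMr ?ltr0n // mul1r ler_nat.
have n1 : cnorm (D kap) <= 1.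
  apply: (cyl_Dnorm hc) => // t /andP[t0 t1]; rewrite kapE.
  have h0 (m : 'I_J) : 0 <= (cs_mon j i (m.+1%:R / J%:R) : R) <= 1 by apply: cs_mon01.
  rewrite ger0_norm; last by apply: sumr_ge0 => m _; rewrite mulr_ge0 ?chi_ge0 //; case/andP: (h0 m).
  have sle : \sum_(m < J) chi J m.+1 t <= 1.
    by rewrite -[leRHS](chi_sum J t1) big_ord_recl lerDr chi_ge0.
  apply: le_trans sle.
  apply: ler_sum => m _; rewrite -[leRHS]mul1r ler_wpM2r ?chi_ge0 //; by case/andP: (h0 m).
have n2 : cnorm (D (fun t => -1 * cs_mon j i t + kap t)) <= e.
  apply: (cyl_Dnorm hc).
    by apply: le_trans (he 0 0 _ _ _); rewrite ?subrr ?normr0 ?lexx ?ler01 ?invr_ge0.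
  move=> t t01; rewrite mulN1r addrC kapE; apply: chi_approx => //.
  exact: cs_mon0.
apply: le_trans (cnormD _ _) _; rewrite addrC lerD //; apply: le_trans (cnormM _ _) _.
  by rewrite ler_pM ?cnorm_ge0 ?(cyl_norm hc).
by rewrite -[leRHS]mul1r ler_pM ?cnorm_ge0 ?(cyl_norm hc).
Qed.

End Swap.

(** * An ultrafilter on finite sequences *)

Section IndexUltrafilter.

(** Finite sequences ordered by inclusion are paired with a precision, so that a single index
    exhausts an arbitrary algebra and lets tolerances tend to 0. *)
Lemma seq_ultrafilter (T : eqType) : exists2 W : set_system (seq T * nat), UltraFilter W &
  forall x n, \forall i \near W, x \in (i.1 : seq T) /\ (n <= i.2)%N.
Proof.
pose B (i0 : seq T * nat) : set (seq T * nat) :=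
  [set i : seq T * nat | {subset i0.1 <= i.1 :> seq T} /\ (i0.2 <= i.2)%N].
pose G : set_system (seq T * nat) := filter_from setT B.
have GF : Filter G.
  apply: filter_from_filter; first by exists ([::], 0%N).
  move=> i j _ _; exists (i.1 ++ j.1, maxn i.2 j.2) => // k [/= k1].
  rewrite geq_max => /andP[k2 k3]; split; split=> // x xi; apply: k1; rewrite mem_cat xi ?orbT //.
have GP : ProperFilter G.
  by apply: filter_from_proper => i _; exists i; split.
have [W [WU GW]] := ultraFilterLemma GP.
exists W => // x n; apply: GW; exists ([:: x], n) => // i [/= h1 h2].
by split=> //; apply: h1; rewrite inE.
Qed.

End IndexUltrafilter.

(** * A lower bound for the norm of the cone map *)

Section CornerNorm.
Variables (R : realType) (A Q : cstarAlgType R) (b : A -> Q) (D : (R -> R) -> Q) (tau r1 r2 : Q).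
Hypothesis hc : cyl setT 0 b D tau r1 r2.
Variables (n : nat) (f : {linear A -> 'M[R[i]]_n}) (g : {linear 'M[R[i]]_n -> A}).
Hypothesis f_c : forall a, cnorm a <= 1 -> mxcontraction (f a).
Hypothesis g_c : forall X, mxcontraction X -> cnorm (g X) <= 1.
Variables (xi : 'I_n -> Q).
Hypothesis xi_b : forall x k l, star (xi k) * b x * xi l = f x k l *: 1.
Hypothesis D_xi : forall k l, bounded01 k -> D k * xi l = (k 1)%:C *: xi l.

Let nrm2 (v : 'cV[R[i]]_n) : R := \sum_i (complex.Re `|v i 0|) ^+ 2.

Let normCRe (z : R[i]) : `|z| = (complex.Re `|z|)%:C.
Proof. by rewrite normc_def. Qed.

Lemma nrm2E v : (nrm2 v)%:C = \sum_i `|v i 0| ^+ 2.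
Proof.
rewrite /nrm2 (big_morph (fun r => r%:C) (@rcD R) (erefl _)); apply: eq_bigr => i _.
by rewrite normCRe expr2 rcM expr2.
Qed.

Let vec_xi (v : 'cV[R[i]]_n) := \sum_l v l 0 *: xi l.

Lemma vec_xi_form k x v w : bounded01 k ->
  star (vec_xi v) * (D k * b x) * vec_xi w =
  ((k 1)%:C * \sum_l Num.conj (v l 0) * (f x *m w) l 0) *: 1.
Proof.
move=> hk; rewrite /vec_xi star_sum !mulr_suml mulr_sumr scaler_suml; apply: eq_bigr => l _.
rewrite mulr_sumr mxE !mulr_sumr scaler_suml; apply: eq_bigr => l' _.
have -> : star (v l 0 *: xi l) * (D k * b x) = (Num.conj (v l 0) * (k 1)%:C) *: (star (xi l) * b x).
  rewrite starZ scaleMl mulrA -(cyl_Dstar hc hk) -starM D_xi // starZr scaleMl scalerA.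
  by [].
by rewrite scaleMl scaleMr xi_b !scalerA; congr (_ *: _); ring.
Qed.

(** The squared norm is the scalar [c], the inner product of [v] with [f 1 v]. It is real, and
    expanding the squared norm of [v - f 1 v] bounds it by that of [v], because [f 1] is a
    contraction. *)
Lemma vec_xi_norm v : cnorm (vec_xi v) ^+ 2 <= nrm2 v.
Proof.
pose w := f 1 *m v; pose c := \sum_l Num.conj (v l 0) * w l 0.
have b1 : bounded01 (fun=> 1 : R) by exact: bounded01_cst.
have pv : D (fun=> 1) * b 1 * vec_xi v = vec_xi v.
  rewrite (cyl_1b hc) (cyl_b1 hc) /vec_xi mulr_sumr; apply: eq_bigr => l _.
  by rewrite scaleMr D_xi // scale1r.
have e : star (vec_xi v) * vec_xi v = c *: 1.
  by rewrite -{2}pv mulrA vec_xi_form // mul1r.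
have c0 : 0 <= c by apply: starM_scalar_ge0 e.
have cc : Num.conj c = c by rewrite conj_Creal // ger0_real.
have wv : \sum_l `|w l 0| ^+ 2 <= \sum_l `|v l 0| ^+ 2.
  by apply: f_c; rewrite cnorm1.
have : 0 <= \sum_l `|v l 0 - w l 0| ^+ 2 by apply: sumr_ge0 => l _; rewrite exprn_ge0.
have -> : \sum_l `|v l 0 - w l 0| ^+ 2 = \sum_l `|v l 0| ^+ 2 - c - c + \sum_l `|w l 0| ^+ 2.
  rewrite -{2}cc /c cj_sum -!sumrB -big_split; apply: eq_bigr => l _.
  by rewrite /= !normCK cjB cjM cjK; ring.
move=> h; have cn : c <= (nrm2 v)%:C.
  rewrite nrm2E; have : c + c <= \sum_l `|v l 0| ^+ 2 + \sum_l `|v l 0| ^+ 2.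
    apply: le_trans (lerD (lexx _) wv); rewrite -subr_ge0; apply: le_trans h _.
    by rewrite le_eqVlt; apply/orP; left; apply/eqP; ring.
  by rewrite -!mulr2n ler_pMn2r.
rewrite -cnorm_starM e cnormZ cnorm1 mulr1 ger0_norm //.
by move: cn; case: (c) => x y; rewrite lecE /= => /andP[].
Qed.

(** [f x] is the matrix of [D k * b x] between the vectors [xi], on which [D k] acts by [k 1 = 1].
    Its operator norm is thus at most that of [D k * b x], and [g] is contractive. *)
Lemma corner_norm k x : bounded01 k -> k 1 = 1 -> cnorm (g (f x)) <= cnorm (D k * b x).
Proof.
move=> hk k1; apply/ler_addgt0Pr => e e0; set d := cnorm (D k * b x).
(* The extra [e] keeps the divisor positive when [d = 0]. *)
have d0 : 0 < d + e by rewrite ltr_wpDl // cnorm_ge0.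
suff : mxcontraction (((d + e)^-1)%:C *: f x).
  move/g_c; rewrite linearZ /= cnormZr gtr0_norm ?invr_gt0 //.
  by rewrite mulrC ler_pdivrMr // mul1r.
move=> v; set w := f x *m v.
have nw : nrm2 w <= d ^+ 2 * nrm2 v.
  have := vec_xi_form x w v hk; rewrite k1 mul1r -/w.
  have -> : \sum_l Num.conj (w l 0) * w l 0 = (nrm2 w)%:C.
    by rewrite nrm2E; apply: eq_bigr => l _; rewrite normCK mulrC.
  move=> /(congr1 (@cnorm R Q)); rewrite cnormZr cnorm1 mulr1 => h.
  have n0 u : 0 <= nrm2 u by apply: sumr_ge0 => i _; rewrite sqr_ge0.
  rewrite ger0_norm // in h.
  have h1 : nrm2 w <= cnorm (vec_xi w) * d * cnorm (vec_xi v).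
    rewrite -h; apply: le_trans (cnormM _ _) _; apply: ler_wpM2r; first exact: cnorm_ge0.
    by apply: le_trans (cnormM _ _) _; rewrite cnorm_star.
  have a0 := cnorm_ge0 (vec_xi w); have c0 := cnorm_ge0 (vec_xi v); have d0' : 0 <= d by exact: cnorm_ge0.
  have h2 := vec_xi_norm w; have h3 := vec_xi_norm v.
  have [->|w0] := eqVneq (nrm2 w) 0; first by rewrite mulr_ge0 ?sqr_ge0.
  have wp : 0 < nrm2 w by rewrite lt_def w0 n0.
  rewrite -(ler_pM2l wp); apply: le_trans (_ : (cnorm (vec_xi w) * d * cnorm (vec_xi v)) ^+ 2 <= _).
    by rewrite -expr2 ler_pXn2r ?nnegrE ?mulr_ge0.
  have -> : (cnorm (vec_xi w) * d * cnorm (vec_xi v)) ^+ 2 =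
      cnorm (vec_xi w) ^+ 2 * (d ^+ 2 * cnorm (vec_xi v) ^+ 2) by ring.
  by rewrite ler_pM ?mulr_ge0 ?sqr_ge0 // ler_wpM2l ?sqr_ge0.
rewrite -scalemxAl; under eq_bigr do rewrite mxE normrM exprMn.
rewrite -mulr_sumr -!nrm2E normCr gtr0_norm ?invr_gt0 // -rmorphXn -rcM lecR.
rewrite exprVn mulrC ler_pdivrMr ?exprn_gt0 //; apply: le_trans nw _.
rewrite mulrC ler_wpM2l //; first by apply: sumr_ge0 => i _; rewrite sqr_ge0.
by rewrite ler_pXn2r ?nnegrE ?cnorm_ge0 ?(ltW d0) // lerDl ltW.
Qed.

End CornerNorm.

(** * Nuclear algebras embed into iterated ultrapowers *)

Section NuclearEmbedding.
Variables (R : realType) (A : cstarAlgType R) (W : set_system (seq A * nat)).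
Context {WU : UltraFilter W}.
Hypothesis W_cvg : forall x n, \forall i \near W, x \in (i.1 : seq A) /\ (n <= i.2)%N.

Let I := (seq A * nat)%type.

Let W_mem (x : A) : \forall i \near W, x \in (i.1 : seq A).
Proof. by apply: filterS (W_cvg x 0) => i []. Qed.

Let W_infty N : \forall i \near W, (N <= i.2)%N.
Proof. by apply: filterS (W_cvg 0 N) => i []. Qed.

Let W_inv (e : R) : 0 < e -> \forall i \near W, (i.2.+1%:R)^-1 < e.
Proof. exact: (@inv_succ_cvg R I W WU (fun i => i.2) W_infty). Qed.

Variables (B Q1 Q2 Q3 : cstarAlgType R).
Variables (q1 : (I -> B) -> Q1) (q2 : (I -> Q1) -> Q2) (q3 : (I -> Q2) -> Q3).
Hypothesis hq1 : is_ultrapower W q1.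
Hypothesis hq2 : is_ultrapower W q2.
Hypothesis hq3 : is_ultrapower W q3.

(** Here [f] and the mesh [1 / J] stay fixed while the number of levels and the finite set grow
    along [W]: the weight becomes central before the completely positive factorization is
    refined. *)
Lemma cylinder (s1 s2 : B) n (f : {linear A -> 'M[R[i]]_n}) J :
  completely_positive (@star R A) (@cmxstar R n) f -> cuntz2_rel s1 s2 ->
  exists (b : A -> Q1) (D : (R -> R) -> Q1) (tau r1 r2 : Q1) (xi : nat -> 'I_n -> Q1),
  [/\ cyl setT 0 b D tau r1 r2,
      forall x j j' k l, (j <= J)%N -> (j' <= J)%N ->
        star (xi j k) * b x * xi j' l = (if j == j' then f x k l else 0) *: 1
    & forall k j l, bounded01 k -> (j <= J)%N -> D k * xi j l = (k (j%:R / J%:R))%:C *: xi j l].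
Proof.
move=> fcp s12.
have /choice[b] := fun i : I => cyl_ex J i.2 i.1 fcp s12.
move=> /choice[D] /choice[tau] /choice[r1] /choice[r2] /choice[xi] h.
have hc i : cyl [set x | x \in (i.1 : seq A)] i.2.+1%:R^-1 (b i) (D i) (tau i) (r1 i) (r2 i).
  by case: (h i).
have b1 : bounded01 (fun=> 1 : R) by exact: bounded01_cst.
have bxi j l : (j <= J)%N -> bounded_family (fun i => xi i j l).
  move=> jJ; exists (complex.Re `|f 1 l l| + 1) => i; have [hci h1 h2] := h i.
  have e : star (xi i j l) * xi i j l = f 1 l l *: 1.
    have := h1 1 j j l l jJ jJ; rewrite eqxx (cyl_b1 hci) -mulrA h2 // scale1r.
    by [].
  have := cnorm_starM (xi i j l); rewrite e cnormZ cnorm1 mulr1 => ->.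
  by have := cnorm_ge0 (xi i j l); nra.
have bb x := cyl_bd_b hc x; have bD k (hk : bounded01 k) := cyl_bd_D hc hk.
exists (fun x => q1 (fun i => b i x)), (fun k => q1 (fun i => D i k)), (q1 tau), (q1 r1), (q1 r2).
exists (fun j l => q1 (fun i => xi i j l)); split.
- apply: (cyl_lim hq1 hc); [exact: W_mem|exact: W_inv].
- move=> x j j' k l jJ jJ'; have xj := bxi _ k jJ; have xj' := bxi _ l jJ'.
  rewrite -(uq_star hq1) // -!(uqM hq1) //; try by do ?apply: bfamM => //; exact: bfam_star.
  rewrite -(uq1 hq1) -(uqZ hq1); last exact: bfam_cst.
  by congr q1; apply/funext => i; have [_ h1 _] := h i; apply: h1.
- move=> k j l hk jJ; have xj := bxi _ l jJ; have hD := bD _ hk.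
  rewrite -(uqM hq1) // -(uqZ hq1) //; congr q1; apply/funext => i.
  by have [_ _ h2] := h i; apply: h2.
Qed.

(* what the argument needs from a completely positive approximation of the
   identity on [F] up to [d] *)
Definition swap_data (F : seq A) (d : R) (b : A -> Q1) (D : (R -> R) -> Q1)
    (tau r1 r2 V eta : Q1) : Prop :=
  [/\ cyl setT 0 b D tau r1 r2, star V * V = 1,
      (forall i j x e, x \in F -> (0 < i)%N -> (0 < j)%N ->
        (forall t u, 0 <= t <= 1 -> 0 <= u <= 1 -> `|t - u| <= d ->
           `|cs_mon j i t - cs_mon j i u| <= e) ->
        cnorm (star V * (D (cs_mon i j) * b x) * V - D (cs_mon j i) * b x) <= e * cnorm x + d),
      star eta * eta = 1 /\ (forall k, bounded01 k -> D k * eta = (k 1)%:C *: eta)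
    & forall x, x \in F -> cnorm x <= cnorm (D (cs_mon 2 0) * b x) + d].

Lemma bounded01_mon i j : bounded01 (@cs_mon R i j).
Proof. by exists 1 => t /(cs_mon01 i j)/andP[h0 h1]; rewrite ger0_norm. Qed.

Lemma swap_data_ex (s1 s2 : B) (F : seq A) (m : nat) : nuclear A -> cuntz2_rel s1 s2 ->
  exists (b : A -> Q1) (D : (R -> R) -> Q1) (tau r1 r2 V eta : Q1),
    swap_data F m.+1%:R^-1 b D tau r1 r2 V eta.
Proof.
move=> A_nuc s12; set d : R := m.+1%:R^-1.
have d0 : 0 < d by rewrite invr_gt0 ltr0n.
have d1 : d <= 1 by rewrite invf_le1 ?ltr0n // ler1n.
(* The unit joins [F] so that [f 1] cannot vanish, which yields the vector [eta] below. *)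
have [n [f [g [fcp gcp fc gc fg]]]] := A_nuc (1 :: F) d d0.
have [b [D [tau [r1 [r2 [xi [hc h1 h2]]]]]]] := cylinder m.+1 fcp s12.
have gf1 : cnorm (g (f 1)) <= 1 by apply/gc/fc; rewrite cnorm1.
have [V [V1 hV]] := swap_isometry hc (uq_pair hq1 s12) fcp gcp gf1 (ltn0Sn m) h1 h2.
have J1 : m.+1%:R / m.+1%:R = 1 :> R by rewrite divff ?pnatr_eq0.
have [k fk] : exists k, f 1 k k != 0.
  apply: contrapT => hk; have f0 k : f 1 k k = 0.
    by apply/eqP; apply: contraT => h; case: hk; exists k.
  have F1 : f 1 = 0.
    apply/matrixP => k l; rewrite mxE -(cpform_unit f) lmul_op1.
    apply: (phi_null (cpform_conj fcp) (cpform_lin f) (cpform_ge0 fcp)).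
    by rewrite -{2}[unit_at _ l]lmul_op1 cpform_unit f0.
  have := fg 1 (mem_head _ _); rewrite F1 linear0 sub0r cnormN cnorm1; lra.
have b1 : bounded01 (fun=> 1 : R) by exact: bounded01_cst.
have e1 : star (xi m.+1 k) * xi m.+1 k = f 1 k k *: 1.
  have := h1 1 m.+1 m.+1 k k (leqnn _) (leqnn _).
  by rewrite eqxx (cyl_b1 hc) -mulrA h2 // scale1r.
have f1 : 0 < f 1 k k by rewrite lt_def fk (starM_scalar_ge0 e1).
(* [eta] is a normalized vector of the last copy, of weight 1: every [D k] acts on it by [k 1]. *)
pose c := (sqrtC (f 1 k k))^-1; pose eta := c *: xi m.+1 k.
have cr : Num.conj c = c by rewrite conj_Creal // ger0_real // invr_ge0 sqrtC_ge0 ltW.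
exists b, D, tau, r1, r2, V, eta; split=> //.
- move=> i j x e xF i0 j0 he; apply: le_trans (hV i j x e i0 j0 he) _.
  by rewrite lerD // ltW // fg // inE xF orbT.
- split.
    rewrite /eta starZ scaleMl scaleMr e1 !scalerA cr /c -invfM -expr2 sqrtCK mulVf //.
    by rewrite scale1r.
  move=> k' hk'; rewrite /eta scaleMr h2 // J1 !scalerA; congr (_ *: _); exact: mulrC.
- move=> x xF.
  have c1 := corner_norm hc fc gc (xi := xi m.+1) _ _ x (bounded01_mon 2 0) (cs_mon1 R 2).
  have := fg x; rewrite inE xF orbT => /(_ isT) => c2.
  have c3 : cnorm (g (f x)) <= cnorm (D (cs_mon 2 0) * b x).
    apply: c1 => [y k1 l|k' l hk']; first by rewrite h1 // eqxx.
    by rewrite h2 // J1.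
  have := cnorm_triangle (g (f x)) x 0; rewrite !subr0 cnormBC; lra.
Qed.

(** In [Q2] the exchange of weights becomes exact, because the monomials are uniformly continuous
    and the tolerances tend to 0. Injectivity comes from the corner [g 2 0], whose norm at [x] is at
    least [cnorm x] in the limit. *)
Lemma nuclear_embedding (s : B * B) : nuclear A -> cuntz2_rel s.1 s.2 -> self_absorbing B ->
  exists Phi : {lrmorphism A -> Q3}, star_preserving Phi /\ injective Phi.
Proof.
move=> A_nuc s12 B_abs.
have /choice[b] := fun i : I => swap_data_ex i.1 i.2 A_nuc s12.
move=> /choice[D] /choice[tau] /choice[r1] /choice[r2] /choice[V] /choice[eta] h.
have hc i : cyl setT 0 (b i) (D i) (tau i) (r1 i) (r2 i) by case: (h i).
have V1 i : star (V i) * V i = 1 by case: (h i).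
have eta1 i : star (eta i) * eta i = 1 by case: (h i) => _ _ _ [].
have bV := bd_iso V1; have beta := bd_iso eta1.
have bb x := cyl_bd_b hc x; have bD k (hk : bounded01 k) := cyl_bd_D hc hk.
have hm := bounded01_mon.
have hc2 : cyl setT 0 (fun x => q2 (fun i => b i x)) (fun k => q2 (fun i => D i k))
    (q2 tau) (q2 r1) (q2 r2).
  by apply: (cyl_lim hq2 hc) => [x|e e0]; apply: nearW.
pose b2 x := q2 (fun i => b i x); pose D2 k := q2 (fun i => D i k).
pose g i j x := D2 (cs_mon i j) * b2 x.
have gq i j x : g i j x = q2 (fun i' => D i' (cs_mon i j) * b i' x).
  by rewrite /g /D2 /b2 -(uqM hq2) //; exact: bD.
have bg i j x : bounded_family (fun i' => D i' (cs_mon i j) * b i' x).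
  by apply: bfamM => //; exact: bD.
have D2b i j x : D2 (cs_mon i j) * b2 x = b2 x * D2 (cs_mon i j).
  exact: (central_mon hc2 i j).2.
have D2M i j i' j' : D2 (cs_mon i j) * D2 (cs_mon i' j') = D2 (cs_mon (i + i') (j + j')).
  rewrite -(cyl_DM hc2) //; congr D2; apply/funext => t; exact: cs_monM.
have bM i j x y : (0 < i)%N -> D2 (cs_mon i j) * (b2 x * b2 y) = D2 (cs_mon i j) * b2 (x * y).
  move=> i0; have e : b2 x * b2 y * D2 (cs_mon i j) = b2 (x * y) * D2 (cs_mon i j).
    by apply: (cyl_bM hc2) => //; exact: cs_mon0.
  by rewrite mulrA D2b -mulrA D2b mulrA e D2b.
have V2 : star (q2 V) * q2 V = 1.
  rewrite -(uq_star hq2) // -(uqM hq2) //; last exact: bfam_star.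
  by rewrite -(uq1 hq2); congr q2; apply/funext.
have V_swap i j x : (0 < i)%N -> (0 < j)%N -> star (q2 V) * g i j x * q2 V = g j i x.
  move=> i0 j0; rewrite !gq -(uq_star hq2) //.
  have sV := bfam_star bV; have bVg := bfamM sV (bg i j x).
  rewrite -!(uqM hq2) //; apply/(uq_eq hq2) => //; first exact: bfamM.
  move=> e e0; pose e' := e / 2 / (cnorm x + 1).
  have x1 : 0 < cnorm x + 1 by rewrite ltr_wpDl ?cnorm_ge0.
  have e'0 : 0 < e' by rewrite !divr_gt0.
  have [d d0 hd] := ucont01_mon j i e'0.
  have dm0 : 0 < Num.min d (e / 2) by rewrite lt_min d0 divr_gt0.
  apply: filterS2 (W_mem x) (W_inv dm0) => i' xi'; rewrite lt_min => /andP[hd1 hd2].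
  rewrite subr0; have [_ _ hsw _ _] := h i'.
  apply: le_lt_trans (hsw i j x e' xi' i0 j0 _) _.
    by move=> t u t01 u01 tu; apply: hd => //; exact: le_trans tu (ltW hd1).
  have : e' * cnorm x <= e / 2.
    rewrite /e' mulrAC ler_pdivrMr // ler_pM2l ?divr_gt0 // lerDl ler01.
    by [].
  move: hd2; set z := _^-1; lra.
have [||||||psi [psi_lin psiM psi_star psi_r1 psi_eta]] :=
  @doubling_hom R A Q2 g (q2 r1) (q2 r2) (q2 V) _ _ _ _ (cyl_r hc2) _ _ V2 V_swap.
- by move=> i j c x y; rewrite /g /b2 (cyl_lin hc2) mulrDr scaleMr.
- move=> i j k l x y ik; rewrite /g -mulrA (mulrA (b2 x)) -D2b -!mulrA mulrA D2M.
  exact: bM.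
- by move=> i j x; rewrite /g starM -(cyl_star hc2) (cyl_Dstar hc2) // -D2b.
- move=> i j x; rewrite /g -mulrDl; congr (_ * _).
  have := cyl_Dlin hc2 1 (hm i.+2 j) (hm i j.+2); rewrite scale1r -/D2 => <-.
  apply: (cyl_ext hc2) => //; first exact: bounded01_lin.
  by move=> t t01; rewrite mul1r cs_mon_sum.
- by move=> i j x; rewrite /g -mulrA (cyl_r1b hc2) mulrA (cyl_r1D hc2) // mulrA.
- by move=> i j x; rewrite /g -mulrA (cyl_r2b hc2) mulrA (cyl_r2D hc2) // mulrA.
have D2eta k : bounded01 k -> D2 k * q2 eta = (k 1)%:C *: q2 eta.
  move=> hk; have hD := bD _ hk; rewrite /D2 -(uqM hq2) // -(uqZ hq2) //; congr q2.
  by apply/funext => i; case: (h i) => _ _ _ [_ h2] _; exact: h2.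
have geta i j : g i j 1 * q2 eta = (cs_mon i j 1)%:C *: q2 eta.
  rewrite /g /b2 (cyl_b1 hc2) -mulrA -/D2 D2eta; last exact: bounded01_cst.
  by rewrite scale1r D2eta.
have psi1 : psi 1 * (q2 r1 * q2 eta) = q2 r1 * q2 eta.
  apply: psi_eta; rewrite geta; first by rewrite cs_mon1 scale1r.
  by rewrite cs_mon1_0 // scale0r.
have y1 : star (q2 r1 * q2 eta) * (q2 r1 * q2 eta) = 1.
  rewrite starM -mulrA (mulrA (star (q2 r1))) (cuntz_11 (cyl_r hc2)) mul1r.
  rewrite -(uq_star hq2) // -(uqM hq2) //; last exact: bfam_star.
  by rewrite -(uq1 hq2); congr q2; apply/funext.
have [Phi [Phi_star Phi_inj]] := unital_corner hq3 W_infty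
  (self_absorbing_uq hq2 (self_absorbing_uq hq1 B_abs)) psi_lin psiM psi_star y1 psi1.
exists Phi; split=> // x y xy; apply/eqP; rewrite -subr_eq0; apply/eqP/cnorm_eq0P.
have /Phi_inj p0 : Phi (x - y) = 0.
  by rewrite rmorphB; apply/eqP; rewrite subr_eq0; apply/eqP; exact: xy.
have g0 : g 2 0 (x - y) = 0 by rewrite -psi_r1 p0 mulr0 mul0r.
apply/ler_addgt0Pr => e e0; rewrite add0r.
have e2 : 0 < e / 2 by rewrite divr_gt0.
have lt : cnorm (q2 (fun i => D i (cs_mon 2 0) * b i (x - y))) < e / 2.
  by rewrite -gq g0 cnorm0.
have [i [[h1 h2] h3]] := filter_ex (filterI (filterI (uq_norm_lt hq2 (bg 2 0%N (x - y)) lt)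
  (W_inv e2)) (W_mem (x - y))).
have [_ _ _ _ hn] := h i; apply: le_trans (hn _ h3) _.
by rewrite (splitr e) lerD // ltW.
Qed.

End NuclearEmbedding.

(** The condition is carried along the embedding and then descends through the three ultrapowers one
    at a time. *)
Theorem nuclear_conditions (R : realType) (K : connectives R) (A B : cstarAlgType R) (s : B * B)
    (v : new_constants -> A) (p : set (expression K)) :
  nuclear A -> cuntz2_rel s.1 s.2 -> self_absorbing B -> finite_set p -> models v p ->
  exists w : new_constants -> B, models w p.
Proof.
move=> A_nuc s12 B_abs pf vp.
have [W WU W_cvg] := seq_ultrafilter A.
have [Q1 [q1 hq1]] := @ultrapower_ex R _ W WU B.
have [Q2 [q2 hq2]] := @ultrapower_ex R _ W WU Q1.
have [Q3 [q3 hq3]] := @ultrapower_ex R _ W WU Q2.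
have [Phi [Phis Phii]] := @nuclear_embedding R A W WU W_cvg B Q1 Q2 Q3 q1 q2 q3 hq1 hq2 hq3 s
  A_nuc s12 B_abs.
have m3 : models (Phi \o v) p.
  case: vp => vi vp; split; first exact: interpretation_morph.
  by move=> e pe; rewrite qf_val_morph //; exact: vp.
have [v2 [_ _ /filter_ex[i m2]]] := los_models hq3 pf m3.
have [v1 [_ _ /filter_ex[j m1]]] := los_models hq2 pf m2.
have [v0 [_ _ /filter_ex[k m0]]] := los_models hq1 pf m1.
by exists (v0 k).
Qed.

(** * The Cuntz algebra *)

Lemma kernel_closed (R : realType) (B D : cstarAlgType R) (h : B -> D) (C : R) :
  (forall x y, h (x - y) = h x - h y) -> (forall x, cnorm (h x) <= C * cnorm x) ->
  cnorm_closure [set x | h x = 0] `<=` [set x | h x = 0].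
Proof.
move=> hB hC x xc /=; apply: cnorm_eq0P; apply/ler_addgt0Pr => e e0; rewrite add0r.
have C1 : 0 < `|C| + 1 by rewrite ltr_wpDl.
have [y /= hy xy] := xc _ (divr_gt0 e0 C1).
rewrite -[h x]subr0 -hy -hB; apply: le_trans (hC _) _.
have : (`|C| + 1) * cnorm (x - y) <= e by rewrite mulrC -ler_pdivlMr // ltW.
by have := ler_norm C; have := cnorm_ge0 (x - y); nra.
Qed.

(** * The Cuntz algebra absorbs doubles *)

Section SelfAbsorbing.
Variables (R : realType) (B : cstarAlgType R) (s1 s2 : B).
Hypothesis s12 : cuntz2_rel s1 s2.
Hypothesis B_gen : generated_by [set s1; s2].

Local Notation lam := (clam s1 s2).

Lemma clamM x y : lam x * lam y = lam (x * y).
Proof. exact: (csumM s12). Qed.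

Lemma clam_star x : star (lam x) = lam (star x).
Proof. by rewrite /clam; rsimp s12. Qed.

Lemma clam_lin c x y : lam (c *: x + y) = c *: lam x + lam y.
Proof.
rewrite /clam; do 2 rewrite ?(mulrDl, mulrDr, scaleMr, scaleMl, scalerDr).
by rewrite addrACA.
Qed.

Lemma clam_norm x : cnorm (lam x) <= 2 * cnorm x.
Proof.
have n (s : B) : star s * s = 1 -> cnorm (s * x * star s) = cnorm x by exact: cnorm_conj.
apply: le_trans (cnormD _ _) _.
by rewrite !n ?(cuntz_11 s12) ?(cuntz_22 s12) // mulrDl mul1r.
Qed.

(** The doubled pair is again a Cuntz pair, so a unitary conjugates the original pair to it. The
    elements on which this conjugation implements [lam] form a closed star-subalgebra containing the
    generators. *)
Lemma clam_unitary (I : Type) (W : set_system I) {WU : UltraFilter W} (n : I -> nat)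
    (D : cstarAlgType R) (q : (I -> B) -> D) :
  (forall N, \forall i \near W, (N <= n i)%N) -> is_ultrapower W q ->
  exists u : D, [/\ star u * u = 1, u * star u = 1
    & forall x, u * q (fun=> x) = q (fun=> lam x) * u].
Proof.
move=> n_infty hq; have [f [fs finj fE]] := uq_diag hq.
pose S (c : bool) := if c then s1 else s2.
have hS : is_cz S by [].
have l1 : lam 1 = 1 by have := iter_clam1 s12 1.
have hT : is_cz (fun c => lam (S c)).
  have lD x y : lam x + lam y = lam (x + y) by have := clam_lin 1 x y; rewrite !scale1r.
  split; rewrite !clam_star !clamM ?lD ?(cuntz_11 s12) ?(cuntz_22 s12) ?(cuntz_sum s12) //.
have [u [u1 u2 u3]] := @cuntz_unique R I W WU n n_infty B D q hq S _ hS hT.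
exists u; split=> // x; rewrite -!fE; apply/eqP; rewrite -subr_eq0; apply/eqP.
pose h x := u * f x - f (lam x) * u.
have hlin c y z : h (c *: y + z) = c *: h y + h z.
  have fl a b : f (c *: a + b) = c *: f a + f b by exact: linearP.
  rewrite /h clam_lin !fl mulrDr mulrDl scaleMr scaleMl scalerBr; abel.
have h_comm y : h y = 0 <-> u * f y = f (lam y) * u.
  by rewrite /h; split=> [/eqP|->]; rewrite ?subrr // subr_eq0 => /eqP.
suff H : [set y | h y = 0] = setT by have : [set y | h y = 0] x by rewrite H.
apply: B_gen => [|_ [->|->]]; last 2 first.
- by apply/h_comm; rewrite !fE; exact: (u3 true).
- by apply/h_comm; rewrite !fE; exact: (u3 false).
split.
- apply: (@kernel_closed R B D h 3) => [y z|y].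
    by have := hlin (-1) z y; rewrite !scaleN1r !(addrC (- _)).
  have un : cnorm u = 1 by exact: isometry_norm.
  have f1 := starhom_contractive fs; rewrite /h; apply: le_trans (cnormB _ _) _.
  have a1 : cnorm (u * f y) <= cnorm y.
    by apply: le_trans (cnormM _ _) _; rewrite un mul1r f1.
  have a2 : cnorm (f (lam y) * u) <= 2 * cnorm y.
    by apply: le_trans (cnormM _ _) _; rewrite un mulr1; apply: le_trans (f1 _) (clam_norm y).
  lra.
- by apply/h_comm; rewrite l1 !rmorph1 mul1r mulr1.
- by move=> c y z /= hy hz; rewrite hlin hy hz scaler0 addr0.
- move=> y z /= /h_comm hy /h_comm hz; apply/h_comm.
  by rewrite -clamM !rmorphM mulrA hy -!mulrA hz.
- move=> y /= /h_comm hy; apply/h_comm.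
  have hy' : star u * f (lam y) = f y * star u.
    by rewrite -[LHS]mulr1 -u2 mulrA -(mulrA (star u)) -hy mulrA u1 mul1r.
  have := congr1 (@star R D) hy'; rewrite !starM starK -!fs clam_star => e.
  by rewrite -e.
Qed.

Lemma cuntz_self_absorbing : self_absorbing B.
Proof.
have [W WU W_cvg] := seq_ultrafilter unit.
have [D [q hq]] := @ultrapower_ex R _ W WU B.
have n_infty N : \forall i \near W, (N <= i.2)%N by apply: filterS (W_cvg tt N) => i [].
have [u [u1 u2 ux]] := @clam_unitary _ W WU (fun i => i.2) D q n_infty hq.
exists (s1, s2) => //= x e e0; have [v vb vu] := uq_surj hq u.
have sv := bfam_star vb; have c (y : B) : bounded_family (fun _ : seq unit * nat => y) by exact: bfam_cst.
have near0 (y z : seq unit * nat -> B) : bounded_family y -> bounded_family z -> q y = q z ->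
    \forall i \near W, cnorm (y i - z i) < e.
  by move=> yb zb /(uq_eq hq yb zb) /(_ e e0); apply: filterS => i; rewrite subr0.
have n1 : \forall i \near W, cnorm (star (v i) * v i - 1) < e.
  apply: near0 => //; first exact: bfamM.
  by rewrite (uqM hq) // (uq_star hq) // vu u1 (uq1 hq).
have n2 : \forall i \near W, cnorm (v i * star (v i) - 1) < e.
  apply: near0 => //; first exact: bfamM.
  by rewrite (uqM hq) // (uq_star hq) // vu u2 (uq1 hq).
have n3 : \forall i \near W, cnorm (v i * x - lam x * v i) < e.
  apply: near0; do ?exact: bfamM.
  by rewrite !(uqM hq) // vu ux.
have [i [[h1 h2] h3]] := filter_ex (filterI (filterI n1 n2) n3).
by exists (v i).
Qed.

End SelfAbsorbing.

Lemma psd_factor (R : realType) (T : finType) (G : T -> T -> R[i]) :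
  (forall s t, G t s = Num.conj (G s t)) ->
  (forall x : T -> R[i], 0 <= \sum_s \sum_t Num.conj (x s) * x t * G s t) ->
  exists Z : T -> T -> R[i], forall s t, G s t = \sum_r Num.conj (Z r s) * Z r t.
Proof.
move=> GC G0; pose E := {ffun T -> R[i]^o} : lmodType R[i].
pose phi (x y : E) : R[i] := \sum_s \sum_t Num.conj (x s) * y t * G s t.
have phiC (x y : E) : phi y x = Num.conj (phi x y).
  rewrite /phi exchange_big cj_sum; apply: eq_bigr => s _; rewrite cj_sum.
  by apply: eq_bigr => t _; rewrite !cjM cjK -GC; ring.
have phi_lin (x : E) a (y z : E) : phi x (a *: y + z) = a * phi x y + phi x z.
  rewrite /phi mulr_sumr -big_split; apply: eq_bigr => s _ /=.
  rewrite mulr_sumr -big_split; apply: eq_bigr => t _ /=.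
  by rewrite !ffunE /GRing.scale /=; ring.
have phi0 (x : E) : 0 <= phi x x by exact: G0.
have [Z ZE] := gram_factor phiC phi_lin phi0 (fun t : T => [ffun s => (s == t)%:R] : E).
exists Z => s t; rewrite -ZE /phi (bigD1 s) //= [X in _ + X]big1 ?addr0 => [|s' ss]; last first.
  by rewrite big1 // => t' _; rewrite !ffunE (negbTE ss) cj0 !mul0r.
rewrite (bigD1 t) //= big1 ?addr0 => [|t' tt]; last by rewrite !ffunE (negbTE tt) mulr0 mul0r.
by rewrite !ffunE !eqxx cj1 !mul1r.
Qed.

Section ScalarClosed.
Variables (R : realType) (I : Type) (W : set_system I).
Context {WU : UltraFilter W}.
Variables (n : I -> nat) (n_infty : forall N, \forall i \near W, (N <= n i)%N).

(** The approximating coefficients are bounded, and their limit along [W] is the coefficient of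
    [z]. *)
Lemma scalar_closed (B : cstarAlgType R) (z : B) :
  (forall e : R, 0 < e -> exists c : R[i], cnorm (z - c *: 1) < e) -> exists c, z = c *: 1.
Proof.
move=> h; have /choice[c hc] : forall i, exists c : R[i], cnorm (z - c *: 1) < (n i).+1%:R^-1.
  by move=> i; apply: h; rewrite invr_gt0 ltr0n.
have le1 i : (n i).+1%:R^-1 <= 1 :> R by rewrite invf_le1 ?ltr0n // ler1n.
have cb i : complex.Re `|c i| <= cnorm z + 1.
  have -> : complex.Re `|c i| = cnorm (c i *: (1 : B)) by rewrite cnormZ cnorm1 mulr1.
  have := cnorm_triangle z (c i *: (1 : B)) 0; rewrite !subr0 cnormBC.
  by have := lt_le_trans (hc i) (le1 i); lra.
have nrm (x y : R) : `|x| <= complex.Re `|x +i* y| /\ `|y| <= complex.Re `|x +i* y|.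
  rewrite normc_def /= -!sqrtr_sqr; split; apply: ler_wsqrtr; rewrite ?lerDl ?lerDr sqr_ge0 //.
have [|a ha] := @ultra_bounded_cvg R I W WU (fun i => complex.Re (c i)) (cnorm z + 1).
  by move=> i; apply: le_trans (cb i); case: (c i) => x y; case: (nrm x y).
have [|b hb] := @ultra_bounded_cvg R I W WU (fun i => complex.Im (c i)) (cnorm z + 1).
  by move=> i; apply: le_trans (cb i); case: (c i) => x y; case: (nrm x y).
exists (a +i* b); apply/eqP; rewrite -subr_eq0; apply/eqP/cnorm_eq0P.
apply/ler_addgt0Pr => e e0; rewrite add0r.
have e3 : 0 < e / 3 by rewrite divr_gt0.
move/cvgrPdist_lt: ha => /(_ _ e3) ha; move/cvgrPdist_lt: hb => /(_ _ e3) hb.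
have [i [[h1 h2] h3]] := filter_ex (filterI (filterI ha hb) (@inv_succ_cvg R I W WU n n_infty _ e3)).
have := cnorm_triangle (c i *: (1 : B)) z ((a +i* b) *: 1).
rewrite -scalerBl; have -> : c i - (a +i* b) = (complex.Re (c i) - a)%:C + 'i * (complex.Im (c i) - b)%:C.
  by case: (c i) => x y; rewrite -[RHS]/((_ + _) +i* (_ + _)) /=; congr (_ +i* _); ring.
rewrite scalerDl -scalerA; have := cnormD ((complex.Re (c i) - a)%:C *: (1 : B)) ('i *: ((complex.Im (c i) - b)%:C *: 1)).
rewrite cnormZ (cnormZ 'i) normCi mul1r !cnormZ normCr cnorm1 !mulr1 normCr /=.
rewrite distrC in h1; rewrite distrC in h2; have := lt_trans (hc i) h3; clear -h1 h2; lra.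
Qed.

End ScalarClosed.

(** A homogeneous element that shifts the length of words by [p - r] is recovered from the window of
    lengths once for each such pair, hence in a proportion tending to 1 after division by [L]. *)
Lemma pair_count d L p r :
  let cnt := (\sum_(k <- iota d L) \sum_(l <- iota d L) (k + r == l + p))%N in
  (cnt <= L)%N /\ (L <= cnt + (p + r))%N.
Proof.
have inner k : (\sum_(l <- iota d L) (k + r == l + p) = ((p + d <= k + r) && (k + r < p + d + L)))%N.
  have [pk|kp] := leqP p (k + r).
    transitivity (count_mem (k + r - p)%N (iota d L)).
      rewrite -sum1_count [RHS]big_mkcond; apply: eq_bigr => l _.
      have -> : (k + r == l + p)%N = (l == k + r - p)%N by lia.
      by rewrite /=; case: (_ == _).
    rewrite count_uniq_mem ?iota_uniq // mem_iota; congr nat_of_bool; lia.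
  rewrite big1 => [|l _]; first by case: andP => // -[]; lia.
  by case: eqP => //; lia.
rewrite /=; under eq_bigr do rewrite inner.
have shift (G : nat -> nat) : (\sum_(k <- iota d L) G k = \sum_(i < L) G (d + i))%N.
  by rewrite -{1}[d]addn0 iotaDl big_map -(big_mkord xpredT (fun i => G (d + i)%N)) /index_iota subn0.
rewrite shift; split.
  by rewrite -[leqRHS]card_ord -sum1_card leq_sum // => i _; case: (_ && _).
have c1 m p' : (\sum_(i < m) (i < p') <= minn m p')%N.
  elim: m => [|m IH]; first by rewrite big_ord0.
  by rewrite big_ord_recr /=; apply: leq_trans (leq_add IH (leqnn _)) _; case: ltnP => /=; lia.
have c2 : (\sum_(i < L) (L <= i + r) <= r)%N.
  apply: leq_trans (_ : \sum_(i < L) (i < r) <= r)%N; last exact: leq_trans (c1 L r) (geq_minr _ _).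
  rewrite (reindex_inj rev_ord_inj) /= leq_sum // => i _.
  by have := ltn_ord i; case: leqP => //; case: ltnP => //; lia.
have c3 := leq_trans (c1 L p) (geq_minr _ _).
apply: leq_trans (leq_add (leqnn _) (leq_add c3 c2)); rewrite -!big_split /=.
rewrite -[leqLHS]card_ord -sum1_card leq_sum // => i _.
by have := ltn_ord i; case: andP => h; case: ltnP => //; case: leqP => //; lia.
Qed.

(** * Nuclearity by compression to words *)

Section CuntzWords.
Variables (R : realType) (B : cstarAlgType R) (s1 s2 : B).
Hypothesis s12 : cuntz2_rel s1 s2.
Hypothesis B_gen : generated_by [set s1; s2].
Variables (I : Type) (W : set_system I).
Context {WU : UltraFilter W}.
Variables (n : I -> nat) (n_infty : forall N, \forall i \near W, (N <= n i)%N).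
Variables (D : cstarAlgType R) (q : (I -> B) -> D).
Hypothesis hq : is_ultrapower W q.
Variable F : {lrmorphism B -> D}.
Hypothesis Fs : star_preserving F.
Hypothesis FE : forall b, F b = q (fun=> b).

Definition cgen (c : bool) := if c then s1 else s2.
Local Notation S := cgen.

Lemma cgenM b c : star (S b) * S c = (b == c)%:R.
Proof.
by case: b; case: c; rewrite /= ?(cuntz_11 s12) ?(cuntz_22 s12) ?(cuntz_12 s12) ?(cuntz_21 s12).
Qed.

Lemma cgen_norm c : cnorm (S c) = 1.
Proof. by apply: isometry_norm; rewrite cgenM eqxx. Qed.

(** The elements that preserve [V] by left multiplication together with their adjoints form a closed
    star-subalgebra containing the generators; they are applied to [1]. *)
Lemma gen_module (V : set B) : cnorm_closure V `<=` V ->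
  (forall c x y, V x -> V y -> V (c *: x + y)) -> V 1 ->
  (forall b x, V x -> V (S b * x)) -> (forall b x, V x -> V (star (S b) * x)) ->
  forall x, V x.
Proof.
move=> Vc Vl V1 VS VS' x; rewrite -[x]mulr1.
have V0 : V 0 by have := Vl (-1) 1 1 V1 V1; rewrite scaleN1r addNr.
pose L := [set a | forall x, V x -> V (a * x) /\ V (star a * x)].
suff LT : L = setT by have : L x by [rewrite LT]; move=> /(_ 1 V1)[].
apply: B_gen => [|_ [->|->]]; last 2 first.
- by move=> y Vy; split; [exact: (VS true)|exact: (VS' true)].
- by move=> y Vy; split; [exact: (VS false)|exact: (VS' false)].
split.
- move=> a ac y Vy.
  have y1 : 0 < cnorm y + 1 by rewrite ltr_wpDl ?cnorm_ge0.
  have lt (b z : B) e : 0 < e -> cnorm (z - b) < e / (cnorm y + 1) -> cnorm (z * y - b * y) < e.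
    move=> e0 h; rewrite -mulrBl; apply: le_lt_trans (cnormM _ _) _.
    have : cnorm (z - b) * (cnorm y + 1) < e by rewrite -ltr_pdivlMr.
    by have := cnorm_ge0 (z - b); lra.
  split; apply: Vc => e e0; have [b Lb ab] := ac _ (divr_gt0 e0 y1).
    by exists (b * y); [case: (Lb y Vy)|exact: lt].
  exists (star b * y); first by case: (Lb y Vy).
  by apply: lt => //; rewrite -starB cnorm_star.
- by move=> y Vy; rewrite star1 mul1r.
- move=> c a b La Lb y Vy; have [a1 a2] := La y Vy; have [b1 b2] := Lb y Vy.
  by rewrite starD starZ !mulrDl !scaleMl; split; exact: Vl.
- move=> a b La Lb y Vy; rewrite starM -!mulrA; have [b1 b2] := Lb y Vy.
  have [a1 a2] := La y Vy; split; first by case: (La _ b1).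
  by case: (Lb _ a2).
- by move=> a La y Vy; rewrite starK; have [] := La y Vy.
Qed.

(* [y r] is [s1^(N - r) s2] for an infinite [N] *)
Definition inf_vec (r : nat) : D := q (fun i => csig s1 s2 (n i - r)).
Local Notation y := inf_vec.

Let csig_bd (m : I -> nat) : bounded_family (fun i => csig s1 s2 (m i)).
Proof. by apply: bd_iso => i; rewrite (csig_orth s12) eqxx. Qed.

Lemma inf_vec_orth r r' : star (y r) * y r' = (r == r')%:R.
Proof.
rewrite -(uq_star hq) // -(uqM hq) //; last exact: bfam_star.
have -> : (r == r')%:R = q (fun=> (r == r')%:R) :> D by rewrite -FE rmorph_nat.
apply: (uq_near_eq hq).
- by apply: bfamM => //; exact: bfam_star.
- exact: bfam_cst.
apply: filterS2 (n_infty r) (n_infty r') => i h1 h2; rewrite (csig_orth s12).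
congr (_%:R); congr nat_of_bool; apply/eqP/eqP => [h|->//].
by rewrite -(subKn h1) h subKn.
Qed.

(** The word begins with infinitely many letters [s1]: [star s1] removes one of them, and [star s2]
    annihilates the word. *)
Lemma S_inf_vec c r : star (F (S c)) * y r = if c then y r.+1 else 0.
Proof.
rewrite -Fs FE -(uqM hq) //; last exact: bfam_cst.
have -> : (if c then y r.+1 else 0) = q (fun i => if c then csig s1 s2 (n i - r.+1) else 0).
  by case: c; rewrite // -FE rmorph0.
apply: (uq_near_eq hq).
- by apply: bfamM => //; exact: bfam_cst.
- by case: c => //; exact: bfam_cst.
apply: filterS (n_infty r.+1) => i h.
rewrite /csig -(subnSK h) exprS !mulrA; case: c => /=.
  by rewrite (cuntz_11 s12) mul1r.
by rewrite (cuntz_21 s12) !mul0r.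
Qed.

Definition uw (w : seq bool) : B := foldr (fun c x => S c * x) 1 w.
Definition eta w r : D := F (uw w) * y r.

Lemma eta_cons c w r : eta (c :: w) r = F (S c) * eta w r.
Proof. by rewrite /eta /= rmorphM mulrA. Qed.

Lemma F_S b c : star (F (S b)) * F (S c) = (b == c)%:R.
Proof. by rewrite -Fs -rmorphM cgenM rmorph_nat. Qed.

Lemma S_eta c w r : star (F (S c)) * eta w r = 0 \/
  exists w' r', star (F (S c)) * eta w r = eta w' r'.
Proof.
case: w => [|b w].
  rewrite /eta /= rmorph1 mul1r S_inf_vec; case: c; last by left.
  by right; exists [::], r.+1; rewrite /= rmorph1 mul1r.
rewrite eta_cons mulrA F_S; case: eqP => _; last by left; rewrite mul0r.
by right; exists w, r; rewrite mul1r.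
Qed.

Definition scal (z : D) := exists c, z = c *: 1.

Lemma scal0 : scal 0. Proof. by exists 0; rewrite scale0r. Qed.

Lemma eta_scal w r w' r' : scal (star (eta w r) * eta w' r').
Proof.
elim: w w' r' => [|c w IH] w' r'.
  elim: w' r r' => [|c w' IH] r r'.
    by exists (r == r')%:R; rewrite /eta /= rmorph1 !mul1r inf_vec_orth scaler_nat.
  rewrite eta_cons mulrA -(starK (F (S c))) -starM /eta /= rmorph1 mul1r S_inf_vec.
  case: c; last by rewrite star0 mul0r; exact: scal0.
  by have := IH r.+1 r'; rewrite /eta /= rmorph1 mul1r.
rewrite eta_cons starM -mulrA; have [->|[w2 [r2 ->]]] := S_eta c w' r'; last exact: IH.
by rewrite mulr0; exact: scal0.
Qed.

Lemma eta_norm w r : cnorm (eta w r) <= 1.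
Proof.
elim: w => [|c w IH].
  rewrite /eta /= rmorph1 mul1r isometry_norm // inf_vec_orth eqxx; reflexivity.
rewrite eta_cons; apply: le_trans (cnormM _ _) _.
by rewrite isometry_norm ?mul1r // F_S eqxx.
Qed.

(** The adjoints of the generators send each [eta w r] to such a vector or to 0, so the compressions
    of products of generators and adjoints are scalars, and so are their limits. These scalars serve
    as matrix coefficients of a representation of [B]. *)
Lemma eta_form_scal x w r w' r' : scal (star (eta w r) * F x * eta w' r').
Proof.
pose V := [set x | forall w r w' r', scal (star (eta w r) * F x * eta w' r')].
suff : V x by apply.
apply: gen_module => [z zc|c z t Vz Vt|||].
- move=> {}w {}r {}w' {}r'; apply: (scalar_closed n_infty) => e e0.
  have [t Vt zt] := zc e e0; have [c hc] := Vt w r w' r'; exists c; rewrite -hc.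
  rewrite -mulrBl -mulrBr -rmorphB; apply: le_lt_trans zt.
  apply: le_trans (cnormM _ _) _; rewrite -[leRHS]mulr1 ler_pM ?cnorm_ge0 ?eta_norm //.
  apply: le_trans (cnormM _ _) _; rewrite cnorm_star -[leRHS]mul1r ler_pM ?cnorm_ge0 ?eta_norm //.
  exact: starhom_contractive.
- move=> {}w {}r {}w' {}r'; have [a ha] := Vz w r w' r'; have [b hb] := Vt w r w' r'.
  by exists (c * a + b); rewrite linearP mulrDr mulrDl scaleMr scaleMl ha hb scalerDl scalerA.
- by move=> {}w {}r {}w' {}r'; rewrite rmorph1 mulr1; exact: eta_scal.
- move=> b z Vz {}w {}r {}w' {}r'; rewrite rmorphM mulrA -(mulrA (star _) (F _)).
  rewrite -(starK (F (S b))) mulrA -starM.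
  have [->|[w2 [r2 ->]]] := S_eta b w r; last exact: Vz.
  by rewrite star0 !mul0r; exact: scal0.
- move=> b z Vz {}w {}r {}w' {}r'; rewrite rmorphM mulrA -(mulrA (star _) (F _)) Fs.
  by rewrite mulrA -starM -eta_cons; exact: Vz.
Qed.

Definition ev w w' x : R[i] := xget 0 [set c | star (eta w 0) * F x * eta w' 0 = c *: 1].

Lemma evE w w' x : star (eta w 0) * F x * eta w' 0 = ev w w' x *: 1.
Proof.
have [c hc] := eta_form_scal x w 0 w' 0.
exact: (@xgetI _ 0 [set c | star (eta w 0) * F x * eta w' 0 = c *: 1] c hc).
Qed.

Lemma scal_inj (a b : R[i]) : a *: (1 : D) = b *: 1 -> a = b.
Proof.
move=> h; apply/eqP; rewrite -subr_eq0; apply/eqP/(@scale1_inj R D).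
by rewrite scalerBl h subrr.
Qed.

Lemma ev_unique w w' x c : star (eta w 0) * F x * eta w' 0 = c *: 1 -> ev w w' x = c.
Proof. by rewrite evE => /scal_inj. Qed.

Lemma ev_lin w w' c x x' : ev w w' (c *: x + x') = c * ev w w' x + ev w w' x'.
Proof.
by apply: ev_unique; rewrite linearP mulrDr mulrDl scaleMr scaleMl !evE scalerDl scalerA.
Qed.

Lemma ev0 w w' : ev w w' 0 = 0.
Proof. by apply: ev_unique; rewrite rmorph0 mulr0 mul0r scale0r. Qed.

Lemma ev_star w w' x : ev w' w (star x) = Num.conj (ev w w' x).
Proof.
apply: ev_unique; rewrite Fs -[RHS]starK starZ star1 cjK -evE !starM !starK mulrA.
by [].
Qed.

Lemma FM x z : F (x * z) = F x * F z. Proof. exact: rmorphM. Qed.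

Lemma F_sum (J : Type) (r : seq J) (P : pred J) (G : J -> B) :
  F (\sum_(j <- r | P j) G j) = \sum_(j <- r | P j) F (G j).
Proof. exact: raddf_sum. Qed.

Lemma ev_consl c w w' x : ev (c :: w) w' x = ev w w' (star (S c) * x).
Proof. by apply/ev_unique; rewrite eta_cons starM -evE FM Fs !mulrA. Qed.

Lemma ev_consr c w w' x : ev w (c :: w') x = ev w w' (x * S c).
Proof. by apply/ev_unique; rewrite eta_cons -evE FM !mulrA. Qed.

(** Each letter of [w] either kills the product or advances the index of the left vector by one, so
    the two indices end up different. *)
Lemma eta_nil_cons w r r' : (0 < r + size w)%N -> star (eta [::] (r + r')) * eta w r' = 0.
Proof.
elim: w r => [|c w IH] r /=.
  rewrite addn0 => r0; rewrite /eta /= rmorph1 !mul1r inf_vec_orth.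
  by rewrite -[X in _ == X]add0n eqn_add2r gtn_eqF.
move=> _; rewrite eta_cons mulrA -(starK (F (S c))) -starM {1}/eta /= rmorph1 mul1r S_inf_vec.
case: c; last by rewrite star0 mul0r.
by have := IH r.+1 isT; rewrite /eta /= rmorph1 mul1r.
Qed.

Lemma ev1 w w' : ev w w' 1 = (w == w')%:R.
Proof.
have nc c (v : seq bool) : ev [::] (c :: v) 1 = 0.
  by apply: ev_unique; rewrite rmorph1 mulr1 scale0r -[0%N]addn0 eta_nil_cons.
elim: w w' => [|c w IH] [|c' w'].
- by apply: ev_unique; rewrite rmorph1 mulr1 /eta /= rmorph1 mul1r inf_vec_orth scale1r.
- exact: nc.
- by rewrite -star1 ev_star nc cj0.
rewrite ev_consl mulr1 ev_consr cgenM eqseq_cons; case: eqP => _ /=; last exact: ev0.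
exact: IH.
Qed.

Fixpoint words k : seq (seq bool) :=
  if k is k'.+1 then map (cons true) (words k') ++ map (cons false) (words k') else [:: [::]].

(** The part of [x] seen from words of length [l] to words of length [k], put back into [B]. *)
Definition expE k l x : B :=
  \sum_(w <- words k) \sum_(w' <- words l) ev w w' x *: (uw w * star (uw w')).

Lemma expE_lin k l c x x' : expE k l (c *: x + x') = c *: expE k l x + expE k l x'.
Proof.
rewrite /expE scaler_sumr -big_split; apply: eq_bigr => w _ /=.
rewrite scaler_sumr -big_split; apply: eq_bigr => w' _ /=.
by rewrite ev_lin scalerDl scalerA.
Qed.

Lemma expE0 k l : expE k l 0 = 0.
Proof. by rewrite /expE big1 // => w _; rewrite big1 // => w' _; rewrite ev0 scale0r. Qed.

Lemma expE_Sl k l x : expE k.+1 l x =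
  S true * expE k l (star (S true) * x) + S false * expE k l (star (S false) * x).
Proof.
have h c : \sum_(w <- map (cons c) (words k)) \sum_(w' <- words l) ev w w' x *: (uw w * star (uw w')) =
    S c * expE k l (star (S c) * x).
  rewrite big_map /expE mulr_sumr; apply: eq_bigr => w _; rewrite mulr_sumr; apply: eq_bigr => w' _.
  by rewrite ev_consl scaleMr /= mulrA.
by rewrite {1}/expE /= big_cat /= !h.
Qed.

Lemma expE_Sr k l x : expE k l.+1 x =
  expE k l (x * S true) * star (S true) + expE k l (x * S false) * star (S false).
Proof.
have h c w : \sum_(w' <- map (cons c) (words l)) ev w w' x *: (uw w * star (uw w')) =
    (\sum_(w' <- words l) ev w w' (x * S c) *: (uw w * star (uw w'))) * star (S c).
  rewrite big_map mulr_suml; apply: eq_bigr => w' _.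
  by rewrite ev_consr scaleMl /= starM mulrA.
rewrite /expE !mulr_suml -big_split; apply: eq_bigr => w _ /=.
by rewrite big_cat /= !h.
Qed.

Lemma expE_genl k l b x : expE k.+1 l (S b * x) = S b * expE k l x.
Proof.
rewrite expE_Sl !mulrA !cgenM; case: b; rewrite /= !mul1r !mul0r expE0 mulr0.
  by rewrite addr0.
by rewrite add0r.
Qed.

Lemma expE_gens k l b x : expE k l (star (S b) * x) = star (S b) * expE k.+1 l x.
Proof.
rewrite expE_Sl mulrDr !mulrA !cgenM; case: b; rewrite /= !mul1r !mul0r.
  by rewrite addr0.
by rewrite add0r.
Qed.

Lemma size_words k w : w \in words k -> size w = k.
Proof.
elim: k w => [|k IH] w; first by rewrite inE => /eqP->.
by rewrite mem_cat => /orP[] /mapP[v /IH <- ->].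
Qed.

Lemma expE1 k l : expE k l 1 = (k == l)%:R.
Proof.
elim: k l => [|k IH] l.
  case: l => [|l]; first by rewrite /expE !big_seq1 ev1 eqxx scale1r star1 mulr1.
  rewrite /expE big_seq1 big1_seq // => w /andP[_ /size_words sw].
  by rewrite ev1; case: w sw => //= c w _; rewrite scale0r.
case: l => [|l].
  rewrite /expE big1_seq // => w /andP[_ /size_words sw].
  by rewrite big_seq1 ev1; case: w sw => //= c w _; rewrite scale0r.
rewrite expE_Sl !mulr1 !expE_Sr !cgenM /= !expE0 !mul0r addr0 add0r IH eqSS.
case: eqP => _; rewrite ?mul0r ?mulr0 ?addr0 // !mul1r.
exact: (cuntz_sum s12).
Qed.

(** A finite sum of homogeneous parts. A part of index [(p, r)] shifts lengths by [p - r], and for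
    long words it is reproduced by [expE k l] exactly when [k - l] is this shift, written additively
    to stay in natural numbers. *)
Definition finite_type (x : B) := exists (d0 : nat) (ts : seq (nat * nat * B)),
  x = \sum_(t <- ts) t.2 /\ forall k l, (d0 <= k)%N -> (d0 <= l)%N ->
    expE k l x = \sum_(t <- ts) if (k + t.1.2 == l + t.1.1)%N then t.2 else 0.

Lemma finite_type_lin c x z : finite_type x -> finite_type z -> finite_type (c *: x + z).
Proof.
move=> [d1 [t1 [e1 h1]]] [d2 [t2 [e2 h2]]].
exists (maxn d1 d2), ([seq (t.1, c *: t.2) | t <- t1] ++ t2); split.
  by rewrite big_cat big_map /= -scaler_sumr -e1 -e2.
move=> k l; rewrite !geq_max => /andP[k1 k2] /andP[l1 l2].
rewrite expE_lin h1 // h2 // big_cat big_map /= scaler_sumr; congr (_ + _).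
by apply: eq_bigr => t _; case: ifP => _; rewrite ?scaler0.
Qed.

Lemma finite_type1 : finite_type 1.
Proof.
exists 0%N, [:: (0%N, 0%N, 1 : B)]; rewrite big_seq1; split=> // k l _ _.
by rewrite big_seq1 expE1 /= !addn0; case: eqP.
Qed.

Lemma finite_type_S b x : finite_type x -> finite_type (S b * x).
Proof.
move=> [d0 [ts [e h]]]; exists d0.+1, [seq (t.1.1.+1, t.1.2, S b * t.2) | t <- ts].
rewrite big_map /= -mulr_sumr -e; split=> // -[//|k] l k0 l0.
rewrite expE_genl h ?(ltnW l0) // big_map /= mulr_sumr; apply: eq_bigr => t _.
by rewrite addSn addnS eqSS; case: ifP => _; rewrite ?mulr0.
Qed.

Lemma finite_type_Ss b x : finite_type x -> finite_type (star (S b) * x).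
Proof.
move=> [d0 [ts [e h]]]; exists d0, [seq (t.1.1, t.1.2.+1, star (S b) * t.2) | t <- ts].
rewrite big_map /= -mulr_sumr -e; split=> // k l k0 l0.
rewrite expE_gens h ?(leqW k0) // big_map /= mulr_sumr; apply: eq_bigr => t _.
by rewrite addSn addnS; case: ifP => _; rewrite ?mulr0.
Qed.

Lemma finite_type_dense x (e : R) : 0 < e -> exists2 z, finite_type z & cnorm (x - z) < e.
Proof.
pose V := cnorm_closure finite_type; suff : V x by apply.
have VM a : cnorm a <= 1 -> (forall z, finite_type z -> finite_type (a * z)) ->
    forall z, V z -> V (a * z).
  move=> a1 ha z Vz d d0; have [t ht zt] := Vz d d0; exists (a * t); first exact: ha.
  rewrite -mulrBr; apply: le_lt_trans (cnormM _ _) _; apply: le_lt_trans zt.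
  by rewrite -[leRHS]mul1r ler_wpM2r ?cnorm_ge0.
apply: gen_module => [z zc d d0|c z t Vz Vt d d0|d d0|b|b].
- have d2 : 0 < d / 2 by rewrite divr_gt0.
  have [t Vt zt] := zc _ d2; have [u hu tu] := Vt _ d2; exists u => //.
  by have := cnorm_triangle t z u; lra.
- have c1 : 0 < complex.Re `|c| + 1.
    by have := cnorm_ge0 (c *: (1 : B)); rewrite cnormZ cnorm1 mulr1; lra.
  have [z' hz' zz] := Vz _ (divr_gt0 (divr_gt0 d0 (ltr0Sn R 1)) c1).
  have [t' ht' tt] := Vt _ (divr_gt0 d0 (ltr0Sn R 1)).
  exists (c *: z' + t'); first exact: finite_type_lin.
  have -> : c *: z + t - (c *: z' + t') = c *: (z - z') + (t - t') by rewrite scalerBr; abel.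
  apply: le_lt_trans (cnormD _ _) _; rewrite cnormZ.
  have h : cnorm (z - z') * (complex.Re `|c| + 1) < d / 2 by rewrite -ltr_pdivlMr.
  by have := cnorm_ge0 (z - z'); move: tt; nra.
- by exists 1; [exact: finite_type1|rewrite subrr cnorm0].
- by apply: VM; [rewrite cgen_norm|exact: finite_type_S].
- by apply: VM; [rewrite cnorm_star cgen_norm|exact: finite_type_Ss].
Qed.

Section Approximation.
Variables d L : nat.
Hypothesis L0 : (0 < L)%N.

Definition cw_seq := flatten [seq words k | k <- iota d L].
Local Notation Wl := cw_seq.
Local Notation N := (size cw_seq).
Let wd (a : 'I_N) : seq bool := nth [::] Wl a.
Let h : R[i] := (L%:R^-1 : R)%:C.

Let sum_Wl (V : nmodType) (G : seq bool -> V) : \sum_a G (wd a) = \sum_(k <- iota d L) \sum_(w <- words k) G w.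
Proof. by rewrite -(big_map (@words) xpredT (fun ws => \sum_(w <- ws) G w)) -big_flatten (big_nth [::]) big_mkord. Qed.

Lemma uniq_words k : uniq (words k).
Proof.
elim: k => //= k IH; rewrite cat_uniq !map_inj_uniq ?IH ?andbT //=; try by move=> ? ? [].
by apply/hasPn => w /mapP[v _ ->]; apply/negP => /mapP[].
Qed.

Lemma uniq_Wl : uniq Wl.
Proof.
rewrite /cw_seq; elim: L d => [|L' IH] d' //=; rewrite cat_uniq uniq_words IH andbT /=.
apply/hasPn => w /flattenP[ws /mapP[k]]; rewrite mem_iota => /andP[dk _] -> /size_words sw.
by apply/negP => /size_words sw'; move: dk; rewrite -sw sw' ltnn.
Qed.

Lemma wd_eq a b : (wd a == wd b) = (a == b).
Proof. by rewrite /wd nth_uniq ?uniq_Wl. Qed.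

Definition cw_f (x : B) : 'M[R[i]]_N := \matrix_(a, b) ev (wd a) (wd b) x.
Definition cw_g (X : 'M[R[i]]_N) : B := (L%:R^-1 : R)%:C *: \sum_a \sum_b X a b *: (uw (wd a) * star (uw (wd b))).

Local Notation fmap := cw_f.
Local Notation gmap := cw_g.

Lemma cw_f_lin c x z : fmap (c *: x + z) = c *: fmap x + fmap z.
Proof. by apply/matrixP => a b; rewrite !mxE ev_lin. Qed.

Lemma cw_g_lin c X Y : gmap (c *: X + Y) = c *: gmap X + gmap Y.
Proof.
rewrite /cw_g scalerA mulrC -scalerA -scalerDr; congr (_ *: _).
rewrite scaler_sumr -big_split; apply: eq_bigr => a _ /=.
rewrite scaler_sumr -big_split; apply: eq_bigr => b _ /=.
by rewrite !mxE scalerDl scalerA.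
Qed.

Let et (a : 'I_N) : D := eta (wd a) 0.

Let et_orth a b : star (et a) * et b = (a == b)%:R.
Proof.
have := evE (wd a) (wd b) 1; rewrite rmorph1 mulr1 ev1 wd_eq => ->.
by rewrite scaler_nat.
Qed.

Let et_ev a b x : star (et a) * F x * et b = fmap x a b *: 1.
Proof. by rewrite evE mxE. Qed.

(** The entries are compressions between the vectors [et]. Their Gram form is nonnegative because
    its values are scalars [star z * z] in [D], and [psd_factor] then gives the required
    factorization. *)
Lemma cw_f_cp : completely_positive (@star R B) (@cmxstar R N) fmap.
Proof.
move=> k X [Y ->]; pose T : finType := ('I_k * 'I_N)%type.
pose G (s t : T) := fmap (\sum_j star (Y j s.1) * Y j t.1) s.2 t.2.
have F12 := uq_pair hq s12.
have GE s t : G s t *: (1 : D) = \sum_j star (F (Y j s.1) * et s.2) * (F (Y j t.1) * et t.2).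
  rewrite -et_ev F_sum mulr_sumr mulr_suml; apply: eq_bigr => j _.
  by move: (et s.2) (et t.2) => u u'; rewrite starM FM Fs !mulrA.
have [||Z hZ] := @psd_factor R T G.
- move=> s t; apply: scal_inj; rewrite -[RHS]starK starZ star1 cjK !GE star_sum.
  by apply: eq_bigr => j _; rewrite [RHS]starM starK.
- move=> x; pose z (j : 'I_k) := \sum_(t : T) x t *: (F (Y j t.1) * et t.2).
  apply: (@starM_scalar_ge0 R D (\sum_(j < k) csig (q (fun=> s1)) (q (fun=> s2)) j * z j)
    (\sum_s \sum_t (Num.conj (x s) * x t * G s t))).
  rewrite (orth_sumM _ _ (csig_orth F12)) scaler_suml.
  transitivity (\sum_j \sum_s \sum_t (Num.conj (x s) * x t) *:
      (star (F (Y j s.1) * et s.2) * (F (Y j t.1) * et t.2))).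
    apply: eq_bigr => j _; rewrite /z star_sum mulr_suml; apply: eq_bigr => s _.
    rewrite mulr_sumr; apply: eq_bigr => t _.
    by rewrite starZ scaleMl scaleMr scalerA.
  rewrite exchange_big; apply: eq_bigr => s _; rewrite exchange_big scaler_suml.
  by apply: eq_bigr => t _; rewrite -scalerA GE scaler_sumr.
exists (\matrix_(r, p) \matrix_(m, a) Z (r, m) (p, a)).
apply/matrixP => p p'; rewrite !mxE; apply/matrixP => a a'; rewrite summxE.
transitivity (G (p, a) (p', a')).
  by rewrite /G; congr (fmap _ a a'); apply: eq_bigr => j _; rewrite !mxE.
rewrite hZ; transitivity (\sum_r \sum_m Num.conj (Z (r, m) (p, a)) * Z (r, m) (p', a')).
  by rewrite pair_bigA; apply: eq_bigr => -[].
by apply: eq_bigr => r _; rewrite !mxE; apply: eq_bigr => m _; rewrite !mxE.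
Qed.

Lemma cw_g_cp : completely_positive (@cmxstar R N) (@star R B) gmap.
Proof.
move=> k X [Y ->].
pose om j m p : B := \sum_b Y j p m b *: star (uw (wd b)).
have gsum (r : seq 'I_k) (G : 'I_k -> 'M[R[i]]_N) : gmap (\sum_(j <- r) G j) = \sum_(j <- r) gmap (G j).
  apply: (big_morph gmap) => [U V|].
    by have := cw_g_lin 1 U V; rewrite !scale1r.
  by have := cw_g_lin (-1) 0 0; rewrite !scaleN1r oppr0 !addr0 addNr.
pose c : R[i] := (Num.sqrt (L%:R^-1))%:C.
have cc : c * c = h.
  by rewrite /c /h -rcM -expr2 sqr_sqrtr // invr_ge0 ler0n.
have gE j p p' : gmap (cmxstar (Y j p) * Y j p') = \sum_m star (c *: om j m p) * (c *: om j m p').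
  rewrite /cw_g -/h scaler_sumr.
  transitivity (\sum_m \sum_a \sum_b h *: ((Num.conj (Y j p m a) * Y j p' m b) *: (uw (wd a) * star (uw (wd b))))).
    rewrite exchange_big; apply: eq_bigr => a _; rewrite exchange_big scaler_sumr.
    apply: eq_bigr => b _; rewrite mxE scaler_suml scaler_sumr; apply: eq_bigr => m _.
    by rewrite !mxE.
  apply: eq_bigr => m _; rewrite starZ scaleMl scaleMr scalerA cjr cc /om star_sum mulr_suml scaler_sumr.
  apply: eq_bigr => a _; rewrite mulr_sumr scaler_sumr; apply: eq_bigr => b _.
  by congr (_ *: _); rewrite starZ starK scaleMl scaleMr scalerA.
exists (\matrix_(j, p) \sum_(m < N) csig s1 s2 m * (c *: om j m p)).
apply/matrixP => p p'; rewrite !mxE gsum; apply: eq_bigr => j _.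
by rewrite !mxE (orth_sumM _ _ (csig_orth s12)) gE.
Qed.

Lemma cw_f_contraction x : cnorm x <= 1 -> mxcontraction (fmap x).
Proof.
move=> x1 v; pose w := fmap x *m v.
pose z := \sum_b v b 0 *: et b; pose t := \sum_a w a 0 *: et a.
have zn (u : 'cV[R[i]]_N) : star (\sum_b u b 0 *: et b) * (\sum_b u b 0 *: et b) =
    (\sum_b `|u b 0| ^+ 2) *: 1.
  have := vec_vec et_orth (fun b => u b 0) (fun b => u b 0); rewrite /vec => ->.
  by congr (_ *: _); apply: eq_bigr => b _; rewrite normCK mulrC.
have tz : star t * F x * z = (\sum_a `|w a 0| ^+ 2) *: 1.
  rewrite /t star_sum !mulr_suml scaler_suml; apply: eq_bigr => a _.
  rewrite starZ !scaleMl normCK [in RHS]mulrC -scalerA; congr (_ *: _).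
  rewrite /z mulr_sumr /w mxE scaler_suml; apply: eq_bigr => b _.
  by rewrite scaleMr et_ev scalerA mulrC.
pose nr (u : 'cV[R[i]]_N) : R := \sum_b complex.Re `|u b 0| ^+ 2.
have nrE u : (nr u)%:C = \sum_b `|u b 0| ^+ 2.
  rewrite /nr (big_morph (fun r => r%:C) (@rcD R) (erefl _)); apply: eq_bigr => b _.
  by rewrite normc_def expr2 rcM expr2.
have nr0 u : 0 <= nr u by apply: sumr_ge0 => b _; rewrite sqr_ge0.
rewrite -/w -!nrE lecR; rewrite -nrE in tz.
have n1 (u : 'cV[R[i]]_N) : cnorm (\sum_b u b 0 *: et b) ^+ 2 = nr u.
  by rewrite -cnorm_starM zn -nrE cnormZr cnorm1 mulr1 ger0_norm.
have h1 := congr1 (@cnorm R D) tz; rewrite cnormZr cnorm1 mulr1 ger0_norm // in h1.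
have h2 : nr w <= cnorm t * cnorm z.
  rewrite -h1; apply: le_trans (cnormM _ _) _; apply: ler_wpM2r; first exact: cnorm_ge0.
  apply: le_trans (cnormM _ _) _; rewrite cnorm_star -[leRHS]mulr1 ler_wpM2l ?cnorm_ge0 //.
  exact: le_trans (starhom_contractive Fs x) x1.
have h3 : cnorm t ^+ 2 = nr w := n1 w; have h4 : cnorm z ^+ 2 = nr v := n1 v.
have t0 := cnorm_ge0 t; have z0 := cnorm_ge0 z.
rewrite -h3 -h4 ler_pXn2r ?nnegrE //; rewrite -h3 in h2.
by have [->//|tn0] := eqVneq (cnorm t) 0; move: h2; rewrite expr2 ler_pM2l // lt_def tn0.
Qed.

(** [gmap X] is the matrix [X] compressed by [V]. For each length the range projections of the words
    add up to 1, so [L] lengths give [L], and the factor [1 / L] makes [V] an isometry. *)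
Lemma cw_g_contraction X : mxcontraction X -> cnorm (gmap X) <= 1.
Proof.
move=> Xc; pose sg (a : 'I_N) := csig s1 s2 a.
have so a b : star (sg a) * sg b = (a == b)%:R by rewrite (csig_orth s12).
pose c : R[i] := (Num.sqrt (L%:R^-1))%:C.
have cc : c * c = h.
  by rewrite /c /h -rcM -expr2 sqr_sqrtr // invr_ge0 ler0n.
pose V := c *: \sum_a sg a * star (uw (wd a)).
have uu k : \sum_(w <- words k) uw w * star (uw w) = 1.
  elim: k => [|k IH]; first by rewrite big_seq1 star1 mulr1.
  have hc b : \sum_(w <- map (cons b) (words k)) uw w * star (uw w) = S b * star (S b).
    transitivity (S b * (\sum_(w <- words k) uw w * star (uw w)) * star (S b)); last by rewrite IH mulr1.
    rewrite big_map mulr_sumr mulr_suml; apply: eq_bigr => w _.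
    by rewrite -[uw (b :: w)]/(S b * uw w) (starM (S b)) !mulrA.
  by rewrite /= big_cat /= !hc (cuntz_sum s12).
have V1 : star V * V = 1.
  rewrite /V starZ scaleMl scaleMr scalerA cjr cc (@orth_sumM _ _ (csig s1 s2)); last exact: (csig_orth s12).
  under eq_bigr do rewrite starK.
  rewrite (sum_Wl (fun w => uw w * star (uw w))) (eq_bigr (fun=> 1)) //.
  rewrite big_const_seq count_predT size_iota iter_addr_0.
  by rewrite -scaler_nat scalerA /h -[L%:R in X in _ * X](rmorph_nat (real_complex R)) -rcM mulVf ?pnatr_eq0 -?lt0n // scale1r.
have -> : gmap X = star V * iota_mx sg X * V.
  rewrite /cw_g -/h.
  rewrite /V starZ !scaleMl !scaleMr scalerA cjr cc; congr (_ *: _).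
  pose T := \sum_a sg a * star (uw (wd a)); rewrite -/T; have sT b : star (sg b) * T = star (uw (wd b)).
    rewrite /T mulr_sumr (bigD1 b) //= big1 ?addr0 => [|b' bb].
      by rewrite mulrA so eqxx mul1r.
    by rewrite mulrA so eq_sym (negbTE bb) mul0r.
  have Ts a : star T * sg a = uw (wd a) by rewrite -[LHS]starK starM starK sT starK.
  clearbody T; rewrite /iota_mx mulr_sumr mulr_suml; apply: eq_bigr => a _.
  rewrite mulr_sumr mulr_suml; apply: eq_bigr => b _.
  by rewrite scaleMr scaleMl mulrA Ts -mulrA sT.
have Vn : cnorm V = 1 by exact: isometry_norm.
have Xn : cnorm (iota_mx sg X) <= 1.
  apply: (iota_norm so s12) => // v; rewrite expr1n mul1r.
  have := Xc (\col_a v a); congr (_ <= _); apply: eq_bigr => a _; rewrite !mxE //.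
  by congr (`|_| ^+ 2); apply: eq_bigr => b _; rewrite mxE.
apply: le_trans (cnormM _ _) _; rewrite Vn mulr1; apply: le_trans (cnormM _ _) _.
by rewrite cnorm_star Vn mul1r.
Qed.

Lemma cw_gfE x : gmap (fmap x) = h *: \sum_(k <- iota d L) \sum_(l <- iota d L) expE k l x.
Proof.
rewrite /cw_g; congr (_ *: _).
rewrite (eq_bigr (fun a => \sum_(l <- iota d L) \sum_(w' <- words l)
   ev (wd a) w' x *: (uw (wd a) * star (uw w')))).
  rewrite (sum_Wl (fun w => \sum_(l <- iota d L) \sum_(w' <- words l) ev w w' x *: (uw w * star (uw w')))).
  by apply: eq_bigr => k _; rewrite exchange_big.
move=> a _; rewrite -(sum_Wl (fun w' => ev (wd a) w' x *: (uw (wd a) * star (uw w')))).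
by apply: eq_bigr => b _; rewrite mxE.
Qed.

End Approximation.

(** Each homogeneous part gets multiplied by the proportion counted in [pair_count], which differs
    from 1 by at most [(p + r) / L]. *)
Lemma finite_type_approx x : finite_type x -> exists (d0 : nat) (C : R),
  forall d L, (d0 <= d)%N -> (0 < L)%N -> cnorm (cw_g (cw_f d L x) - x) <= C / L%:R.
Proof.
move=> [d0 [ts [e h]]]; exists d0, (\sum_(t <- ts) (t.1.1 + t.1.2)%:R * cnorm t.2) => d L dd L0.
pose cnt p r := (\sum_(k <- iota d L) \sum_(l <- iota d L) (k + r == l + p))%N.
have L0' : 0 < L%:R :> R by rewrite ltr0n.
have -> : cw_g (cw_f d L x) - x = \sum_(t <- ts) ((cnt t.1.1 t.1.2)%:R / L%:R - 1)%:C *: t.2.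
  rewrite cw_gfE {2}e -sumrN.
  transitivity ((L%:R^-1 : R)%:C *: (\sum_(t <- ts) (cnt t.1.1 t.1.2)%:R *: t.2) - \sum_(t <- ts) t.2).
    rewrite sumrN; congr (_ *: _ - _).
    rewrite (eq_big_seq (fun k => \sum_(l <- iota d L) \sum_(t <- ts)
        (k + t.1.2 == l + t.1.1)%N%:R *: t.2)); last first.
      move=> k; rewrite mem_iota => /andP[dk _]; apply: eq_big_seq => l; rewrite mem_iota => /andP[dl _].
      rewrite h ?(leq_trans dd) //; apply: eq_bigr => t _.
      by case: eqP => _; rewrite ?scale1r ?scale0r.
    under eq_bigr do rewrite exchange_big; rewrite exchange_big; apply: eq_bigr => t _.
    rewrite /cnt natr_sum scaler_suml; apply: eq_bigr => k _.
    by rewrite natr_sum scaler_suml.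
  rewrite scaler_sumr -sumrB; apply: eq_bigr => t _ /=.
  rewrite rcB scalerBl scale1r scalerA rcM mulrC; congr (_ * _ *: _ - _).
  by rewrite rmorph_nat.
apply: le_trans (cnorm_sum _ _ _) _; rewrite mulr_suml; apply: ler_sum => t _.
rewrite cnormZr mulrAC ler_wpM2r ?cnorm_ge0 //.
have [h1 h2] := pair_count d L t.1.1 t.1.2; rewrite -/(cnt _ _) in h1 h2.
have -> : (cnt t.1.1 t.1.2)%:R / L%:R - 1 = ((cnt t.1.1 t.1.2)%:R - L%:R) / L%:R :> R.
  by rewrite mulrBl divff // gt_eqF.
rewrite normrM [`|L%:R^-1|]gtr0_norm ?invr_gt0 // ler_pM2r ?invr_gt0 //.
rewrite -(ler_nat R) in h1; rewrite -(ler_nat R) !natrD in h2.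
by rewrite natrD ler_norml; apply/andP; split; have := ler0n R t.1.1; have := ler0n R t.1.2; lra.
Qed.

Lemma cw_gf_norm d L x : (0 < L)%N -> cnorm (cw_g (cw_f d L x)) <= cnorm x.
Proof.
move=> L0; have [->|/eqP x0] := eqVneq x 0.
  have f0 : cw_f d L 0 = 0 by apply/matrixP => a b; rewrite !mxE ev0.
  rewrite f0 /cw_g big1 ?scaler0 ?cnorm0 // => a _; rewrite big1 // => b _.
  by rewrite mxE scale0r.
have n0 := cnorm_gt0 x0.
have := cw_g_contraction L0 (@cw_f_contraction d L ((cnorm x)^-1%:C *: x) _).
rewrite cnorm_invZ // divff ?gt_eqF // => /(_ (lexx _)).
have fZ c z : cw_f d L (c *: z) = c *: cw_f d L z.
  by apply/matrixP => a b; rewrite !mxE -[c *: z]addr0 ev_lin ev0 addr0.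
have gZ c (X : 'M[R[i]]_(size (cw_seq d L))) : cw_g (c *: X) = c *: cw_g X :> B.
  have := @cw_g_lin d L c X 0; rewrite addr0 => ->; rewrite [X in _ + X](_ : _ = 0) ?addr0 //.
  by rewrite /cw_g big1 ?scaler0 // => a _; rewrite big1 // => b _; rewrite mxE scale0r.
by rewrite fZ gZ cnorm_invZ // ler_pdivrMr // mul1r.
Qed.

Lemma cuntz_words_nuclear : nuclear B.
Proof.
move=> s e e0; have e3 : 0 < e / 3 by rewrite divr_gt0.
(* Two thirds of [e] pay for replacing [x] by an element of finite type, before and after the maps;
   [C / L] pays for that element itself. *)
have [d [C hC]] : exists (d : nat) (C : R), forall x, x \in s -> forall L, (0 < L)%N ->
    forall d', (d <= d')%N -> cnorm (cw_g (cw_f d' L x) - x) <= 2 * (e / 3) + C / L%:R.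
  elim: s => [|x s [d [C hC]]]; first by exists 0%N, 0.
  have [z zf xz] := finite_type_dense x e3.
  have [d0 [C0 h0]] := finite_type_approx zf.
  exists (maxn d d0), (Num.max C C0) => x'; rewrite inE => /orP[/eqP->|xs] L L0 d'; rewrite geq_max => /andP[d1 d2].
    have hz := h0 d' L d2 L0; have hx := cw_gf_norm d' (x - z) L0.
    have l1 : cw_f d' L x = 1 *: cw_f d' L (x - z) + cw_f d' L z.
      by rewrite -cw_f_lin scale1r subrK.
    have -> : cw_g (cw_f d' L x) - x = cw_g (cw_f d' L (x - z)) + (cw_g (cw_f d' L z) - z) + (z - x).
      by rewrite l1 cw_g_lin scale1r; abel.
    have m : C0 / L%:R <= Num.max C C0 / L%:R.
      by rewrite ler_wpM2r ?invr_ge0 ?ler0n // le_max lexx orbT.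
    have := cnormD (cw_g (cw_f d' L (x - z)) + (cw_g (cw_f d' L z) - z)) (z - x).
    have := cnormD (cw_g (cw_f d' L (x - z))) (cw_g (cw_f d' L z) - z).
    rewrite (cnormBC z x); move: xz hx hz m; set u := C0 / _; set u' := _ / _; set t := e / 3; lra.
  have m : C / L%:R <= Num.max C C0 / L%:R.
    by rewrite ler_wpM2r ?invr_ge0 ?ler0n // le_max lexx.
  by apply: le_trans (hC x' xs L L0 d' d1) _; rewrite lerD2l.
have [L hL] : exists L : nat, C / (e / 3) < L.+1%:R.
  by exists (Num.truncn (C / (e / 3))); apply: truncnS_gt.
have CL : C / L.+1%:R < e / 3.
  by rewrite ltr_pdivrMr ?ltr0n // mulrC -ltr_pdivrMr.
pose flin := GRing.isLinear.Build R[i] B _ _ (cw_f d L.+1) (@cw_f_lin d L.+1).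
pose glin := GRing.isLinear.Build R[i] _ B _ (@cw_g d L.+1) (@cw_g_lin d L.+1).
pose f : {linear B -> 'M[R[i]]_(size (cw_seq d L.+1))} := HB.pack (cw_f d L.+1) flin.
pose g : {linear 'M[R[i]]_(size (cw_seq d L.+1)) -> B} := HB.pack (@cw_g d L.+1) glin.
exists (size (cw_seq d L.+1)), f, g; split.
- exact: cw_f_cp.
- exact: cw_g_cp.
- exact: cw_f_contraction.
- exact: cw_g_contraction.
move=> x xs; apply: le_lt_trans (hC x xs L.+1 isT d (leqnn d)) _.
move: CL; set u := C / _; lra.
Qed.

End CuntzWords.

Lemma cuntz_nuclear (R : realType) (B : cstarAlgType R) (s1 s2 : B) :
  cuntz2_rel s1 s2 -> generated_by [set s1; s2] -> nuclear B.
Proof.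
move=> s12 B_gen; have [W WU W_cvg] := seq_ultrafilter unit.
have [D [q hq]] := @ultrapower_ex R _ W WU B.
have n_infty N : \forall i \near W, (N <= i.2)%N by apply: filterS (W_cvg tt N) => i [].
have [F [Fs _ FE]] := uq_diag hq.
exact: (@cuntz_words_nuclear R B s1 s2 s12 B_gen _ W WU (fun i => i.2) n_infty D q hq F Fs FE).
Qed.

(** * Terms and formulas *)

Section Support.
Variable X : symbols.

Fixpoint term_on (P : X -> Prop) k (t : term X k) : Prop :=
  match t with
  | t_sym x => P x
  | t_zero => True
  | t_one => True
  | t_add _ _ t1 t2 => term_on P t1 /\ term_on P t2
  | t_mul _ _ t1 t2 => term_on P t1 /\ term_on P t2
  | t_star _ t1 => term_on P t1
  | t_scale _ _ _ _ _ t1 => term_on P t1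
  | t_incl _ _ _ t1 => term_on P t1
  end.

Fixpoint qf_on (R : realType) (K : connectives R) (P : X -> Prop) (phi : qf K X) : Prop :=
  match phi with
  | qf_dist _ t1 t2 => term_on P t1 /\ term_on P t2
  | qf_conn c phis => forall i, qf_on P (phis i)
  end.

Lemma term_on_sub (P P' : X -> Prop) k (t : term X k) :
  (forall x, P x -> P' x) -> term_on P t -> term_on P' t.
Proof.
by move=> h; elim: t => //= [k1 l1 t1 h1 t2 h2|k1 l1 t1 h1 t2 h2] []; auto.
Qed.

Lemma qf_on_sub (R : realType) (K : connectives R) (P P' : X -> Prop) (phi : qf K X) :
  (forall x, P x -> P' x) -> qf_on P phi -> qf_on P' phi.
Proof.
move=> h; elim: phi => [k t u [h1 h2]|c phis IH hp i] /=; last exact: IH.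
by split; apply: term_on_sub h _.
Qed.

Lemma term_val_ext (R : realType) (A : cstarAlgType R) (v w : X -> A) (P : X -> Prop) k (t : term X k) :
  (forall x, P x -> v x = w x) -> term_on P t -> term_val v t = term_val w t.
Proof.
move=> h; elim: t => //= [k1 l1 t1 IH1 t2 IH2 [h1 h2]|k1 l1 t1 IH1 t2 IH2 [h1 h2]|k1 t1 IH h1|k1 l1 z h0 h0' t1 IH h1].
- by rewrite IH1 ?IH2.
- by rewrite IH1 ?IH2.
- by rewrite IH.
- by rewrite IH.
Qed.

Lemma qf_val_ext (R : realType) (A : cstarAlgType R) (K : connectives R) (v w : X -> A)
    (P : X -> Prop) (phi : qf K X) :
  (forall x, P x -> v x = w x) -> qf_on P phi -> qf_val v phi = qf_val w phi.
Proof.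
move=> h; elim: phi => [k t u [h1 h2]|c phis IH hp] /=.
  by rewrite !(term_val_ext h).
by congr conn_fun; apply/rowP => i; rewrite !mxE IH.
Qed.

Lemma term_on_ex (P : nat -> X -> Prop) k (t : term X k) :
  (forall m n x, (m <= n)%N -> P m x -> P n x) -> (forall x, exists n, P n x) ->
  exists n, term_on (P n) t.
Proof.
move=> mono ex; elim: t => //=; try by exists 0%N.
- move=> ??? [m hm] ? [n hn]; exists (maxn m n); split.
    by apply: term_on_sub hm => x; apply: mono; exact: leq_maxl.
  by apply: term_on_sub hn => x; apply: mono; exact: leq_maxr.
- move=> ??? [m hm] ? [n hn]; exists (maxn m n); split.
    by apply: term_on_sub hm => x; apply: mono; exact: leq_maxl.
  by apply: term_on_sub hn => x; apply: mono; exact: leq_maxr.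
Qed.

Lemma qf_on_ex (R : realType) (K : connectives R) (P : nat -> X -> Prop) (phi : qf K X) :
  (forall m n x, (m <= n)%N -> P m x -> P n x) -> (forall x, exists n, P n x) ->
  exists n, qf_on (P n) phi.
Proof.
move=> mono ex; elim: phi => [k t u|c phis /choice[f hf]] /=.
  have [m hm] := term_on_ex t mono ex; have [n hn] := term_on_ex u mono ex.
  exists (maxn m n); split.
    by apply: term_on_sub hm => x; apply: mono; exact: leq_maxl.
  by apply: term_on_sub hn => x; apply: mono; exact: leq_maxr.
exists (\max_i f i) => i; apply: qf_on_sub (hf i) => x; apply: mono.
exact: leq_bigmax.
Qed.

(* [d] does not depend on the algebra. *)
Lemma term_val_cont (R : realType) (P : X -> Prop) k (t : term X k) (e : R) : 0 < e ->
  exists2 d, 0 < d & forall (A : cstarAlgType R) (v w : X -> A),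
    interpretation v -> interpretation w -> (forall x, P x -> cnorm (v x - w x) < d) ->
    term_on P t -> cnorm (term_val v t - term_val w t) < e.
Proof.
elim: t e => [x|||k1 l1 t1 IH1 t2 IH2|k1 l1 t1 IH1 t2 IH2|k1 t1 IH|k1 l1 z h1 h2 t1 IH|k1 l1 h1 t1 IH] e e0 /=.
- by exists e => // A v w _ _; apply.
- by exists 1 => // A v w _ _ _ _; rewrite subrr cnorm0.
- by exists 1 => // A v w _ _ _ _; rewrite subrr cnorm0.
- have e2 : 0 < e / 2 by rewrite divr_gt0.
  have [d d0 hd] := IH1 _ e2; have [d' d0' hd'] := IH2 _ e2.
  exists (Num.min d d'); first by rewrite lt_min d0.
  move=> A v w vi wi vw [on1 on2].
  have a1 : cnorm (term_val v t1 - term_val w t1) < e / 2.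
    by apply: hd => // x /vw; rewrite lt_min => /andP[].
  have a2 : cnorm (term_val v t2 - term_val w t2) < e / 2.
    by apply: hd' => // x /vw; rewrite lt_min => /andP[].
  have -> : term_val v t1 + term_val v t2 - (term_val w t1 + term_val w t2) =
    (term_val v t1 - term_val w t1) + (term_val v t2 - term_val w t2) by abel.
  by apply: le_lt_trans (cnormD _ _) _; lra.
- pose c : R := k1%:R + l1%:R + 1.
  have c0 : 0 < c by rewrite /c ltr_wpDl ?addr_ge0 ?ler0n.
  have e2 : 0 < e / (2 * c) by rewrite divr_gt0 ?mulr_gt0.
  have [d d0 hd] := IH1 _ e2; have [d' d0' hd'] := IH2 _ e2.
  exists (Num.min d d'); first by rewrite lt_min d0.
  move=> A v w vi wi vw [on1 on2].
  have a1 : cnorm (term_val v t1 - term_val w t1) < e / (2 * c).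
    by apply: hd => // x /vw; rewrite lt_min => /andP[].
  have a2 : cnorm (term_val v t2 - term_val w t2) < e / (2 * c).
    by apply: hd' => // x /vw; rewrite lt_min => /andP[].
  have -> : term_val v t1 * term_val v t2 - term_val w t1 * term_val w t2 =
    (term_val v t1 - term_val w t1) * term_val v t2 + term_val w t1 * (term_val v t2 - term_val w t2).
    by rewrite mulrBl mulrBr; abel.
  have n1 := term_val_norm t1 wi; have n2 := term_val_norm t2 vi.
  apply: le_lt_trans (cnormD _ _) _.
  have m1 := cnormM (term_val v t1 - term_val w t1) (term_val v t2).
  have m2 := cnormM (term_val w t1) (term_val v t2 - term_val w t2).
  have b1 : cnorm (term_val v t1 - term_val w t1) * cnorm (term_val v t2) <= e / (2 * c) * l1%:R.
    by rewrite ler_pM ?cnorm_ge0 // ltW.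
  have b2 : cnorm (term_val w t1) * cnorm (term_val v t2 - term_val w t2) <= k1%:R * (e / (2 * c)).
    by rewrite ler_pM ?cnorm_ge0 // ltW.
  have : e / (2 * c) * (k1%:R + l1%:R) < e.
    have -> : e / (2 * c) * (k1%:R + l1%:R) = e * ((k1%:R + l1%:R) / (2 * c)) by field; rewrite gt_eqF.
    rewrite -[ltRHS]mulr1 ltr_pM2l // ltr_pdivrMr ?mulr_gt0 // mul1r /c.
    by have := ler0n R k1; have := ler0n R l1; lra.
  move: b1 b2; set u := e / _; lra.
- have [d d0 hd] := IH _ e0; exists d => // A v w vi wi vw on1.
  by rewrite -starB cnorm_star; exact: hd.
- pose c := complex.Re `|rat_complex R z| + 1.
  have c0' : 0 <= complex.Re `|rat_complex R z| by rewrite normc_def /= sqrtr_ge0.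
  have c0 : 0 < c by rewrite /c ltr_wpDl.
  have [d d0 hd] := IH _ (divr_gt0 e0 c0); exists d => // A v w vi wi vw on1.
  rewrite -scalerBr cnormZ; have := hd A v w vi wi vw on1.
  rewrite ltr_pdivlMr // /c; have := cnorm_ge0 (term_val v t1 - term_val w t1).
  by set n := cnorm _; nra.
- exact: IH.
Qed.

End Support.

(** * Formulas obtained from a dense family of connectives *)

Section Formulas.
Variables (R : realType) (K : connectives R) (X : symbols).

Lemma composition_formula n (g : 'rV[R]_n -> R) (phi : 'I_n -> qf K X) : composition K g ->
  exists psi : qf K X, forall (A : cstarAlgType R) (v : X -> A),
    qf_val v psi = g (\row_i qf_val v (phi i)).
Proof.
elim=> [i|c h _ /choice[f hf]]; first by exists (phi i) => A v; rewrite mxE.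
exists (qf_conn f) => A v /=; congr conn_fun; apply/rowP => i.
by rewrite !mxE hf.
Qed.

(** Distances are formed within one sort, so both terms are included in the ball of radius
    [k + l]. *)
Definition mdist k l (t : term X k) (u : term X l) : qf K X :=
  qf_dist K (t_incl (leq_addr l k) t) (t_incl (leq_addl k l) u).

Lemma mdistE k l (t : term X k) (u : term X l) (A : cstarAlgType R) (v : X -> A) :
  qf_val v (mdist t u) = cnorm (term_val v t - term_val v u).
Proof. by []. Qed.

Hypothesis K_dense : dense_connectives K.

(** Conditions bound formulas from above; a formula close to minus a distance turns such a bound
    into a lower bound for the distance. *)
Lemma neg_mdist k l (t : term X k) (u : term X l) (e : R) : 0 < e -> exists psi : qf K X,
  forall (A : cstarAlgType R) (v : X -> A), interpretation v ->
    `|qf_val v psi + cnorm (term_val v t - term_val v u)| < e.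
Proof.
move=> e0; have fc : continuous (fun x : 'rV[R]_1 => - x 0 0).
  by move=> x; apply: continuousN; exact: coord_continuous.
have [g gK hg] := K_dense fc (k%:R + l%:R) e0.
have [psi hpsi] := composition_formula (fun=> mdist t u) gK.
exists psi => A v vi; rewrite hpsi.
have := hg (\row_i qf_val v (mdist t u)); rewrite mxE mdistE => h.
rewrite addrC -normrN opprD; apply: h => i; rewrite mxE ger0_norm ?cnorm_ge0 //.
by apply: le_trans (cnormB _ _) _; rewrite lerD ?term_val_norm.
Qed.

End Formulas.

(** * Subalgebras generated by values of terms *)

Section TermClosure.
Variable R : realType.

Lemma rat_dense (x e : R) : 0 < e -> exists r : rat, `|x - ratr r| < e.
Proof.
move=> e0; have [r] : exists r : rat, ratr r \in `]x - e, x + e[%R.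
  by apply: rat_in_itvoo; lra.
by rewrite in_itv /= => /andP[h1 h2]; exists r; rewrite ltr_norml; apply/andP; split; lra.
Qed.

Lemma rat_complex_dense (c : R[i]) (e : R) : 0 < e ->
  exists z : rat * rat, complex.Re `|c - rat_complex R z| < e.
Proof.
case: c => x y e0; have e2 : 0 < e / 2 by rewrite divr_gt0.
have [r hr] := rat_dense x e2; have [s hs] := rat_dense y e2; exists (r, s).
rewrite /rat_complex normc_def /=.
apply: le_lt_trans (_ : `|x - ratr r| + `|y - ratr s| < e); last by lra.
rewrite -[leRHS]ger0_norm ?addr_ge0 // -sqrtr_sqr ler_wsqrtr // [leRHS]sqrrD !real_normK ?num_real //.
by rewrite addrAC lerDl mulrn_wge0 // mulr_ge0.
Qed.

Lemma scale_sort (z : rat * rat) (k : nat) :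
  exists l : nat, (0 < l)%N /\ (z.1 ^+ 2 + z.2 ^+ 2) * k%:R ^+ 2 <= l%:R ^+ 2 :> rat.
Proof.
set x := _ * _; exists (Num.truncn x).+1; split=> //.
apply: le_trans (ltW (truncnS_gt x)) _.
by rewrite expr2 -natrM ler_nat leq_pmulr.
Qed.

Variables (A : cstarAlgType R) (X : symbols) (v : X -> A) (P : X -> Prop).

Definition term_vals := [set x : A | exists k (t : term X k), term_on P t /\ x = term_val v t].

Let cseq x : cnorm_closure term_vals x <->
  exists u : nat -> A, (forall n, term_vals (u n)) /\ ccvg \oo u x.
Proof.
split=> [xc|[u [hu ux]] e e0].
  have /choice[u hu] : forall n : nat, exists y, term_vals y /\ cnorm (x - y) < n.+1%:R^-1.
    by move=> n; have [|y h1 h2] := xc (n.+1%:R^-1); [rewrite invr_gt0 ltr0n|exists y].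
  exists u; split=> [n|e e0]; first by case: (hu n).
  have [N hN] : exists N : nat, e^-1 < N.+1%:R by exists (Num.truncn e^-1); apply: truncnS_gt.
  exists N => // n /= Nn; rewrite cnormBC; case: (hu n) => _ h; apply: lt_trans h _.
  rewrite -[ltRHS]invrK ltf_pV2 ?posrE ?ltr0n ?invr_gt0 //.
  by apply: lt_le_trans hN _; rewrite ler_nat.
have [n hn] := filter_ex (ux e e0); exists (u n); first exact: hu.
by rewrite cnormBC.
Qed.

(** The scalars of the syntax are rational, so arbitrary linear combinations are reached as
    limits. *)
Lemma term_closure : cstar_subalgebra (cnorm_closure term_vals).
Proof.
have U1 : term_vals 1 by exists 1%N, (t_one X).
have UD x y : term_vals x -> term_vals y -> term_vals (x + y).
  by move=> [k [t [ht ->]]] [l [u [hu ->]]]; exists (k + l)%N, (t_add t u).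
have UM x y : term_vals x -> term_vals y -> term_vals (x * y).
  by move=> [k [t [ht ->]]] [l [u [hu ->]]]; exists (k * l)%N, (t_mul t u).
have Us x : term_vals x -> term_vals (star x).
  by move=> [k [t [ht ->]]]; exists k, (t_star t).
have UZ z x : term_vals x -> term_vals (rat_complex R z *: x).
  move=> [k [t [ht ->]]]; have [l [l0 hl]] := scale_sort z k.
  by exists l, (t_scale l0 hl t).
split.
- move=> x xc e e0; have e2 : 0 < e / 2 by rewrite divr_gt0.
  have [y yc xy] := xc _ e2; have [z zU yz] := yc _ e2; exists z => //.
  by have := cnorm_triangle y x z; lra.
- by move=> e e0; exists 1 => //; rewrite subrr cnorm0.
- move=> c x y /cseq[u [hu ux]] /cseq[w [hw wy]]; apply/cseq.
  have /choice[z hz] : forall n : nat, exists z, complex.Re `|c - rat_complex R z| < n.+1%:R^-1.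
    by move=> n; apply: rat_complex_dense; rewrite invr_gt0 ltr0n.
  exists (fun n => rat_complex R (z n) *: u n + w n); split=> [n|]; first by apply: UD; auto.
  apply: ccvgD wy; have cz : ccvg \oo (fun n => (c - rat_complex R (z n)) *: (1 : A)) 0.
    move=> e e0; have [N hN] : exists N : nat, e^-1 < N.+1%:R by exists (Num.truncn e^-1); apply: truncnS_gt.
    exists N => // n /= Nn; rewrite subr0 cnormZ cnorm1 mulr1; apply: lt_trans (hz n) _.
    rewrite -[ltRHS]invrK ltf_pV2 ?posrE ?ltr0n ?invr_gt0 //.
    by apply: lt_le_trans hN _; rewrite ler_nat.
  have h : ccvg \oo (fun i => c *: u i - (c - rat_complex R (z i))%:A * u i) (c *: x - 0 * x).
    by apply: ccvgB; [exact: ccvgZ|exact: ccvgM].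
  apply: (ccvg_eq h) => [n|]; last by rewrite mul0r subr0.
  by rewrite scaleMl mul1r -scalerBl opprB addrC subrK.
- move=> x y /cseq[u [hu ux]] /cseq[w [hw wy]]; apply/cseq.
  by exists (fun n => u n * w n); split=> [n|]; [apply: UM|exact: ccvgM].
- move=> x /cseq[u [hu ux]]; apply/cseq.
  by exists (fun n => star (u n)); split=> [n|]; [apply: Us|exact: ccvg_star].
Qed.

End TermClosure.

(** * The game *)

Section NearIsometries.
Variables (R : realType) (A : cstarAlgType R).
Implicit Types (x y e s t : A).

(* Newton's iteration for the polar part of [x]. *)
Fixpoint newton_seq x n : A :=
  if n is m.+1 then
    let y := newton_seq x m in y - (2^-1 : R)%:C *: (y * (star y * y - 1))
  else x.

(** Since [h = 2 k] the terms of first order cancel, leaving [2 k^3 - 3 k^2]. *)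
Lemma newton_step (h : A) : let k := (2^-1 : R)%:C *: h in
  star h = h -> cnorm h <= 2^-1 ->
  cnorm ((1 - k) * (1 + h) * (1 - k) - 1) <= cnorm h / 2.
Proof.
move=> k hs h1; have hh : h = k + k by rewrite -scalerDr half_scale.
have -> : (1 - k) * (1 + h) * (1 - k) - 1 = h * k * k - (k * k + k * k + k * k).
  by rewrite hh; ncr.
have kn : cnorm k = cnorm h / 2 by rewrite /k cnormZr ger0_norm ?invr_ge0 // mulrC.
have kk : cnorm (k * k) <= cnorm h ^+ 2 / 4.
  by apply: le_trans (cnormM _ _) _; rewrite kn; nra.
have n1 := cnormB (h * k * k) (k * k + k * k + k * k).
have n2 := cnormD (k * k + k * k) (k * k); have n3 := cnormD (k * k) (k * k).
have n4 : cnorm (h * k * k) <= cnorm h * cnorm (k * k) by rewrite -mulrA cnormM.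
have := cnorm_ge0 (k * k); have := cnorm_ge0 h; nra.
Qed.

(** Each step at least halves the bound on the defect, so the iteration converges. All iterates are
    right multiples of [x], whence the last clause: whatever fixes [x] from the left fixes [y]
    too. *)
Lemma near_isometry x (d : R) : d <= 2^-1 -> cnorm (star x * x - 1) <= d ->
  exists y, [/\ star y * y = 1, cnorm (y - x) <= 2 * d & forall e, e * x = x -> e * y = y].
Proof.
move=> d1 xd; have d0 : 0 <= d := le_trans (cnorm_ge0 _) xd.
have d_bnd n : 0 <= 2^-1 ^+ n * d <= 2^-1.
  rewrite mulr_ge0 ?exprn_ge0 ?invr_ge0 //=; apply: le_trans d1.
  by rewrite ler_piMl // exprn_ile1 ?invr_ge0 //; lra.
pose u := newton_seq x; have hu n : cnorm (star (u n) * u n - 1) <= 2^-1 ^+ n * d.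
  elim: n => [|n IH]; first by rewrite expr0 mul1r.
  rewrite /u /= -/u; move: (u n) IH => y IH; set h := star y * y - 1 in IH *.
  have hs : star h = h by rewrite starB starM starK star1.
  have h1 : cnorm h <= 2^-1 by apply: le_trans IH _; case/andP: (d_bnd n).
  set k := (2^-1 : R)%:C *: h.
  have yk : y - (2^-1 : R)%:C *: (y * h) = y * (1 - k) by rewrite -scaleMr -/k [RHS]mulrBr mulr1.
  have := newton_step hs h1; rewrite -/k yk starM starB star1 /k starZr hs -/k.
  have -> : (1 - k) * star y * (y * (1 - k)) = (1 - k) * (1 + h) * (1 - k).
    by rewrite [1 + h]addrC subrK !mulrA.
  move=> /le_trans; apply; rewrite exprS; lra.
have un n : cnorm (u n) <= 2.
  apply: cnorm_le_sqr => //; have := cnormD (star (u n) * u n - 1) 1.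
  by rewrite subrK cnorm1; have := hu n; case/andP: (d_bnd n); lra.
have ud n : cnorm (u n.+1 - u n) <= 2^-1 ^+ n * d.
  rewrite /u /= -/u addrAC subrr add0r cnormN cnormZr ger0_norm ?invr_ge0 //.
  have := cnormM (u n) (star (u n) * u n - 1); have := hu n; have := un n.
  have := cnorm_ge0 (u n); have := cnorm_ge0 (star (u n) * u n - 1); case/andP: (d_bnd n).
  set p := _ ^+ n * d; nra.
have dist n k : cnorm (u (n + k)%N - u n) <= 2 * (2^-1 ^+ n * d) - 2 * (2^-1 ^+ (n + k) * d).
  elim: k => [|k IH]; first by rewrite addn0 !subrr cnorm0.
  have := cnorm_triangle (u (n + k)%N) (u (n + k).+1) (u n); have := ud (n + k)%N.
  rewrite addnS exprS; lra.
have dist2 n m : (n <= m)%N -> cnorm (u m - u n) <= 2 * (2^-1 ^+ n * d).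
  by move=> /subnKC <-; apply: le_trans (dist _ _) _; case/andP: (d_bnd (n + (m - n))%N); lra.
have uc : exists y, ccvg \oo u y.
  apply: ccauchy_cvg => e e0; have e4 : 0 < e / 4 by rewrite divr_gt0.
  have [N hN] := half_exp_lt e4; exists N => m n Nm Nn.
  have := cnorm_triangle (u N) (u m) (u n); rewrite (cnormBC (u N)).
  have := dist2 _ _ Nm; have := dist2 _ _ Nn.
  have : 2^-1 ^+ N * d <= 2^-1 ^+ N * 2^-1 by rewrite ler_wpM2l ?exprn_ge0 ?invr_ge0.
  lra.
have [y uy] := uc; exists y; split.
- have h : ccvg \oo (fun n => star (u n) * u n) (star y * y).
    by exact: ccvgM (ccvg_star uy) uy.
  apply: (ccvg_unique h) => e e0; have [N hN] := half_exp_lt e0.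
  exists N => // n /= Nn; apply: le_lt_trans (hu n) _.
  have h1 : (2^-1 : R) ^+ n <= 2^-1 ^+ N.
    by rewrite -(subnKC Nn) exprD ler_piMr ?exprn_ge0 ?invr_ge0 // exprn_ile1 ?invr_ge0 //; lra.
  have h2 : (2^-1 : R) ^+ n * d <= 2^-1 ^+ n by rewrite ler_piMr ?exprn_ge0 ?invr_ge0 //; lra.
  exact: le_lt_trans (le_trans h2 h1) hN.
- have h : ccvg \oo (fun n => u n - x) (y - x).
    by exact: ccvgB uy (ccvg_cst x).
  apply: (ccvg_norm_le h); apply: filterE => n.
  by have := dist2 0%N n (leq0n n); rewrite expr0 mul1r.
- move=> e ex; have eu n : e * u n = u n.
    elim: n => [|n IH] //; rewrite /u /= -/u; move: (u n) IH => z IH.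
    by rewrite mulrBr scaleMr mulrA IH.
  have h : ccvg \oo (fun n => e * u n) (e * y).
    by exact: ccvgM (ccvg_cst e) uy.
  by apply: (ccvg_unique h); apply: ccvg_ext uy => n; rewrite eu.
Qed.

Definition near_cuntz (d : R) s t :=
  [/\ cnorm (star s * s - 1) <= d, cnorm (star t * t - 1) <= d,
      cnorm (star s * t) <= d & cnorm (s * star s + t * star t - 1) <= d].

(** [s] is corrected first; [t] is cut by [1 - s' * star s'] before its own correction, so the
    ranges become exactly orthogonal. The remaining defect is a projection of norm below 1, hence
    0. *)
Lemma near_cuntz_exact s t (d : R) : d <= 40^-1 -> near_cuntz d s t ->
  exists s' t', [/\ cuntz2_rel s' t', cnorm (s' - s) <= 9 * d & cnorm (t' - t) <= 9 * d].
Proof.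
move=> d1 [sd td std stsum]; have d0 : 0 <= d := le_trans (cnorm_ge0 _) sd.
have [|s' [s's' s's _]] := @near_isometry s d _ sd; first lra.
have tn : cnorm t <= 2.
  apply: cnorm_le_sqr => //; have := cnormD (star t * t - 1) 1; rewrite subrK cnorm1; lra.
have sn : cnorm s <= 2.
  apply: cnorm_le_sqr => //; have := cnormD (star s * s - 1) 1; rewrite subrK cnorm1; lra.
have s't : cnorm (star s' * t) <= 5 * d.
  have -> : star s' * t = star s * t + star (s' - s) * t by rewrite starB mulrBl; abel.
  have := cnormD (star s * t) (star (s' - s) * t); have := cnormM (star (s' - s)) t.
  by rewrite cnorm_star; have := cnorm_ge0 (s' - s); have := cnorm_ge0 t; nra.
pose e := 1 - s' * star s'.
have es : star e = e by rewrite /e starB star1 starM starK.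
have ee : e * e = e.
  rewrite /e; have -> : (1 - s' * star s') * (1 - s' * star s') =
    1 - s' * star s' - s' * star s' + s' * (star s' * s') * star s' by ncr.
  by rewrite s's' mulr1 subrK.
have t0 : cnorm (star (e * t) * (e * t) - 1) <= 2 * d.
  have -> : star (e * t) * (e * t) - 1 = (star t * t - 1) - star (star s' * t) * (star s' * t).
    rewrite starM es -mulrA (mulrA e) ee /e starM starK; ncr.
  have := cnormB (star t * t - 1) (star (star s' * t) * (star s' * t)).
  by rewrite cnorm_starM; have := cnorm_ge0 (star s' * t); nra.
have [|t' [t't' t't te]] := @near_isometry _ (2 * d) _ t0; first lra.
have et' : e * t' = t' by apply: te; rewrite mulrA ee.
have st0 : star s' * t' = 0.
  by rewrite -et' /e mulrBl mul1r mulrBr !mulrA s's' mul1r subrr.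
have tt : cnorm (t' - t) <= 9 * d.
  have := cnorm_triangle (e * t) t' t.
  have -> : e * t - t = - (s' * (star s' * t)) by rewrite /e; ncr.
  rewrite cnormN cnormMl //; lra.
have s'1 := isometry_norm s's'; have t'1 := isometry_norm t't'.
exists s', t'; split=> //; last lra.
split=> //; pose E := 1 - s' * star s' - t' * star t'.
have Es : star E = E by rewrite /E !starB star1 !starM !starK.
have EE : star E * E = E.
  have ts0 : star t' * s' = 0 by rewrite -(starK s') -starM st0 star0.
  rewrite Es /E; have -> : (1 - s' * star s' - t' * star t') * (1 - s' * star s' - t' * star t') =
    1 - s' * star s' - s' * star s' - t' * star t' - t' * star t' + s' * (star s' * s') * star s'
    + t' * (star t' * t') * star t' + s' * (star s' * t') * star t' + t' * (star t' * s') * star s' by ncr.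
  by rewrite s's' t't' st0 ts0 !mulr1 !mulr0 !mul0r !addr0; abel.
(* The five summands contribute [d], [2 d], [4 d], [9 d] and [18 d]; with [d <= 1 / 40] the total is
   below 1. *)
have En : cnorm E <= 34 * d.
  have -> : E = - (s * star s + t * star t - 1) - (s' - s) * star s' - s * star (s' - s)
     - (t' - t) * star t' - t * star (t' - t) by rewrite /E !starB; ncr.
  set a := - _; set b := (s' - s) * _; set c := s * _; set f := (t' - t) * _; set g := t * _.
  have := cnormB a b; have := cnormB (a - b) c; have := cnormB (a - b - c) f; have := cnormB (a - b - c - f) g.
  have := cnormM (s' - s) (star s'); have := cnormM s (star (s' - s)).
  have := cnormM (t' - t) (star t'); have := cnormM t (star (t' - t)).
  rewrite -/b -/c -/f -/g !cnorm_star s'1 t'1 /a cnormN.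
  have := cnorm_ge0 (s' - s); have := cnorm_ge0 (t' - t); have := cnorm_ge0 s; have := cnorm_ge0 t; nra.
have E0 : E = 0.
  have := cnorm_starM E; rewrite EE => h; have := cnorm_ge0 E => h0.
  apply: cnorm_eq0P; nra.
by apply/eqP; rewrite -subr_eq0 -oppr_eq0; apply/eqP; rewrite -E0 /E; abel.
Qed.

End NearIsometries.

(** * Enumeration of terms *)

Section TermEnumeration.
Variables (X : symbols) (C : countType) (f : X -> C).
Hypothesis f_inj : injective f.

Definition rterm := {k & term X k}.

Fixpoint term_code k (t : term X k) : GenTree.tree (option C * nat * (rat * rat)) :=
  match t with
  | t_sym x => GenTree.Leaf (Some (f x), 0%N, (0, 0))
  | t_zero => GenTree.Node 0 [::]
  | t_one => GenTree.Node 1 [::]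
  | t_add _ _ t1 t2 => GenTree.Node 2 [:: term_code t1; term_code t2]
  | t_mul _ _ t1 t2 => GenTree.Node 3 [:: term_code t1; term_code t2]
  | t_star _ t1 => GenTree.Node 4 [:: term_code t1]
  | t_scale _ l z _ _ t1 => GenTree.Node 5 [:: GenTree.Leaf (None, l, z); term_code t1]
  | t_incl _ l _ t1 => GenTree.Node 6 [:: GenTree.Leaf (None, l, (0, 0)); term_code t1]
  end.

(** Terms of different sorts are compared as tagged pairs and transported along the equations
    between sorts. The side conditions are boolean, so their proofs agree. *)
Lemma term_code_inj k (t : term X k) l (u : term X l) : term_code t = term_code u ->
  Tagged (term X) t = Tagged (term X) u.
Proof.
pose T k0 := term X k0.
have sub k1 l1 (t1 : T k1) (u1 : T l1) : Tagged T t1 = Tagged T u1 ->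
    exists e : k1 = l1, eq_rect k1 T t1 l1 e = u1.
  by move=> h; exists (EqdepFacts.eq_sigT_fst h); move: h; rewrite /Tagged => h; apply: EqdepFacts.eq_sigT_snd.
elim: t l u => [x|||k1 l1 t1 IH1 t2 IH2|k1 l1 t1 IH1 t2 IH2|k1 t1 IH1|k1 l1 z h1 h2 t1 IH1|k1 l1 h1 t1 IH1] l [] //=.
- by move=> y [/f_inj->].
- move=> k2 l2 u1 u2 [/IH1/sub[e <-] /IH2/sub[e' <-]]; by case: _ / e; case: _ / e'.
- move=> k2 l2 u1 u2 [/IH1/sub[e <-] /IH2/sub[e' <-]]; by case: _ / e; case: _ / e'.
- by move=> k2 u1 [/IH1/sub[e <-]]; case: _ / e.
- move=> k2 l2 z' a1 a2 u1 [e1 e2 /IH1/sub[e <-]]; move: a2; case: _ / e => a2.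
  move: a1 a2; case: _ / e1; case: _ / e2 => a1 a2.
  by rewrite (bool_irrelevance a1 h1) (bool_irrelevance a2 h2).
- move=> k2 l2 a1 u1 [e1 /IH1/sub[e <-]]; move: a1; case: _ / e => {u1 IH1}.
  by case: _ / e1 => a1; rewrite (bool_irrelevance a1 h1).
Qed.

(** The number is a precision: every pair of terms returns with every precision, so that all
    distances are decided in the limit. *)
Lemma term_enumeration : exists e : nat -> rterm * rterm * nat, forall x, exists n, e n = x.
Proof.
pose g (x : rterm * rterm * nat) := pickle (term_code (projT2 x.1.1), term_code (projT2 x.1.2), x.2).
have g_inj : injective g.
  case=> [[[k t] [l u]] m] [[[k' t'] [l' u']] m'] /(pcan_inj pickleK).
  by case=> /term_code_inj e1 /term_code_inj e2 ->; congr (_, _, _).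
have /choice[e he] : forall n, exists x, (exists y, g y = n) -> g x = n.
  move=> n; have [[y yn]|nex] := pselect (exists y, g y = n); first by exists y.
  by exists (Tagged (term X) (t_one X), Tagged (term X) (t_one X), 0%N) => yn; case: (nex yn).
by exists e => x; exists (g x); apply: g_inj; apply: he; exists x.
Qed.

End TermEnumeration.

(** A unitary of an ultrapower conjugates the pair of [w] into that of [v]. After this conjugation
    [u c] differs from [v c] by three errors: [v c] against its polynomial, the polynomial at [w]
    against the one at [u], and the latter against [u c]. The conjugate of [u] still satisfies [p],
    and one of its coordinates is [v']. *)
Lemma conj_close (R : realType) (K : connectives R) (B : cstarAlgType R) (v u : new_constants -> B)
    (p : set (expression K)) (L : set new_constants) (P : new_constants -> rterm new_constants)
    (w : new_constants -> B) (s t : new_constants) (e : R) :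
  models u p -> finite_set p -> finite_set L ->
  interpretation v -> cuntz2_rel (v s) (v t) -> cuntz2_rel (w s) (w t) ->
  (forall c, term_on (fun x => x = s \/ x = t) (projT2 (P c))) ->
  (forall c, L c -> [/\ cnorm (v c - term_val v (projT2 (P c))) < e,
      cnorm (term_val w (projT2 (P c)) - term_val u (projT2 (P c))) < e &
      cnorm (u c - term_val u (projT2 (P c))) < e]) ->
  exists v', models v' p /\ forall c, L c -> cnorm (v c - v' c) < 3 * e.
Proof.
move=> up pf Lf vi vst wst Pon h.
have [W WU Wn] := seq_ultrafilter nat; pose n (i : seq nat * nat) := i.2.
have n_inf N : \forall i \near W, (N <= n i)%N by apply: filterS (Wn 0%N N) => i [].
have [D [q hq]] := @ultrapower_ex R _ W WU B.
pose S b := if b then v s else v t; pose T b := if b then w s else w t.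
have [a [a1 a2 aT]] := @cuntz_unique R _ W WU n n_inf B D q hq T S wst vst.
have [F [F_star F_inj FE]] := uq_diag hq.
have FD x y : F (x + y) = F x + F y by exact: rmorphD.
have FM x y : F (x * y) = F x * F y by exact: rmorphM.
have F1 : F 1 = 1 by exact: rmorph1.
have FZ c x : F (c *: x) = c *: F x by exact: linearZ.
have [|||G GE] := @lrmorphism_ex R B D (fun x => a * F x * star a).
- by move=> c x y; rewrite FD FZ mulrDr mulrDl scaleMr scaleMl.
- move=> x y; rewrite FM; have -> : a * F x * star a * (a * F y * star a) =
    a * F x * (star a * a) * F y * star a by rewrite !mulrA.
  by rewrite a1 mulr1 !mulrA.
- by rewrite F1 mulr1.
have G_star : star_preserving G.
  by move=> x; rewrite !GE F_star !starM starK mulrA.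
have G_inj : injective G.
  move=> x y; rewrite !GE => /(congr1 (fun z => star a * z * a)).
  have e1 z : star a * (a * z * star a) * a = (star a * a) * z * (star a * a) by rewrite !mulrA.
  by rewrite !e1 a1 !mul1r !mulr1 => /F_inj.
have GT b : G (T b) = F (S b) by rewrite GE !FE aT -mulrA a2 mulr1.
have Gn := starhom_isometric G_star G_inj; have Fn := starhom_isometric F_star F_inj.
have Gup : models (fun c => G (u c)) p.
  case: up => ui uv; split; first exact: (interpretation_morph G_star G_inj).
  by move=> x px; rewrite (qf_val_morph G_star G_inj); exact: uv.
have [vs [vsi vsq vsp]] := los_models hq pf Gup.
have cl : \forall i \near W, forall c, L c -> cnorm (v c - vs i c) < 3 * e.
  apply: filter_finite Lf _ => c Lc.
  have b1 : bounded_family (fun i : seq nat * nat => v c) by exact: bfam_cst.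
  have b2 : bounded_family (vs^~ c) by exists (sym_sort c).+1%:R => i; exact: vsi.
  apply: (@uq_norm_lt R _ W WU B D q hq (fun i => v c - vs i c)); first exact: bfamB.
  rewrite (uqB hq) // vsq -FE; case: (h c Lc); case: (P c) (Pon c) => k r /= ron h1 h2 h3.
  have e1 : F (term_val v r) = G (term_val w r).
    rewrite -(term_val_morph F_star) -(term_val_morph G_star).
    apply: (term_val_ext _ ron) => x [] ->; first by rewrite -[v s]/(S true) -GT.
    by rewrite -[v t]/(S false) -GT.
  have FB x y : F (x - y) = F x - F y by exact: rmorphB.
  have GB x y : G (x - y) = G x - G y by exact: rmorphB.
  move: (cnorm_triangle (F (term_val v r)) (F (v c)) (G (u c))); rewrite -FB Fn e1.
  move: (cnorm_triangle (G (term_val u r)) (G (term_val w r)) (G (u c))).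
  rewrite -[G (term_val w r) - G (term_val u r)]GB -[G (term_val u r) - _]GB !Gn (cnormBC (term_val u r)); lra.
have [i [h1 h2]] := filter_ex (filterI cl vsp); by exists (vs i).
Qed.

(** * One move of the second player *)

Section GameStep.
Variables (R : realType) (K : connectives R) (B : cstarAlgType R).
Local Notation X := new_constants.

Definition small (N : nat) : set X :=
  [set c : (nat * nat)%type | (c.1 < N)%N /\ (c.2 < N)%N].

Lemma small_finite N : finite_set (small N).
Proof.
apply: (sub_finite_set (B := `I_N `*` `I_N)); last by apply: finite_setX; exact: finite_II.
by move=> c [].
Qed.

Lemma small_mono m n c : (m <= n)%N -> small m c -> small n c.
Proof. by move=> mn [h1 h2]; split; exact: leq_trans mn. Qed.

Lemma small_ex c : exists n, small n c.
Proof.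
by case: c => a b; exists (maxn a b).+1; split=> /=; rewrite ltnS ?leq_maxl ?leq_maxr.
Qed.

Definition close (d : R) N (v w : X -> B) : Prop :=
  forall c, small N c -> cnorm (v c - w c) < d.

(* The invariant maintained by the strategy of the second player. *)
Definition followed (d : R) N (v : X -> B) (q : set (expression K)) : Prop :=
  forall p : condition K, q `<=` p -> exists2 w, models w p & close d N v w.

Definition decided (e : R) (x : rterm X * rterm X) (q : set (expression K)) : Prop :=
  exists r, forall (A : cstarAlgType R) (w : X -> A), models w q ->
    `|cnorm (term_val w (projT2 x.1) - term_val w (projT2 x.2)) - r| < e.

Definition upd2 (s t : X) (a b : B) (w : X -> B) (c : X) : B :=
  if (c : (nat * nat)%type) == s then a else if (c : (nat * nat)%type) == t then b else w c.

Lemma upd2_interp s t a b w : star a * a = 1 -> star b * b = 1 -> interpretation w ->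
  interpretation (upd2 s t a b w).
Proof.
move=> /isometry_norm a1 /isometry_norm b1 wi c; rewrite /upd2.
have h : 1 <= (sym_sort c).+1%:R :> R by rewrite ler1n.
by case: eqP => [_|_]; last case: eqP => [_|_]; rewrite ?a1 ?b1.
Qed.

Variables (s0 t0 : B).
Hypothesis K_dense : dense_connectives K.
Hypothesis st0 : cuntz2_rel s0 t0.
Hypothesis st_gen : generated_by [set s0; t0].
Hypothesis KL : forall p : condition K, exists v : X -> B, models v p.

(* The fresh constants [s], [t] name the generators. Since [q] records the other
   constants as approximate polynomials in them, any model of a later condition is
   unitarily conjugate, in an ultrapower, to one which is close to [v1]. *)
Lemma game_step (i N : nat) (d0 d : R) (v : X -> B) (x : rterm X * rterm X * nat)
    (p : condition K) : 0 < d -> (exists2 w, models w p & close d0 N v w) ->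
  exists (v1 : X -> B) (N1 : nat) (q : condition K),
    [/\ p `<=` q, models v1 q, close d0 N v v1, (N <= N1)%N & (i <= N1)%N] /\
    [/\ forall e, cond_set p e -> exists2 r, r < e.2 & cond_set q (e.1, r),
        decided x.2.+1%:R^-1 x.1 q,
        exists s t, [/\ small N1 s, small N1 t, v1 s = s0 & v1 t = t0]
      & followed d N1 v1 q].
Proof.
move=> dp [w [wi wp] vw]; have d3 : 0 < d / 3 by rewrite divr_gt0.
have [M [Mi MN Mp]] : exists M, [/\ (i <= M)%N, (N <= M)%N &
    forall e, cond_set p e -> qf_on (small M) e.1].
  have h : \forall M \near \oo, forall e, cond_set p e -> qf_on (small M) e.1.
    apply: filter_finite (cond_finite p) _ => e pe.
    have [n hn] := qf_on_ex e.1 small_mono small_ex; exists n => // M /= nM.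
    by apply: qf_on_sub hn => c; exact: small_mono.
  by have [M [h1 [h2 h3]]] := filter_ex (filterI h (filterI (nbhs_infty_ge i) (nbhs_infty_ge N))); exists M.
(* Fresh names in the sort of radius 1: the rank [M] lies beyond the constants of [p] and those
   followed so far. *)
pose s : X := (0%N, M); pose t : X := (0%N, M.+1).
pose v1 := upd2 s t s0 t0 w.
have [s01 t01 _] := st0.
have v1i : interpretation v1 by exact: upd2_interp.
have v1w c : small M c -> v1 c = w c.
  case: c => a b [/= _ bM]; rewrite /v1 /upd2; case: eqP => [[_ e]|_].
    by rewrite e ltnn in bM.
  by case: eqP => // -[_ e]; move: bM; rewrite e => /ltnW; rewrite ltnn.
have v1s : v1 s = s0 by rewrite /v1 /upd2 eqxx.
have v1t : v1 t = t0.
  by rewrite /v1 /upd2 eqxx; case: eqP => // -[/eqP]; rewrite gtn_eqF.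
have ss : small M.+2 s by split.
have st : small M.+2 t by split.
pose st_set (c : X) := c = s \/ c = t.
have cl : cnorm_closure (term_vals v1 st_set) = setT.
  apply: st_gen (term_closure _ _) _ => y /= [->|->] e e0.
    exists s0; last by rewrite subrr cnorm0.
    by exists (sym_sort s).+1, (t_sym s); split; [left|rewrite /= v1s].
  exists t0; last by rewrite subrr cnorm0.
  by exists (sym_sort t).+1, (t_sym t); split; [right|rewrite /= v1t].
have /choice[P hP] : forall c : X, exists r : rterm X,
    term_on st_set (projT2 r) /\ cnorm (v1 c - term_val v1 (projT2 r)) < d / 3.
  move=> c; have : setT (v1 c) by []; rewrite -cl => /(_ _ d3)[y [k [r [h ->]]] h'].
  by exists (existT _ k r).
have /choice[dl hdl] : forall c : X, exists dl : R, 0 < dl /\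
    forall (v w : X -> B), interpretation v -> interpretation w ->
    (forall x, st_set x -> cnorm (v x - w x) < dl) ->
    cnorm (term_val v (projT2 (P c)) - term_val w (projT2 (P c))) < d / 3.
  move=> c; have [dl dl0 h] := term_val_cont st_set (projT2 (P c)) d3.
  by exists dl; split=> // v' w' vi' wi' h'; apply: h => //; case: (hP c).
(* [near_cuntz_exact] moves the pair by at most [9 de], which must stay within the continuity moduli
   of all the polynomials in use. *)
have [de [de0 de1 hde]] : exists de : R, [/\ 0 < de, de <= 40^-1 & forall c, small M.+2 c -> 9 * de < dl c].
  have h : \forall y \near (0 : R)^'+, forall c, small M.+2 c -> y < dl c / 9.
    apply: filter_finite (small_finite M.+2) _ => c _; apply: nbhs_right_lt.
    by rewrite divr_gt0 //; case: (hdl c).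
  have h2 : \forall y \near (0 : R)^'+, y < 40^-1 by apply: nbhs_right_lt; rewrite invr_gt0.
  have [y [h1' [h2' h3']]] := filter_ex (filterI h (filterI h2 (nbhs_right_gt 0))).
  exists y; split=> //; first exact: ltW.
  by move=> c /h1'; lra.
pose e : R := x.2.+1%:R^-1; have e0 : 0 < e by rewrite invr_gt0 ltr0n.
have e3 : 0 < e / 3 by rewrite divr_gt0.
pose x1 := projT2 x.1.1; pose x2 := projT2 x.1.2.
have [psi hpsi] := neg_mdist K_dense x1 x2 e3.
pose r := cnorm (term_val v1 x1 - term_val v1 x2).
pose S := t_sym s; pose T := t_sym t.
(* Each inequality of [p] is repeated with half its slack, so that strictness survives the limit.
   The polynomials are recorded up to [d / 3], one distance is confined to within [e] of [r], from
   below through [psi], and the Cuntz relations are imposed up to [de]. *)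
pose q0 : set (expression K) :=
  p `|` [set (y.1, (qf_val v1 y.1 + y.2) / 2) | y in p]
  `|` [set (mdist K (t_sym c) (projT2 (P c)), d / 3) | c in small M.+2]
  `|` [set (mdist K x1 x2, r + e)] `|` [set (psi, e / 3 * 2 - r)]
  `|` [set (mdist K (t_mul (t_star S) S) (t_one X), de)]
  `|` [set (mdist K (t_mul (t_star T) T) (t_one X), de)]
  `|` [set (mdist K (t_mul (t_star S) T) (t_zero X), de)]
  `|` [set (mdist K (t_add (t_mul S (t_star S)) (t_mul T (t_star T))) (t_one X), de)].
have q0f : finite_set q0.
  rewrite /q0; do ! (rewrite finite_setU; split; last exact: finite_set1).
  rewrite !finite_setU; split; last by apply: finite_image; exact: small_finite.
  by split; [|apply: finite_image]; exact: cond_finite.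
have v1p y : cond_set p y -> qf_val v1 y.1 < y.2.
  by move=> py; rewrite (qf_val_ext (w := w) v1w) ?wp //; apply: Mp.
have v1q : models v1 q0.
  split=> // y; rewrite /q0 => -[[[[[[[[py|[z pz <-]]|[c Nc <-]]|->]|->]|->]|->]|->]|->].
  - exact: v1p.
  - by have := v1p _ pz; rewrite /=; lra.
  - by case: (hP c).
  - by rewrite /= /r ltrDl.
  - by have := hpsi _ v1 v1i; rewrite ltr_norml /= -/r; lra.
  - by rewrite mdistE /= v1s s01 subrr cnorm0.
  - by rewrite mdistE /= v1t t01 subrr cnorm0.
  - by rewrite mdistE /= v1s v1t (cuntz_12 st0) subrr cnorm0.
  - by rewrite mdistE /= v1s v1t (cuntz_sum st0) subrr cnorm0.
pose q := Condition q0f (ex_intro _ B (ex_intro _ v1 v1q)).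
have sub_q (p' : condition K) : q `<=` p' -> forall u : X -> B, models u p' -> models u q0.
  by move=> qp' u [ui up]; split=> // y qy; apply: up; exact: qp'.
exists v1, M.+2, q; split; split=> //.
- by move=> y py; do 8 left.
- by move=> c Nc; rewrite v1w; [exact: vw|exact: small_mono Nc].
- by apply: leq_trans MN _; rewrite !leqW.
- by apply: leq_trans Mi _; rewrite !leqW.
- move=> y py; exists ((qf_val v1 y.1 + y.2) / 2); first by have := v1p _ py; lra.
  by do 7 left; right; exists y.
- exists r => A u [ui uq].
  have h1 := uq (mdist K x1 x2, r + e); have h2 := uq (psi, e / 3 * 2 - r).
  have {h1} : cnorm (term_val u x1 - term_val u x2) < r + e by apply: h1; do 5 left; right.
  have {h2} : qf_val u psi < e / 3 * 2 - r by apply: h2; do 4 left; right.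
  have := hpsi _ u ui; rewrite -/x1 -/x2 !ltr_norml -/e; lra.
- by exists s, t.
(* A model [u] of a later condition contains an approximate pair; its repair [u'] changes only the
   constants [s] and [t]. *)
move=> p' qp'; have [u up'] := KL p'; have [ui uq] := sub_q _ qp' _ up'.
have nc : near_cuntz de (u s) (u t).
  split.
  - by apply/ltW/(uq (mdist K (t_mul (t_star S) S) (t_one X), de)); do 3 left; right.
  - by apply/ltW/(uq (mdist K (t_mul (t_star T) T) (t_one X), de)); do 2 left; right.
  - have := uq (mdist K (t_mul (t_star S) T) (t_zero X), de).
    by rewrite mdistE /= subr0 => h; apply/ltW/h; left; right.
  - by apply/ltW/(uq (mdist K (t_add (t_mul S (t_star S)) (t_mul T (t_star T))) (t_one X), de)); right.
have [a [b [ab ua ub]]] := near_cuntz_exact de1 nc.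
pose u' := upd2 s t a b u.
have u's : u' s = a by rewrite /u' /upd2 eqxx.
have u't : u' t = b.
  by rewrite /u' /upd2 eqxx; case: eqP => // -[/eqP]; rewrite gtn_eqF.
have u'i : interpretation u' by apply: upd2_interp => //; case: ab.
have ust : cuntz2_rel (u' s) (u' t) by rewrite u's u't.
have vst : cuntz2_rel (v1 s) (v1 t) by rewrite v1s v1t.
have [|c Nc|v' [v'p h]] := @conj_close R K B v1 u p' (small M.+2) P u' s t (d / 3) up'
    (cond_finite p') (small_finite _) v1i vst ust.
- by move=> c; case: (hP c).
- split; first by case: (hP c).
    case: (hdl c) => _; apply=> // y [->|->].
      by rewrite u's; apply: le_lt_trans ua _; exact: hde.
    by rewrite u't; apply: le_lt_trans ub _; exact: hde.
  by apply: (uq (mdist K (t_sym c) (projT2 (P c)), d / 3)); do 6 left; right; exists c.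
exists v' => // c Nc; have := h c Nc; have -> : 3 * (d / 3) = d by field.
by [].
Qed.

End GameStep.

Lemma term_val_cvg (R : realType) (A : cstarAlgType R) (I : Type) (W : set_system I) {FW : Filter W}
    (X : symbols) (vs : I -> X -> A) (v : X -> A) k (t : term X k) :
  (forall x, ccvg W (vs^~ x) (v x)) -> ccvg W (fun i => term_val (vs i) t) (term_val v t).
Proof.
move=> h; elim: t => //= [||k1 l1 t1 h1 t2 h2|k1 l1 t1 h1 t2 h2|k1 t1 h1|k1 l1 z h0 h0' t1 h1].
- exact: ccvg_cst.
- exact: ccvg_cst.
- exact: ccvgD.
- exact: ccvgM.
- exact: ccvg_star.
- exact: ccvgZ.
Qed.

Lemma id_lrmorphism (R : realType) (A : cstarAlgType R) :
  exists f : {lrmorphism A -> A}, forall x, f x = x.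
Proof. exact: (@lrmorphism_ex R A A id). Qed.

(** * The strategy and the limit structure *)

Section GamePlay.
Variables (R : realType) (K : connectives R) (B : cstarAlgType R).
Local Notation X := new_constants.
Variables (s0 t0 : B).
Hypothesis K_dense : dense_connectives K.
Hypothesis st0 : cuntz2_rel s0 t0.
Hypothesis st_gen : generated_by [set s0; t0].
Hypothesis KL : forall p : condition K, exists v : X -> B, models v p.

Local Notation state := ((X -> B) * nat)%type.
Local Notation "e_[ i ]" := ((2^-1 : R) ^+ i) (format "e_[ i ]").

Let pre (z : nat * state * condition K) :=
  exists2 w, models w z.2 & close e_[z.1.1] z.1.2.2 z.1.2.1 w.

Let post (en : nat -> rterm X * rterm X * nat) (i : nat) (z : state) (p : condition K)
    (v1 : X -> B) N1 (q : condition K) :=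
  [/\ models v1 q, close e_[i] z.2 z.1 v1, (z.2 <= N1)%N & (i <= N1)%N] /\
  [/\ forall e, cond_set p e -> exists2 r, r < e.2 & cond_set q (e.1, r),
      decided (en i).2.+1%:R^-1 (en i).1 q,
      exists s t, [/\ small N1 s, small N1 t, v1 s = s0 & v1 t = t0]
    & followed e_[i.+1] N1 v1 q].

Lemma cuntz_enforceable : enforceable K (fun A => cstar_iso A B).
Proof.
have [en enP] := @term_enumeration X (nat * nat)%type id (fun _ _ e => e).
have /choice[gs gsP] : forall z : nat * state * condition K, exists y : state * condition K,
    z.2 `<=` y.2 /\ (pre z -> post en z.1.1 z.1.2 z.2 y.1.1 y.1.2 y.2).
  (* Where the invariant fails the answer is the move itself, which is legal; this case does not
     arise in plays that follow the strategy. *)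
  move=> [[i [v N]] p]; have [h|nh] := pselect (pre (i, (v, N), p)); last first.
    by exists ((v, N), p); split=> // /nh.
  have d0 : 0 < e_[i.+1] by rewrite exprn_gt0 // invr_gt0.
  have [v1 [N1 [q [[h1 h2 h3 h4 h5] h6]]]] := game_step K_dense st0 st_gen KL i (en i) d0 h.
  by exists ((v1, N1), q); split.
(* The state is not part of the play; it is recomputed from the moves of the first player, those of
   even rank. *)
pose fix stt (p : nat -> condition K) i : state :=
  if i is j.+1 then (gs (j, stt p j, p j.*2)).1 else (fun=> 0, 0%N).
have stt_ext p p' i : (forall j, (j < i.*2)%N -> p j = p' j) -> stt p i = stt p' i.
  elim: i => //= i IH h; rewrite IH => [|j ji]; last first.
    by apply: h; apply: ltn_trans ji _; rewrite doubleS ltnS leqnSn.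
  by rewrite h // doubleS.
(* The default value of [nth] is harmless: the state depends only on positions inside the
   history. *)
pose tau (h : seq (condition K)) (p : condition K) := (gs ((size h)./2, stt (nth p h) (size h)./2, p)).2.
exists tau => [h p|p [p_mono p_odd]]; first by case: (gsP ((size h)./2, stt (nth p h) (size h)./2, p)).
pose S i := stt p i; pose q i := p (i.*2).+1.
have qE i : q i = (gs (i, S i, p i.*2)).2.
  rewrite /q p_odd /tau size_mkseq doubleK; congr (gs (_, _, _)).2.
  by apply: stt_ext => j ji; rewrite nth_mkseq.
have SE i : S i.+1 = (gs (i, S i, p i.*2)).1 by [].
have qp i : q i `<=` p i.+1.*2 by rewrite doubleS; exact: p_mono.
have hpost i : post en i (S i) (p i.*2) (S i.+1).1 (S i.+1).2 (q i).
  elim: i => [|i [_ [_ _ _ /(_ _ (qp i)) h]]].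
    rewrite qE SE; case: (gsP (0%N, S 0%N, p 0%N)) => _; apply.
    by have [w wp] := KL (p 0%N); exists w => // c [].
  by rewrite qE SE; case: (gsP (i.+1, S i.+1, p i.+1.*2)) => _; apply.
pose v i := (S i).1; pose N i := (S i).2.
have vq i : models (v i.+1) (q i) by case: (hpost i) => [[]].
have N_mono i j : (i <= j)%N -> (N i <= N j)%N.
  by move=> /subnKC <-; elim: (j - i)%N => [|n]; rewrite ?addn0 // addnS => /leq_trans; apply; case: (hpost (i + n)%N) => [[]].
have N_ex c : exists n, small (N n) c.
  have [n hn] := small_ex c; exists n.+1; apply: small_mono hn.
  by case: (hpost n) => [[]].
have vc i k c : small (N i) c -> cnorm (v (i + k)%N c - v i c) <= 2 * e_[i] - 2 * e_[i + k].
  move=> hc; elim: k => [|k IH]; first by rewrite addn0 !subrr cnorm0.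
  have h : cnorm (v (i + k)%N c - v (i + k).+1 c) < e_[i + k].
    by case: (hpost (i + k)%N) => [[_ h _ _] _]; apply: h; apply: small_mono hc; apply: N_mono; exact: leq_addr.
  have := cnorm_triangle (v (i + k)%N c) (v (i + k).+1 c) (v i c).
  rewrite cnormBC in h; rewrite addnS exprS; lra.
have vc2 i j c : (i <= j)%N -> small (N i) c -> cnorm (v j c - v i c) <= 2 * e_[i].
  move=> /subnKC <- /(vc i (j - i)%N c) /le_trans; apply.
  by have : 0 <= e_[i + (j - i)%N]; [rewrite exprn_ge0 // invr_ge0|lra].
have e_small (e : R) : 0 < e -> exists n, 2 * e_[n] < e.
  by move=> e0; have [|n hn] := @half_exp_lt R (e / 2); [lra|exists n; lra].
have e_mono m n : (m <= n)%N -> e_[n] <= e_[m].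
  by move=> /subnKC <-; rewrite exprD ler_piMr ?exprn_ge0 ?invr_ge0 // exprn_ile1 ?invr_ge0 //; lra.
have /choice[w wP] : forall c, exists y, ccvg \oo (v^~ c) y.
  move=> c; have [n0 hc] := N_ex c; apply: ccauchy_cvg => e e0.
  have [|n1 hn1] := e_small (e / 2); first lra.
  exists (maxn n0 n1) => i j hi hj; set m := maxn n0 n1 in hi hj.
  have hm : small (N m) c by apply: small_mono hc; apply: N_mono; exact: leq_maxl.
  have := cnorm_triangle (v m c) (v i c) (v j c); have := vc2 _ _ _ hi hm; have := vc2 _ _ _ hj hm.
  rewrite (cnormBC (v m c)); have := e_mono _ _ (leq_maxr n0 n1 : (n1 <= m)%N); lra.
have w_near i c : small (N i) c -> cnorm (w c - v i c) <= 2 * e_[i].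
  move=> hc; have h : ccvg \oo (fun j => v j c - v i c) (w c - v i c) by exact: ccvgB (wP c) (ccvg_cst _).
  by apply: (ccvg_norm_le h); exists i => // j /= ij; exact: vc2.
have wi : interpretation w.
  move=> c; apply: (ccvg_norm_le (wP c)); exists 1%N => // -[|i] // _.
  by case: (vq i).
set pbar := \bigcup_i _.
have q_sub i j : (i <= j)%N -> q i `<=` q j.
  move=> /subnKC <-; elim: (j - i)%N => [|n IH]; rewrite ?addn0 // addnS.
  move=> y /IH /(qp (i + n)%N) hy; exact: (p_mono _ _ hy).
have wp : models w pbar.
  (* Each inequality of the play is tightened in a later answer to some [r < y.2], so the limit of
     the values is still strictly below [y.2]. *)
  split=> // y [k _ pk].
  have pk2 : cond_set (p k.*2) y.
    rewrite -addnn; move: pk; elim: (X in (X + k)%N) => // n IH /IH h.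
    by rewrite addSn; exact: p_mono.
  have [r ry qr] : exists2 r, r < y.2 & cond_set (q k) (y.1, r).
    by case: (hpost k) => _ [h _ _ _]; exact: h.
  apply: le_lt_trans ry.
  have cv : qf_val (v i) y.1 @[i --> \oo] --> qf_val w y.1.
    apply: (qf_val_cvg (A := fun=> B)) => l t u; apply: ccvg_norm.
    by apply: ccvgB; exact: term_val_cvg.
  apply: (cvgr_to_le cv); exists k.+1 => // -[|i] //= ki.
  by apply/ltW; case: (vq i) => _ h; apply: (h (y.1, r)); apply: q_sub qr.
have dec l (t u : term X l) (A : cstarAlgType R) (z : X -> A) : models z pbar ->
    qf_val z (qf_dist K t u) = qf_val w (qf_dist K t u).
  move=> zp /=; apply/eqP; rewrite -subr_eq0 -normr_le0; apply/ler_addgt0Pr => e e0.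
  have [m hm] : exists m : nat, (e / 2)^-1 < m.+1%:R by exists (Num.truncn (e / 2)^-1); apply: truncnS_gt.
  have [n hn] := enP (existT _ l t, existT _ l u, m).
  have mq (A' : cstarAlgType R) (z' : X -> A') : models z' pbar -> models z' (q n).
    by move=> [z'i z'p]; split=> // y qy; apply: z'p; exists (n.*2).+1.
  case: (hpost n) => _ [_ [r hr] _ _]; rewrite hn /= in hr.
  have := hr _ _ (mq _ _ zp); have := hr _ _ (mq _ _ wp).
  have : m.+1%:R^-1 < e / 2 by rewrite -[ltRHS]invrK ltf_pV2 ?posrE ?ltr0n ?invr_gt0 // divr_gt0.
  set a := cnorm _; set b := cnorm _; set ie := m.+1%:R^-1.
  rewrite !ltr_norml add0r ler_norml => h /andP[h1 h2] /andP[h3 h4]; apply/andP; split; lra.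
split=> [l t u|].
  exists (qf_val w (qf_dist K t u)); split=> [A z|r hr]; first exact: dec.
  by rewrite -(hr _ _ wp).
exists B; split; last first.
  have [f fE] := id_lrmorphism B; exists f; split; first by move=> x; rewrite !fE.
  by exists id => x; rewrite fE.
exists w; split=> // [l t u r hr|]; first exact: hr.
have -> : [set x | exists k (t : term X k), x = term_val w t] = term_vals w (fun=> True).
  rewrite eqEsubset; split=> x [k [t]]; last by move=> [_ ->]; exists k, t.
  by move=> ->; exists k, t; split=> //; elim: t => //=.
(* The generators receive new names at every turn; [w] at a name chosen late enough is as close to
   the generator as desired. *)
apply: st_gen (term_closure _ _) _ => y yst e e0; have [i hi] := e_small e e0.
have [c sc vy] : exists2 c, small (N i.+1) c & v i.+1 c = y.
  case: (hpost i) => _ [_ _ [s [t [h1 h2 h3 h4]]] _].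
  by case: yst => ->; [exists s|exists t].
exists (w c); first by exists (sym_sort c).+1, (t_sym c).
rewrite -vy cnormBC; apply: le_lt_trans (w_near _ _ sc) _.
by apply: le_lt_trans hi; rewrite ler_pM2l // e_mono.
Qed.

End GamePlay.

(** * What enforceability and embeddings say about conditions *)

Section Implications.
Variables (R : realType) (K : connectives R).
Implicit Types (A B M D : cstarAlgType R).
Local Notation X := new_constants.

Lemma enforceable_sub (P Q : cstarAlgType R -> Prop) :
  (forall M, P M -> Q M) -> enforceable K P -> enforceable K Q.
Proof.
move=> PQ [tau tau_legal h]; exists tau => // p hp.
by have [h1 [M [h2 /PQ h3]]] := h p hp; split=> //; exists M.
Qed.

(** Definitiveness fixes the atomic values, the compiled structure has these values, and connectives
    propagate the agreement with any model. *)
Lemma compiled_qf_val (p : set (expression K)) A M (w : X -> A) (v : X -> M) (phi : qf K X) :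
  definitive p -> models w p ->
  (forall k (t u : term X k) r, entails_dist p t u r -> qf_val v (qf_dist K t u) = r) ->
  qf_val v phi = qf_val w phi.
Proof.
move=> pdef wp hv; elim: phi => [k t u|c phis IH] /=; last first.
  by congr conn_fun; apply/rowP => i; rewrite !mxE IH.
have [r [hr _]] := pdef k t u.
by have := hv k t u r hr; have := hr A w wp; rewrite /= => -> ->.
Qed.

(** The first player opens with [p0] and then always repeats the last position; the compiled
    structure of this play satisfies [p0]. *)
Lemma enforceable_models (P : cstarAlgType R -> Prop) (p0 : condition K) :
  enforceable K P -> exists M (v : X -> M), P M /\ models v p0.
Proof.
move=> [tau tau_legal h].
pose hist := fix hist n := if n is m.+1 then
  let h := hist m in rcons (rcons h (last p0 h)) (tau h (last p0 h)) else [::].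
pose p k := let h := hist k./2 in if odd k then tau h (last p0 h) else last p0 h.
have pe i : p i.*2 = last p0 (hist i) by rewrite /p odd_double doubleK.
have po i : p i.*2.+1 = tau (hist i) (last p0 (hist i)).
  by rewrite /p /= odd_double /= uphalf_double.
have hE i : mkseq p i.*2 = hist i.
  by elim: i => // i IH; rewrite doubleS !mkseqS IH pe po.
have pS i : p i `<=` p i.+1.
  rewrite -(odd_double_half i); case: odd => /=; last by rewrite add0n po pe; exact: tau_legal.
  by rewrite add1n -doubleS pe po /= last_rcons.
have [|pdef [M [[v [vi vd _]] PM]]] := h p; first by split=> // i; rewrite po hE pe.
set pbar := \bigcup_i _ in pdef vd.
(* If the union of the play had no model, every real would be entailed as the distance from 0 to 0,
   against the uniqueness in [definitive]. *)
have [[A [w wp]]|none] := pselect (exists A (w : X -> A), models w pbar); last first.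
  have all (r : R) : entails_dist pbar (t_zero X) (t_zero X) r.
    by move=> A w wp; case: none; exists A, w.
  have [r [_ hr]] := pdef _ (t_zero X) (t_zero X).
  by have := hr _ (all 0); rewrite (hr _ (all 1)) => /eqP; rewrite oner_eq0.
exists M, v; split=> //; split=> // e pe0; rewrite (compiled_qf_val _ pdef wp vd).
by case: wp => _; apply; exists 0%N.
Qed.

Lemma models_embeds A B (v : X -> A) (p : set (expression K)) : embeds A B -> models v p ->
  exists w : X -> B, models w p.
Proof.
move=> [f [fs fi]] [vi vp]; exists (fun x => f (v x)).
split=> [|e pe]; first exact: (interpretation_morph fs fi).
by rewrite (qf_val_morph fs fi); exact: vp.
Qed.

Lemma models_ultrapower (I : Type) (W : set_system I) A B (v : X -> A) (p : set (expression K)) :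
  UltraFilter W -> finite_set p -> embeds_in_ultrapower W B A -> models v p ->
  exists w : X -> B, models w p.
Proof.
move=> WU pf [D [q [hq AD]]] /(models_embeds AD)[w wp].
have [vs [_ _ vsp]] := los_models hq pf wp.
by have [i hi] := filter_ex vsp; exists (vs i).
Qed.

Lemma cstar_iso_inv A B : cstar_iso A B -> exists f : {lrmorphism B -> A},
  [/\ star_preserving f, injective f & forall a, exists b, f b = a].
Proof.
move=> [f [fs [g fK gK]]].
have fD x y : f (x + y) = f x + f y by exact: rmorphD.
have fM x y : f (x * y) = f x * f y by exact: rmorphM.
have fZ c x : f (c *: x) = c *: f x by exact: linearZ.
have [|||G GE] := @lrmorphism_ex R B A g.
- by move=> c x y; apply: (can_inj fK); rewrite gK fD fZ !gK.
- by move=> x y; apply: (can_inj fK); rewrite gK fM !gK.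
- by apply: (can_inj fK); rewrite gK rmorph1.
exists G; split.
- by move=> x; rewrite !GE; apply: (can_inj fK); rewrite gK fs gK.
- by move=> x y; rewrite !GE => /(can_inj gK).
- by move=> a; exists (f a); rewrite GE fK.
Qed.

Lemma cuntz2_iso A B (s t : B) : cstar_iso A B -> cuntz2_rel s t -> generated_by [set s; t] ->
  exists s' t' : A, cuntz2_rel s' t' /\ generated_by [set s'; t'].
Proof.
move=> /cstar_iso_inv[f [fs fi f_surj]] [ss tt st] gen.
have fD x y : f (x + y) = f x + f y by exact: rmorphD.
have fB x y : f (x - y) = f x - f y by exact: rmorphB.
have fM x y : f (x * y) = f x * f y by exact: rmorphM.
have fZ c x : f (c *: x) = c *: f x by exact: linearZ.
have f1 : f 1 = 1 by exact: rmorph1.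
exists (f s), (f t); split; first by split; rewrite -!fs -!fM ?ss ?tt // -fD st.
move=> S [Scl S1 Slin SM Sst] Sst0.
have fS : f @^-1` S = setT.
  apply: gen => [|y /= [->|->]]; [|by apply: Sst0; left|by apply: Sst0; right].
  split=> [x hx||c x y|x y|x] /=.
  - apply: Scl => e e0; have [y Sy xy] := hx e e0; exists (f y) => //.
    by rewrite -fB (starhom_isometric fs fi).
  - by rewrite f1.
  - by rewrite fD fZ; exact: Slin.
  - by rewrite fM; exact: SM.
  - by rewrite fs; exact: Sst.
rewrite eqEsubset; split=> // a _; have [b <-] := f_surj a.
by have : setT b by []; rewrite -fS.
Qed.

Lemma sup_supinf_val0 A (sigma : nat -> supinf_sentence R) : defines_nuclearity sigma ->
  sup_supinf_val A sigma = 0%E <-> nuclear A.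
Proof.
move=> [pos nuc]; split=> [h|/nuc h].
  apply/nuc => m; apply/eqP; rewrite eq_le pos andbT -h.
  by apply: ereal_sup_ubound; exists m.
rewrite /sup_supinf_val; have -> : range (fun m => supinf_val A (sigma m)) = [set 0%E].
  rewrite eqEsubset; split=> [x [m _ <-]|x ->]; first by rewrite /= h.
  by exists 0%N; rewrite ?h.
exact: ereal_sup1.
Qed.

Lemma iso_embeds_in_ultrapower (I : Type) (W : set_system I) A B :
  UltraFilter W -> cstar_iso A B -> embeds_in_ultrapower W B A.
Proof.
move=> WU [f [fs /bij_inj fi]]; have [D [q hq]] := @ultrapower_ex R I W WU B.
have [F [Fs Fi _]] := uq_diag hq; exists D, q; split=> //.
exists (F \o f); split; last exact: inj_comp.
by move=> x /=; rewrite fs Fs.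
Qed.

End Implications.

(** * The embedding problem *)

Section Constants.
Variable X : symbols.

Fixpoint term_supp k (t : term X k) : seq X :=
  match t with
  | t_sym x => [:: x]
  | t_zero => [::]
  | t_one => [::]
  | t_add _ _ t1 t2 => term_supp t1 ++ term_supp t2
  | t_mul _ _ t1 t2 => term_supp t1 ++ term_supp t2
  | t_star _ t1 => term_supp t1
  | t_scale _ _ _ _ _ t1 => term_supp t1
  | t_incl _ _ _ t1 => term_supp t1
  end.

Lemma term_supp_on k (t : term X k) : term_on (fun x => (x : {classic X}) \in (term_supp t : seq {classic X})) t.
Proof.
elim: t => //= [x|k1 l1 t1 h1 t2 h2|k1 l1 t1 h1 t2 h2]; first by rewrite inE.
- by split; [apply: term_on_sub h1|apply: term_on_sub h2] => x; rewrite mem_cat => ->; rewrite ?orbT.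
- by split; [apply: term_on_sub h1|apply: term_on_sub h2] => x; rewrite mem_cat => ->; rewrite ?orbT.
Qed.

Variable f : X -> nat.

Definition sym_const (x : X) : new_constants := (sym_sort x, f x).

Fixpoint term_const k (t : term X k) : term new_constants k :=
  match t with
  | t_sym x => t_sym (sym_const x)
  | t_zero => t_zero _
  | t_one => t_one _
  | t_add _ _ t1 t2 => t_add (term_const t1) (term_const t2)
  | t_mul _ _ t1 t2 => t_mul (term_const t1) (term_const t2)
  | t_star _ t1 => t_star (term_const t1)
  | t_scale _ _ _ h1 h2 t1 => t_scale h1 h2 (term_const t1)
  | t_incl _ _ h t1 => t_incl h (term_const t1)
  end.

Lemma term_val_const (R : realType) (A : cstarAlgType R) (v : new_constants -> A) k (t : term X k) :
  term_val v (term_const t) = term_val (v \o sym_const) t.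
Proof.
by elim: t => //= [k1 l1 t1 -> t2 ->|k1 l1 t1 -> t2 ->|k1 t1 ->|k1 l1 z h1 h2 t1 ->].
Qed.

End Constants.

Section Embedding.
Variables (R : realType) (K : connectives R) (A B : cstarAlgType R).
Hypothesis K_dense : dense_connectives K.
Hypothesis KL : forall p : condition K, exists v : new_constants -> B, models v p.

(** The sort [truncn (cnorm a)] stands for a radius larger by one, which bounds the norm of [a]. *)
Definition elts : symbols := @Symbols A (fun a => Num.truncn (cnorm a)).

Local Notation tpair := (rterm elts * rterm elts)%type.
Local Notation tdist C v x :=
  (cnorm (@term_val R C elts v _ (projT2 x.1) - @term_val R C elts v _ (projT2 x.2))).

(** Finitely many distances in [A], bounded from above and below, form a condition satisfied in [A];
    a model of it in [B] reproduces them up to [e]. *)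
Lemma finite_embedding (l : seq {classic tpair}) (e : R) : 0 < e ->
  exists w : elts -> B, interpretation w /\
    forall x : {classic tpair}, x \in l -> `|tdist B w x - tdist A id x| < e.
Proof.
move=> e0; have e3 : 0 < e / 3 by rewrite divr_gt0.
pose supp (x : tpair) : seq {classic A} := term_supp (projT2 x.1) ++ term_supp (projT2 x.2).
pose sy : seq {classic A} := flatten [seq supp x | x <- l].
pose f (a : elts) := index (a : {classic A}) sy.
(* The constant [(k, n)] names the [n]-th listed element if that element has sort [k]; all other
   constants are 0, which lies in every ball. *)
pose v (c : new_constants) : A := let a : A := nth (0 : {classic A}) sy c.2 in
  if Num.truncn (cnorm a) == c.1 then a else 0.
have vi : interpretation v.
  case=> k n; rewrite /v /=; case: eqP => [<-|_]; first exact/ltW/truncnS_gt.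
  by rewrite cnorm0.
have vf a : (a : {classic A}) \in sy -> v (sym_const f a) = a.
  by move=> h; rewrite /v /= nth_index // eqxx.
pose c1 (x : tpair) := term_const f (projT2 x.1); pose c2 (x : tpair) := term_const f (projT2 x.2).
have /choice[psi hpsi] : forall x : tpair, exists psi : qf K new_constants,
    forall (C : cstarAlgType R) (w : new_constants -> C), interpretation w ->
    `|qf_val w psi + cnorm (term_val w (c1 x) - term_val w (c2 x))| < e / 3.
  by move=> x; exact: neg_mdist.
pose p : set (expression K) := [set (mdist K (c1 x) (c2 x), tdist A id x + e) | x in [set` l]]
  `|` [set (psi x, e / 3 * 2 - tdist A id x) | x in [set` l]].
have pf : finite_set p.
  by rewrite finite_setU; split; apply: finite_image; exact: finite_seq.
have vp : models v p.
  have tv (x : {classic tpair}) : x \in l -> cnorm (term_val v (c1 x) - term_val v (c2 x)) = tdist A id x.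
    move=> xl; have sub a : a \in supp x -> a \in sy.
      by move=> ax; apply/flattenP; exists (supp x) => //; apply: map_f.
    rewrite /c1 /c2 !term_val_const; congr (cnorm (_ - _)).
      apply: term_val_ext (term_supp_on _) => a ha; apply: vf; apply: sub.
      by rewrite mem_cat ha.
    apply: term_val_ext (term_supp_on _) => a ha; apply: vf; apply: sub.
    by rewrite mem_cat ha orbT.
  split=> // y [] [x xl <-] /=; first by rewrite tv // ltrDl.
  by have := hpsi x _ _ vi; rewrite tv // ltr_norml; lra.
have [w [wi wp]] := KL (Condition pf (ex_intro _ A (ex_intro _ v vp))).
exists (w \o sym_const f); split=> [a|x xl]; first exact: wi.
rewrite -!(term_val_const f w) -/(c1 x) -/(c2 x).
have h1 : cnorm (term_val w (c1 x) - term_val w (c2 x)) < tdist A id x + e.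
  by apply: (wp (mdist K (c1 x) (c2 x), tdist A id x + e)); left; exists x.
have h2 : qf_val w (psi x) < e / 3 * 2 - tdist A id x.
  by apply: (wp (psi x, e / 3 * 2 - tdist A id x)); right; exists x.
by have := hpsi x _ _ wi; rewrite !ltr_norml; lra.
Qed.

(** In the ultrapower the distances between terms are exactly those of [A], so every equation
    between terms passes to the images. The algebraic operations are such equations; arbitrary
    scalars follow from rational ones by density, as [F] is isometric. *)
Lemma conditions_embed : exists (I : Type) (W : set_system I),
  UltraFilter W /\ embeds_in_ultrapower W B A.
Proof.
have [W WU Wn] := seq_ultrafilter {classic tpair}.
exists (seq {classic tpair} * nat)%type, W; split=> //.
have [D [q hq]] := @ultrapower_ex R _ W WU B; exists D, q; split=> //.
have /choice[w hw] : forall i : seq {classic tpair} * nat, exists w : elts -> B,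
    interpretation w /\ forall x : {classic tpair}, x \in i.1 ->
      `|tdist B w x - tdist A id x| < i.2.+1%:R^-1.
  by move=> i; apply: finite_embedding; rewrite invr_gt0 ltr0n.
pose F (a : elts) := q (fun i => w i a).
have wi i : interpretation (w i) by case: (hw i).
have tF k (t : term elts k) : q (fun i => term_val (w i) t) = term_val F t.
  by apply: (los_term hq).
have dist (x : {classic tpair}) : tdist D F x = tdist A id x.
  have b1 : bounded_family (fun i => term_val (w i) (projT2 x.1)) by exact: bfam_term.
  have b2 : bounded_family (fun i => term_val (w i) (projT2 x.2)) by exact: bfam_term.
  have cv : tdist B (w i) x @[i --> W] --> tdist D F x.
    by rewrite -!tF -(uqB hq) //; apply: (uq_norm hq); exact: bfamB.
  apply: (cvg_unique _ cv) => //; apply/cvgrPdist_lt => e e0.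
  have [m hm] : exists m : nat, e^-1 < m.+1%:R by exists (Num.truncn e^-1); apply: truncnS_gt.
  apply: filterS (Wn x m) => i [xi mi]; rewrite distrC.
  case: (hw i) => _ /(_ _ xi) h; apply: lt_trans h _.
  rewrite -[ltRHS]invrK ltf_pV2 ?posrE ?ltr0n ?invr_gt0 //.
  by apply: lt_le_trans hm _; rewrite ler_nat.
pose S (a : A) : rterm elts := existT _ _ (@t_sym elts a).
have Fd a b : cnorm (F a - F b) = cnorm (a - b) by exact: (dist (S a, S b)).
have eqF k l (t : term elts k) (u : term elts l) :
    term_val (id : elts -> A) t = term_val (id : elts -> A) u -> term_val F t = term_val F u.
  move=> tu; apply/eqP; rewrite -subr_eq0; apply/eqP/cnorm_eq0P.
  by rewrite (dist (existT _ k t, existT _ l u)) /= tu subrr cnorm0.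
have FD (a b : A) : F (a + b) = F a + F b.
  exact: (eqF _ _ (@t_sym elts (a + b)) (t_add (@t_sym elts a) (@t_sym elts b))).
have FM (a b : A) : F (a * b) = F a * F b.
  exact: (eqF _ _ (@t_sym elts (a * b)) (t_mul (@t_sym elts a) (@t_sym elts b))).
have Fs (a : A) : F (star a) = star (F a).
  exact: (eqF _ _ (@t_sym elts (star a)) (t_star (@t_sym elts a))).
have F1 : F 1 = 1 by exact: (eqF _ _ (@t_sym elts 1) (t_one _)).
have Fz z (a : A) : F (rat_complex R z *: a) = rat_complex R z *: F a.
  have [l [l0 hl]] := scale_sort z (Num.truncn (cnorm a)).+1.
  exact: (eqF _ _ (@t_sym elts (rat_complex R z *: a)) (t_scale l0 hl (@t_sym elts a))).
have F0 : F 0 = 0 by exact: (eqF _ _ (@t_sym elts 0) (t_zero _)).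
have Fn a : cnorm (F a) = cnorm a by rewrite -[F a]subr0 -F0 Fd subr0.
have FZ c (a : A) : F (c *: a) = c *: F a.
  apply/eqP; rewrite -subr_eq0; apply/eqP/cnorm_eq0P.
  apply/ler_addgt0Pr => e e0; rewrite add0r.
  have k0 : 0 < 2 * cnorm a + 1 by have := cnorm_ge0 a; lra.
  have [z hz] := rat_complex_dense c (divr_gt0 e0 k0).
  have := cnorm_triangle (F (rat_complex R z *: a)) (F (c *: a)) (c *: F a).
  rewrite Fd Fz (cnormBC (rat_complex R z *: F a)) -!scalerBl !cnormZ Fn.
  move: hz; rewrite ltr_pdivlMr //; have := cnorm_ge0 a.
  have : 0 <= complex.Re `|c - rat_complex R z| by rewrite normc_def /= sqrtr_ge0.
  set d := complex.Re _; set n := cnorm a; lra.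
have [|||G GE] := @lrmorphism_ex R A D F => //; first by move=> c x y; rewrite FD FZ.
exists G; split=> [x|x y]; first by rewrite !GE Fs.
rewrite !GE => /eqP; rewrite -subr_eq0 => /eqP xy; apply/eqP; rewrite -subr_eq0.
by apply/eqP/cnorm_eq0P; rewrite -Fd xy cnorm0.
Qed.

End Embedding.

Theorem proposition5p5 (R : realType)
    (K : connectives R) (K_countable : countable [set: K])
    (K_dense : dense_connectives K)
    (O2 : cstarAlgType R) (O2_cuntz : is_cuntz2 O2)
    (U : set_system nat) (U_ultra : UltraFilter U)
    (U_nonprincipal : nonprincipal U)
    (sigma : nat -> supinf_sentence R) (sigma_nuc : defines_nuclearity sigma) :
  [<-> KEP O2;
       enforceable K (fun A => sup_supinf_val A sigma = 0%E);
       enforceable K (fun A => cstar_iso A O2);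
       enforceable K (fun A => embeds_in_ultrapower U O2 A)].
Proof.
case: O2_cuntz => s [t [st st_gen _]].
pose KL := forall p : condition K, exists v : new_constants -> O2, models v p.
have kep_kl : KEP O2 -> KL.
  move=> kep p; have [A [v vp]] := cond_satisfiable p; have [I [W [WU AW]]] := kep A.
  exact: (models_ultrapower WU (cond_finite p) AW vp).
have kl_iso : KL -> enforceable K (fun A => cstar_iso A O2) by exact: (cuntz_enforceable K_dense st st_gen).
have iso_nuc : enforceable K (fun A => cstar_iso A O2) ->
    enforceable K (fun A => sup_supinf_val A sigma = 0%E).
  apply: enforceable_sub => M MO2; apply/(sup_supinf_val0 M sigma_nuc).
  by have [s' [t' [st' gen']]] := cuntz2_iso MO2 st st_gen; exact: cuntz_nuclear gen'.
have nuc_kl : enforceable K (fun A => sup_supinf_val A sigma = 0%E) -> KL.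
  move=> enf p; have [M [v [/(sup_supinf_val0 M sigma_nuc) Mnuc vp]]] := enforceable_models p enf.
  apply: (@nuclear_conditions R K M O2 (s, t) v p Mnuc st _ (cond_finite p) vp).
  exact: (cuntz_self_absorbing st).
have kl_kep : KL -> KEP O2 by move=> kl A; exact: (conditions_embed A K_dense kl).
tfae.
- by move=> /kep_kl/kl_iso/iso_nuc.
- by move=> /nuc_kl/kl_iso.
- by apply: enforceable_sub => M; exact: iso_embeds_in_ultrapower.
- move=> enf; apply: kl_kep => p; have [M [v [MU vp]]] := enforceable_models p enf.
  exact: (models_ultrapower U_ultra (cond_finite p) MU vp).
Qed.
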